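(* Let $\Sigma$ be a solenoid. There exists an uncountable family $\{e_\alpha\}_{\alpha\in A}$ of pairwise inequivalent embeddings $e_\alpha:\Sigma\to\mathbb{R}^3$ such that for every $\alpha\in A$ the set $e_\alpha(\Sigma)$ is not an attractor for any homeomorphism of $\mathbb{R}^3$.
   Context: A (generalized) solenoid is a continuum homeomorphic to an intersection $\bigcap_{i\geq0}T_i$ of nested solid tori in $\mathbb{R}^3$ whose thickness decreases to zero and such that $T_{i+1}$ winds $n_i\geq2$ times inside $T_i$; as an abstract space it is the inverse limit of circles $\mathbb{S}^1\subseteq\mathbb{C}$ with bonding maps $z\mapsto z^{n_i}$, with integers $n_i\geq 2$. Two embeddings $e,e':\Sigma\to\mathbb{R}^3$ are equivalent if there exists a homeomorphism $h$ of $\mathbb{R}^3$ with $h(e(\Sigma))=e'(\Sigma)$. Let $f$ be a homeomorphism of $\mathbb{R}^3$. A compact set $P$ is attracted by $K$ if for each neighbourhood $V$ of $K$ there exists $n_0\in\mathbb{N}$ such that $f^n(P)\subseteq V$ for all $n\geq n_0$. A compact set $K$ with $f(K)=K$ is an attractor for $f$ if it has a neighbourhood $U$ such that every compact set $P\subseteq U$ is attracted by $K$. *)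

(* Defs.v *)
From mathcomp Require Import all_boot all_order all_algebra complex.
From mathcomp Require Import boolp classical_sets functions cardinality.
From mathcomp Require Import reals topology normedtype.
Import Order.TTheory GRing.Theory Num.Theory numFieldNormedType.Exports.

Set Implicit Arguments.
Unset Strict Implicit.
Unset Printing Implicit Defensive.

Local Open Scope classical_set_scope.
Local Open Scope ring_scope.

Definition homeomorphism (T U : topologicalType) (f : T -> U) : Prop :=
  exists g : U -> T,
    [/\ cancel f g, cancel g f, continuous f & continuous g].

Definition homeomorphic (T U : topologicalType) : Prop :=
  exists f : T -> U, homeomorphism f.

(* Homeomorphism onto the image, the image having the subset topology
   (that of [set_type]). *)
Definition embedding (T U : topologicalType) (e : T -> U) : Prop :=
  exists2 f : T -> set_type (range e),
    homeomorphism f & forall x, set_val (f x) = e x.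

(* The norm topology of the complex numbers is found by the library on the
   regular algebra [R[i]^o], which is convertible to [R[i]]. *)
Definition circle (R : realType) : set R[i]^o := [set z | `|z| = 1].

(* Inverse limit of [circle <- circle <- ...] along [z |-> z ^+ n i] from the
   (i+1)-st circle to the i-th one, as a subset of the product of the circles.
   Its type [set_type (power_limit n)] carries the subset topology. *)
Definition power_limit (R : realType) (n : nat -> nat) :
    set (prod_topology (fun _ : nat => set_type (@circle R))) :=
  [set z | forall i, set_val (z i) = (set_val (z i.+1) : R[i]) ^+ n i].

Definition solenoid (R : realType) (S : topologicalType) : Prop :=
  exists2 n : nat -> nat, (forall i, (2 <= n i)%N) &
    homeomorphic S (set_type (@power_limit R n)).

Definition equivalent_embeddings (T U : topologicalType) (e e' : T -> U) : Prop :=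
  exists2 h : U -> U, homeomorphism h & h @` range e = range e'.

(* [set_nbhs K] is the filter of the (not necessarily open) neighbourhoods of
   the set [K]. *)
Definition attracted (T : topologicalType) (f : T -> T) (K P : set T) : Prop :=
  forall V, set_nbhs K V ->
    exists n0 : nat, forall n, (n0 <= n)%N -> iter n f @` P `<=` V.

Definition attractor (T : topologicalType) (f : T -> T) (K : set T) : Prop :=
  [/\ compact K, f @` K = K &
    exists2 U, set_nbhs K U &
      forall P, compact P -> P `<=` U -> attracted f K P].

(* Main.v *)
(* A point of an arc in R^3 is "knotted" if, near it, some cubic polynomial with
   simple roots whose coefficients are continuous off the arc has, on every
   smaller neighbourhood, neither a continuous root nor a continuous square root
   of its discriminant.  This is invariant under local homeomorphisms and fails
   for a flat arc, where local monodromy is abelian.  A long trefoil travelled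
   back and forth infinitely often, while it is scaled down to a point, gives an
   arc with a single knotted point besides, possibly, an isolated endpoint.
   Copies of it put into an interval cluster, for every n, at 2 ^- (n + 2) from
   the right, and also from the left if n belongs to S, for a given set S.

   The solenoid is the suspension of a Cantor fibre.  It is embedded by sweeping
   translates of the arc so obtained; their vertical distances are so sparse that
   the copies do not meet.  A homeomorphism of R^3 taking one embedded solenoid
   onto another maps flow lines to flow lines through a homeomorphism th of the
   time, and preserves knotted points, hence clustering.  Up to a translation, th
   therefore fixes the integers and the points 2 ^- (n + 2) modulo integers; so
   the two sets S are equal, and th t - t is bounded.

   Were the solenoid an attractor, some iterate f would take a thickening of it
   into the domain of a nonvanishing extension of the coordinate j + 1, while
   passages of a flow line with equal coordinate j lie close to each other.
   Following the argument of that extension along segments between the passages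
   shows that the period of the coordinate j + 1 divides that of the coordinate j,
   of which it is a proper multiple. *)
Require Import Defs.
From mathcomp Require Import all_boot all_order all_algebra complex.
From mathcomp Require Import boolp classical_sets functions cardinality.
From mathcomp Require Import reals topology normedtype.
From mathcomp Require Import sequences realfun trigo numfun.
From mathcomp Require Import ring lra zify.
Import Order.TTheory GRing.Theory Num.Theory numFieldNormedType.Exports.
Local Open Scope classical_set_scope.
Local Open Scope ring_scope.

Set Implicit Arguments.
Unset Strict Implicit.
Unset Printing Implicit Defensive.

Local Notation Re := (@complex.Re _).
Local Notation Im := (@complex.Im _).

(** The monodromy of a cubic off an arc is a group of permutations of three roots. Without a
    continuous root it fixes no root, and without a continuous square root of the discriminant it
    has an odd element. Near a flat arc one loop generates everything, and a single permutation of
    three letters either fixes a letter or is even. No fundamental group is formed: loops enter only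
    through lifts over star-shaped sets and over the line. The trefoil suits this test, being the
    locus [A ^+ 3 = B ^+ 2] for explicit [A] and [B], where the discriminant vanishes.

    Whether the free end of a copy is knotted stays undecided, which is why only cluster points of
    knotted times are compared.

    Parallel strands must miss each other, although a vertical translate of a knotted strand may
    meet it. That happens only at crossings of the trefoil, which lie in the middle of each sweep,
    so translations by amounts close to suitable powers of two are harmless. The bound on
    [th t - t], needed to compare winding numbers, comes from recovering the integers from the
    clusters. *)

Definition selection_on (V Y : topologicalType) (S : V -> set Y) (U : set V)
    (s : V -> Y) : Prop :=
  forall x, U x -> S x (s x) /\ {for x, continuous s}.

(* [S] behaves like the fibres of a covering of [D]. *)
Definition unique_germs (V Y : topologicalType) (S : V -> set Y) (D : set V) :
    Prop :=
  forall z, D z -> forall s t : V -> Y, {for z, continuous s} ->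
    {for z, continuous t} -> (\forall x \near z, S x (s x) /\ S x (t x)) ->
    s z = t z -> \forall x \near z, s x = t x.

(** The radius depends on the centre alone, and a section over the whole ball passes through every
    value over every point of the ball. This uniformity allows a lift to be continued past the end
    of the part already covered. *)
Definition local_sections (R : realType) (V : normedModType R)
    (Y : topologicalType) (S : V -> set Y) (D : set V) : Prop :=
  forall y, D y -> exists2 e : R, 0 < e & ball y e `<=` D /\
    forall m, ball y e m -> forall r, S m r ->
      exists2 s : V -> Y, s m = r & selection_on S (ball y e) s.

(** Connectedness of the unit interval in the form of a continuation argument; openness of the
    negation plays the role of closedness. *)
Lemma interval_ind (R : realType) (P : R -> Prop) :
  (forall r, 0 <= r <= 1 -> P r -> \forall x \near r, 0 <= x <= 1 -> P x) ->
  (forall r, 0 <= r <= 1 -> ~ P r -> \forall x \near r, 0 <= x <= 1 -> ~ P x) ->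
  P 0 -> forall r, 0 <= r <= 1 -> P r.
Proof.
move=> oP cP P0 r r01.
have c : connected `[(0:R), 1] by exact: segment_connected.
have I01 (x : R) : `[0, 1]%classic x = (0 <= x <= 1) by rewrite /= in_itv.
have E : `[(0:R), 1] `&` [set x | P x] = `[0, 1]%classic.
  apply: c.
  - by exists 0; split=> //; rewrite I01 lexx ler01.
  - exists ([set x : R | 0 <= x <= 1 -> P x]°); first exact: open_interior.
    apply/seteqP; split=> x [x01 h]; split => //; first exact: oP.
    by apply: interior_subset h _; rewrite -I01.
  - exists (~` ([set x : R | 0 <= x <= 1 -> ~ P x]°)).
      by apply: open_closedC; exact: open_interior.
    apply/seteqP; split=> x [x01 h]; split=> //.
      by move=> h'; apply: (interior_subset h' _ h); rewrite -I01.
    by apply: contrapT => nP; apply: h; apply: cP.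
by have : (`[(0:R), 1] `&` [set x | P x]) r; [rewrite E I01|case].
Qed.

(** * Sections over star-shaped sets *)

Section star.
Context {R : realType} {V : normedModType R} {Y : topologicalType}.
Variables (S : V -> set Y) (D : set V) (x0 : V).
Hypotheses (HY : hausdorff_space Y) (openD : open D) (Dx0 : D x0).
Hypothesis starD : forall x, D x -> forall t : R, 0 <= t <= 1 ->
  D (x0 + t *: (x - x0)).
Hypotheses (UN : unique_germs S D) (LS : local_sections S D).

Lemma continuous_segment (x y : V) : continuous (fun t : R => x + t *: (y - x)).
Proof.
move=> t; apply: cvgD; first exact: cvg_cst.
by apply: cvgZr_tmp; exact: cvg_id.
Qed.

Lemma near_segment (x y : V) (r : R) (P : set V) :
  nbhs (x + r *: (y - x)) P -> \forall t \near r, P (x + t *: (y - x)).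
Proof. exact: continuous_segment. Qed.

(** The set of parameters where the two selections agree is open by uniqueness of germs and closed
    because [Y] is Hausdorff. *)
Lemma selection_eq_segment (W : set V) s t x y : W `<=` D -> open W ->
  selection_on S W s -> selection_on S W t ->
  (forall r : R, 0 <= r <= 1 -> W (x + r *: (y - x))) ->
  s x = t x -> s y = t y.
Proof.
move=> WD oW hs ht sW sx.
pose l (r : R) : V := x + r *: (y - x).
have -> : y = l 1 by rewrite /l scale1r addrC subrK.
apply: (@interval_ind R (fun r => s (l r) = t (l r))); last 1 first.
- by rewrite lexx ler01.
- move=> r r01 e.
  have : \forall z \near l r, s z = t z.
    have Wlr := sW r r01.
    have hn : \forall z \near l r, S z (s z) /\ S z (t z).
      have : nbhs (l r) W by exact: open_nbhs_nbhs.
      by apply: filterS => z Wz; split; [case: (hs z Wz)|case: (ht z Wz)].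
    exact: (UN (WD _ Wlr) (hs _ Wlr).2 (ht _ Wlr).2 hn e).
  by move/near_segment; apply: filterS => z + _.
- move=> r r01 ne.
  have [[U1 U2]/=] : exists2 AB : set Y * set Y, s (l r) \in AB.1 /\ t (l r) \in AB.2 &
      [/\ open AB.1, open AB.2 & AB.1 `&` AB.2 == set0].
    by move: HY; rewrite open_hausdorff; apply; apply/eqP.
  rewrite !inE => -[m1 m2] [o1 o2 d].
  have Wlr := sW r r01.
  have n1 : \forall z \near l r, U1 (s z) by apply: (hs _ Wlr).2; exact: open_nbhs_nbhs.
  have n2 : \forall z \near l r, U2 (t z) by apply: (ht _ Wlr).2; exact: open_nbhs_nbhs.
  have : \forall z \near l r, s z <> t z.
    apply: filterS2 n1 n2 => z z1 z2 e.
    by have : set0 (s z) by rewrite -d; split=> //; rewrite e.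
  by move/near_segment; apply: filterS => z + _.
- by rewrite /l scale0r addr0.
Qed.

Let star_set (U : set V) := [/\ open U, U `<=` D, U x0 &
  forall x, U x -> forall t : R, 0 <= t <= 1 -> U (x0 + t *: (x - x0))].

Lemma ball_segment (y : V) (e : R) a b (t : R) : ball y e a -> ball y e b ->
  0 <= t <= 1 -> ball y e (a + t *: (b - a)).
Proof.
rewrite -!ball_normE /ball_ /= => ha hb /andP[t0 t1].
have -> : y - (a + t *: (b - a)) = (1 - t) *: (y - a) + t *: (y - b).
  rewrite scalerBl scale1r -[in RHS]addrA -scalerN -scalerDr !opprB addrA subrK.
  by rewrite opprD addrA -scalerN opprB.
apply: (le_lt_trans (ler_normD _ _)).
rewrite !normrZ (ger0_norm t0) ger0_norm ?subr_ge0//.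
have [->|tn0] := eqVneq t 0; first by rewrite subr0 mul1r mul0r addr0.
have t0' : 0 < t by rewrite lt_def tn0.
have -> : e = (1 - t) * e + t * e by ring.
apply: ler_ltD; last by rewrite ltr_pM2l.
by rewrite ler_wpM2l ?subr_ge0// ltW.
Qed.

Let segment_segment (a z : V) (t q : R) :
  a + t *: (z - a) + q *: (z - (a + t *: (z - a))) =
  a + (t + q * (1 - t)) *: (z - a).
Proof.
rewrite -addrA; congr (_ + _); rewrite opprD addrA.
by rewrite -[X in q *: (X - _)]scale1r -scalerBl scalerA -scalerDl.
Qed.

(** Sections over open sets star-shaped about [x0] agree wherever both are defined, by comparison
    along the segment from [x0]. So it is enough that each point of [D] lies in the domain of one of
    them; this is proved by continuation along its segment, and the pieces are then united. *)
Theorem star_lifting y0 : S x0 y0 ->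
  exists2 s, s x0 = y0 & selection_on S D s.
Proof.
move=> Sy0.
pose good (U : set V) s := [/\ star_set U, s x0 = y0 & selection_on S U s].
have good_eq U U' s s' x : good U s -> good U' s' -> U x -> U' x -> s x = s' x.
  move=> [[oU UD Ux0 stU] sx0 hs] [[oU' UD' Ux0' stU'] sx0' hs'] Ux U'x.
  apply: (@selection_eq_segment (U `&` U') s s' x0 x).
  - by move=> z [/UD].
  - exact: openI.
  - by move=> z [/hs].
  - by move=> z [_ /hs'].
  - by move=> r r01; split; [exact: stU|exact: stU'].
  - by rewrite sx0 sx0'.
have all_good x : D x -> exists2 U : set V, U x & exists s, good U s.
  move=> Dx.
  pose l (r : R) : V := x0 + r *: (x - x0).
  suff : exists2 U : set V, U (l 1) & exists s, good U s.
    by rewrite /l scale1r addrC subrK.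
  apply: (@interval_ind R (fun r => exists2 U, U (l r) & exists s, good U s)).
  - move=> r r01 [U Ulr [s gs]].
    have : nbhs (l r) U by apply: open_nbhs_nbhs; split=> //; case: gs => [[]].
    by move/near_segment; apply: filterS => z Uz _; exists U => //; exists s.
  - move=> r r01 nP.
    have Dlr : D (l r) by exact: starD.
    have [e e0 [BD sec]] := LS Dlr.
    have : nbhs (l r) (ball (l r) e) by exact: nbhsx_ballx.
    move/near_segment; apply: filterS => r1 /= Br1 r101 [U Ur1 [s gs]].
    apply: nP; rewrite -/(l r1) in Br1.
    have [[oU UD Ux0 stU] sx0 hs] := gs.
    (* If [r <= r1], then [l r] lies on the segment from [x0] to [l r1], inside [U] already.
       Otherwise the section must be prolonged by a local one. *)
    have [rr1|r1r] := leP r r1.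
      exists U; last by exists s.
      have [r10|r10] := eqVneq r1 0.
        have -> : r = r1 by apply: le_anti; rewrite rr1 r10; case/andP: r01.
        exact: Ur1.
      have -> : l r = x0 + (r / r1) *: (l r1 - x0).
        by rewrite /l [x0 + _ - _]addrC addKr scalerA divfK.
      apply: stU => //; case/andP: r01 => r0 _; case/andP: r101 => r10' _.
      have {}r10' : 0 < r1 by rewrite lt_def r10.
      apply/andP; split; first exact: divr_ge0 r0 (ltW r10').
      by rewrite ler_pdivrMr// mul1r.
    have [s1 s1m hs1] := sec _ Br1 _ (hs _ Ur1).1.
    have [d d0 dB] : exists2 d, 0 < d & ball (l r1) d `<=` U `&` ball (l r) e.
      have : nbhs (l r1) (U `&` ball (l r) e).
        apply: filterI; first exact: open_nbhs_nbhs.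
        by apply: open_nbhs_nbhs; split => //; exact: ball_open.
      by case/nbhs_ballP => d d0 h; exists d.
    pose Bm := ball (l r1) d.
    have eqBm z : Bm z -> s z = s1 z.
      move=> Bz; apply: (@selection_eq_segment Bm s s1 (l r1) z) => //.
      - by move=> w /dB[/UD].
      - exact: ball_open.
      - by move=> w /dB[/hs].
      - by move=> w /dB[_ /hs1].
      - by move=> t t01; apply: ball_segment => //; exact: ballxx.
    (* The points of the ball about [l r] that are seen from [x0] through the small ball [Bm], on
       which [s] and [s1] coincide. Adding them to [U] keeps it open and star-shaped about [x0], and
       reaches [l r]. *)
    pose Cn := [set z | ball (l r) e z /\ exists2 t : R, 0 < t <= 1 & Bm (x0 + t *: (z - x0))].
    have oCn : open Cn.
      rewrite openE => z [Bz [t t01 Bt]]; rewrite /interior.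
      have nz : \forall w \near z, Bm (x0 + t *: (w - x0)).
        have ct : {for z, continuous (fun w : V => x0 + t *: (w - x0))}.
          apply: cvgD; first exact: cvg_cst.
          apply: cvgZl_tmp; apply: cvgB; [exact: cvg_id|exact: cvg_cst].
        by apply: ct; apply: open_nbhs_nbhs; split=> //; exact: ball_open.
      have nB : \forall w \near z, ball (l r) e w.
        by apply: open_nbhs_nbhs; split=> //; exact: ball_open.
      by apply: filterS2 nz nB => w w1 w2; split => //; exists t.
    have eqC z : U z -> Cn z -> s z = s1 z.
      move=> Uz [Bz [t t01 Bt]]; case/andP: t01 => t0 t1.
      apply: (@selection_eq_segment (U `&` ball (l r) e) s s1 (x0 + t *: (z - x0)) z).
      - by move=> w [/UD].
      - by apply: openI => //; exact: ball_open.
      - by move=> w [/hs].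
      - by move=> w [_ /hs1].
      - move=> q /andP[q0 q1]; split.
          rewrite segment_segment.
          apply: stU => //; apply/andP; split; nra.
        by apply: ball_segment => //; [case: (dB _ Bt)|rewrite q0 q1].
      - exact: eqBm.
    exists (U `|` Cn).
      right; split; first exact: ballxx.
      have r0 : 0 < r by apply: le_lt_trans r1r; case/andP: r101.
      (* For [r1 = 0] the window [Bm] surrounds [x0] itself and the parameter must still be
         positive, so a small one is taken; otherwise [r1 / r] hits the centre of [Bm]. *)
      move: r101; rewrite le_eqVlt => /andP[/orP[/eqP r10|r10] r11].
        case/andP: r01 => _ r1'.
        have Ux0e : l r1 = x0 by rewrite /l -r10 scale0r addr0.
        have : nbhs (x0 + (0:R) *: (l r - x0)) Bm.
          by rewrite scale0r addr0 -Ux0e; exact: nbhsx_ballx.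
        move=> /near_segment/nbhs_ballP[dd dd0 hdd].
        exists (Num.min 1 (dd / 2)); first by rewrite lt_min ltr01 divr_gt0//= ge_min lexx.
        apply: hdd; rewrite -ball_normE /ball_ /= sub0r normrN ger0_norm.
          by rewrite gt_min; apply/orP; right; rewrite ltr_pdivrMr// ltr_pMr// ltr1n.
        by rewrite le_min ler01 divr_ge0// ltW.
      exists (r1 / r); first by rewrite divr_gt0//= ler_pdivrMr// mul1r ltW.
      rewrite /l [x0 + _ - _]addrC addKr scalerA divfK ?gt_eqF//.
      exact: ballxx.
    exists (fun z => if `[< U z >] then s z else s1 z); split.
    + split.
      * exact: openU.
      * by move=> z [/UD//|[/BD]].
      * by left.
      * move=> z [Uz|[Bz [t /andP[t0 t1] Bt]]] q /andP[q0 q1].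
          by left; apply: stU => //; rewrite q0.
        have [tq|qt] := leP t q.
          right; split.
            have -> : x0 + q *: (z - x0) = x0 + t *: (z - x0) +
                ((q - t) / (1 - t)) *: (z - (x0 + t *: (z - x0))).
              rewrite segment_segment; congr (_ + _).
              congr (_ *: _); have [t1'|t1'] := eqVneq (1 - t) 0; last first.
                by rewrite divfK// addrC subrK.
              by rewrite t1' mulr0 addr0; lra.
            apply: ball_segment => //; first by case: (dB _ Bt).
            have [t1'|t1'] := eqVneq (1 - t) 0; first by rewrite t1' invr0 mulr0 lexx ler01.
            have t1'' : 0 < 1 - t by lra.
            rewrite divr_ge0 ?subr_ge0//= ler_pdivrMr// mul1r; lra.
          exists (t / q); first by rewrite divr_gt0//= ?ler_pdivrMr ?mul1r//; lra.
          rewrite [x0 + q *: _ - _]addrC addKr scalerA divfK//; lra.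
        left; have -> : x0 + q *: (z - x0) = x0 + (q / t) *: (x0 + t *: (z - x0) - x0).
          by rewrite [x0 + t *: _ - _]addrC addKr scalerA divfK//; lra.
        apply: stU; first by case: (dB _ Bt).
        by rewrite divr_ge0//= ?ler_pdivrMr ?mul1r//; lra.
    + by rewrite asboolT.
    + move=> z UCz; split.
        case: asboolP => [Uz|nUz]; first by case: (hs _ Uz).
        case: UCz => [//|[Bz _]].
        by case: (hs1 _ Bz).
      case: UCz => [Uz|Cz].
        apply: (cvg_trans _ (_ : s w @[w --> z] --> _)); last first.
          by rewrite asboolT//; exact: (hs _ Uz).2.
        apply: near_eq_cvg; have : nbhs z U by exact: open_nbhs_nbhs.
        by apply: filterS => w Uw; rewrite asboolT.
      rewrite /prop_for /continuous_at /=.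
      have -> : (if `[< U z >] then s z else s1 z) = s1 z.
        by case: asboolP => // Uz; exact: eqC.
      apply: (cvg_trans _ (_ : s1 w @[w --> z] --> _)); last first.
        by case: Cz => Bz _; exact: (hs1 _ Bz).2.
      apply: near_eq_cvg; have : nbhs z Cn by exact: open_nbhs_nbhs.
      by apply: filterS => w Cw; case: asboolP => // Uw; rewrite eqC.
  - rewrite /l scale0r addr0.
    have [e e0 [BD sec]] := LS Dx0.
    have [s sx0 hs] := sec x0 (ballxx _ e0) y0 Sy0.
    exists (ball x0 e); first exact: ballxx.
    exists s; split => //; split => //.
    + exact: ball_open.
    + exact: ballxx.
    + by move=> z Bz t t01; apply: ball_segment => //; exact: ballxx.
  - by rewrite ler01 lexx.
have /choice[F FP] : forall x, exists p : set V * (V -> Y),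
    D x -> p.1 x /\ good p.1 p.2.
  move=> x; have [Dx|nDx] := pselect (D x); last by exists (set0, fun _ => y0).
  by have [U Ux [s gs]] := all_good x Dx; exists (U, s).
(* At each point the section chosen for that point is used; on its domain it agrees with all other
   choices, whence continuity. *)
exists (fun x => (F x).2 x); first by have [_ []] := FP _ Dx0.
move=> x Dx; have [Fx gx] := FP _ Dx; have [[oU UD _ _] _ hs] := gx.
split; first exact: (hs _ Fx).1.
apply: (cvg_trans _ (_ : (F x).2 w @[w --> x] --> _)); last exact: (hs _ Fx).2.
apply: near_eq_cvg; have : nbhs x (F x).1 by exact: open_nbhs_nbhs.
apply: filterS => w Uw; have [Fw gw] := FP _ (UD _ Uw).
exact: (good_eq _ _ _ _ _ gx gw).
Qed.

End star.

(** * Complex numbers and their arguments *)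

Section complex_topology.
Context {R : realType}.
Local Notation C := (R[i]^o : topologicalType).
Implicit Types z w : R[i].

(** The norm of [R[i]] takes its values in [R[i]]; this is the same number as an element of [R],
    where limits and inequalities are handled. *)
Definition cabs (z : R[i]) : R := Num.sqrt (Re z ^+ 2 + Im z ^+ 2).

Lemma cabsE z : `|z| = (cabs z)%:C%C.
Proof. exact: normc_def. Qed.

Lemma cabs_ge0 z : 0 <= cabs z.
Proof. exact: sqrtr_ge0. Qed.

Lemma sqr_cabs z : cabs z ^+ 2 = Re z ^+ 2 + Im z ^+ 2.
Proof. by rewrite sqr_sqrtr// addr_ge0// sqr_ge0. Qed.

Lemma cabsM z w : cabs (z * w) = cabs z * cabs w.
Proof. by apply/complexI; rewrite -cabsE normrM !cabsE rmorphM. Qed.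

Lemma cabsX z n : cabs (z ^+ n) = cabs z ^+ n.
Proof. by apply/complexI; rewrite -cabsE normrX !cabsE rmorphXn. Qed.

Lemma cabs1 : cabs 1 = 1.
Proof. by apply/complexI; rewrite -cabsE normr1. Qed.

Lemma cabs0 : cabs 0 = 0.
Proof. by apply/complexI; rewrite -cabsE normr0. Qed.

Lemma cabsN z : cabs (- z) = cabs z.
Proof. by apply/complexI; rewrite -!cabsE normrN. Qed.

Lemma cabsV z : cabs z^-1 = (cabs z)^-1.
Proof.
have [->|z0] := eqVneq z 0; first by rewrite invr0 cabs0 invr0.
by apply/complexI; rewrite -cabsE normrV ?unitfE// cabsE fmorphV.
Qed.

Lemma cabs_eq0 z : (cabs z == 0) = (z == 0).
Proof. by rewrite -(inj_eq (@complexI R)) -cabsE normr_eq0. Qed.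

Lemma cabs_gt0 z : (0 < cabs z) = (z != 0).
Proof. by rewrite lt_def cabs_ge0 andbT cabs_eq0. Qed.

Lemma cabsD z w : cabs (z + w) <= cabs z + cabs w.
Proof. by rewrite -lecR -cabsE rmorphD/= -!cabsE ler_normD. Qed.

Lemma cabs_real (x : R) : cabs x%:C%C = `|x|.
Proof. by rewrite /cabs/= expr0n/= addr0 sqrtr_sqr. Qed.

Lemma ge_Re_cabs z : `|Re z| <= cabs z.
Proof. by rewrite -lecR -cabsE normc_ge_Re. Qed.

Lemma ge_Im_cabs z : `|Im z| <= cabs z.
Proof. by rewrite -sqrtr_sqr ler_wsqrtr// lerDr sqr_ge0. Qed.

Lemma cabs_le z : cabs z <= `|Re z| + `|Im z|.
Proof.
rewrite -(ler_pXn2r (n := 2)) ?nnegrE ?cabs_ge0 ?addr_ge0// sqr_cabs.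
rewrite sqrrD !real_normK ?num_real// -addrA [_ *+ 2 + _]addrC addrA lerDl.
by rewrite mulrn_wge0// mulr_ge0.
Qed.

Lemma nbhs_cabsP (z : C) (P : set C) : nbhs z P <->
  exists2 e : R, 0 < e & forall w, cabs (w - z) < e -> P w.
Proof.
split=> [/nbhs_ballP[e /= e0 eP]|[e e0 eP]].
  exists (Re e); first by move: e0; rewrite ltcE => /andP[].
  move=> w h; apply: eP; rewrite -ball_normE /ball_ /= -normrN opprB cabsE.
  move: e0; rewrite ltcE /= => /andP[/eqP ei e0].
  by rewrite (complexE e) ei /= mulr0 addr0 ltcR.
have e0' : (0 : R[i]) < e%:C%C by rewrite ltcR.
apply/nbhs_ballP; exists (e%:C%C : R[i]) => //= w.
by rewrite -ball_normE /ball_ /= -normrN opprB cabsE ltcR => /eP.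
Qed.

Lemma near_cabs (z : C) (e : R) : 0 < e -> \forall w \near z, cabs (w - z) < e.
Proof. by move=> e0; apply/nbhs_cabsP; exists e. Qed.

Lemma cvg_complexP (T : Type) (F : set_system T) (FF : Filter F) (f : T -> C)
    (z : C) : (forall e : R, 0 < e -> \forall x \near F, cabs (f x - z) < e) ->
  f @ F --> z.
Proof.
move=> h P /nbhs_cabsP[e e0 eP]; rewrite /nbhs/=.
by apply: filterS (h _ e0) => x /eP.
Qed.

Lemma nbhs_filterC (z : C) : Filter (nbhs z).
Proof. exact: (@nbhs_filter C). Qed.

Lemma continuous_Re : continuous (@complex.Re R : C -> R).
Proof.
move=> z; have F := nbhs_filterC z; apply/cvgrPdist_lt => e e0.
apply/nbhs_cabsP; exists e => // w h; apply: le_lt_trans h.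
by rewrite -normrN opprB -raddfB ge_Re_cabs.
Qed.

Lemma continuous_Im : continuous (@complex.Im R : C -> R).
Proof.
move=> z; have F := nbhs_filterC z; apply/cvgrPdist_lt => e e0.
apply/nbhs_cabsP; exists e => // w h; apply: le_lt_trans h.
by rewrite -normrN opprB -raddfB ge_Im_cabs.
Qed.

Lemma cvg_complex (T : Type) (F : set_system T) (FF : Filter F) (f g : T -> R)
    (a b : R) : f @ F --> a -> g @ F --> b ->
  (fun x => (f x +i* g x)%C : C) @ F --> ((a +i* b)%C : C).
Proof.
move=> fa gb; apply: cvg_complexP => e e0.
have e2 : 0 < e / 2 by rewrite divr_gt0.
move/cvgrPdist_lt: fa => /(_ _ e2) fa; move/cvgrPdist_lt: gb => /(_ _ e2) gb.
apply: filterS2 fa gb => x fx gx; apply: (le_lt_trans (cabs_le _)) => /=.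
by rewrite (splitr e) ltrD// -normrN opprB.
Qed.

Lemma continuous_cabs : continuous (cabs : C -> R).
Proof.
move=> z; have F := nbhs_filterC z; apply/cvgrPdist_lt => e e0.
apply/nbhs_cabsP; exists e => // w h; apply: le_lt_trans h.
rewrite ler_norml; apply/andP; split.
  have := cabsD z (w - z); rewrite addrC subrK; lra.
by have := cabsD (z - w) w; rewrite subrK -(cabsN (z - w)) opprB; lra.
Qed.

Lemma hausdorff_complex : hausdorff_space C.
Proof. exact: norm_hausdorff. Qed.

(** Functions are written with values in [R[i]], for the sake of the field operations; the
    annotation selects the norm topology carried by [R[i]^o]. *)
Definition ccont (T : topologicalType) (f : T -> R[i]) (x : T) : Prop :=
  {for x, continuous (f : T -> C)}.

Lemma near_neq (T : topologicalType) (f : T -> R[i]) (x : T) (z : R[i]) :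
  ccont f x -> f x != z -> \forall y \near x, f y != z.
Proof.
move=> fx ne; have e0 : 0 < cabs (f x - z) by rewrite cabs_gt0 subr_eq0.
have : \forall y \near x, cabs (f y - f x) < cabs (f x - z).
  exact: fx _ (near_cabs (f x) e0).
apply: filterS => y /=.
by move=> h; apply: contraTneq h => ->; rewrite -cabsN opprB ltxx.
Qed.

End complex_topology.

Section continuity.
Context {R : realType} {T : topologicalType}.
Local Notation C := (R[i]^o : topologicalType).
Variable x : T.
Implicit Types (f g : T -> R[i]) (p q : T -> R).

Lemma contD f g : ccont f x -> ccont g x ->
  ccont (fun y => f y + g y) x.
Proof. exact: (@cvgD R[i] R[i]^o T (nbhs x) _ f g). Qed.

Lemma contB f g : ccont f x -> ccont g x ->
  ccont (fun y => f y - g y) x.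
Proof. exact: (@cvgB R[i] R[i]^o T (nbhs x) _ f g). Qed.

Lemma contM f g : ccont f x -> ccont g x ->
  ccont (fun y => f y * g y) x.
Proof. exact: (@cvgM R[i] T (nbhs x) _ f g). Qed.

Lemma contK (c : R[i]) : ccont (fun _ : T => c) x.
Proof. exact: cvg_cst. Qed.

Lemma cont_eq (Y : topologicalType) (f g : T -> Y) : f =1 g ->
  {for x, continuous f} -> {for x, continuous g}.
Proof. by move=> /funext ->. Qed.

Lemma contX f n : ccont f x -> ccont (fun y => f y ^+ n) x.
Proof.
move=> cf; elim: n => [|n ih].
  by apply: (@cont_eq C (fun=> 1)) => [y|]; [rewrite expr0|exact: contK].
apply: (@cont_eq C (fun y => f y * f y ^+ n)) => [y|]; first by rewrite exprS.
exact: contM.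
Qed.

Lemma contRe f : ccont f x -> {for x, continuous (fun y => Re (f y))}.
Proof.
move=> cf; apply: (@continuous_comp T C R f (@complex.Re R : C -> R)) => //.
exact: continuous_Re.
Qed.

Lemma contIm f : ccont f x -> {for x, continuous (fun y => Im (f y))}.
Proof.
move=> cf; apply: (@continuous_comp T C R f (@complex.Im R : C -> R)) => //.
exact: continuous_Im.
Qed.

Lemma cont_cabs f : ccont f x -> {for x, continuous (fun y => cabs (f y))}.
Proof.
move=> cf; apply: (@continuous_comp T C R f (cabs : C -> R)) => //.
exact: continuous_cabs.
Qed.

Lemma rcontD p q : {for x, continuous p} -> {for x, continuous q} ->
  {for x, continuous (fun y => p y + q y)}.
Proof. exact: (@cvgD R R T (nbhs x) _ p q). Qed.

Lemma rcontB p q : {for x, continuous p} -> {for x, continuous q} ->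
  {for x, continuous (fun y => p y - q y)}.
Proof. exact: (@cvgB R R T (nbhs x) _ p q). Qed.

Lemma rcontN p : {for x, continuous p} -> {for x, continuous (fun y => - p y)}.
Proof. exact: (@cvgN R R T (nbhs x) _ p). Qed.

Lemma rcontM p q : {for x, continuous p} -> {for x, continuous q} ->
  {for x, continuous (fun y => p y * q y)}.
Proof. exact: (@cvgM R T (nbhs x) _ p q). Qed.

Lemma rcontV p : {for x, continuous p} -> p x != 0 ->
  {for x, continuous (fun y => (p y)^-1)}.
Proof. by move=> cp p0; exact: (@cvgV R T (nbhs x) _ p). Qed.

Lemma rcontK (c : R) : {for x, continuous (fun _ : T => c)}.
Proof. exact: cvg_cst. Qed.

Lemma rcontX p n : {for x, continuous p} -> {for x, continuous (fun y => p y ^+ n)}.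
Proof.
move=> cp; elim: n => [|n ih].
  by apply: (@cont_eq R (fun=> 1)) => [y|]; [rewrite expr0|exact: rcontK].
apply: (@cont_eq R (fun y => p y * p y ^+ n)) => [y|]; first by rewrite exprS.
exact: rcontM.
Qed.

Lemma rcont_abs p : {for x, continuous p} -> {for x, continuous (fun y => `|p y|)}.
Proof. by move=> cp; exact: (@cvg_norm R R T (nbhs x) _ p). Qed.

Lemma rcont_max p q : {for x, continuous p} -> {for x, continuous q} ->
  {for x, continuous (fun y => Num.max (p y) (q y))}.
Proof. exact: continuous_max. Qed.

Lemma rcont_min p q : {for x, continuous p} -> {for x, continuous q} ->
  {for x, continuous (fun y => Num.min (p y) (q y))}.
Proof. exact: continuous_min. Qed.

Lemma cont_complex p q : {for x, continuous p} -> {for x, continuous q} ->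
  ccont (fun y => (p y +i* q y)%C) x.
Proof. by move=> cp cq; exact: (@cvg_complex R T (nbhs x) _ p q). Qed.

Lemma cont_pair (Y Z : topologicalType) (f : T -> Y) (g : T -> Z) :
  {for x, continuous f} -> {for x, continuous g} ->
  {for x, continuous (fun y => (f y, g y))}.
Proof. by move=> cf cg; apply: cvg_pair. Qed.

End continuity.

Section cis.
Context {R : realType}.
Local Notation C := (R[i]^o : topologicalType).
Local Notation pi := (@pi R).

(** The character [exp (2 i pi t)], normalised so that its kernel is the set of integers: lifts
    through it count turns. *)
Definition cis (t : R) : R[i] := (cos (2 * pi * t) +i* sin (2 * pi * t))%C.

Lemma cis0 : cis 0 = 1.
Proof. by rewrite /cis mulr0 cos0 sin0. Qed.

Lemma cisD s t : cis (s + t) = cis s * cis t.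
Proof.
rewrite /cis mulrDr cosD sinD; apply/eqP; rewrite eq_complex/=.
by apply/andP; split; apply/eqP; ring.
Qed.

Lemma cabs_cis t : cabs (cis t) = 1.
Proof. by rewrite /cabs/= cos2Dsin2 sqrtr1. Qed.

Lemma cis_neq0 t : cis t != 0.
Proof. by rewrite -cabs_eq0 cabs_cis oner_eq0. Qed.

Lemma cisN t : cis (- t) = (cis t)^-1.
Proof.
apply: (mulfI (cis_neq0 t)); rewrite -cisD subrr cis0 mulfV//; exact: cis_neq0.
Qed.

Lemma cisB s t : cis (s - t) = cis s / cis t.
Proof. by rewrite cisD cisN. Qed.

Lemma cisMn t n : cis (t *+ n) = cis t ^+ n.
Proof. by elim: n => [|n ih]; rewrite ?mulr0n ?cis0// mulrS cisD ih exprS. Qed.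

Lemma cis_nat n : cis n%:R = 1.
Proof.
rewrite cisMn; have -> : cis 1 = 1; last by rewrite expr1n.
by rewrite /cis mulr1 -mulr_natl !mulr_natl cos2pi sin2pi.
Qed.

Lemma cis_int (m : int) : cis m%:~R = 1.
Proof.
by case: m => n; rewrite ?NegzE ?rmorphN/= ?cisN (cis_nat n.+1, cis_nat n) ?invr1.
Qed.

Lemma cis1 : cis 1 = 1. Proof. exact: (cis_nat 1). Qed.

Lemma cis_eq1 t : cis t = 1 -> exists m : int, t = m%:~R.
Proof.
move=> h; exists (Num.floor t).
pose f := t - (Num.floor t)%:~R.
have f0 : 0 <= f by rewrite subr_ge0 floor_le.
have f1 : f < 1 by rewrite ltrBlDl -(rmorphD _ _ 1%:Z) /= floorD1_gt.
have : cis f = 1 by rewrite cisB h cis_int divr1.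
move=> /eqP; rewrite eq_complex /= => /andP[/eqP c _].
have pi0 := @pi_gt0 R.
suff : f = 0 by move/eqP; rewrite subr_eq0 => /eqP.
(* The cosine is injective on [[0, pi]] only. An angle beyond [pi] is reflected to [2 pi] minus the
   angle, which is then forced to vanish, against [f < 1]. *)
have [fle|fgt] := leP (2 * pi * f) pi.
  have /eqP : 2 * pi * f = 0.
    apply: cos_inj; last by rewrite c cos0.
      by rewrite in_itv/= fle andbT; nra.
    by rewrite in_itv/= lexx ltW.
  by rewrite !mulf_eq0 pnatr_eq0/= gt_eqF//= => /eqP.
have /eqP : 2 * pi - 2 * pi * f = 0.
  apply: cos_inj.
  - by rewrite in_itv/=; apply/andP; split; nra.
  - by rewrite in_itv/= lexx ltW.
  have -> : 2 * pi - 2 * pi * f = - (2 * pi * f) + pi *+ 2 by rewrite -mulr_natl; ring.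
  by rewrite cosD2pi cosN c cos0.
by rewrite subr_eq0 => /eqP; nra.
Qed.

Lemma cis_eq s t : cis s = cis t -> exists m : int, s = t + m%:~R.
Proof.
move=> h; have [] := @cis_eq1 (s - t); first by rewrite cisB h mulfV// cis_neq0.
by move=> m e; exists m; rewrite -e addrC subrK.
Qed.

Lemma continuous_cis : continuous (cis : R -> C).
Proof.
move=> t; apply: cvg_complex.
  apply: (@continuous_comp _ _ _ (fun t => 2 * pi * t) cos); last exact: continuous_cos.
  by apply: cvgM; [exact: cvg_cst|exact: cvg_id].
apply: (@continuous_comp _ _ _ (fun t => 2 * pi * t) sin); last exact: continuous_sin.
by apply: cvgM; [exact: cvg_cst|exact: cvg_id].
Qed.

(** Argument in turns, correct on the right half of the unit circle only; other points are rotated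
    there first. *)
Definition arg0 (z : R[i]) : R := asin (Im z) / (2 * pi).

Lemma arg0K z : cabs z = 1 -> 0 <= Re z -> cis (arg0 z) = z.
Proof.
move=> z1 rz; have pi0 := @pi_gt0 R.
have e : Re z ^+ 2 + Im z ^+ 2 = 1 by rewrite -sqr_cabs z1 expr1n.
have i1 : -1 <= Im z <= 1 by rewrite -ler_norml; apply: le_trans (ge_Im_cabs z) _; rewrite z1.
rewrite /cis /arg0 mulrC divfK ?gt_eqF ?mulr_gt0// asinK ?in_itv//= cos_asin//.
have -> : 1 - Im z ^+ 2 = Re z ^+ 2 by rewrite -e addrK.
by rewrite sqrtr_sqr ger0_norm//; case: (z).
Qed.

Lemma continuous_arg0 (z : C) : cabs z = 1 -> 0 < Re z -> {for z, continuous (arg0 : C -> R)}.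
Proof.
have F := nbhs_filterC z. move=> z1 rz;  apply: cvgMr_tmp.
apply: (@continuous_comp _ _ _ (@complex.Im R : C -> R) asin); first exact: continuous_Im.
apply: continuous_asin; rewrite -ltr_norml.
have e : Re z ^+ 2 + Im z ^+ 2 = 1 by rewrite -sqr_cabs z1 expr1n.
by rewrite -(ltr_pXn2r (n := 2)) ?nnegrE// real_normK ?num_real// expr1n -e ltrDr exprn_gt0.
Qed.

Lemma cis_surj z : cabs z = 1 -> exists t, z = cis t.
Proof.
move=> z1.
have [rz|rz] := leP 0 (Re z); first by exists (arg0 z); rewrite arg0K.
exists (arg0 (- z) + 2^-1); rewrite cisD arg0K ?cabsN//; last first.
  by case: (z) rz => a b /=; rewrite oppr_ge0 => /ltW.
have -> : cis 2^-1 = -1.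
  rewrite /cis; have -> : 2 * pi * 2^-1 = pi by field.
  rewrite cospi sinpi.
  by apply/eqP; rewrite eq_complex/= oppr0 !eqxx.
by rewrite mulrN1 opprK.
Qed.

(** Two lifts differ by an integer, which is smaller than 1 in absolute value once both are within
    [1/2] of their common value at [z]. *)
Lemma lift_cis_unique (V : topologicalType) (p : V -> R[i]) (D : set V) :
  unique_germs (fun v => [set t : R | cis t = p v]) D.
Proof.
move=> z Dz s t cs ct h e.
have e2 : 0 < 1 / 2 :> R by rewrite divr_gt0.
move/cvgrPdist_lt: cs => /(_ _ e2) cs; move/cvgrPdist_lt: ct => /(_ _ e2) ct.
apply: filterS3 h cs ct => x [/= sx tx] sx' tx'.
have [m mE] : exists m : int, s x = t x + m%:~R by apply: cis_eq; rewrite sx tx.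
have : `|m%:~R : R| < 1.
  have -> : (m%:~R : R) = (s x - s z) + (t z - t x) by rewrite mE e; ring.
  by apply: le_lt_trans (ler_normD _ _) _; rewrite -(normrN (s x - _)) opprB; lra.
rewrite -intr_norm -[1]/(1%:~R) ltr_int.
by rewrite mE; case: m {mE} => [[|n]|n]//; rewrite addr0.
Qed.

(** Dividing by [p y] moves nearby values into the right half-plane, where [arg0] is a continuous
    inverse of [cis]. *)
Lemma lift_cis_local (V : normedModType R) (p : V -> R[i]) (D : set V) : open D ->
  (forall v, D v -> ccont p v) -> (forall v, D v -> cabs (p v) = 1) ->
  local_sections (fun v => [set t : R | cis t = p v]) D.
Proof.
move=> oD cp p1 y Dy.
have pn0 v : D v -> p v != 0 by move=> Dv; rewrite -cabs_eq0 p1// oner_eq0.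
have n1 : \forall v \near y, D v by exact: open_nbhs_nbhs.
have cq v : D v -> {for v, continuous (fun v : V => p v / p y : C)}.
  by move=> Dv; apply: cvgMr_tmp; exact: cp.
have n2 : \forall v \near y, 0 < Re (p v / p y).
  have c : {for y, continuous (fun v => Re (p v / p y))}.
    by apply: (@continuous_comp _ _ _ _ (@complex.Re R : C -> R)); [exact: cq|exact: continuous_Re].
  have r0 : 0 < Re (p y / p y) by rewrite divff ?pn0//= ltr01.
  by have /cvgrPdist_lt/(_ _ r0) := c; apply: filterS => v; rewrite ltr_norml => /andP[_]; lra.
have [e /= e0 he] := (nbhs_ballP _ _).1 (filterI n1 n2).
exists e => //; split=> [v /he[]//|].
move=> m Bm r /= rm.
exists (fun v => r - arg0 (p m / p y) + arg0 (p v / p y)); first by rewrite subrK.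
have q1 v : D v -> cabs (p v / p y) = 1 by move=> Dv; rewrite cabsM cabsV !p1// invr1 mulr1.
move=> v Bv; have [Dv rv] := he _ Bv; have [Dm rm'] := he _ Bm; split => /=.
  rewrite cisD cisB rm !arg0K ?q1// ?ltW//.
  by field; rewrite !pn0.
apply: cvgD; first exact: cvg_cst.
apply: (@continuous_comp _ _ _ (fun v : V => p v / p y : C) (arg0 : C -> R)); first exact: cq.
by apply: continuous_arg0; rewrite ?q1.
Qed.

End cis.

(** * Roots of cubics and knotted germs *)

Section cubic.
Context {R : realType}.
Local Notation C := (R[i]^o : topologicalType).
Implicit Types A B r s t : R[i].

(** Normalised so that the discriminant is [108 (A ^+ 3 - B ^+ 2)]: the roots are simple exactly
    when [A ^+ 3 != B ^+ 2]. *)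
Definition cubic A B r : R[i] := r ^+ 3 - 3 * A * r + 2 * B.

Lemma cubic_factor A B : exists t1 t2 t3,
  forall r, cubic A B r = (r - t1) * (r - t2) * (r - t3).
Proof.
have [t1 t1E] := @solve_monicpoly R[i] 3 (nth 0 [:: - 2 * B; 3 * A; 0]) isT.
have {}t1E : t1 ^+ 3 = 3 * A * t1 - 2 * B.
  by rewrite t1E !big_ord_recr big_ord0 /=; ring.
pose q := sqrtc (12 * A - 3 * t1 ^+ 2).
have qE : q ^+ 2 = 12 * A - 3 * t1 ^+ 2 by rewrite sqr_sqrtc.
exists t1, ((- t1 + q) / 2), ((- t1 - q) / 2) => r.
have n2 : (2 : R[i]) != 0 by rewrite pnatr_eq0.
have -> : (r - t1) * (r - (- t1 + q) / 2) * (r - (- t1 - q) / 2) =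
  (r - t1) * (r ^+ 2 + t1 * r + (t1 ^+ 2 - q ^+ 2) / 4) by field.
have -> : (r - t1) * (r ^+ 2 + t1 * r + (t1 ^+ 2 - q ^+ 2) / 4) =
  r ^+ 3 + r * ((t1 ^+ 2 - q ^+ 2) / 4 - t1 ^+ 2) - t1 * (t1 ^+ 2 - q ^+ 2) / 4.
  by field.
rewrite qE /cubic; have -> : t1 * (t1 ^+ 2 - (12 * A - 3 * t1 ^+ 2)) / 4 =
  t1 ^+ 3 - 3 * A * t1 by field.
by rewrite t1E; field.
Qed.

(** The expression is the derivative at [r]. If it vanished, then [A = r ^+ 2], and the equation
    would give [B = r ^+ 3]. *)
Lemma cubic_root_neq A B r : A ^+ 3 != B ^+ 2 -> cubic A B r = 0 ->
  r ^+ 2 + r * r + r ^+ 2 - 3 * A != 0.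
Proof.
move=> h; rewrite /cubic => e; apply: contra h => /eqP h.
have rA : A = r ^+ 2.
  have : 3 * A = 3 * r ^+ 2.
    by apply/eqP; rewrite eq_sym -subr_eq0 -h; apply/eqP; ring.
  by apply: mulfI; rewrite pnatr_eq0.
have rB : B = r ^+ 3.
  have : 2 * B = 2 * r ^+ 3.
    by apply/eqP; rewrite -subr_eq0 -e rA; apply/eqP; ring.
  by apply: mulfI; rewrite pnatr_eq0.
by rewrite rA rB -!exprM.
Qed.

(** The last factor is the divided difference of the cubic. That it differs from zero is an open
    condition, which makes simple roots locally unique. *)
Lemma cubic_roots_eq A B r s : cubic A B r = 0 -> cubic A B s = 0 ->
  r ^+ 2 + r * s + s ^+ 2 - 3 * A != 0 -> r = s.
Proof.
rewrite /cubic => hr hs h; apply/eqP; rewrite -subr_eq0.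
have : (r - s) * (r ^+ 2 + r * s + s ^+ 2 - 3 * A) = 0.
  rewrite -[RHS](subrr 0) -{1}hr -hs; ring.
by move/eqP; rewrite mulf_eq0 (negbTE h) orbF.
Qed.

Lemma cubic_factor_distinct A B t1 t2 t3 : t1 != t2 -> t1 != t3 -> t2 != t3 ->
  cubic A B t1 = 0 -> cubic A B t2 = 0 -> cubic A B t3 = 0 ->
  t1 + t2 + t3 = 0 /\ t1 * t2 + t2 * t3 + t3 * t1 = - (3 * A) /\
  t1 * t2 * t3 = - (2 * B).
Proof.
rewrite /cubic => n12 n13 n23 h1 h2 h3.
have e12 : t1 ^+ 2 + t1 * t2 + t2 ^+ 2 - 3 * A = 0.
  apply/eqP; apply: contraNT n12 => h; apply/eqP.
  by apply: (@cubic_roots_eq A B).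
have e13 : t1 ^+ 2 + t1 * t3 + t3 ^+ 2 - 3 * A = 0.
  apply/eqP; apply: contraNT n13 => h; apply/eqP.
  by apply: (@cubic_roots_eq A B).
have s0 : t1 + t2 + t3 = 0.
  apply/eqP; apply: contraNT n23 => h; rewrite -subr_eq0.
  have : (t2 - t3) * (t1 + t2 + t3) = 0.
    rewrite -[RHS](subrr 0) -{1}e12 -e13; ring.
  by move/eqP; rewrite mulf_eq0 (negbTE h) orbF.
have t3E : t3 = - t1 - t2 by apply/eqP; rewrite -subr_eq0 -s0; apply/eqP; ring.
split=> //; split.
  by apply/eqP; rewrite -subr_eq0 t3E -oppr_eq0 -e12; apply/eqP; ring.
apply/eqP; rewrite -subr_eq0 -h1 t3E.
have -> : 3 * A = t1 ^+ 2 + t1 * t2 + t2 ^+ 2.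
  by apply/eqP; rewrite -subr_eq0 -oppr_eq0 -e12; apply/eqP; ring.
by apply/eqP; ring.
Qed.

Lemma cubic_roots_exhaust A B t1 t2 t3 : t1 != t2 -> t1 != t3 -> t2 != t3 ->
  cubic A B t1 = 0 -> cubic A B t2 = 0 -> cubic A B t3 = 0 ->
  forall r, cubic A B r = 0 -> [\/ r = t1, r = t2 | r = t3].
Proof.
move=> n12 n13 n23 h1 h2 h3 r.
have [e1 [e2 e3]] := cubic_factor_distinct n12 n13 n23 h1 h2 h3.
have -> : cubic A B r = (r - t1) * (r - t2) * (r - t3).
  have -> : (r - t1) * (r - t2) * (r - t3) = r ^+ 3 - (t1 + t2 + t3) * r ^+ 2 +
    (t1 * t2 + t2 * t3 + t3 * t1) * r - t1 * t2 * t3 by ring.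
  by rewrite e1 e2 e3 /cubic; ring.
move/eqP; rewrite !mulf_eq0 !subr_eq0 -orbA => /or3P[] /eqP ->.
- exact: Or31.
- exact: Or32.
- exact: Or33.
Qed.

(** The square of the product of the differences is the discriminant [108 (A ^+ 3 - B ^+ 2)]; the
    divisor 6 leaves the factor 3 of [knotted_germ]. *)
Lemma cubic_vandermonde A B t1 t2 t3 : t1 != t2 -> t1 != t3 -> t2 != t3 ->
  cubic A B t1 = 0 -> cubic A B t2 = 0 -> cubic A B t3 = 0 ->
  ((t1 - t2) * (t2 - t3) * (t3 - t1) / 6) ^+ 2 = 3 * (A ^+ 3 - B ^+ 2).
Proof.
move=> n12 n13 n23 h1 h2 h3.
have [e1 [e2 e3]] := cubic_factor_distinct n12 n13 n23 h1 h2 h3.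
have t3E : t3 = - t1 - t2 by apply/eqP; rewrite -subr_eq0 -e1; apply/eqP; ring.
have n3 : (3 : R[i]) != 0 by rewrite pnatr_eq0.
have -> : A = - (t1 * t2 + t2 * t3 + t3 * t1) / 3 by rewrite e2; field.
have -> : B = - (t1 * t2 * t3) / 2 by rewrite e3; field.
by rewrite t3E; field.
Qed.

Lemma cubic_distinct A B : A ^+ 3 != B ^+ 2 -> exists t1 t2 t3,
  [/\ t1 != t2, t1 != t3 & t2 != t3] /\
  [/\ cubic A B t1 = 0, cubic A B t2 = 0 & cubic A B t3 = 0].
Proof.
move=> h; have [t1 [t2 [t3 tE]]] := cubic_factor A B.
have z1 : cubic A B t1 = 0 by rewrite tE subrr !mul0r.
have z2 : cubic A B t2 = 0 by rewrite tE subrr mulr0 mul0r.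
have z3 : cubic A B t3 = 0 by rewrite tE subrr mulr0.
exists t1, t2, t3; split => //.
have s0 : t1 + t2 + t3 = 0.
  (* Coefficients are compared by evaluating the factorisation at 0, 1 and -1. *)
  have := tE 0; have := tE 1; have := tE (-1); rewrite /cubic => p1 p2 p3.
  have : 2 * (t1 + t2 + t3) = 0.
    transitivity (2 * ((0 - t1) * (0 - t2) * (0 - t3)) -
      (1 - t1) * (1 - t2) * (1 - t3) - (-1 - t1) * (-1 - t2) * (-1 - t3)); first by ring.
    by rewrite -p1 -p2 -p3; ring.
  by move/eqP; rewrite mulf_eq0 pnatr_eq0 => /eqP.
have aE : 3 * A = - (t1 * t2 + t2 * t3 + t3 * t1).
  have := tE 0; have := tE 1; have := tE (-1); rewrite /cubic => p1 p2 p3.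
  have n2 : (2 : R[i]) != 0 by rewrite pnatr_eq0.
  apply: (mulfI n2).
  transitivity ((-1 - t1) * (-1 - t2) * (-1 - t3) - (1 - t1) * (1 - t2) * (1 - t3) + 2).
    by rewrite -p1 -p2; ring.
  by ring.
have t3E : t3 = - t1 - t2 by apply/eqP; rewrite -subr_eq0 -s0; apply/eqP; ring.
have nn r : cubic A B r = 0 -> r ^+ 2 + r * r + r ^+ 2 - 3 * A != 0.
  exact: cubic_root_neq.
split; apply/eqP => e.
- move: (nn _ z1); rewrite aE t3E -e; apply/negP; rewrite negbK; apply/eqP; ring.
- have t2E : t2 = - t1 - t1 by rewrite {2}e t3E; ring.
  by move: (nn _ z1); rewrite aE -e t2E; apply/negP; rewrite negbK; apply/eqP; ring.
- have t1E : t1 = - t2 - t2 by rewrite {2}e t3E; ring.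
  by move: (nn _ z2); rewrite aE -e t1E; apply/negP; rewrite negbK; apply/eqP; ring.
Qed.

Lemma cubic_root_bound A B r : cubic A B r = 0 ->
  cabs r <= 1 + 3 * cabs A + 2 * cabs B.
Proof.
rewrite /cubic => h.
have cn n : cabs (n%:R : R[i]) = n%:R.
  by apply/complexI; rewrite -cabsE normr_nat rmorph_nat.
have rE : r ^+ 3 = 3 * A * r - 2 * B.
  by apply/eqP; rewrite -subr_eq0 -h; apply/eqP; ring.
have : cabs r ^+ 3 <= 3 * cabs A * cabs r + 2 * cabs B.
  rewrite -cabsX rE; apply: (le_trans (cabsD _ _)).
  by rewrite cabsN !cabsM !cn.
have := cabs_ge0 A; have := cabs_ge0 B; have := cabs_ge0 r.
set x := cabs r; set a := cabs A; set b := cabs B => x0 b0 a0 hx.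
rewrite leNgt; apply/negP => hlt.
clearbody x a b; clear h cn rE A B r.
have x1 : 1 < x by lra.
have : 0 <= a * x by rewrite mulr_ge0.
have : (1 + 3 * a + 2 * b) * x ^+ 2 < x * x ^+ 2 by rewrite ltr_pM2r// exprn_gt0// (lt_trans ltr01).
rewrite exprS in hx; nra.
Qed.

End cubic.

Section cubic_lifting.
Context {R : realType}.
Local Notation C := (R[i]^o : topologicalType).

Definition cubic_roots (V : Type) (A B : V -> R[i]) (v : V) : set C :=
  [set r | cubic (A v) (B v) r = 0].

Lemma continuous_cubic (T : topologicalType) (A B r : T -> R[i]) (x : T) :
  ccont A x -> ccont B x -> ccont r x ->
  ccont (fun y => cubic (A y) (B y) (r y)) x.
Proof.
move=> cA cB cr; rewrite /cubic; apply: contD; last by apply: contM cB; exact: contK.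
apply: contB; first exact: contX cr.
by apply: contM cr; apply: contM cA; exact: contK.
Qed.

Lemma unique_germs_cubic (V : topologicalType) (A B : V -> R[i]) (D : set V) :
  (forall v, D v -> ccont A v) ->
  (forall v, D v -> A v ^+ 3 != B v ^+ 2) ->
  unique_germs (cubic_roots A B) D.
Proof.
move=> cA ne z Dz s t cs ct nst e.
have h0 : cubic (A z) (B z) (s z) = 0 by have [] := nbhs_singleton nst.
pose s' : V -> R[i] := s; pose t' : V -> R[i] := t.
have c : ccont (fun v => s' v ^+ 2 + s' v * t' v + t' v ^+ 2 - 3 * A v) z.
  have cs' : ccont s' z := cs; have ct' : ccont t' z := ct.
  exact: (contB (contD (contD (contX cs') (contM cs' ct')) (contX ct'))
    (contM (@contK _ _ _ 3) (cA _ Dz))).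
have nz : \forall v \near z, s' v ^+ 2 + s' v * t' v + t' v ^+ 2 - 3 * A v != 0.
  apply: near_neq c _; rewrite /= /t' -e; apply: cubic_root_neq h0; exact: ne.
apply: filterS2 nst nz => v [/= sv tv] nv; exact: cubic_roots_eq sv tv nv.
Qed.

(** The modulus of the nearby cubic at [r] is the product of the distances from [r] to its three
    roots; if it is below [e ^+ 3], one distance is below [e]. *)
Lemma near_cubic_root (V : topologicalType) (A B : V -> R[i]) (z : V) (r : R[i])
    (e : R) : ccont A z -> ccont B z ->
  cubic (A z) (B z) r = 0 -> 0 < e ->
  \forall v \near z, exists2 t, cubic (A v) (B v) t = 0 & cabs (t - r) < e.
Proof.
move=> cA cB h0 e0.
have c : ccont (fun v => cubic (A v) (B v) r) z.
  exact: (continuous_cubic cA cB (@contK _ _ _ r)).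
have e3 : 0 < e ^+ 3 by rewrite exprn_gt0.
have : \forall v \near z, cabs (cubic (A v) (B v) r - cubic (A z) (B z) r) < e ^+ 3.
  exact: c _ (near_cabs _ e3).
apply: filterS => v; rewrite h0 subr0.
have [t1 [t2 [t3 tE]]] := cubic_factor (A v) (B v).
rewrite tE !cabsM => hlt.
have z1 : cubic (A v) (B v) t1 = 0 by rewrite tE subrr !mul0r.
have z2 : cubic (A v) (B v) t2 = 0 by rewrite tE subrr mulr0 mul0r.
have z3 : cubic (A v) (B v) t3 = 0 by rewrite tE subrr mulr0.
have sw t : cabs (t - r) = cabs (r - t) by rewrite -cabsN opprB.
have [h1|h1] := ltP (cabs (r - t1)) e; first by exists t1; rewrite ?sw.
have [h2|h2] := ltP (cabs (r - t2)) e; first by exists t2; rewrite ?sw.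
have [h3|h3] := ltP (cabs (r - t3)) e; first by exists t3; rewrite ?sw.
exfalso; move: hlt; apply/negP; rewrite -leNgt !exprS expr0 mulr1 mulrA.
exact: (ler_pM (mulr_ge0 (ltW e0) (ltW e0)) (ltW e0) (ler_pM (ltW e0) (ltW e0) h1 h2) h3).
Qed.

(** A root of the nearby cubic is bounded by [M], so the cubic at [y] takes there a value of modulus
    below [d ^+ 3], by the choice of [q]. This modulus is the product of the distances to [t1], [t2]
    and [t3], so one of them is below [d]. *)
Lemma near_cubic_cover (V : topologicalType) (A B : V -> R[i]) (y : V)
    (t1 t2 t3 : R[i]) (d : R) : ccont A y -> ccont B y ->
  (forall r, cubic (A y) (B y) r = (r - t1) * (r - t2) * (r - t3)) -> 0 < d ->
  \forall v \near y, forall r, cubic (A v) (B v) r = 0 ->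
    [\/ cabs (r - t1) < d, cabs (r - t2) < d | cabs (r - t3) < d].
Proof.
move=> cA cB tE d0.
pose M := 1 + 3 * (cabs (A y) + 1) + 2 * (cabs (B y) + 1).
have M1 : 1 < M by have := cabs_ge0 (A y); have := cabs_ge0 (B y); rewrite /M; lra.
pose q := Num.min 1 (d ^+ 3 / (5 * M)).
have q0 : 0 < q by rewrite lt_min ltr01 divr_gt0 ?exprn_gt0// mulr_gt0//; lra.
have nA : \forall v \near y, cabs (A v - A y) < q by exact: cA _ (near_cabs _ q0).
have nB : \forall v \near y, cabs (B v - B y) < q by exact: cB _ (near_cabs _ q0).
apply: filterS2 nA nB => v vA vB r hr.
have q1 : q <= 1 by rewrite ge_min lexx.
have qM : q * (5 * M) <= d ^+ 3.
  by rewrite -ler_pdivlMr ?mulr_gt0//; [rewrite ge_min lexx orbT|lra].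
have rM : cabs r <= M.
  apply: le_trans (cubic_root_bound hr) _; rewrite /M.
  have := cabsD (A v - A y) (A y); have := cabsD (B v - B y) (B y).
  by rewrite !subrK; lra.
have : cabs (cubic (A y) (B y) r) < d ^+ 3.
  have -> : cubic (A y) (B y) r = 3 * (A v - A y) * r - 2 * (B v - B y).
    by rewrite -[LHS]subr0 -hr /cubic; ring.
  apply: le_lt_trans (cabsD _ _) _; rewrite cabsN !cabsM.
  have cn n : cabs (n%:R : R[i]) = n%:R.
    by apply/complexI; rewrite -cabsE normr_nat rmorph_nat.
  rewrite !cn; have := cabs_ge0 r; have := cabs_ge0 (A v - A y).
  have := cabs_ge0 (B v - B y).
  move: vA vB rM qM M1 q0; set a := cabs (A v - A y); set b := cabs (B v - B y).
  set x := cabs r => aq bq xM qM M1 q0 b0 a0 x0.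
  have : a * x <= q * M by apply: ler_pM => //; exact: ltW.
  nra.
rewrite tE !cabsM => hlt.
have [h1|h1] := ltP (cabs (r - t1)) d; first exact: Or31.
have [h2|h2] := ltP (cabs (r - t2)) d; first exact: Or32.
have [h3|h3] := ltP (cabs (r - t3)) d; first exact: Or33.
exfalso; move: hlt; apply/negP; rewrite -leNgt !exprS expr0 mulr1 mulrA.
exact: (ler_pM (mulr_ge0 (ltW d0) (ltW d0)) (ltW d0) (ler_pM (ltW d0) (ltW d0) h1 h2) h3).
Qed.

Lemma near_cubic_unique (V : topologicalType) (A B : V -> R[i]) (y : V) (r : R[i]) :
  ccont A y -> A y ^+ 3 != B y ^+ 2 -> cubic (A y) (B y) r = 0 ->
  exists2 d : R, 0 < d & \forall v \near y, forall s t,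
    cabs (s - r) < d -> cabs (t - r) < d ->
    cubic (A v) (B v) s = 0 -> cubic (A v) (B v) t = 0 -> s = t.
Proof.
move=> cA ne hr.
pose f (w : V * (C * C)) : R[i] :=
  (w.2.1 : R[i]) ^+ 2 + (w.2.1 : R[i]) * (w.2.2 : R[i]) + (w.2.2 : R[i]) ^+ 2 - 3 * A w.1.
have cf : ccont f (y, (r, r) : C * C).
  have c1 : ccont (fun w : V * (C * C) => w.2.1) (y, (r, r) : C * C).
    by apply: (@cvg_comp _ _ _ snd fst); [exact: cvg_snd|exact: cvg_fst].
  have c2 : ccont (fun w : V * (C * C) => w.2.2) (y, (r, r) : C * C).
    by apply: (@cvg_comp _ _ _ snd snd); [exact: cvg_snd|exact: cvg_snd].
  have c3 : ccont (fun w : V * (C * C) => A w.1) (y, (r, r) : C * C).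
    by apply: (@continuous_comp _ _ C fst (A : V -> C)); [exact: cvg_fst|exact: cA].
  exact: (contB (contD (contD (contX c1) (contM c1 c2)) (contX c2))
    (contM (@contK _ _ _ 3) c3)).
have := near_neq cf (cubic_root_neq ne hr).
case=> [[/= N1 N2] [n1 [[M1 M2] /= [m1 m2] hM]] hN].
have [d1 d10 hd1] := (nbhs_cabsP _ _).1 m1.
have [d2 d20 hd2] := (nbhs_cabsP _ _).1 m2.
exists (Num.min d1 d2); first by rewrite lt_min d10.
apply: filterS n1 => v Nv s t; rewrite !lt_min => /andP[s1 s2] /andP[t1 t2] hs ht.
apply: cubic_roots_eq hs ht _.
by apply: (hN (v, (s, t))); split => //=; apply: hM; split => /=; [exact: hd1|exact: hd2].
Qed.

(** Over a small ball each disc of radius [d] about a root at [y] contains exactly one root, and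
    every root lies in one of the discs. A disc therefore defines a section, and a disc holding [r]
    gives one through [r]. *)
Lemma local_sections_cubic (V : normedModType R) (A B : V -> R[i]) (D : set V) :
  open D -> (forall v, D v -> ccont A v) ->
  (forall v, D v -> ccont B v) ->
  (forall v, D v -> A v ^+ 3 != B v ^+ 2) ->
  local_sections (cubic_roots A B) D.
Proof.
move=> oD cA cB ne y Dy.
have [t1 [t2 [t3 tE]]] := cubic_factor (A y) (B y).
have z1 : cubic (A y) (B y) t1 = 0 by rewrite tE subrr !mul0r.
have z2 : cubic (A y) (B y) t2 = 0 by rewrite tE subrr mulr0 mul0r.
have z3 : cubic (A y) (B y) t3 = 0 by rewrite tE subrr mulr0.
have [d1 d10 n1] := near_cubic_unique (cA _ Dy) (ne _ Dy) z1.
have [d2 d20 n2] := near_cubic_unique (cA _ Dy) (ne _ Dy) z2.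
have [d3 d30 n3] := near_cubic_unique (cA _ Dy) (ne _ Dy) z3.
pose d := Num.min d1 (Num.min d2 d3).
have d0 : 0 < d by rewrite !lt_min d10 d20.
have dd : [/\ d <= d1, d <= d2 & d <= d3] by rewrite /d !ge_min !lexx !orbT.
have e1 := near_cubic_root (cA _ Dy) (cB _ Dy) z1 d0.
have e2 := near_cubic_root (cA _ Dy) (cB _ Dy) z2 d0.
have e3 := near_cubic_root (cA _ Dy) (cB _ Dy) z3 d0.
have cov := near_cubic_cover (cA _ Dy) (cB _ Dy) tE d0.
have nD : \forall v \near y, D v by exact: open_nbhs_nbhs.
have good t : [\/ t = t1, t = t2 | t = t3] -> \forall v \near y,
    (exists2 s, cubic (A v) (B v) s = 0 & cabs (s - t) < d) /\
    (forall r s, cabs (r - t) < d -> cabs (s - t) < d ->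
    cubic (A v) (B v) r = 0 -> cubic (A v) (B v) s = 0 -> r = s).
  case: dd => dd1 dd2 dd3 [->|->|->].
  - apply: filterS2 e1 n1 => v ex un; split=> // r s hr hs; apply: un.
      exact: lt_le_trans hr dd1.
    exact: lt_le_trans hs dd1.
  - apply: filterS2 e2 n2 => v ex un; split=> // r s hr hs; apply: un.
      exact: lt_le_trans hr dd2.
    exact: lt_le_trans hs dd2.
  - apply: filterS2 e3 n3 => v ex un; split=> // r s hr hs; apply: un.
      exact: lt_le_trans hr dd3.
    exact: lt_le_trans hs dd3.
have g1 := good _ (Or31 _ _ erefl); have g2 := good _ (Or32 _ _ erefl).
have g3 := good _ (Or33 _ _ erefl).
have [e /= e0 he] := (nbhs_ballP _ _).1
  (filterI (filterI nD cov) (filterI g1 (filterI g2 g3))).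
exists e => //; split=> [v /he[[]]//|m Bm r rm].
have [t tm ht] : exists2 t, cabs (r - t) < d & forall v, ball y e v ->
    (exists2 s, cubic (A v) (B v) s = 0 & cabs (s - t) < d) /\
    (forall r s, cabs (r - t) < d -> cabs (s - t) < d ->
    cubic (A v) (B v) r = 0 -> cubic (A v) (B v) s = 0 -> r = s).
  have [[_ cm] _] := he _ Bm.
  case: (cm _ rm) => h; [exists t1|exists t2|exists t3] => // v /he[_ [? []]] //.
have /choice[s sP] : forall v, exists s, ball y e v ->
    cubic (A v) (B v) s = 0 /\ cabs (s - t) < d.
  move=> v; have [Bv|nBv] := pselect (ball y e v); last by exists 0.
  by have [[s s0 st] _] := ht _ Bv; exists s.
exists (s : V -> C).
  have [s0 st] := sP _ Bm; exact: (ht _ Bm).2 _ _ st tm s0 rm.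
move=> v Bv; have [s0 st] := sP _ Bv; split => //.
have Dv : D v by have [[]] := he _ Bv.
apply: cvg_complexP => q q0.
(* This bound keeps a root close to [s v] inside the disc about [t], where it must be the value of
   [s]. *)
pose q' := Num.min q (d - cabs (s v - t)).
have q'0 : 0 < q' by rewrite lt_min q0 subr_gt0.
have nv := near_cubic_root (cA _ Dv) (cB _ Dv) s0 q'0.
have nB : \forall w \near v, ball y e w by apply: open_nbhs_nbhs; split => //; exact: ball_open.
apply: filterS2 nv nB => w [r' r'0]; rewrite lt_min => /andP[rq rd] Bw.
have [w0 wt] := sP _ Bw.
suff -> : s w = r' by [].
apply: (ht _ Bw).2 => //.
by have := cabsD (r' - s v) (s v - t); rewrite addrA subrK; lra.
Qed.

End cubic_lifting.

(** * Knotted germs and the flat arc *)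

Section knotted.
Context {R : realType}.
Local Notation C := (R[i]^o : topologicalType).
Local Notation T3 := (R * R * R)%type.

(* Some cubic [t^3 - 3 A t + 2 B] with simple roots, defined off [a] near [p],
   has nonabelian monodromy on every neighbourhood of [p]: neither a root nor a
   square root of the discriminant can be chosen continuously. *)
Definition knotted_germ (X : topologicalType) (a : set X) (p : X) : Prop :=
  exists2 U : set X, open U /\ U p & exists A B : X -> R[i],
    (forall x, U x -> ~ a x -> [/\ ccont A x, ccont B x & A x ^+ 3 != B x ^+ 2]) /\
    forall V : set X, open V -> V p -> V `<=` U ->
      (~ exists r : X -> R[i], forall x, V x -> ~ a x ->
         ccont r x /\ cubic (A x) (B x) (r x) = 0) /\
      (~ exists r : X -> R[i], forall x, V x -> ~ a x ->
         ccont r x /\ r x ^+ 2 = 3 * (A x ^+ 3 - B x ^+ 2)).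

Definition local_homeo (X Y : topologicalType) (f : X -> Y) (g : Y -> X)
    (O : set X) (O' : set Y) : Prop :=
  [/\ open O /\ open O',
    forall x, O x -> [/\ O' (f x), g (f x) = x & {for x, continuous f}] &
    forall y, O' y -> [/\ O (g y), f (g y) = y & {for y, continuous g}]].

Lemma open_preimage_in (X Y : topologicalType) (f : X -> Y) (O : set X)
    (W : set Y) : open O -> (forall x, O x -> {for x, continuous f}) ->
  open W -> open (O `&` f @^-1` W).
Proof.
move=> oO cf oW; rewrite openE => x [Ox Wx]; rewrite /interior.
apply: filterI; first exact: open_nbhs_nbhs.
by apply: (cf _ Ox); exact: open_nbhs_nbhs.
Qed.

Lemma knotted_germ_local (X Y : topologicalType) (f : X -> Y) (g : Y -> X) O O'
    (a : set X) (a' : set Y) (p : X) : local_homeo f g O O' -> O p ->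
  (forall x, O x -> (a x <-> a' (f x))) ->
  knotted_germ a p -> knotted_germ a' (f p).
Proof.
move=> [[oO oO'] fO gO] Op aa [U [oU Up] [A [B [hAB hV]]]].
exists (O' `&` g @^-1` U).
  split; first by apply: open_preimage_in => // y /gO[].
  by have [? e _] := fO _ Op; split=> //=; rewrite e.
have comp_g (h : X -> R[i]) y : O' y -> ccont h (g y) -> ccont (h \o g) y.
  move=> O'y ch; apply: (@continuous_comp _ _ C g (h : X -> C)) => //.
  by case: (gO _ O'y).
exists (A \o g), (B \o g); split.
  move=> y [O'y Uy] na; have [Ogy fg cg] := gO _ O'y.
  have [|cA cB ne] := hAB _ Uy; first by rewrite aa// fg.
  by split; [exact: comp_g O'y cA|exact: comp_g O'y cB|exact: ne].
move=> V oV Vfp VU.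
have oW : open (O `&` f @^-1` V) by apply: open_preimage_in => // x /fO[].
have WU : O `&` f @^-1` V `<=` U.
  by move=> x [Ox Vx]; have [_] := VU _ Vx; have [_ + _] := fO _ Ox; rewrite /= => ->.
have [h1 h2] := hV _ oW (conj Op Vfp) WU.
split=> -[r hr]; [apply: h1|apply: h2]; exists (r \o f) => x [Ox Vx] nax;
  have [O'x gfx cf] := fO _ Ox; have := hr _ Vx;
  rewrite /= gfx -aa// => /(_ nax)[cr e]; split => //;
  exact: (@continuous_comp _ _ C f (r : Y -> C)).
Qed.

Lemma knotted_germ_eq (X : topologicalType) (a a' O : set X) (p : X) : open O ->
  O p -> (forall x, O x -> (a x <-> a' x)) -> knotted_germ a p ->
  knotted_germ a' p.
Proof.
move=> oO Op aa; apply: (@knotted_germ_local _ _ id id O O) => //.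
by split => // x Ox; split => //; exact: cvg_id.
Qed.

Lemma near_glue (X Y : topologicalType) (f g : X -> Y) (x : X) :
  (\forall y \near x, f y = g y) -> {for x, continuous f} ->
  {for x, continuous g}.
Proof.
move=> fg; rewrite /prop_for /continuous_at (nbhs_singleton fg) => cf.
by apply: cvg_trans cf; apply: near_eq_cvg; apply: filterS fg => y ->.
Qed.

Lemma glue2 (X : topologicalType) (U V : set X) (f g : X -> R[i]) (P : X -> R[i] -> Prop) :
  open U -> open V ->
  (forall x, U x -> ccont f x /\ P x (f x)) ->
  (forall x, V x -> ccont g x /\ P x (g x)) ->
  (forall x, U x -> V x -> f x = g x) ->
  exists h : X -> R[i], forall x, (U `|` V) x -> ccont h x /\ P x (h x).
Proof.
move=> oU oV hf hg fg; exists (fun x => if `[< U x >] then f x else g x).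
move=> x UVx; split; last first.
  by case: asboolP => [/hf[]|nU] //; case: UVx => // /hg[].
have [Ux|nUx] := pselect (U x).
  apply: (@near_glue _ C (f : X -> C)) (hf _ Ux).1; have : nbhs x U by exact: open_nbhs_nbhs.
  by apply: filterS => y Uy; rewrite asboolT.
have Vx : V x by case: UVx.
apply: (@near_glue _ C (g : X -> C)) (hg _ Vx).1; have : nbhs x V by exact: open_nbhs_nbhs.
by apply: filterS => y Vy; case: asboolP => // Uy; rewrite fg.
Qed.

Definition axis : set T3 := [set x | x.1.2 = 0 /\ x.2 = 0].

Lemma continuous_x (x : T3) : {for x, continuous (fun x : T3 => x.1.1)}.
Proof. by apply: (@cvg_comp _ _ _ fst fst); [exact: cvg_fst|exact: cvg_fst]. Qed.

Lemma continuous_y (x : T3) : {for x, continuous (fun x : T3 => x.1.2)}.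
Proof. by apply: (@cvg_comp _ _ _ fst snd); [exact: cvg_fst|exact: cvg_snd]. Qed.

Lemma continuous_z (x : T3) : {for x, continuous (fun x : T3 => x.2)}.
Proof. exact: cvg_snd. Qed.

Lemma open_gt_fun (T : topologicalType) (f : T -> R) (a : R) :
  continuous f -> open [set x | a < f x].
Proof.
move=> cf; rewrite (_ : mkset _ = f @^-1` [set y | a < y])//.
by apply: open_comp => [x _|]; [exact: cf|exact: open_gt].
Qed.

Lemma open_lt_fun (T : topologicalType) (f : T -> R) (a : R) :
  continuous f -> open [set x | f x < a].
Proof.
move=> cf; rewrite (_ : mkset _ = f @^-1` [set y | y < a])//.
by apply: open_comp => [x _|]; [exact: cf|exact: open_lt].
Qed.

(** The ball minus the axis is covered by two slit balls, star-shaped about [ctr 1] and [ctr (-1)],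
    that meet in an upper and a lower half. Over each the three roots are sections; numbered so as
    to agree on the upper half, they are permuted on the lower one. A fixed index yields a
    continuous root; otherwise the permutation is a 3-cycle, which preserves the product of the
    differences. *)
Lemma axis_not_knotted (h : R) : ~ knotted_germ axis ((h, 0, 0) : T3).
Proof.
set p : T3 := (h, 0, 0).
move=> [U [oU Up] [A [B [hAB hV]]]].
have [e /= e0 BU] : exists2 e, 0 < e & ball p e `<=` U.
  by have /nbhs_ballP[e e0 ?] : nbhs p U by [exact: open_nbhs_nbhs]; exists e.
have oB : open (ball p e) by exact: ball_open.
have [nr nd] := hV _ oB (ballxx _ e0) BU.
pose up := ball p e `&` [set x : T3 | 0 < x.2].
pose lo := ball p e `&` [set x : T3 | x.2 < 0].
pose D (s : R) := ball p e `&`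
  ([set x : T3 | 0 < s * x.1.2] `|` ([set x | 0 < x.2] `|` [set x | x.2 < 0])).
have oup : open up by apply: openI => //; apply: open_gt_fun => x; exact: continuous_z.
have olo : open lo by apply: openI => //; apply: open_lt_fun => x; exact: continuous_z.
have oD s : open (D s).
  apply: openI => //; apply: openU; last apply: openU.
  - by apply: open_gt_fun => x; apply: cvgM; [exact: cvg_cst|exact: continuous_y].
  - by apply: open_gt_fun => x; exact: continuous_z.
  - by apply: open_lt_fun => x; exact: continuous_z.
have Dnax s x : D s x -> ~ axis x.
  move=> [_ Dx] [y0 z0]; move: Dx; rewrite /= y0 z0 mulr0 ltxx.
  by move=> [|[|]].
have upD s : up `<=` D s by move=> x [? ?]; split=> //; right; left.
have loD s : lo `<=` D s by move=> x [? ?]; split=> //; right; right.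
have hD s x : D s x -> [/\ ccont A x, ccont B x & A x ^+ 3 != B x ^+ 2].
  by move=> Dx; apply: hAB; [apply: BU; case: Dx|exact: (Dnax s)].
have UN s : unique_germs (cubic_roots A B) (D s).
  by apply: unique_germs_cubic => x /hD[cA _ ne]; [exact: cA|exact: ne].
have LS s : local_sections (cubic_roots A B) (D s).
  apply: local_sections_cubic; [exact: oD|..]; move=> x /hD[cA cB ne];
    [exact: cA|exact: cB|exact: ne].
have e2 : 0 < e / 2 by rewrite divr_gt0.
have ballE (x : T3) : ball p e x = (`|h - x.1.1| < e /\ `|x.1.2| < e /\ `|x.2| < e).
  rewrite /p; case: x => [[x y] z]; rewrite propeqE; split.
    move=> [[]]; rewrite -!ball_normE /ball_ /= => hx hy hz.
    by move: hy hz; rewrite !sub0r !normrN.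
  move=> [hx [hy hz]]; split=> /=; last by rewrite -ball_normE /ball_ /= sub0r normrN.
  by split; rewrite -ball_normE /ball_ //= sub0r normrN.
pose ctr (s : R) : T3 := (h, s * (e / 2), 0).
have sgn (s : R) : s = 1 \/ s = -1 -> `|s| = 1 /\ s * s = 1.
  by case=> ->; rewrite ?normrN ?normr1 ?mulrNN mulr1.
have Dctr s : s = 1 \/ s = -1 -> D s (ctr s).
  move=> /sgn[s1 ss]; split.
    rewrite ballE /= subrr normr0 e0; split => //; split => //.
    by rewrite normrM s1 mul1r gtr0_norm// ltr_pdivrMr// ltr_pMr// ltr1n.
  by left; rewrite /= mulrA ss mul1r.
have star s : s = 1 \/ s = -1 -> forall x, D s x -> forall t : R, 0 <= t <= 1 ->
    D s (ctr s + t *: (x - ctr s)).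
  move=> s1 x [Bx sx] t t01; split.
    by apply: ball_segment => //; case: (Dctr _ s1).
  have [t0|t0] := eqVneq t 0.
    by rewrite t0 scale0r addr0; case: (Dctr _ s1).
  have {}t0 : 0 < t by rewrite lt_def t0; case/andP: t01.
  case: sx => [sx|[sx|sx]].
  - left; rewrite /=; have [_ ss] := sgn _ s1; case/andP: t01 => _ t1.
    rewrite /= in sx.
    have -> : s * (s * (e / 2) + t *: (x.1.2 - s * (e / 2))) =
      (1 - t) * (s * s) * (e / 2) + t * (s * x.1.2) by rewrite /GRing.scale/=; ring.
    by rewrite ss mulr1; nra.
  - by right; left; rewrite /= add0r subr0 /GRing.scale/= mulr_gt0.
  - by right; right; rewrite /= add0r subr0 /GRing.scale/= pmulr_rlt0.
have star' s : s = 1 \/ s = -1 -> forall x, D s x -> forall t : R, 0 <= t <= 1 ->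
    D s (x + t *: (ctr s - x)).
  move=> s1 x Dx t t01.
  have -> : x + t *: (ctr s - x) = ctr s + (1 - t) *: (x - ctr s).
    rewrite scalerBl scale1r addrA [ctr s + (x - ctr s)]addrC subrK.
    by rewrite -scalerN opprB.
  by apply: star => //; case/andP: t01 => *; apply/andP; split; lra.
have eqseg s (W : set T3) f g x y : W `<=` D s -> open W ->
    selection_on (cubic_roots A B) W f -> selection_on (cubic_roots A B) W g ->
    (forall r : R, 0 <= r <= 1 -> W (x + r *: (y - x))) -> f x = g x -> f y = g y.
  exact: (@selection_eq_segment _ _ _ _ (D s) (@hausdorff_complex R) (UN s)).
have neqD s f g x y : s = 1 \/ s = -1 -> selection_on (cubic_roots A B) (D s) f ->
    selection_on (cubic_roots A B) (D s) g -> D s x -> D s y -> f x = g x -> f y = g y.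
  move=> s1 hf hg Dx Dy fgx.
  have fgc : f (ctr s) = g (ctr s).
    have X := eqseg s (D s) f g x (ctr s) (fun z h => h) (oD s) hf hg (fun r r01 => star' s s1 x Dx r r01) fgx. exact: X.
  exact: eqseg _ _ _ _ _ _ (fun z h => h) (oD s) hf hg (fun r r01 => star s s1 y Dy r r01) fgc.
(* Lifting prescribes values at the centre only. The three sections through the roots there stay
   distinct, so at [m] they exhaust the roots and one of them takes the value [r]. *)
have lift s : s = 1 \/ s = -1 -> forall m, D s m -> forall r, cubic (A m) (B m) r = 0 ->
    exists2 f : T3 -> C, f m = r & selection_on (cubic_roots A B) (D s) f.
  move=> s1 m Dm r hr.
  have [_ _ ne] := hD _ _ (Dctr _ s1).
  have [t1 [t2 [t3 [[n12 n13 n23] [z1 z2 z3]]]]] := cubic_distinct ne.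
  have L := @star_lifting _ _ _ _ (D s) (ctr s) (@hausdorff_complex R) (Dctr _ s1) (star _ s1) (UN s) (LS s).
  have [f1 f1c hf1] := L t1 z1; have [f2 f2c hf2] := L t2 z2; have [f3 f3c hf3] := L t3 z3.
  have ne12 : f1 m != f2 m.
    apply: contraNneq n12 => /(neqD _ _ _ _ _ s1 hf1 hf2 Dm (Dctr _ s1)).
    by rewrite f1c f2c => ->.
  have ne13 : f1 m != f3 m.
    apply: contraNneq n13 => /(neqD _ _ _ _ _ s1 hf1 hf3 Dm (Dctr _ s1)).
    by rewrite f1c f3c => ->.
  have ne23 : f2 m != f3 m.
    apply: contraNneq n23 => /(neqD _ _ _ _ _ s1 hf2 hf3 Dm (Dctr _ s1)).
    by rewrite f2c f3c => ->.
  have [-> | -> | ->] := cubic_roots_exhaust ne12 ne13 ne23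
    (hf1 _ Dm).1 (hf2 _ Dm).1 (hf3 _ Dm).1 hr.
  - exact: (ex_intro2 _ _ f1 erefl hf1).
  - exact: (ex_intro2 _ _ f2 erefl hf2).
  - exact: (ex_intro2 _ _ f3 erefl hf3).
have seg_up (x y : T3) (t : R) : up x -> up y -> 0 <= t <= 1 -> up (x + t *: (y - x)).
  move=> [Bx x0] [By y0] t01; split; first exact: ball_segment.
  rewrite /= /GRing.scale /= in x0 y0 *; case/andP: t01 => t0 t1.
  have [->|tn] := eqVneq t 0; first by rewrite mul0r addr0.
  have {}t0 : 0 < t by rewrite lt_def tn.
  nra.
have seg_lo (x y : T3) (t : R) : lo x -> lo y -> 0 <= t <= 1 -> lo (x + t *: (y - x)).
  move=> [Bx x0] [By y0] t01; split; first exact: ball_segment.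
  rewrite /= /GRing.scale /= in x0 y0 *; case/andP: t01 => t0 t1.
  have [->|tn] := eqVneq t 0; first by rewrite mul0r addr0.
  have {}t0 : 0 < t by rewrite lt_def tn.
  nra.
pose mu : T3 := (h, 0, e / 2); pose ml : T3 := (h, 0, - (e / 2)).
have e2e : e / 2 < e by rewrite ltr_pdivrMr// ltr_pMr// ltr1n.
have upmu : up mu.
  split=> //; rewrite ballE /= subrr !normr0 e0; split=> //; split=> //.
  by rewrite gtr0_norm.
have loml : lo ml.
  split=> /=; last by rewrite oppr_lt0.
  by rewrite ballE /= subrr !normr0 e0; split=> //; split=> //; rewrite normrN gtr0_norm.
have P1 : (1 : R) = 1 \/ (1 : R) = -1 by left.
have N1 : (-1 : R) = 1 \/ (-1 : R) = -1 by right.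
have eq_up f g x : selection_on (cubic_roots A B) (D 1) f ->
    selection_on (cubic_roots A B) (D (-1)) g -> f mu = g mu -> up x -> f x = g x.
  move=> hf hg fg ux.
  have hf' : selection_on (cubic_roots A B) up f by move=> y /(upD 1); exact: hf.
  have hg' : selection_on (cubic_roots A B) up g by move=> y /(upD (-1)); exact: hg.
  exact: eqseg _ _ _ _ _ _ (upD 1) oup hf' hg' (fun t t01 => seg_up _ _ t upmu ux t01) fg.
have eq_lo f g x : selection_on (cubic_roots A B) (D 1) f ->
    selection_on (cubic_roots A B) (D (-1)) g -> f ml = g ml -> lo x -> f x = g x.
  move=> hf hg fg ux.
  have hf' : selection_on (cubic_roots A B) lo f by move=> y /(loD 1); exact: hf.
  have hg' : selection_on (cubic_roots A B) lo g by move=> y /(loD (-1)); exact: hg.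
  exact: eqseg _ _ _ _ _ _ (loD 1) olo hf' hg' (fun t t01 => seg_lo _ _ t loml ux t01) fg.
have Dcap x : D 1 x -> D (-1) x -> up x \/ lo x.
  move=> [Bx [d1|[d1|d1]]] [_ [d2|[d2|d2]]]; try by [left|right].
  by exfalso; move: d1 d2; rewrite /= mul1r mulN1r; lra.
have Dcup x : ball p e x -> ~ axis x -> (D 1 `|` D (-1)) x.
  move=> Bx nax; have [z0|z0|z0] := ltrgtP x.2 0.
  - by left; split=> //; right; right.
  - by left; split=> //; right; left.
  - have [y0|y0|y0] := ltrgtP x.1.2 0; last by case: nax.
      by right; split=> //; left; rewrite /= mulN1r oppr_gt0.
    by left; split=> //; left; rewrite /= mul1r.
have [_ _ ne] := hD 1 mu (upD _ _ upmu).
have [t1 [t2 [t3 [[n12 n13 n23] [z1 z2 z3]]]]] := cubic_distinct ne.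
have [f1 f1m hf1] := lift _ P1 mu (upD _ _ upmu) _ z1.
have [f2 f2m hf2] := lift _ P1 mu (upD _ _ upmu) _ z2.
have [f3 f3m hf3] := lift _ P1 mu (upD _ _ upmu) _ z3.
have [g1 g1m hg1] := lift _ N1 mu (upD _ _ upmu) _ z1.
have [g2 g2m hg2] := lift _ N1 mu (upD _ _ upmu) _ z2.
have [g3 g3m hg3] := lift _ N1 mu (upD _ _ upmu) _ z3.
have e1m : f1 mu = g1 mu := etrans f1m (esym g1m).
have e2m : f2 mu = g2 mu := etrans f2m (esym g2m).
have e3m : f3 mu = g3 mu := etrans f3m (esym g3m).
have root_glue f g : selection_on (cubic_roots A B) (D 1) f ->
    selection_on (cubic_roots A B) (D (-1)) g -> f mu = g mu -> f ml = g ml -> False.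
  move=> hf hg eu el; apply: nr.
  have [r hr] := @glue2 _ (D 1) (D (-1)) f g (fun x r => cubic (A x) (B x) r = 0) (oD _) (oD _)
    (fun x Dx => conj (hf x Dx).2 (hf x Dx).1) (fun x Dx => conj (hg x Dx).2 (hg x Dx).1)
    (fun x Dx Dx' => match Dcap x Dx Dx' with
      | or_introl ux => eq_up f g x hf hg eu ux | or_intror lx => eq_lo f g x hf hg el lx end).
  by exists r => x Bx /(Dcup _ Bx) /hr.
have dist f g : forall s, s = 1 \/ s = -1 -> selection_on (cubic_roots A B) (D s) f ->
    selection_on (cubic_roots A B) (D s) g -> f mu != g mu -> forall x, D s x -> f x != g x.
  move=> s s1 hf hg nfg x Dx; apply: contraNneq nfg => fgx; apply/eqP.
  exact: neqD s1 hf hg Dx (upD _ _ upmu) fgx.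
have nf12 : f1 mu != f2 mu by rewrite f1m f2m.
have f12 x (Dx : D 1 x) : f1 x != f2 x := dist _ _ _ P1 hf1 hf2 nf12 x Dx.
have nf13 : f1 mu != f3 mu by rewrite f1m f3m.
have f13 x (Dx : D 1 x) : f1 x != f3 x := dist _ _ _ P1 hf1 hf3 nf13 x Dx.
have nf23 : f2 mu != f3 mu by rewrite f2m f3m.
have f23 x (Dx : D 1 x) : f2 x != f3 x := dist _ _ _ P1 hf2 hf3 nf23 x Dx.
have ng12 : g1 mu != g2 mu by rewrite g1m g2m.
have g12 x (Dx : D (-1) x) : g1 x != g2 x := dist _ _ _ N1 hg1 hg2 ng12 x Dx.
have ng13 : g1 mu != g3 mu by rewrite g1m g3m.
have g13 x (Dx : D (-1) x) : g1 x != g3 x := dist _ _ _ N1 hg1 hg3 ng13 x Dx.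
have ng23 : g2 mu != g3 mu by rewrite g2m g3m.
have g23 x (Dx : D (-1) x) : g2 x != g3 x := dist _ _ _ N1 hg2 hg3 ng23 x Dx.
have ex g : selection_on (cubic_roots A B) (D (-1)) g ->
    [\/ g ml = f1 ml, g ml = f2 ml | g ml = f3 ml].
  move=> hg; have Dm := loD 1 _ loml.
  exact: (@cubic_roots_exhaust R (A ml) (B ml) (f1 ml) (f2 ml) (f3 ml) (f12 _ Dm)
    (f13 _ Dm) (f23 _ Dm) (hf1 _ Dm).1 (hf2 _ Dm).1 (hf3 _ Dm).1 (g ml)
    (hg _ (loD (-1) _ loml)).1).
pose vd (a b c : T3 -> R[i]) (x : T3) : R[i] :=
  (a x - b x) * (b x - c x) * (c x - a x) / 6.
have cvd (a b c : T3 -> R[i]) x : ccont a x -> ccont b x -> ccont c x ->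
    ccont (vd a b c) x.
  move=> ca cb cc.
  exact: (contM (contM (contM (contB ca cb) (contB cb cc)) (contB cc ca)) (@contK _ _ _ (6^-1))).
have vd_glue : (forall x, lo x -> vd f1 f2 f3 x = vd g1 g2 g3 x) -> False.
  move=> el; apply: nd.
  have [] := @glue2 _ (D 1) (D (-1)) (vd f1 f2 f3) (vd g1 g2 g3)
    (fun x d => d ^+ 2 = 3 * (A x ^+ 3 - B x ^+ 2)) (oD _) (oD _); last first.
  - by move=> r hr; exists r => x Bx /(Dcup _ Bx) /hr.
  - move=> x Dx Dx'; have [ux|lx] := Dcap _ Dx Dx'; last exact: el.
    by rewrite /vd (eq_up f1 g1 x hf1 hg1 e1m ux) (eq_up f2 g2 x hf2 hg2 e2m ux)
      (eq_up f3 g3 x hf3 hg3 e3m ux).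
  - move=> x Dx; have [c1 e1'] := hg1 _ Dx; have [c2 e2''] := hg2 _ Dx; have [c3 e3'] := hg3 _ Dx.
    split; first exact: cvd e1' e2'' e3'.
    exact: cubic_vandermonde (g12 _ Dx) (g13 _ Dx) (g23 _ Dx) c1 c2 c3.
  - move=> x Dx; have [c1 e1'] := hf1 _ Dx; have [c2 e2''] := hf2 _ Dx; have [c3 e3'] := hf3 _ Dx.
    split; first exact: cvd e1' e2'' e3'.
    exact: cubic_vandermonde (f12 _ Dx) (f13 _ Dx) (f23 _ Dx) c1 c2 c3.
have Dml := loD (-1) _ loml.
(* Case distinction over the permutation read off at [ml]: fixed indices go to [root_glue], the two
   3-cycles to [vd_glue], and coinciding values are impossible. *)
have [e1|e1|e1] := ex _ hg1.
- exact: (root_glue f1 g1 hf1 hg1 e1m (esym e1)).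
- have [e'|e'|e'] := ex _ hg2.
  + have [e''|e''|e''] := ex _ hg3; last exact: (root_glue f3 g3 hf3 hg3 e3m (esym e'')).
      by have := g23 _ Dml; rewrite e' e'' eqxx.
    by have := g13 _ Dml; rewrite e1 e'' eqxx.
  + by have := g12 _ Dml; rewrite e1 e' eqxx.
  + have [e''|e''|e''] := ex _ hg3; [|by have := g13 _ Dml; rewrite e1 e'' eqxx|by have := g23 _ Dml; rewrite e' e'' eqxx].
    have H x : lo x -> vd f1 f2 f3 x = vd g1 g2 g3 x.
      move=> lx; rewrite /vd -(eq_lo f2 g1 x hf2 hg1 (esym e1) lx) -(eq_lo f3 g2 x hf3 hg2 (esym e') lx) -(eq_lo f1 g3 x hf1 hg3 (esym e'') lx).
      by congr (_ / _); ring.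
    exact: vd_glue H.
- have [e'|e'|e'] := ex _ hg2.
  + have [e''|e''|e''] := ex _ hg3; [by have := g23 _ Dml; rewrite e' e'' eqxx| |by have := g13 _ Dml; rewrite e1 e'' eqxx].
    have H x : lo x -> vd f1 f2 f3 x = vd g1 g2 g3 x.
      move=> lx; rewrite /vd -(eq_lo f3 g1 x hf3 hg1 (esym e1) lx) -(eq_lo f1 g2 x hf1 hg2 (esym e') lx) -(eq_lo f2 g3 x hf2 hg3 (esym e'') lx).
      by congr (_ / _); ring.
    exact: vd_glue H.
  + exact: (root_glue f2 g2 hf2 hg2 e2m (esym e')).
  + by have := g12 _ Dml; rewrite e1 e' eqxx.
Qed.

End knotted.
Arguments knotted_germ R {X} a p.

(** * A long trefoil *)

Section trefoil.
Context {R : realType}.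
Local Notation C := (R[i]^o : topologicalType).
Local Notation T3 := (R * R * R)%type.
Implicit Types (p : T3) (u : R[i]).

(** [zeta] is the horizontal complex coordinate; [beta] is the complex coordinate, centred at the
    unit circle, in the vertical half-plane through the point. *)
Definition zeta p : R[i] := (p.1.1 +i* p.1.2)%C.
Definition beta p : R[i] := ((cabs (zeta p) - 1) +i* p.2)%C.
(** Equal to 1 up to [1/2] and to 0 from [3/4] on. The first range covers the tube of radius [1/4]
    that carries the knot, the second the vertical axis, at distance 1 from the unit circle. *)
Definition mcut (t : R) : R := Num.max 0 (Num.min 1 (3 - 4 * t)).

(* The knot is the zero set of [mA ^+ 3 - mB ^+ 2]; the factor [mcut] makes [mA]
   vanish near the axis of the torus, where the angle is undefined. *)
Definition mA p : R[i] :=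
  (mcut (cabs (beta p)) / Num.max (cabs (zeta p)) (1 / 4))%:C%C * zeta p.
Definition mB p : R[i] := 4 * beta p.

(** The torus knot of type (2, 3) on the tube of radius [1/4] about the unit circle: the direction
    of [zeta] is [u ^+ 2] and [4 beta] is [u ^+ 3]. *)
Definition knot_pt u : T3 :=
  let v := (1 + Re (u ^+ 3) / 4)%:C%C * u ^+ 2 in (Re v, Im v, Im (u ^+ 3) / 4).

Definition knot : set T3 := [set p | exists2 u, cabs u = 1 & p = knot_pt u].

Lemma sqrcE (a b : R) : (a +i* b)%C ^+ 2 = ((a ^+ 2 - b ^+ 2) +i* (2 * a * b))%C.
Proof. by apply/eqP; rewrite eq_complex/=; apply/andP; split; apply/eqP; ring. Qed.

Lemma cubecE (a b : R) : (a +i* b)%C ^+ 3 =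
  ((a ^+ 3 - 3 * a * b ^+ 2) +i* (3 * a ^+ 2 * b - b ^+ 3))%C.
Proof. by apply/eqP; rewrite eq_complex/=; apply/andP; split; apply/eqP; ring. Qed.

Lemma cabs1P (a b : R) : cabs (a +i* b)%C = 1 -> a ^+ 2 + b ^+ 2 = 1.
Proof. by move=> h; have := sqr_cabs (a +i* b)%C; rewrite h expr1n /= => <-. Qed.

Lemma realcM (r a b : R) : r%:C%C * (a +i* b)%C = ((r * a) +i* (r * b))%C.
Proof. by apply/eqP; rewrite eq_complex/=; apply/andP; split; apply/eqP; ring. Qed.

Lemma Re_unit_cube u : cabs u = 1 -> `|Re (u ^+ 3)| <= 1.
Proof. by move=> h; apply: le_trans (ge_Re_cabs _) _; rewrite cabsX h expr1n. Qed.

Lemma Im_unit_cube u : cabs u = 1 -> `|Im (u ^+ 3)| <= 1.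
Proof. by move=> h; apply: le_trans (ge_Im_cabs _) _; rewrite cabsX h expr1n. Qed.

Lemma zeta_knot_pt u : zeta (knot_pt u) = (1 + Re (u ^+ 3) / 4)%:C%C * u ^+ 2.
Proof. by rewrite /zeta /knot_pt /=; case: (_ * _). Qed.

Lemma cabs_zeta_knot_pt u : cabs u = 1 ->
  cabs (zeta (knot_pt u)) = 1 + Re (u ^+ 3) / 4.
Proof.
move=> h; rewrite zeta_knot_pt cabsM cabs_real cabsX h expr1n mulr1 ger0_norm//.
by have := Re_unit_cube h; rewrite ler_norml => /andP[]; lra.
Qed.

Lemma beta_knot_pt u : cabs u = 1 -> 4 * beta (knot_pt u) = u ^+ 3.
Proof.
move=> h; rewrite /beta cabs_zeta_knot_pt//=.
have -> : (4 : R[i]) = (4 : R)%:C%C by rewrite rmorph_nat.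
rewrite realcM; case: (u ^+ 3) => a b /=.
by apply/eqP; rewrite eq_complex/=; apply/andP; split; apply/eqP; field.
Qed.

Lemma mcut_le1 t : 0 <= mcut t <= 1.
Proof. by rewrite /mcut le_max lexx/= ge_max ler01/= ge_min lexx. Qed.

Lemma cabs_nat n : cabs (n%:R : R[i]) = n%:R.
Proof. by apply/complexI; rewrite -cabsE normr_nat rmorph_nat. Qed.

(** The equation gives [|mA| ^+ 3 = 16 |beta| ^+ 2] with [|mA| <= 1], hence [|beta| <= 1/4]. There
    the cut-off is inactive and [mA] has modulus 1, so [u = mB / mA] solves [u ^+ 2 = mA] and
    [u ^+ 3 = mB]. *)
Lemma knotP p : mA p ^+ 3 = mB p ^+ 2 <-> knot p.
Proof.
split=> [e|[u u1 ->]]; last first.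
  have z0 := cabs_zeta_knot_pt u1; have b0 := beta_knot_pt u1.
  have r1 := Re_unit_cube u1.
  have bn : cabs (beta (knot_pt u)) = 1 / 4.
    have : cabs (4 * beta (knot_pt u)) = 1 by rewrite b0 cabsX u1 expr1n.
    rewrite cabsM cabs_nat; lra.
  rewrite /mA /mB b0 bn z0 zeta_knot_pt.
  have r0 : 3 / 4 <= 1 + Re (u ^+ 3) / 4.
    by move: r1; rewrite ler_norml => /andP[]; lra.
  set r := 1 + _ in r0 *.
  have -> : Num.max r (1 / 4) = r by apply/max_idPl; lra.
  have -> : mcut (1 / 4) = 1.
    by rewrite /mcut min_l ?max_r//; lra.
  rewrite mulrA -rmorphM/= divfK ?mul1r; last by rewrite gt_eqF//; lra.
  by rewrite -!exprM.
have ce : cabs (mA p) ^+ 3 = 16 * cabs (beta p) ^+ 2.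
  by rewrite -cabsX e cabsX /mB cabsM cabs_nat exprMn; ring.
have mx : 0 < Num.max (cabs (zeta p)) (1 / 4) by rewrite lt_max; apply/orP; right; lra.
have cA : cabs (mA p) <= 1.
  rewrite /mA cabsM cabs_real ger0_norm; last first.
    by apply: divr_ge0; [case/andP: (mcut_le1 (cabs (beta p)))|exact: ltW].
  rewrite mulrAC ler_pdivrMr// [leRHS]mul1r.
  have /andP[m0 m1] := mcut_le1 (cabs (beta p)).
  by apply: le_trans (ler_piMl (cabs_ge0 _) m1) _; rewrite le_max lexx.
have b4 : cabs (beta p) <= 1 / 4.
  have := cabs_ge0 (mA p); have := cabs_ge0 (beta p); move: ce cA.
  move: (cabs (mA p)) (cabs (beta p)) => a b ce a1 b0 a0.
  have : a ^+ 3 <= 1 by rewrite exprn_ile1.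
  by rewrite ce; nra.
have rz : `|cabs (zeta p) - 1| <= 1 / 4 by apply: le_trans (ge_Re_cabs (beta p)) b4.
have rz' : 3 / 4 <= cabs (zeta p) by move: rz; rewrite ler_norml => /andP[]; lra.
have AE : mA p = (cabs (zeta p))^-1%:C%C * zeta p.
  rewrite /mA; congr (_%:C%C * _).
  rewrite (_ : mcut _ = 1) ?mul1r; last by rewrite /mcut min_l ?max_r//; lra.
  by rewrite (_ : Num.max _ _ = cabs (zeta p))//; apply/max_idPl; lra.
have rn0 : cabs (zeta p) != 0 by rewrite gt_eqF//; lra.
have A1 : cabs (mA p) = 1.
  by rewrite AE cabsM cabs_real gtr0_norm ?mulVf// invr_gt0; lra.
have An0 : mA p != 0 by rewrite -cabs_eq0 A1 oner_eq0.
pose u := mB p / mA p.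
have u2 : u ^+ 2 = mA p.
  by rewrite /u expr_div_n -e exprSr mulrAC divff ?mul1r// expf_neq0.
have u3 : u ^+ 3 = mB p by rewrite exprSr u2 /u mulrC divfK.
have u1 : cabs u = 1.
  have : cabs u ^+ 2 = 1 by rewrite -cabsX u2.
  by move/eqP; rewrite sqrf_eq1 => /orP[/eqP//|/eqP h]; have := cabs_ge0 u; rewrite h; lra.
exists u => //.
have bE : beta p = ((Re (u ^+ 3) / 4) +i* (Im (u ^+ 3) / 4))%C.
  rewrite u3 /mB; have -> : (4 : R[i]) = (4 : R)%:C%C by rewrite rmorph_nat.
  case: (beta p) => a b; rewrite realcM /=.
  by apply/eqP; rewrite eq_complex/=; apply/andP; split; apply/eqP; field.
have [rE zE] : cabs (zeta p) = 1 + Re (u ^+ 3) / 4 /\ p.2 = Im (u ^+ 3) / 4.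
  by move: bE => [h ->]; split => //; rewrite -h; ring.
have zetaE : zeta p = (1 + Re (u ^+ 3) / 4)%:C%C * u ^+ 2.
  rewrite -rE u2 AE mulrA -rmorphM/= mulfV// mul1r.
  by [].
rewrite /knot_pt -zetaE -zE /zeta /=.
by case: (p) => [[? ?] ?].
Qed.

Lemma knot_pt_unit_eq u v : cabs u = 1 -> cabs v = 1 ->
  (knot_pt u).1 = (knot_pt v).1 -> u ^+ 2 = v ^+ 2 /\ Re (u ^+ 3) = Re (v ^+ 3).
Proof.
move=> hu hv h.
have zE : zeta (knot_pt u) = zeta (knot_pt v) by rewrite /zeta h.
have rE : Re (u ^+ 3) = Re (v ^+ 3).
  by have := cabs_zeta_knot_pt hu; rewrite zE cabs_zeta_knot_pt//; lra.
split => //; move: zE; rewrite !zeta_knot_pt rE; apply: mulfI.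
rewrite (inj_eq (@complexI R) _ 0) gt_eqF//.
by have := Re_unit_cube hv; rewrite ler_norml => /andP[]; lra.
Qed.

Lemma knot_pt_inj u v : cabs u = 1 -> cabs v = 1 -> knot_pt u = knot_pt v -> u = v.
Proof.
move=> hu hv h.
have [e2 re] := knot_pt_unit_eq hu hv (congr1 fst h).
have im : Im (u ^+ 3) = Im (v ^+ 3) by have := congr1 snd h; rewrite /=; lra.
have e3 : u ^+ 3 = v ^+ 3.
  by move: re im; case: (u ^+ 3) (v ^+ 3) => a b [a' b'] /= -> ->.
have un0 : u ^+ 2 != 0 by rewrite expf_neq0// -cabs_eq0 hu oner_eq0.
by apply: (mulfI un0); rewrite -exprSr e3 exprSr e2.
Qed.

(** These are the crossings of the vertical projection: the angle determines [u] up to sign, and the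
    cubes, being opposite with equal real parts, are imaginary. *)
Lemma knot_pt_sheets u v : cabs u = 1 -> cabs v = 1 -> u <> v ->
  (knot_pt u).1 = (knot_pt v).1 -> v = - u /\ Re (u ^+ 3) = 0.
Proof.
move=> hu hv ne h; have [e2 re] := knot_pt_unit_eq hu hv h.
have vE : v = - u.
  apply/eqP; move/eqP: e2; rewrite eqf_sqr => /orP[/eqP//|/eqP ->].
  by rewrite opprK.
by split => //; move: re; rewrite vE; case: u {hu hv ne h e2 vE} => a b;
  rewrite !cubecE /= => re; move: re; rewrite (exprS _ 2) (exprS (-a) 2); nra.
Qed.

(** Stereographic parametrisation [(s + i) / (s - i)] of the unit circle without the point 1.
    Leaving out that point opens the knot to a long strand. *)
Definition su (s : R) : R[i] :=
  (((s ^+ 2 - 1) / (s ^+ 2 + 1)) +i* (2 * s / (s ^+ 2 + 1)))%C.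

Lemma s21_gt0 (s : R) : 0 < s ^+ 2 + 1.
Proof. by rewrite ltr_wpDl// sqr_ge0. Qed.

Lemma cabs_su s : cabs (su s) = 1.
Proof.
have h := s21_gt0 s.
rewrite /cabs /= (_ : _ + _ = 1) ?sqrtr1//.
by field; rewrite gt_eqF.
Qed.

Lemma su_surj u : cabs u = 1 -> Re u != 1 -> u = su (Im u / (1 - Re u)).
Proof.
case: u => a b /cabs1P /= ab a1.
have a1' : 1 - a != 0 by rewrite subr_eq0 eq_sym.
have bE : b ^+ 2 = (1 - a) * (1 + a) by rewrite -subr_sqr expr1n -ab addrC addKr.
have e : (b / (1 - a)) ^+ 2 = (1 + a) / (1 - a).
  by rewrite expr_div_n bE; field.
have n2 : (2 : R) != 0 by rewrite pnatr_eq0.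
have d0 : 1 + a + (1 - a) != 0 by rewrite addrACA subrr addr0.
rewrite /su e; apply/eqP; rewrite eq_complex/=; apply/andP; split; apply/eqP.
  by field; rewrite d0 a1'.
by field; rewrite d0 a1'.
Qed.

Lemma su_inj : injective su.
Proof.
move=> s t [h1 h2].
have E (r : R) : 2 * r / (r ^+ 2 + 1) = r * (1 - (r ^+ 2 - 1) / (r ^+ 2 + 1)).
  by field; rewrite gt_eqF ?s21_gt0.
have : (s - t) * (1 - (t ^+ 2 - 1) / (t ^+ 2 + 1)) = 0.
  by rewrite mulrBl -E -h2 -h1 -E subrr.
move/eqP; rewrite mulf_eq0 subr_eq0 => /orP[/eqP//|].
have -> : 1 - (t ^+ 2 - 1) / (t ^+ 2 + 1) = 2 / (t ^+ 2 + 1).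
  by field; rewrite gt_eqF ?s21_gt0.
by rewrite mulf_eq0 pnatr_eq0/= invr_eq0 gt_eqF ?s21_gt0.
Qed.

(** With [a = cos phi] this is the product of [1 + cos (3 phi) / 4] and [cos (2 phi)], the first
    coordinate of the knot. *)
Definition xC (a : R) : R := (1 + (4 * a ^+ 3 - 3 * a) / 4) * (2 * a ^+ 2 - 1).

(** The abscissa at [s = 9] and [s = -9], where [Re (su s) = 40 / 41]. The part of the knot not
    beyond it is the single strand [|s| <= 9]. *)
Definition cut : R := xC (40 / 41).

Lemma knot_pt_x u : cabs u = 1 -> (knot_pt u).1.1 = xC (Re u).
Proof.
case: u => a b /cabs1P ab; rewrite /knot_pt cubecE sqrcE realcM /= /xC.
have -> : b ^+ 2 = 1 - a ^+ 2 by rewrite -ab addrC addKr.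
by field.
Qed.

Lemma xC_mono a b : 3 / 4 <= a -> a < b -> xC a < xC b.
Proof.
move=> a0 ab; rewrite /xC.
have f1 : (4 * a ^+ 3 - 3 * a) < (4 * b ^+ 3 - 3 * b).
  rewrite -subr_gt0; have -> : (4 * b ^+ 3 - 3 * b) - (4 * a ^+ 3 - 3 * a) =
    (b - a) * (4 * (b ^+ 2 + a * b + a ^+ 2) - 3) by ring.
  by apply: mulr_gt0; nra.
have f2 : a ^+ 2 < b ^+ 2 by nra.
have f0 : 0 <= 1 + (4 * a ^+ 3 - 3 * a) / 4.
  have -> : 1 + (4 * a ^+ 3 - 3 * a) / 4 = 1 + a * (a ^+ 2 - 3 / 4) by field.
  nra.
apply: ltr_pM => //; first by nra.
  by lra.
by lra.
Qed.

End trefoil.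

Section near_order.
Context {R : realType} {T : topologicalType}.
Variables (f : T -> R) (x : T).

Lemma near_gt a : {for x, continuous f} -> a < f x -> \forall y \near x, a < f y.
Proof. by move=> cf h; exact: (cf _ (lt_nbhsr h)). Qed.

Lemma near_lt a : {for x, continuous f} -> f x < a -> \forall y \near x, f y < a.
Proof. by move=> cf h; exact: (cf _ (lt_nbhsl h)). Qed.

End near_order.

(** * The strand up to the cut, charts along the knot, and two test loops *)

Section strand.
Context {R : realType}.
Local Notation C := (R[i]^o : topologicalType).
Local Notation T3 := (R * R * R)%type.
Local Notation pi := (@pi R).
Implicit Types (p : T3) (u : R[i]) (s : R).

Definition strand s : T3 := knot_pt (su s).

(** For [p.1.1 <= cut] this is the l1 distance from [p] to the vertical line [x = cut], [y = 0]. The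
    half-planes bounded by that line are the pages of a book on which the strand is read off, and
    [lam] is the distance from the spine. *)
Definition lam p : R := cut - p.1.1 + `|p.1.2|.

Lemma cut_bounds : 1 < cut :> R /\ cut < 5 / 4 :> R.
Proof.
rewrite /cut /xC; set a : R := 40 / 41.
have a1 : 39 / 40 <= a < 99 / 100 by rewrite /a; apply/andP; split; lra.
clearbody a; case/andP: a1 => a0 a1.
have a2 : 19 / 20 <= a ^+ 2 by nra.
have a2' : a ^+ 2 <= 99 / 100 by nra.
have a3 : a ^+ 3 = a * a ^+ 2 by rewrite exprS.
have a3' : 92 / 100 <= a ^+ 3 by rewrite a3; nra.
have a3'' : a ^+ 3 <= a by rewrite a3; nra.
have f1 : 117 / 100 <= 1 + (4 * a ^+ 3 - 3 * a) / 4 by lra.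
have f2 : 1 + (4 * a ^+ 3 - 3 * a) / 4 <= 5 / 4 by lra.
move: (1 + _) f1 f2 => f f1 f2.
have g1 : 9 / 10 <= 2 * a ^+ 2 - 1 by lra.
have g2 : 2 * a ^+ 2 - 1 <= 98 / 100 by lra.
move: (_ - 1) g1 g2 => g g1 g2.
by split; nra.
Qed.

Lemma xC_le1 a : -1 <= a <= 3 / 4 -> xC a <= 1 :> R.
Proof.
move=> /andP[a0 a1]; rewrite /xC.
have -> : 1 + (4 * a ^+ 3 - 3 * a) / 4 = 1 + a * (a ^+ 2 - 3 / 4) :> R by field.
have a2 : a ^+ 2 <= 1 by nra.
have f0 : 0 <= 1 + a * (a ^+ 2 - 3 / 4).
  have -> : 1 + a * (a ^+ 2 - 3 / 4) = 3 / 4 + (a + 1) * (2 * a - 1) ^+ 2 / 4 by field.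
  suff : 0 <= (a + 1) * (2 * a - 1) ^+ 2 by lra.
  by apply: mulr_ge0; [lra|exact: sqr_ge0].
have f2 : 1 + a * (a ^+ 2 - 3 / 4) <= 5 / 4.
  have -> : 1 + a * (a ^+ 2 - 3 / 4) = 5 / 4 - (1 - a) * (2 * a + 1) ^+ 2 / 4 by field.
  suff : 0 <= (1 - a) * (2 * a + 1) ^+ 2 by lra.
  by apply: mulr_ge0; [lra|exact: sqr_ge0].
have [h|h] := leP (a ^+ 2) (3 / 4).
  by move: (1 + _) f0 f2 => f f0 f2; nra.
have a3 : a < 0.
  by rewrite ltNge; apply/negP => a3; nra.
have f1 : 1 + a * (a ^+ 2 - 3 / 4) <= 1 by nra.
by move: (1 + _) f0 f1 f2 => f f0 f1 f2; nra.
Qed.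

Lemma Re_su s : Re (su s) = (s ^+ 2 - 1) / (s ^+ 2 + 1). Proof. by []. Qed.

Lemma Re_su_lt s t : s ^+ 2 < t ^+ 2 -> Re (su s) < Re (su t).
Proof.
move=> st; rewrite !Re_su ltr_pdivrMr ?s21_gt0// mulrAC ltr_pdivlMr ?s21_gt0//.
nra.
Qed.

Lemma Re_su_bound s : -1 <= Re (su s) <= 1.
Proof.
by rewrite -ler_norml; apply: le_trans (ge_Re_cabs _) _; rewrite cabs_su.
Qed.

Lemma strand_x s : (strand s).1.1 = xC (Re (su s)).
Proof. by rewrite /strand knot_pt_x// cabs_su. Qed.

Lemma Re_su9 : Re (su 9) = 40 / 41 :> R.
Proof. by rewrite Re_su; field. Qed.

Lemma strand_x_lt s : `|s| < 9 -> (strand s).1.1 < cut.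
Proof.
move=> s9; rewrite strand_x /cut -Re_su9.
have lt : Re (su s) < Re (su 9).
  by move: s9; rewrite ltr_norml => /andP[s1 s2]; apply: Re_su_lt; nra.
have [h|h] := leP (3 / 4) (Re (su s)); first exact: xC_mono.
apply: le_lt_trans (xC_le1 _) _; first by case/andP: (Re_su_bound s) => -> _ /=; rewrite ltW.
by rewrite Re_su9; case: cut_bounds.
Qed.

Lemma strand_x9 s : `|s| = 9 -> (strand s).1.1 = cut.
Proof.
move=> s9; rewrite strand_x /cut -Re_su9 !Re_su.
by rewrite -(real_normK (num_real s)) s9.
Qed.

Lemma strand_x_mono s t : 3 <= s -> s < t -> (strand s).1.1 < (strand t).1.1.
Proof.
move=> s3 st; rewrite !strand_x; apply: xC_mono; last first.
  by apply: Re_su_lt; nra.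
by rewrite Re_su ler_pdivlMr ?s21_gt0//; nra.
Qed.

Lemma knot_cut p : knot p -> p.1.1 <= cut -> exists2 s, `|s| <= 9 & p = strand s.
Proof.
move=> [u u1 ->] px.
have ne : Re u != 1.
  apply: contraTneq px => h; rewrite knot_pt_x// h -ltNge /xC.
  by case: cut_bounds => _; rewrite !expr1n; lra.
have uE := su_surj u1 ne; set s := _ / _ in uE.
exists s; last by rewrite /strand -uE.
rewrite leNgt; apply/negP => s9.
move: px; rewrite uE -/(strand s) strand_x; apply/negP; rewrite -ltNge /cut -Re_su9.
apply: xC_mono; first by rewrite Re_su9; lra.
by apply: Re_su_lt; rewrite -(real_normK (num_real s)); nra.
Qed.

Lemma strand_inj : injective strand.
Proof. by move=> s t /knot_pt_inj h; apply: su_inj; apply: h; exact: cabs_su. Qed.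

Lemma strand_knot s : knot (strand s).
Proof. by exists (su s) => //; exact: cabs_su. Qed.

Lemma strandN s : strand (- s) =
  ((strand s).1.1, - (strand s).1.2, - (strand s).2).
Proof.
rewrite /strand /knot_pt /su !cubecE !sqrcE !realcM /= sqrrN.
by congr (_, _, _); field; rewrite gt_eqF ?s21_gt0.
Qed.

Lemma strand_y9 : 0 < (strand 9).1.2.
Proof.
have := @Re_unit_cube R (su 9) (cabs_su 9); rewrite ler_norml => /andP[r0 _].
rewrite /strand /knot_pt; set r := 1 + _; have r0' : 0 < r by rewrite /r; lra.
rewrite /su sqrcE realcM /= mulr_gt0//.
by rewrite !mulr_gt0// ?invr_gt0 ?s21_gt0//; lra.
Qed.

Lemma strand_ye s : `|s| = 9 -> (strand s).1.2 = s / 9 * (strand 9).1.2.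
Proof.
move=> h; have [s0|s0] := leP 0 s.
  by move: h; rewrite ger0_norm// => ->; rewrite divff ?mul1r ?pnatr_eq0.
have -> : s = - 9 by move: h; rewrite ltr0_norm//; lra.
by rewrite strandN /= mulNr divff ?mulN1r ?pnatr_eq0.
Qed.

Lemma strand_ye0 s : `|s| = 9 -> (strand s).1.2 != 0.
Proof.
move=> h; have s0 : s != 0 by rewrite -normr_eq0 h pnatr_eq0.
by rewrite strand_ye// !mulf_neq0 ?invr_eq0 ?pnatr_eq0// gt_eqF// strand_y9.
Qed.

(** The strand reaches the plane [x = cut] only at its two ends, which have nonzero second
    coordinate; so it misses the spine. *)
Lemma lam_gt0 p : knot p -> p.1.1 <= cut -> 0 < lam p.
Proof.
move=> kp px; rewrite /lam.
have [s s9 pE] := knot_cut kp px.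
move: s9; rewrite le_eqVlt => /orP[/eqP s9|s9].
  have := strand_ye0 s9; rewrite -normr_gt0 pE strand_x9//; lra.
by have := strand_x_lt s9; rewrite pE; have := normr_ge0 (strand s).1.2; lra.
Qed.

Lemma knot_bounds p : knot p ->
  [/\ `|p.1.1| <= 5 / 4, `|p.1.2| <= 5 / 4 & `|p.2| <= 1 / 4].
Proof.
move=> [u u1 ->].
have z1 : cabs (zeta (knot_pt u)) <= 5 / 4.
  rewrite cabs_zeta_knot_pt//; have := Re_unit_cube u1; rewrite ler_norml => /andP[]; lra.
split; first exact: le_trans (ge_Re_cabs (zeta (knot_pt u))) z1.
  exact: le_trans (ge_Im_cabs (zeta (knot_pt u))) z1.
rewrite /knot_pt /= normrM (ger0_norm (_ : 0 <= 4^-1)) ?invr_ge0//.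
by have := Im_unit_cube u1; lra.
Qed.

(** At a crossing [Re (u ^+ 3) = 0], so the two heights are [1/4] and [- 1/4]. The real part [a] of
    [u] then satisfies [a (4 a ^+ 2 - 3) = 0], which leaves crossings with [y = 0] or
    [y ^+ 2 = 3/4]. The strict inequality keeps crossings away from the outer pages; vertical
    translation of the strand exploits this room. *)
Lemma knot_chord p q : knot p -> knot q -> p.1 = q.1 -> p <> q ->
  `|p.2 - q.2| = 1 / 2 /\ 2 * p.1.2 ^+ 2 < lam p ^+ 2.
Proof.
move=> [u u1 ->] [v v1 ->] h ne.
have uv : u <> v by move=> e; apply: ne; rewrite e.
have [vE re0] := knot_pt_sheets u1 v1 uv h.
have c3 : cabs (u ^+ 3) = 1 by rewrite cabsX u1 expr1n.
have imE : `|Im (u ^+ 3)| = 1.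
  by move: c3; rewrite /cabs re0 expr0n/= add0r sqrtr_sqr.
split.
  rewrite vE /knot_pt /= exprNn -[(-1) ^+ 3]/(-1 * (-1 * -1)) mulN1r mulrNN !mulr1.
  rewrite mulN1r (_ : Im (- u ^+ 3) = - Im (u ^+ 3)); last by case: (u ^+ 3).
  by rewrite mulNr opprK -mulrDl normrM -mulr2n normrMn imE ger0_norm//; lra.
rewrite /lam knot_pt_x//.
case: u u1 re0 {c3 imE uv vE ne h} => a b /cabs1P ab.
rewrite [in X in X -> _]cubecE -[complex.Re _]/(a ^+ 3 - 3 * a * b ^+ 2) => re0.
have bE : b ^+ 2 = 1 - a ^+ 2 by rewrite -ab addrC addKr.
have {}re0 : a * (4 * a ^+ 2 - 3) = 0 by rewrite -[RHS]re0 bE; ring.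
have yE : (knot_pt (a +i* b)%C).1.2 = 2 * a * b.
  rewrite /knot_pt cubecE sqrcE realcM /=.
  rewrite (_ : a ^+ 3 - 3 * a * b ^+ 2 = a * (4 * a ^+ 2 - 3)); last by rewrite bE; ring.
  by rewrite re0; ring.
have xE : xC a = 2 * a ^+ 2 - 1.
  have e : 4 * a ^+ 3 - 3 * a = a * (4 * a ^+ 2 - 3) by ring.
  by rewrite /xC e re0 mul0r addr0 mul1r.
rewrite -[complex.Re (a +i* b)%C]/a xE yE; have [c1 _] := cut_bounds.
move/eqP: re0; rewrite mulf_eq0 => /orP[/eqP ->|/eqP a2].
  by rewrite mulr0 mul0r normr0 expr0n/= !mulr0 addr0; nra.
have {}a2 : a ^+ 2 = 3 / 4 by lra.
have y2 : (2 * a * b) ^+ 2 = 3 / 4 by rewrite !exprMn bE a2; field.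
rewrite y2 a2; have y2' : `|2 * a * b| ^+ 2 = 3 / 4 by rewrite real_normK ?num_real.
have := normr_ge0 (2 * a * b); move: `|2 * a * b| y2' => y y2' y0.
have y12 : 1 / 2 < y by nra.
by move: cut c1 => c c1; nra.
Qed.

Lemma ccont_zeta p : ccont zeta p.
Proof. apply: cont_complex; [exact: continuous_x|exact: continuous_y]. Qed.

Lemma ccont_beta p : ccont beta p.
Proof.
apply: cont_complex; last exact: continuous_z.
by apply: rcontB; [exact: cont_cabs (@ccont_zeta p)|exact: rcontK].
Qed.

Lemma ccont_real (T : topologicalType) (f : T -> R) (x : T) :
  {for x, continuous f} -> ccont (fun y => (f y)%:C%C) x.
Proof. by move=> cf; apply: cont_complex cf _; exact: rcontK. Qed.

Lemma ccont_mA p : ccont mA p.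
Proof.
apply: contM (@ccont_zeta p); apply: ccont_real; apply: rcontM.
  apply: rcont_max; first exact: rcontK.
  apply: rcont_min; first exact: rcontK.
  apply: rcontB; first exact: rcontK.
  by apply: rcontM; [exact: rcontK|exact: cont_cabs (@ccont_beta p)].
apply: rcontV.
  by apply: rcont_max; [exact: cont_cabs (@ccont_zeta p)|exact: rcontK].
by rewrite gt_eqF// lt_max; apply/orP; right; lra.
Qed.

Lemma ccont_mB p : ccont mB p.
Proof. by apply: contM (@ccont_beta p); exact: contK. Qed.

Section chart.
Variable u1 : R[i].
Hypothesis u1n : cabs u1 = 1.

(** The square root of [u1 ^+ 2 * w] close to [u1]: the vector [1 + w] bisects the angle between 1
    and [w]. It turns the angle of a point into the parameter of the branch of the knot near
    [u1]. *)
Let qhat (w : R[i]) : R[i] := u1 * ((cabs (1 + w))^-1%:C%C * (1 + w)).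
Let ang p : R[i] := (cabs (zeta p))^-1%:C%C * zeta p * (u1 ^+ 2)^-1.
Let dev p : R[i] := beta p - 4^-1 * qhat (ang p) ^+ 3.
Let f p : T3 := (Im (ang p), Re (dev p), Im (dev p)).
Let vw (v : R) : R[i] := (Num.sqrt (1 - v ^+ 2) +i* v)%C.
Let gb (x : T3) : R[i] := (x.1.2 +i* x.2)%C + 4^-1 * qhat (vw x.1.1) ^+ 3.
Let gz (x : T3) : R[i] := (1 + Re (gb x))%:C%C * (vw x.1.1 * u1 ^+ 2).
Let g (x : T3) : T3 := (Re (gz x), Im (gz x), Im (gb x)).
Let O : set T3 := [set p | [/\ 0 < cabs (zeta p), 0 < Re (ang p) & cabs (dev p) < 1 / 4]].
Let O' : set T3 := [set x | `|x.1.1| < 1 /\ cabs (x.1.2 +i* x.2)%C < 1 / 4].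

Let u1n0 : u1 != 0.
Proof. by rewrite -cabs_eq0 u1n oner_eq0. Qed.

Let w1n0 (w : R[i]) : 0 < Re w -> 1 + w != 0.
Proof.
move=> w0; apply: contraTneq w0 => e; rewrite -leNgt.
have -> : w = -1 by apply/eqP; rewrite -subr_eq0 opprK addrC e.
by rewrite raddfN /= oppr_le0 ler01.
Qed.

Let qhat2 (w : R[i]) : cabs w = 1 -> 0 < Re w -> qhat w ^+ 2 = u1 ^+ 2 * w.
Proof.
move=> w1 w0; rewrite /qhat exprMn; congr (_ * _).
have c0 : cabs (1 + w) != 0 by rewrite cabs_eq0 w1n0.
have c2 := sqr_cabs (1 + w).
rewrite exprMn -rmorphXn/= exprVn.
case: w w1 w0 c0 c2 => a b /cabs1P ab /= a0 c0 c2.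
have bE : b ^+ 2 = 1 - a ^+ 2 by rewrite -ab addrC addKr.
rewrite c2 add0r bE.
have -> : (1 + a) ^+ 2 + (1 - a ^+ 2) = 2 * (1 + a) by ring.
have -> : (1 + (a +i* b))%C = ((1 + a) +i* b)%C.
  by apply/eqP; rewrite eq_complex/= eqxx add0r eqxx.
have a1 : 1 + a != 0 by rewrite gt_eqF//; lra.
rewrite sqrcE realcM bE; apply/eqP; rewrite eq_complex/=; apply/andP; split; apply/eqP.
  by field.
by field.
Qed.

Let qhat1 (w : R[i]) : 0 < Re w -> cabs (qhat w) = 1.
Proof.
move=> w0; rewrite /qhat !cabsM u1n mul1r cabs_real ger0_norm ?invr_ge0 ?cabs_ge0//.
by rewrite mulVf// cabs_eq0 w1n0.
Qed.

Let vw_props (v : R) : `|v| < 1 -> cabs (vw v) = 1 /\ 0 < Re (vw v).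
Proof.
move=> v1; have v2 : 0 < 1 - v ^+ 2.
  by rewrite subr_gt0 -(real_normK (num_real v)) expr_lt1.
split; last by rewrite /= sqrtr_gt0.
by rewrite /cabs /= sqr_sqrtr ?subrK ?sqrtr1// ltW.
Qed.

Let ang1 p : 0 < cabs (zeta p) -> cabs (ang p) = 1.
Proof.
move=> z0; rewrite /ang !cabsM cabsV cabsX u1n expr1n invr1 mulr1 cabs_real.
by rewrite gtr0_norm ?invr_gt0// mulVf// gt_eqF.
Qed.

Let vwK (w : R[i]) : cabs w = 1 -> 0 < Re w -> vw (Im w) = w.
Proof.
case: w => a b /cabs1P ab /= a0; rewrite /vw.
have -> : 1 - b ^+ 2 = a ^+ 2 by rewrite -ab addrK.
by rewrite sqrtr_sqr ger0_norm// ltW.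
Qed.

Let fK p : O p -> g (f p) = p.
Proof.
move=> [z0 a0 d0].
have vE : vw (Im (ang p)) = ang p by apply: vwK => //; exact: ang1.
have bE : gb (f p) = beta p.
  rewrite /gb /f /= vE (_ : (_ +i* _)%C = dev p); last by case: (dev p).
  by rewrite /dev subrK.
have zE : gz (f p) = zeta p.
  rewrite /gz bE /= vE addrC subrK /ang -mulrA mulVf ?expf_neq0// mulr1 mulrA.
  by rewrite -rmorphM/= mulfV ?gt_eqF// mul1r.
rewrite /g bE zE; by case: (p) => [[? ?] ?].
Qed.

Let gb_bound (x : T3) : O' x -> cabs (gb x) <= 1 / 2.
Proof.
move=> [v1 d1]; have [vn v0] := vw_props v1.
apply: le_trans (cabsD _ _) _; rewrite cabsM cabsV cabs_nat cabsX qhat1// expr1n; lra.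
Qed.

Let gzE (x : T3) : O' x -> zeta (g x) = gz x /\ cabs (gz x) = 1 + Re (gb x) /\ 0 < 1 + Re (gb x).
Proof.
move=> Ox; have := gb_bound Ox; case: (Ox) => v1 d1 gbb.
have r0 : 0 < 1 + Re (gb x).
  by have := ge_Re_cabs (gb x); rewrite ler_norml => /andP[]; lra.
split; first by rewrite /zeta /g /=; case: (gz x).
split=> //; rewrite /gz cabsM (cabsM (vw _)) cabs_real gtr0_norm// cabsX u1n expr1n.
by rewrite (vw_props v1).1 !mulr1.
Qed.

Let ang_g (x : T3) : O' x -> ang (g x) = vw x.1.1.
Proof.
move=> Ox; have [e1 [e2 e3]] := gzE Ox.
rewrite /ang e1 e2 /gz; have : u1 ^+ 2 != 0 by rewrite expf_neq0.
move: (u1 ^+ 2) => q q0.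
by rewrite mulrA -rmorphM/= mulVf ?gt_eqF// mul1r -mulrA mulfV ?mulr1.
Qed.

Let dev_g (x : T3) : O' x -> dev (g x) = (x.1.2 +i* x.2)%C.
Proof.
move=> Ox; have [e1 [e2 e3]] := gzE Ox.
have bE : beta (g x) = gb x.
  by rewrite /beta e1 e2 [1 + _]addrC addrK /g /=; case: (gb x).
by rewrite /dev bE ang_g// /gb addrK.
Qed.

Let chart_local : local_homeo f g O O'.
Proof.
have cu : forall x : T3, ccont (fun _ => u1) x by move=> x; exact: contK.
have cq (T : topologicalType) (h : T -> R[i]) (x : T) : 0 < Re (h x) -> ccont h x ->
    ccont (fun y => qhat (h y)) x.
  move=> h0 ch; apply: contM; first exact: contK.
  have c1 : ccont (fun y => 1 + h y) x by apply: contD ch; exact: contK.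
  apply: (contM _ c1); apply: ccont_real; apply: rcontV; first exact: cont_cabs c1.
  by rewrite cabs_eq0 w1n0.
have ca p : 0 < cabs (zeta p) -> ccont ang p.
  move=> z0; apply: contM; last exact: contK.
  apply: contM (@ccont_zeta p); apply: ccont_real; apply: rcontV.
    exact: cont_cabs (@ccont_zeta p).
  by rewrite gt_eqF.
have cd p : 0 < cabs (zeta p) -> 0 < Re (ang p) -> ccont dev p.
  move=> z0 a0; apply: contB (@ccont_beta p) _; apply: contM; first exact: contK.
  by apply: contX; apply: cq => //; exact: ca.
have cv v : `|v| < 1 -> ccont vw v.
  move=> v1; apply: cont_complex; last exact: cvg_id.
  apply: (@continuous_comp _ _ _ (fun v : R => 1 - v ^+ 2) Num.sqrt); last exact: sqrt_continuous.
  by apply: rcontB; [exact: rcontK|apply: rcontX; exact: cvg_id].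
have cvx x : O' x -> ccont (fun x : T3 => vw x.1.1) x.
  move=> [v1 _]; apply: (@continuous_comp _ _ C (fun x : T3 => x.1.1) (vw : R -> C)).
    exact: continuous_x.
  exact: cv.
have cgb x : O' x -> ccont gb x.
  move=> Ox; apply: contD.
    by apply: cont_complex; [exact: continuous_y|exact: continuous_z].
  apply: contM; first exact: contK.
  apply: contX; apply: cq; last exact: cvx.
  by case: Ox => v1 _; exact: (vw_props v1).2.
have cgz x : O' x -> ccont gz x.
  move=> Ox; apply: contM.
    apply: ccont_real; apply: rcontD; first exact: rcontK.
    exact: contRe (cgb _ Ox).
  by apply: contM (cvx _ Ox) _; exact: contK.
split.
- split.
    rewrite openE => p [z0 a0 d0]; rewrite /interior.
    have n1 := near_gt (cont_cabs (@ccont_zeta p)) z0.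
    have n2 := near_gt (contRe (ca _ z0)) a0.
    have n3 := near_lt (cont_cabs (cd _ z0 a0)) d0.
    by apply: filterS3 n1 n2 n3 => q *; split.
  rewrite (_ : O' = [set x : T3 | `|x.1.1| < 1] `&` [set x : T3 | cabs (x.1.2 +i* x.2)%C < 1 / 4])//.
  apply: openI; apply: open_lt_fun => x.
    exact: (@rcont_abs R _ x (fun x : T3 => x.1.1) (@continuous_x R x)).
  by apply: cont_cabs; apply: cont_complex; [exact: continuous_y|exact: continuous_z].
- move=> p Op; split; last 1 first.
  + case: Op => z0 a0 d0.
    apply: cont_pair; first apply: cont_pair.
    * exact: contIm (ca _ z0).
    * exact: contRe (cd _ z0 a0).
    * exact: contIm (cd _ z0 a0).
  + case: Op => z0 a0 d0; split => /=; last by case: (dev p) d0.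
    have := ang1 z0; case: (ang p) a0 => a b /= a0 /cabs1P ab.
    by rewrite -(ltr_pXn2r (n := 2)) ?nnegrE// real_normK ?num_real// expr1n; nra.
  + exact: fK.
- move=> x Ox; split; last 1 first.
  + apply: cont_pair; first apply: cont_pair.
    * exact: contRe (cgz _ Ox).
    * exact: contIm (cgz _ Ox).
    * exact: contIm (cgb _ Ox).
  + have [e1 [e2 e3]] := gzE Ox; case: (Ox) => v1 d1.
    rewrite /O /= ang_g// dev_g// e1 e2; split=> //.
    exact: (vw_props v1).2.
  + case: (Ox) => v1 d1; rewrite /f ang_g// dev_g// /=.
    by case: (x) => [[? ?] ?].
Qed.

(** The chart [f] records the angle and the deviation [dev] of [beta] from the branch of the knot
    near [u1]; it maps that branch into the axis, which is not knotted. *)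
Lemma knot_not_knotted : ~ knotted_germ R knot (knot_pt u1).
Proof.
have zu := cabs_zeta_knot_pt u1n; have r1 := Re_unit_cube u1n.
have r0 : 0 < 1 + Re (u1 ^+ 3) / 4 by move: r1; rewrite ler_norml => /andP[]; lra.
have aE u : cabs u = 1 -> ang (knot_pt u) = u ^+ 2 / u1 ^+ 2.
  move=> un; rewrite /ang cabs_zeta_knot_pt// zeta_knot_pt mulrA -rmorphM/= mulVf ?mul1r//.
  have := Re_unit_cube un; rewrite ler_norml => /andP[h1 h2].
  by rewrite gt_eqF//; lra.
have bE u : cabs u = 1 -> beta (knot_pt u) = 4^-1 * u ^+ 3.
  by move=> un; rewrite -beta_knot_pt// mulrA mulVf ?mul1r// pnatr_eq0.
have a1 : ang (knot_pt u1) = 1 by rewrite aE// mulfV// expf_neq0.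
have q1 : qhat 1 = u1.
  rewrite /qhat (_ : 1 + 1 = 2%:R)// cabs_nat.
  have -> : (2%:R^-1)%:C%C = (2%:R : R[i])^-1 by rewrite fmorphV rmorph_nat.
  by rewrite mulVf ?mulr1// pnatr_eq0.
have d1 : dev (knot_pt u1) = 0 by rewrite /dev a1 q1 bE// subrr.
have Op : O (knot_pt u1).
  by split; rewrite ?zu ?a1 ?d1 ?cabs0//= ?ltr01//; lra.
move=> /(knotted_germ_local chart_local Op (a' := axis)) h.
have : knotted_germ R axis (f (knot_pt u1)).
  apply: h => p [z0 a0 d0]; split=> [[u un pE]|].
    have an := ang1 z0.
    have : qhat (ang p) ^+ 2 = u ^+ 2.
      by rewrite qhat2// pE aE// mulrC divfK// expf_neq0.
    move/eqP; rewrite eqf_sqr => /orP[/eqP qE|/eqP qE].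
      have dE : dev p = 0 by rewrite /dev qE {1}pE bE// subrr.
      by rewrite /axis /f /= dE.
    (* The other strand over the same angle belongs to the opposite root; its deviation has modulus
       [1/2], whereas [O] requires less than [1/4]. *)
    exfalso; move: d0; rewrite /dev qE {1}pE bE// exprNn.
    rewrite -[(-1) ^+ 3]/(-1 * (-1 * -1)) mulN1r mulrNN !mulr1 mulN1r mulrN opprK -mulr2n.
    have -> : 4^-1 * u ^+ 3 *+ 2 = 2%:R * (4^-1 * u ^+ 3) by rewrite mulr_natl.
    rewrite cabsM (cabsM _ (u ^+ 3)) cabsV !cabs_nat cabsX un expr1n; lra.
  move=> [dr di]; have dE : dev p = 0 by move: dr di; rewrite /f /=; case: (dev p) => ? ? /= -> ->.
  have an := ang1 z0; have qn := qhat1 a0; have q2 := qhat2 an a0.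
  set q := qhat (ang p) in qn q2 dE.
  have bE' : beta p = 4^-1 * q ^+ 3 by apply/eqP; rewrite -subr_eq0; apply/eqP.
  have qi : 4^-1 * q ^+ 3 = ((Re (q ^+ 3) / 4) +i* (Im (q ^+ 3) / 4))%C.
    have -> : (4 : R[i])^-1 = (4^-1 : R)%:C%C by rewrite fmorphV rmorph_nat.
    by case: (q ^+ 3) => a b; rewrite realcM /= ![_ / 4]mulrC.
  exists q => //; move: bE'; rewrite qi => -[zr zi].
  have zr' : cabs (zeta p) = 1 + Re (q ^+ 3) / 4 by rewrite -zr; ring.
  have zE : zeta p = (1 + Re (q ^+ 3) / 4)%:C%C * q ^+ 2.
    have uE : u1 ^+ 2 * ang p = (cabs (zeta p))^-1%:C%C * zeta p.
      by rewrite mulrC /ang divfK// expf_neq0.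
    by rewrite -zr' q2 uE mulrA -rmorphM/= mulfV ?mul1r// gt_eqF.
  rewrite /knot_pt -zE -zi; by case: (p) => [[? ?] ?].
rewrite /f a1 d1 /=; exact: axis_not_knotted.
Qed.

End chart.

(** A meridian of the unit circle so wide, [|beta| = 9/10], that [mA] vanishes on it. The cubic
    becomes [r ^+ 3 + 2 B] with [B] turning once, so no root closes up. *)
Definition loop_root (t : R) : T3 :=
  (- (1 + 9 / 10 * cos (2 * pi * t)), 0, 9 / 10 * sin (2 * pi * t)).

(** The core circle, where [mB = 0] and [mA] turns once: the discriminant turns three times, so it
    has no continuous square root along the loop. *)
Definition loop_sqrt (t : R) : T3 := (cos (2 * pi * t), sin (2 * pi * t), 0).

Lemma loop_rootE t : mA (loop_root t) = 0 /\ mB (loop_root t) = (18 / 5)%:C%C * cis t.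
Proof.
have c1 := cos_geN1 (2 * pi * t).
have zE : cabs (zeta (loop_root t)) = 1 + 9 / 10 * cos (2 * pi * t).
  rewrite /cabs /zeta /loop_root /= expr0n/= addr0 sqrtr_sqr normrN ger0_norm//; lra.
have bE : beta (loop_root t) = (9 / 10)%:C%C * cis t.
  rewrite /beta zE realcM /loop_root /=.
  by apply/eqP; rewrite eq_complex/= eqxx andbT; apply/eqP; ring.
split.
  rewrite /mA bE cabsM cabs_cis mulr1 cabs_real ger0_norm; last by lra.
  rewrite (_ : mcut _ = 0); last first.
    by rewrite /mcut; apply/max_idPl; rewrite ge_min; apply/orP; right; lra.
  by rewrite mul0r rmorph0 mul0r.
rewrite /mB bE mulrA; congr (_ * _).
have -> : (4 : R[i]) = (4 : R)%:C%C by rewrite rmorph_nat.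
by rewrite -rmorphM/=; congr (_%:C%C); field.
Qed.

Lemma loop_sqrtE t : mA (loop_sqrt t) = cis t /\ mB (loop_sqrt t) = 0.
Proof.
have zE : zeta (loop_sqrt t) = cis t by [].
have bE : beta (loop_sqrt t) = 0.
  by rewrite /beta zE cabs_cis subrr.
rewrite /mA /mB bE zE mulr0 cabs0 cabs_cis; split=> //.
have -> : mcut 0 = 1 :> R by rewrite /mcut min_l ?max_r//; lra.
have -> : Num.max 1 (1 / 4) = 1 :> R by apply/max_idPl; lra.
by rewrite divr1 mul1r.
Qed.

End strand.

(** * Roots compared along paths, and gluing of real functions *)

Section root_paths.
Context {R : realType}.

Lemma cont_sum (T : topologicalType) n (F : nat -> T -> R[i]) x :
  (forall i, ccont (F i) x) -> ccont (fun y => \sum_(i < n) F i y) x.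
Proof.
move=> cF; elim: n => [|n IH].
  apply: (@cont_eq _ _ _ (fun=> 0 : R[i]^o)); last exact: contK.
  by move=> y; rewrite big_ord0.
apply: (@cont_eq _ _ _ (fun y => (\sum_(i < n) F i y) + F n y : R[i]^o)).
  by move=> y; rewrite big_ord_recr.
exact: (contD IH (cF n)).
Qed.

(** The difference of the powers is [f - g] times the sum [h], and [h] is a nonzero multiple of
    [g ^+ n] where the paths agree. Agreement is therefore open as well as closed. *)
Lemma root_path_eq n (f g : R -> R[i]) :
  (forall t, ccont f t) -> (forall t, ccont g t) ->
  (forall t, f t ^+ n.+1 = g t ^+ n.+1) -> (forall t, g t != 0) ->
  f 0 = g 0 -> f 1 = g 1.
Proof.
move=> cf cg fg g0 e0.
apply: (@interval_ind R (fun r => f r = g r)) => //; last by rewrite ler01 lexx.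
  move=> r _ e; pose h y := \sum_(i < n.+1) f y ^+ (n - i) * g y ^+ i.
  have ch : ccont h r.
    by apply: (@cont_sum _ _ (fun i y => f y ^+ (n - i) * g y ^+ i)) => i; exact: (contM (contX (cf _)) (contX (cg _))).
  have h0 : h r != 0.
    rewrite /h (eq_bigr (fun=> g r ^+ n)); last first.
      by move=> i _; rewrite e -exprD subnK// -ltnS.
    by rewrite sumr_const card_ord mulrn_eq0/= expf_neq0.
  apply: filterS (near_neq ch h0) => y hy _; apply/eqP; rewrite -subr_eq0.
  have : (f y - g y) * h y = 0 by rewrite -subrXX fg subrr.
  by move/eqP; rewrite mulf_eq0 (negbTE hy) orbF.
move=> r _ ne; have c := contB (cf r) (cg r).
have h0 : f r - g r != 0 by rewrite subr_eq0; apply/eqP.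
by apply: filterS (near_neq c h0) => y + _; rewrite subr_eq0 => /eqP.
Qed.

End root_paths.

Section real_continuity.
Context {R : realType}.

Definition clamp (a b x : R) : R := Num.max a (Num.min b x).

Lemma clamp_in a b x : a <= b -> a <= clamp a b x <= b.
Proof. by move=> ab; rewrite /clamp le_max lexx/= ge_max ab ge_min lexx. Qed.

Lemma clamp_id a b x : a <= x <= b -> clamp a b x = x.
Proof. by move=> /andP[ax xb]; rewrite /clamp min_r// max_r. Qed.

Lemma continuous_clamp a b (g : R -> R) : a <= b ->
  {within `[a, b], continuous g} -> continuous (fun x => g (clamp a b x)).
Proof.
move=> ab /subspace_continuousP cg x.
have cin : `[a, b]%classic (clamp a b x) by rewrite /= in_itv/=; exact: clamp_in.
move=> N /= Nx; have := cg _ cin N Nx; rewrite /= => h.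
have cc : {for x, continuous (clamp a b)}.
  by apply: rcont_max; [exact: rcontK|apply: rcont_min; [exact: rcontK|exact: cvg_id]].
have h2 : \forall y \near x, `[a, b]%classic (clamp a b y) -> N (g (clamp a b y)) := cc _ h.
apply: filterS h2 => y; apply.
by rewrite /= in_itv/=; exact: clamp_in.
Qed.

(** The jump of the sign is harmless where the other factor vanishes. Such products undo folds, both
    in [unfold] and in the charts at integral shells. *)
Lemma cont_sgr (T : topologicalType) (h D : T -> R) x :
  {for x, continuous h} -> {for x, continuous D} -> (h x = 0 -> D x = 0) ->
  {for x, continuous (fun y => Num.sg (h y) * D y)}.
Proof.
move=> ch cD h0; have [e|ne] := eqVneq (h x) 0.
  apply/cvgrPdist_lt => eps eps0.
  move/cvgrPdist_lt: cD => /(_ _ eps0); apply: filterS => y.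
  rewrite h0// e sgr0 mul0r !sub0r !normrN normrM; apply: le_lt_trans.
  by rewrite normr_sg; case: eqP => _; rewrite ?mul0r ?mul1r.
have near_sg : \forall y \near x, Num.sg (h y) = Num.sg (h x).
  have [h1|h1] := ltP (h x) 0.
    by apply: filterS (near_lt ch h1) => y hy; rewrite !ltr0_sg.
  have h2 : 0 < h x by rewrite lt_neqAle eq_sym ne.
  by apply: filterS (near_gt ch h2) => y hy; rewrite !gtr0_sg.
apply: (@near_glue _ _ (fun y => Num.sg (h x) * D y)).
  by apply: filterS near_sg => y ->.
by apply: rcontM cD; exact: rcontK.
Qed.

End real_continuity.

(** * Knotted points of arcs *)

Section wild.
Context {R : realType}.
Local Notation T3 := (R * R * R)%type.
Implicit Types (p : R -> T3).

(** A bounded window of time is used because a line of the solenoid comes back arbitrarily close to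
    each of its points: its full image is not locally an arc. *)
Definition wild p (t : R) : Prop := knotted_germ R (p @` `[t - 1, t + 1]) (p t).

Definition arc p : Prop := (forall t, {for t, continuous p}) /\ injective p.

(** What distinguishes the two images lies in the compact images of [[t - M, t - e / 2]] and
    [[t + e / 2, t + M]], which miss [p t] by injectivity. *)
Lemma arc_germ p (t M : R) (I J : set R) : arc p -> nbhs t I -> nbhs t J ->
  I `<=` `[t - M, t + M] -> J `<=` `[t - M, t + M] ->
  exists2 O : set T3, open O /\ O (p t) &
    forall x, O x -> ((p @` I) x <-> (p @` J) x).
Proof.
move=> [cp ip] nI nJ IM JM.
have [e /= e0 he] := (nbhs_ballP _ _).1 (filterI nI nJ).
have cl a b : closed (p @` `[a, b]).
  apply: compact_closed; first exact: norm_hausdorff.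
  apply: continuous_compact; last exact: segment_compact.
  by apply: continuous_subspaceT => x; exact: cp.
exists (~` (p @` `[t - M, t - e / 2] `|` p @` `[t + e / 2, t + M])).
  split; first by apply: closed_openC; apply: closedU; exact: cl.
  by move=> [] [s /= + /ip e']; rewrite e' in_itv/=; lra.
have key (I' J' : set R) x : I' `<=` `[t - M, t + M] -> (ball t e `<=` J') ->
    (~` (p @` `[t - M, t - e / 2] `|` p @` `[t + e / 2, t + M])) x ->
    (p @` I') x -> (p @` J') x.
  move=> IM' bJ nx [s Is sx]; exists s => //; apply: bJ.
  have := IM' _ Is; rewrite /= in_itv/= => /andP[s1 s2].
  rewrite /ball/= ltr_norml; apply/andP; split; rewrite ltNge; apply/negP => h; apply: nx.
    by right; exists s => //=; rewrite in_itv/=; apply/andP; split=> //; lra.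
  by left; exists s => //=; rewrite in_itv/=; apply/andP; split=> //; lra.
move=> x Ox; split; apply: key Ox => // y /he[].
  by [].
by [].
Qed.

Lemma knotted_arc p (t : R) (I : set R) (M : R) : arc p -> nbhs t I ->
  I `<=` `[t - M, t + M] -> knotted_germ R (p @` I) (p t) <-> wild p t.
Proof.
move=> ap nI IM.
have n1 : nbhs t `[t - 1, t + 1]%classic.
  by apply/nbhs_ballP; exists 1 => //= y; rewrite /ball/= ltr_norml in_itv/= => /andP[? ?]; apply/andP; split; lra.
have IM' : I `<=` `[t - Num.max M 1, t + Num.max M 1].
  move=> s /IM /=; rewrite !in_itv/= => /andP[s1 s2].
  have : M <= Num.max M 1 by rewrite le_max lexx.
  set m := Num.max _ _ => h; apply/andP; split; lra.
have JM : `[t - 1, t + 1] `<=` `[t - Num.max M 1, t + Num.max M 1].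
  move=> s /=; rewrite !in_itv/= => /andP[s1 s2].
  have : 1 <= Num.max M 1 by rewrite le_max lexx orbT.
  by set m := Num.max _ _ => h; apply/andP; split; lra.
have [O [oO Op] hO] := arc_germ ap nI n1 IM' JM.
split; apply: knotted_germ_eq oO Op _ => x Ox; first exact: hO.
by split=> /(hO _ Ox).
Qed.

Lemma wild_map p p' (f g : T3 -> T3) O O' (th et : R -> R) t :
  arc p -> arc p' -> local_homeo f g O O' -> O (p t) ->
  cancel th et -> cancel et th -> continuous th -> continuous et ->
  (\forall s \near t, f (p s) = p' (th s)) -> wild p t -> wild p' (th t).
Proof.
move=> ap ap' lh Op thK etK cth cet fp w.
have [[oO oO'] fO gO] := lh.
have nO : \forall s \near t, O (p s) by apply: ap.1; exact: open_nbhs_nbhs.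
have [e /= e0 he] := (nbhs_ballP _ _).1 (filterI fp nO).
pose I : set R := `[t - e / 2, t + e / 2]%classic.
have IB : I `<=` ball t e.
  by move=> s; rewrite /I/= in_itv/= /ball/= => /andP[? ?]; rewrite ltr_norml; apply/andP; split; lra.
have nI : nbhs t I.
  apply/nbhs_ballP; exists (e / 2) => /=; first by lra.
  by move=> y; rewrite /ball/= /I/= in_itv/= ltr_norml => /andP[? ?]; apply/andP; split; lra.
have k1 : knotted_germ R (p @` I) (p t) by apply/(knotted_arc ap nI (M := e / 2)).
have k2 : knotted_germ R (p' @` (th @` I)) (f (p t)).
  apply: (knotted_germ_local lh Op) k1 => x Ox; split.
    move=> [s Is <-]; exists (th s); first by exists s.
    by case: (he _ (IB _ Is)) => ->.
  move=> [_ [s Is <-] e']; exists s => //.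
  have [e1 Os] := he _ (IB _ Is).
  have [_ <- _] := fO _ Ox; have [_ <- _] := fO _ Os; by rewrite e1 e'.
move: k2; have [-> _] := he _ (ballxx t e0).
have nJ : nbhs (th t) (th @` I).
  have : \forall s \near th t, I (et s) by apply: cet; rewrite thK.
  by apply: filterS => s Is; exists (et s).
have : compact (th @` I).
  by apply: continuous_compact; [apply: continuous_subspaceT|exact: segment_compact].
move/compact_bounded => [M [_ hM]].
suff IM : th @` I `<=` `[th t - (`|M| + 1 + `|th t|), th t + (`|M| + 1 + `|th t|)].
  exact: (knotted_arc ap' nJ IM).1.
move=> s Js; have : `|s| <= `|M| + 1 by apply: hM Js; have := ler_norm M; lra.
rewrite ler_norml => /andP[s1 s2]; rewrite /= in_itv/=.
have h1 := ler_norm (th t); have h2 := ler_norm (- th t); rewrite normrN in h2.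
by apply/andP; split; lra.
Qed.

Lemma arc_line : arc (fun s : R => (s, 0, 0) : T3).
Proof.
split=> [t|s t [->]//].
by apply: cont_pair; [apply: cont_pair|]; [exact: cvg_id|exact: cvg_cst|exact: cvg_cst].
Qed.

Lemma line_not_wild t : ~ wild (fun s : R => (s, 0, 0) : T3) t.
Proof.
have oO : open [set x : T3 | `|x.1.1 - t| < 1].
  apply: open_lt_fun => x; apply: (@rcont_abs R _ x (fun x : T3 => x.1.1 - t)).
  by apply: rcontB; [exact: continuous_x|exact: rcontK].
have Op : [set x : T3 | `|x.1.1 - t| < 1] (t, 0, 0) by rewrite /= subrr normr0.
move/(knotted_germ_eq (a' := axis) oO Op) => h; apply: (@axis_not_knotted R t); apply: h.
move=> [[a b] c] /=; rewrite ltr_norml => /andP[a1 a2]; split.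
  by move=> [s _ [_ <- <-]].
move=> [/= -> ->]; exists a => //=; rewrite in_itv/=; apply/andP; split; lra.
Qed.

End wild.

(** * An arc with one knotted point *)

Section unfolding.
Context {R : realType}.
Local Notation T3 := (R * R * R)%type.
Local Notation pi := (@pi R).
Implicit Types (p a : T3) (s t v w W x tau : R) (j : int).

(** Inverse of [v |-> - cos (pi * v)], from [[-1, 1]] to [[0, 1]]; the clamp makes it continuous on
    the whole line. *)
Definition ang x : R := acos (clamp (-1) 1 (- x)) / pi.

Lemma continuous_ang : continuous ang.
Proof.
have ca : {within `[(-1), 1], continuous (@acos R)}.
  have := @segment_can_ge_continuous R 0 pi cos (@acos R) (pi_ge0 R).
  rewrite cospi cos0; apply; first by apply: continuous_subspaceT; exact: continuous_cos.
  by move=> x x0; apply: cosK.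
have cl := @continuous_clamp R (-1) 1 _ (ltac:(by lra)) ca.
move=> x; have c1 : {for x, continuous (fun y => acos (clamp (-1) 1 (- y)))}.
  apply: (@continuous_comp _ _ _ (fun x : R => - x) (fun x => acos (clamp (-1) 1 x))).
    by apply: rcontN; exact: cvg_id.
  exact: cl.
exact: (rcontM c1 (@rcontK _ _ _ pi^-1)).
Qed.

Lemma ang_bounds x : 0 <= ang x <= 1.
Proof.
have c := @clamp_in R (-1) 1 (- x) (ltac:(by lra)).
by rewrite /ang divr_ge0 ?acos_ge0 ?pi_ge0//= ler_pdivrMr ?pi_gt0// mul1r acos_lepi.
Qed.

Lemma cos_ang x : -1 <= x <= 1 -> cos (pi * ang x) = - x.
Proof.
move=> /andP[x1 x2]; rewrite /ang clamp_id; last by apply/andP; split; lra.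
rewrite mulrC divfK ?gt_eqF ?pi_gt0// acosK// in_itv/=; apply/andP; split; lra.
Qed.

Lemma angK v : 0 <= v <= 1 -> ang (- cos (pi * v)) = v.
Proof.
move=> /andP[v0 v1]; rewrite /ang opprK clamp_id ?cos_geN1 ?cos_le1//.
rewrite cosK; first by rewrite mulrAC divff ?mul1r// gt_eqF ?pi_gt0.
rewrite in_itv/= mulr_ge0 ?pi_ge0//= -[leRHS]mulr1 ler_wpM2l ?pi_ge0//.
Qed.

Lemma angN1 : ang (-1) = 0.
Proof. by have := @angK 0; rewrite mulr0 cos0; apply; rewrite lexx ler01. Qed.

Lemma ang1 : ang 1 = 1.
Proof. by have := @angK 1; rewrite mulr1 cospi opprK; apply; rewrite lexx ler01. Qed.

Lemma cos_periodic j v : cos (pi * (2 * j%:~R + v)) = cos (pi * v).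
Proof.
have := @cis_int R j; have := @cisD R (j%:~R) (v / 2); move=> + e; rewrite e mul1r => -[+ _].
have -> : 2 * pi * (j%:~R + v / 2) = pi * (2 * j%:~R + v) by field.
by have -> : 2 * pi * (v / 2) = pi * v by field.
Qed.

Lemma sin_periodic j v : sin (pi * (2 * j%:~R + v)) = sin (pi * v).
Proof.
have := @cis_int R j; have := @cisD R (j%:~R) (v / 2); move=> + e; rewrite e mul1r => -[_].
have -> : 2 * pi * (j%:~R + v / 2) = pi * (2 * j%:~R + v) by field.
by have -> : 2 * pi * (v / 2) = pi * v by field.
Qed.

Lemma period_dec w : exists j v, w = 2 * j%:~R + v /\ -1 <= v < 1.
Proof.
have /andP[] := floor_itv ((w + 1) / 2); set j := Num.floor _ => j1 j2.
exists j, (w - 2 * j%:~R); split; first by ring.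
by move: j2; rewrite intrD; move: (j%:~R : R) j1 => J j1 j2; apply/andP; split; lra.
Qed.

(** The number of a page, as [lam] is the distance from the spine: it runs from -1 to 1 as the
    half-plane turns about the spine through the region [x <= cut]. *)
Definition theta p : R := p.1.2 / lam p.

Lemma coord_lam p : p.1.1 = cut + `|p.1.2| - lam p.
Proof. by rewrite /lam; ring. Qed.

Lemma coords_eq p q : lam p != 0 -> lam p = lam q -> theta p = theta q ->
  p.2 = q.2 -> p = q.
Proof.
move=> l0 l e z.
have y : p.1.2 = q.1.2.
  by rewrite -(divfK l0 p.1.2) -[_ / _]/(theta p) e l /theta divfK// -l.
have x : p.1.1 = q.1.1 by rewrite !coord_lam y l.
by case: p x y z {l0 l e} => [[? ?] ?]; case: q => [[? ?] ?] /= -> -> ->.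
Qed.

Lemma strand_le_cut s : `|s| <= 9 -> (strand s).1.1 <= cut.
Proof. by rewrite le_eqVlt => /orP[/eqP/strand_x9 ->//|/strand_x_lt/ltW]. Qed.

Lemma lam_strand_gt0 s : `|s| <= 9 -> 0 < lam (strand s).
Proof. by move=> s9; apply: lam_gt0; [exact: strand_knot|exact: strand_le_cut]. Qed.

Lemma theta_strand_lt s : `|s| < 9 -> `|theta (strand s)| < 1.
Proof.
move=> s9; have l0 := lam_strand_gt0 (ltW s9).
rewrite /theta normrM normfV (gtr0_norm l0) ltr_pdivrMr// mul1r.
by have := strand_x_lt s9; rewrite /lam; lra.
Qed.

Lemma theta_strand9 : theta (strand 9) = 1.
Proof.
have x9 : (strand 9).1.1 = cut :> R by apply: strand_x9; rewrite normr_nat.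
rewrite /theta /lam x9 subrr add0r ger0_norm ?divff ?gt_eqF ?strand_y9//.
by rewrite ltW ?strand_y9.
Qed.

Lemma theta_strandN9 : theta (strand (- 9)) = - 1.
Proof.
by rewrite /theta /lam strandN /= normrN mulNr; congr (- _); exact: theta_strand9.
Qed.

Lemma lam9 : lam (strand 9) = (strand 9).1.2 :> R.
Proof.
have x9 : (strand 9).1.1 = cut :> R by apply: strand_x9; rewrite normr_nat.
by rewrite /lam x9 subrr add0r ger0_norm// ltW// strand_y9.
Qed.

(** The page, rescaled to [[0, 1]] by [ang], on which the strand is found after the fraction [tau]
    of its parameter interval. No monotonicity is claimed; the end values and the strict bounds in
    between are what matters. *)
Definition omega tau : R := ang (theta (strand (9 * (2 * tau - 1)))).

Lemma norm_spar tau : 0 <= tau <= 1 -> `|9 * (2 * tau - 1)| <= 9.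
Proof. by move=> /andP[h1 h2]; rewrite ler_norml; apply/andP; split; lra. Qed.

Lemma theta_le1 tau : 0 <= tau <= 1 -> `|theta (strand (9 * (2 * tau - 1)))| <= 1.
Proof.
move=> /norm_spar; rewrite le_eqVlt => /orP[|/theta_strand_lt/ltW//].
set s := 9 * _; rewrite eqr_norml => /andP[/orP[] /eqP -> _].
  by rewrite theta_strand9 normr1.
by rewrite theta_strandN9 normrN normr1.
Qed.

Lemma cos_omega tau : 0 <= tau <= 1 ->
  theta (strand (9 * (2 * tau - 1))) = - cos (pi * omega tau).
Proof. by move=> /theta_le1; rewrite ler_norml => /cos_ang; rewrite -/(omega tau) => ->; rewrite opprK. Qed.

Lemma omega0 : omega 0 = 0.
Proof. by rewrite /omega mulr0 sub0r mulrN1 theta_strandN9 angN1. Qed.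

Lemma omega1 : omega 1 = 1.
Proof. by rewrite /omega mulr1 (_ : 2 - 1 = 1) ?mulr1 ?theta_strand9 ?ang1//; ring. Qed.

Lemma omega_inside tau : 0 < tau < 1 -> 0 < omega tau < 1.
Proof.
move=> /andP[t0 t1]; have : `|theta (strand (9 * (2 * tau - 1)))| < 1.
  by apply: theta_strand_lt; rewrite ltr_norml; apply/andP; split; lra.
have e := @cos_omega tau (ltac:(by apply/andP; split; lra)).
rewrite e normrN; have := ang_bounds (theta (strand (9 * (2 * tau - 1)))).
rewrite -/(omega tau) => /andP[o0 o1] h; apply/andP; split; rewrite lt_neqAle ?o0 ?o1 andbT.
  by apply: contraTneq h => <-; rewrite mulr0 cos0 normr1 ltxx.
by apply: contraTneq h => ->; rewrite mulr1 cospi normrN normr1 ltxx.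
Qed.

Lemma omega_lt1 tau : 0 <= tau <= 1 -> (omega tau < 1) = (tau < 1).
Proof.
move=> /andP[t0 t1]; have [->|n1] := eqVneq tau 1; first by rewrite omega1 !ltxx.
have tl : tau < 1 by rewrite lt_neqAle n1.
rewrite tl; have [->|n0] := eqVneq tau 0; first by rewrite omega0 ltr01.
by have /andP[] := @omega_inside tau (ltac:(by rewrite tl lt_neqAle eq_sym n0 t0)).
Qed.

Lemma omega_gt0 tau : 0 <= tau <= 1 -> (0 < omega tau) = (0 < tau).
Proof.
move=> /andP[t0 t1]; have [->|n0] := eqVneq tau 0; first by rewrite omega0 !ltxx.
have tl : 0 < tau by rewrite lt_neqAle eq_sym n0.
rewrite tl; have [->|n1] := eqVneq tau 1; first by rewrite omega1 ltr01.
by have /andP[] := @omega_inside tau (ltac:(by rewrite tl lt_neqAle n1 t1)).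
Qed.

(** The triangle wave of period 2, equal to [|v|] at [2 j + v] for [-1 <= v < 1]; with it [spar]
    lets the parameter of the strand oscillate between -9 and 9. *)
Definition tri w : R := ang (- cos (pi * w)).
Definition spar w : R := 9 * (2 * tri w - 1).
(* The time change for which [cos_unfold] holds. *)
Definition unfold w : R := w + Num.sg (sin (pi * w)) * (omega (tri w) - tri w).

Lemma tri_bounds w : 0 <= tri w <= 1. Proof. exact: ang_bounds. Qed.

Lemma tri_dec j v : -1 <= v < 1 -> tri (2 * j%:~R + v) = `|v|.
Proof.
move=> /andP[v1 v2]; rewrite /tri cos_periodic.
have -> : cos (pi * v) = cos (pi * `|v|).
  by have [h|h] := leP 0 v; [rewrite ger0_norm|rewrite ltr0_norm// mulrN cosN].
by rewrite angK// normr_ge0 ler_norml; apply/andP; split; lra.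
Qed.

Lemma unfold_dec j v : -1 <= v < 1 ->
  unfold (2 * j%:~R + v) = 2 * j%:~R + (if v < 0 then - omega `|v| else omega `|v|).
Proof.
move=> vb; have /andP[v1 v2] := vb; rewrite /unfold tri_dec// sin_periodic.
have [vneg|vpos] := ltP v 0.
  rewrite (ltr0_norm vneg); have [->|vN] := eqVneq v (-1).
    by rewrite opprK omega1 subrr mulr0 addr0.
  have s0 : sin (pi * v) < 0.
    have vl : -1 < v by rewrite lt_neqAle eq_sym vN.
    rewrite -[v]opprK mulrN sinN oppr_lt0; apply: sin_gt0_pi; apply/andP; split.
      by rewrite mulr_gt0 ?pi_gt0 ?oppr_gt0.
    by rewrite -[ltRHS]mulr1 ltr_pM2l ?pi_gt0//; lra.
  by rewrite ltr0_sg//; ring.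
rewrite (ger0_norm vpos); have [->|v0] := eqVneq v 0.
  by rewrite omega0 subrr mulr0 !addr0.
have s0 : 0 < sin (pi * v).
  apply: sin_gt0_pi; apply/andP; split; first by rewrite mulr_gt0 ?pi_gt0// lt_neqAle eq_sym v0.
  by rewrite -[ltRHS]mulr1 ltr_pM2l ?pi_gt0.
by rewrite gtr0_sg//; ring.
Qed.

Lemma int_ge1 j : 0 < j%:~R :> R -> 1 <= j%:~R :> R.
Proof. by rewrite ltr0z -[1]/((1%Z)%:~R) ler_int; lia. Qed.

Lemma int_ge2 j : 1 <= j%:~R :> R -> j%:~R != 1 :> R -> 2 <= j%:~R :> R.
Proof. by rewrite -[1]/((1%Z)%:~R) -[2]/((2%Z)%:~R) eqr_int !ler_int; lia. Qed.

Lemma unfold_gt1 w : 1 < w -> 1 < unfold w.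
Proof.
have [j [v [-> vb]]] := period_dec w; rewrite unfold_dec//.
have /andP[v1 v2] := vb => h.
have nb : 0 <= `|v| <= 1 by rewrite normr_ge0 ler_norml; apply/andP; split; lra.
have /andP[o0 o1] := ang_bounds (theta (strand (9 * (2 * `|v| - 1)))).
rewrite -/(omega `|v|) in o0 o1; have j1 := int_ge1 (j := j).
move: h; have [vneg|vpos] := ltP v 0 => h; last first.
  by have := j1 (ltac:(by lra)); lra.
have {}j1 := j1 (ltac:(by lra)).
have [e|ne] := eqVneq (j%:~R : R) 1; last first.
  by have := int_ge2 j1 ne; lra.
have : omega `|v| < 1 by rewrite omega_lt1// ltr_norml; apply/andP; split; lra.
lra.
Qed.

Lemma unfold1 : unfold 1 = 1.
Proof.
have t1 : tri 1 = 1 by rewrite /tri mulr1 cospi opprK ang1.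
by rewrite /unfold t1 omega1 subrr mulr0 addr0.
Qed.

Lemma spar1 : spar 1 = 9.
Proof. by rewrite /spar /tri mulr1 cospi opprK ang1; ring. Qed.

Lemma unfold_near w : `|unfold w - w| <= 1.
Proof.
rewrite /unfold addrAC subrr add0r normrM normr_sg.
have /andP[a0 a1] := tri_bounds w; have /andP[b0 b1] := ang_bounds (theta (strand (9 * (2 * tri w - 1)))).
have : `|omega (tri w) - tri w| <= 1 by rewrite ler_norml /omega; apply/andP; split; lra.
by case: eqP => _ h; rewrite ?mul1r// mul0r.
Qed.

Lemma cos_unfold w : theta (strand (spar w)) = - cos (pi * unfold w).
Proof.
have [j [v [-> vb]]] := period_dec w; rewrite unfold_dec// /spar tri_dec// cos_periodic.
have /andP[v1 v2] := vb.
rewrite cos_omega; last by rewrite normr_ge0 ler_norml; apply/andP; split; lra.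
by case: ifP => // _; rewrite mulrN cosN.
Qed.

(** The page alone does not determine the time, but together with the position [tri] on the strand
    it does: on opposite slopes of the wave, equality would make [omega], strictly between 0 and 1,
    an integer. *)
Lemma unfold_inj w w' : tri w = tri w' -> unfold w = unfold w' -> w = w'.
Proof.
have [j [v [-> vb]]] := period_dec w; have [j' [v' [-> vb']]] := period_dec w'.
rewrite !tri_dec// !unfold_dec//; have /andP[v1 v2] := vb; have /andP[v1' v2'] := vb'.
move=> e; rewrite -e; have nb : 0 <= `|v| <= 1 by rewrite normr_ge0 ler_norml; apply/andP; split; lra.
have o0 := omega_gt0 nb; have o1 := omega_lt1 nb; move: e o0 o1.
have no (k l : int) (o : R) : 0 < o -> o < 1 -> 2 * k%:~R + o = 2 * l%:~R - o -> False.
  move=> o0 o1 h; have lE : o = ((l - k)%R)%:~R by rewrite intrB; lra.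
  by move: o0 o1; rewrite lE ltr0z -[1]/((1%Z)%:~R) ltr_int; lia.
have [h|h] := ltP v 0; have [h'|h'] := ltP v' 0.
- rewrite !ltr0_norm//; lra.
- rewrite ltr0_norm// ger0_norm// => e o0 o1 E; exfalso; apply: (no j' j (omega (- v))).
  + by rewrite o0; lra.
  + by rewrite o1; lra.
  + by rewrite -E.
- rewrite ger0_norm// ltr0_norm// => e o0 o1 E; exfalso; apply: (no j j' (omega v)).
  + by rewrite o0; lra.
  + by rewrite o1; lra.
  + by rewrite -E.
- rewrite !ger0_norm//; lra.
Qed.

(** Every point of the strand on the page shown at [W] is visited at a time with this value of
    [unfold]. Hence on every shell the arc fills the whole intersection of the strand with the
    page. *)
Lemma unfold_surj W s : `|s| <= 9 -> theta (strand s) = - cos (pi * W) ->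
  exists w, [/\ unfold w = W, spar w = s & 1 < W -> 1 < w].
Proof.
move=> s9; have [j [v [-> vb]]] := period_dec W; rewrite cos_periodic => e.
have /andP[v1 v2] := vb; pose tau := (s / 9 + 1) / 2.
have tb : 0 <= tau <= 1.
  by move: s9; rewrite ler_norml /tau => /andP[? ?]; apply/andP; split; lra.
have sE : s = 9 * (2 * tau - 1) by rewrite /tau; field.
have oE : omega tau = `|v|.
  rewrite /omega -sE e; have -> : cos (pi * v) = cos (pi * `|v|).
    by have [h|h] := leP 0 v; [rewrite ger0_norm|rewrite ltr0_norm// mulrN cosN].
  by rewrite angK// normr_ge0 ler_norml; apply/andP; split; lra.
have o0 := omega_gt0 tb; have o1 := omega_lt1 tb; rewrite oE in o0 o1.
have /andP[tb0 tb1] := tb.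
pose v' := if v < 0 then - tau else tau.
have [vb' nE sg] : [/\ -1 <= v' < 1, `|v'| = tau & (v' < 0) = (v < 0)].
  rewrite /v'; have [h|h] := ltP v 0.
    have t0 : 0 < tau by rewrite -o0 normr_gt0 lt_eqF.
    split; [by apply/andP; split; lra|by rewrite normrN ger0_norm|by rewrite oppr_lt0].
  have t1 : tau < 1 by rewrite -o1 ger0_norm.
  by split; [apply/andP; split; lra|rewrite ger0_norm|rewrite ltNge tb0].
exists (2 * j%:~R + v'); split.
- rewrite unfold_dec// nE sg oE; case: ltP => h; first by rewrite ltr0_norm// opprK.
  by rewrite ger0_norm.
- by rewrite /spar tri_dec// nE.
- move=> h; have j1 : 1 <= j%:~R :> R by apply: int_ge1; lra.
  rewrite /v'; case: (ltP v 0) => vs; last by lra.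
  have [e1|ne] := eqVneq (j%:~R : R) 1.
    rewrite e1 in h *; suff : tau < 1 by lra.
    by rewrite -o1 ltr0_norm//; lra.
  by have := int_ge2 j1 ne; lra.
Qed.

Lemma continuous_su s : ccont su s.
Proof.
have c1 : {for s, continuous (fun s : R => s ^+ 2)} by apply: rcontX; exact: cvg_id.
have c2 : {for s, continuous (fun s : R => (s ^+ 2 + 1)^-1)}.
  by apply: rcontV; [apply: rcontD c1 _; exact: rcontK|rewrite gt_eqF// s21_gt0].
apply: cont_complex; apply: rcontM => //.
  by apply: rcontB c1 _; exact: rcontK.
by apply: rcontM; [exact: rcontK|exact: cvg_id].
Qed.

Lemma continuous_strand s : {for s, continuous strand}.
Proof.
have c3 : ccont (fun s => su s ^+ 3) s by apply: contX; exact: continuous_su.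
have c2 : ccont (fun s => su s ^+ 2) s by apply: contX; exact: continuous_su.
have cz : ccont (fun s => (1 + Re (su s ^+ 3) / 4)%:C%C * su s ^+ 2) s.
  apply: (contM _ c2); apply: ccont_real; apply: rcontD; first exact: rcontK.
  by apply: rcontM; [exact: contRe c3|exact: rcontK].
apply: cont_pair; first by apply: cont_pair; [exact: contRe cz|exact: contIm cz].
by apply: rcontM; [exact: contIm c3|exact: rcontK].
Qed.

Lemma continuous_lam p : {for p, continuous lam}.
Proof.
apply: rcontD; first by apply: rcontB; [exact: rcontK|exact: continuous_x].
exact: (@rcont_abs R _ p (fun p : T3 => p.1.2) (@continuous_y R p)).
Qed.

Lemma continuous_theta p : lam p != 0 -> {for p, continuous theta}.
Proof.
move=> l0; apply: rcontM; first exact: continuous_y.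
by apply: rcontV => //; exact: continuous_lam.
Qed.

Lemma continuous_cospi w : {for w, continuous (fun w : R => cos (pi * w))}.
Proof.
apply: (@continuous_comp _ _ _ (fun w : R => pi * w) cos); last exact: continuous_cos.
by apply: rcontM; [exact: rcontK|exact: cvg_id].
Qed.

Lemma continuous_tri w : {for w, continuous tri}.
Proof.
apply: (@continuous_comp _ _ _ (fun w : R => - cos (pi * w)) ang); last exact: continuous_ang.
by apply: rcontN; exact: continuous_cospi.
Qed.

Lemma continuous_spar w : {for w, continuous spar}.
Proof.
apply: rcontM; first exact: rcontK; apply: rcontB; last exact: rcontK.
by apply: rcontM; [exact: rcontK|exact: continuous_tri].
Qed.

Lemma norm_spar_le w : `|spar w| <= 9.
Proof. by apply: norm_spar; exact: tri_bounds. Qed.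

Lemma continuous_unfold w : {for w, continuous unfold}.
Proof.
apply: rcontD; first exact: cvg_id; apply: cont_sgr.
- apply: (@continuous_comp _ _ _ (fun w : R => pi * w) sin); last exact: continuous_sin.
  by apply: rcontM; [exact: rcontK|exact: cvg_id].
- apply: rcontB; last exact: continuous_tri.
  apply: (@continuous_comp _ _ _ (theta \o strand \o spar) ang); last exact: continuous_ang.
  apply: continuous_comp; first exact: continuous_spar.
  apply: continuous_comp; first exact: continuous_strand.
  by apply: continuous_theta; rewrite gt_eqF// lam_strand_gt0// norm_spar_le.
have [j [v [-> vb]]] := period_dec w; rewrite sin_periodic tri_dec//.
move=> s0; have /andP[v1 v2] := vb.
have [->|v0] := eqVneq v 0; first by rewrite normr0 omega0 subrr.
have [->|vN] := eqVneq v (-1); first by rewrite normrN normr1 omega1 subrr.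
have n0 : 0 < sin (pi * `|v|).
  apply: sin_gt0_pi; apply/andP; split; first by rewrite mulr_gt0 ?pi_gt0// normr_gt0.
  rewrite -[ltRHS]mulr1 ltr_pM2l ?pi_gt0// ltr_norml v2 andbT lt_neqAle eq_sym vN.
  by lra.
have : sin (pi * `|v|) = 0.
  by have [h|h] := leP 0 v; [rewrite ger0_norm|rewrite ltr0_norm// mulrN sinN s0 oppr0].
by move=> e; move: n0; rewrite e ltxx.
Qed.

End unfolding.

(** * Shells carrying the pages, and the arc through them *)

Section capsule.
Context {R : realType}.
Local Notation C := (R[i]^o : topologicalType).
Local Notation T3 := (R * R * R)%type.
Local Notation pi := (@pi R).
Implicit Types (p a : T3) (s t w W x : R) (j : int).

(* The shell [a.1.2 = - W^-1] carries the plane [theta = - cos (pi * W)] of the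
   trefoil: as [W] grows the trefoil is swept back and forth, reversing at every
   integer.  The term [Num.min 0 (t + 1)] in [ghat] continues it beyond [-1]. *)
Definition cap W p : T3 :=
  (((strand 9).1.2 - lam p) / (8 * W), - W^-1, (p.2 - (strand 9).2) / (2 * W)).

Definition ghat t : T3 :=
  if t < 0 then
    (* As [t] runs from -1 to 0, [w] runs from 1 to infinity, so the sweeps accumulate at [t = 0];
       the maximum freezes [w] at 1 for earlier [t]. *)
    let w := - (Num.max (-1) t)^-1 in
    let a := cap (unfold w) (strand (spar w)) in
    (a.1.1, a.1.2 + Num.min 0 (t + 1), a.2)
  else (0, t, 0).

(** Its positive level sets are the surfaces of half-infinite boxes around a ray. On the cone where
    [- y] is the largest of the three numbers, which contains the part of the arc on the shells, it
    is the depth. *)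
Definition rad a : R := Num.max (- a.1.2) (Num.max `|a.1.1| `|a.2|).

(* A left inverse of [cap]; taking [max 0] and [rad] extends it to all of the
   complement of the ray [rad = 0] in such a way that the knot has no other
   preimages than the arc. *)
Definition uncap a : T3 :=
  let th := - cos (pi / rad a) in
  let l := Num.max 0 ((strand 9).1.2 - 8 * a.1.1 / rad a) in
  (cut + `|th * l| - l, th * l, (strand 9).2 + 2 * a.2 / rad a).

Lemma lam_knot_bounds p : knot p -> p.1.1 <= cut ->
  `|(strand 9).1.2 - lam p| < 4 /\ `|p.2 - (strand 9).2| <= 1 / 2.
Proof.
move=> kp pc; have l0 := lam_gt0 kp pc.
have [x1 y1 z1] := knot_bounds kp; have [_ y9 z9] := knot_bounds (@strand_knot R 9).
have [c1 c2] := @cut_bounds R; have y90 := @strand_y9 R.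
move: x1 y1 z1 y9 z9; rewrite /lam in l0 *; rewrite !ler_norml ltr_norml.
have := normr_ge0 p.1.2; have := ler_norm p.1.2.
move=> n1 n2 /andP[x1 x2] y1 /andP[z1 z2] /andP[u1 u2] /andP[v1 v2].
have y1' : `|p.1.2| <= 5 / 4 by rewrite ler_norml.
split; apply/andP; split; lra.
Qed.

Lemma strand_knot_bounds w : `|(strand 9).1.2 - lam (strand (spar w))| < 4 /\
  `|(strand (spar w)).2 - (strand 9).2| <= 1 / 2.
Proof.
by apply: lam_knot_bounds; [exact: strand_knot|apply: strand_le_cut; exact: norm_spar_le].
Qed.

Lemma ghat_line t : t <= -1 \/ 0 <= t -> ghat t = (0, t, 0).
Proof.
rewrite /ghat => -[h|h]; last by rewrite ltNge h.
have t0 : t < 0 by lra.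
rewrite t0 max_l// invrN1 opprK unfold1 spar1 /cap /= lam9 !subrr !mul0r invr1.
rewrite min_r; last by lra.
by congr (_, _, _); ring.
Qed.

Lemma ghat_cap t : -1 <= t < 0 -> 1 <= - t^-1 /\
  ghat t = cap (unfold (- t^-1)) (strand (spar (- t^-1))).
Proof.
move=> /andP[t1 t0]; split.
  rewrite -invrN -[leLHS]invr1 lef_pV2 ?posrE; lra.
by rewrite /ghat t0 max_r// min_l ?addr0//; lra.
Qed.

Lemma unfold_ge1 w : 1 <= w -> 1 <= unfold w.
Proof. by rewrite le_eqVlt => /orP[/eqP<-|/unfold_gt1/ltW//]; rewrite unfold1. Qed.

Lemma cap_inj W W' p p' : 0 < W -> 0 < W' -> cap W p = cap W' p' ->
  [/\ W = W', lam p = lam p' & p.2 = p'.2].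
Proof.
move=> W0 W0' [e1 /oppr_inj /invr_inj e2 e3]; rewrite -e2 in e1 e3 *.
have i8 : (8 * W)^-1 != 0 by rewrite invr_eq0 mulf_neq0 ?pnatr_eq0// gt_eqF.
have i2 : (2 * W)^-1 != 0 by rewrite invr_eq0 mulf_neq0 ?pnatr_eq0// gt_eqF.
split=> //; first by move: (mulIf i8 e1); lra.
by move: (mulIf i2 e3); lra.
Qed.

(** The divisors in [cap] are chosen for these margins: with [lam] within 4 and the height within
    [1/2] of the values at [strand 9], the point stays well inside the cone where [rad] is the
    depth. The margins also give continuity of the arc at its tip. *)
Lemma cap_bounds W p : 0 < W -> `|(strand 9).1.2 - lam p| < 4 ->
  `|p.2 - (strand 9).2| <= 1 / 2 ->
  [/\ `|(cap W p).1.1| <= `|(cap W p).1.2| / 2, `|(cap W p).2| <= `|(cap W p).1.2| / 4,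
      rad (cap W p) = W^-1 & `|(cap W p).1.2| = W^-1].
Proof.
move=> W0 h1 h2; have nE : `|(cap W p).1.2| = W^-1 by rewrite normrN gtr0_norm// invr_gt0.
have i0 : 0 < W^-1 by rewrite invr_gt0.
have a1 : `|(cap W p).1.1| <= W^-1 / 2.
  rewrite /cap /= invfM mulrA normrM [`|W^-1|]gtr0_norm// [leRHS]mulrC.
  by rewrite ler_pM2r// normrM [`|8^-1|]gtr0_norm; lra.
have a3 : `|(cap W p).2| <= W^-1 / 4.
  rewrite /cap /= invfM mulrA normrM [`|W^-1|]gtr0_norm// [leRHS]mulrC.
  by rewrite ler_pM2r// normrM [`|2^-1|]gtr0_norm; lra.
split=> //; rewrite ?nE// /rad; have -> : - (cap W p).1.2 = W^-1 by rewrite /= opprK.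
by rewrite max_l// ge_max; apply/andP; split; lra.
Qed.

Lemma uncap_cap W p : 0 < lam p -> theta p = - cos (pi * W) ->
  rad (cap W p) = W^-1 -> 0 < W -> uncap (cap W p) = p.
Proof.
move=> l0 e r W0; rewrite /uncap r invrK -e /cap /=.
have -> : (strand 9).1.2 - 8 * (((strand 9).1.2 - lam p) / (8 * W)) * W = lam p.
  by field; rewrite gt_eqF.
rewrite max_r ?ltW// /theta divfK ?gt_eqF//.
have -> : (strand 9).2 + 2 * ((p.2 - (strand 9).2) / (2 * W)) * W = p.2.
  by field; rewrite gt_eqF.
by rewrite -coord_lam; case: (p) => [[? ?] ?].
Qed.

(** Off the cone no preimage of the knot appears: the bounds of [lam_knot_bounds] give [|x| < rad a]
    and [|z| < rad a], so the maximum defining [rad] is attained by [- y] and [a] lies on a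
    shell. *)
Lemma cap_uncap a : 0 < rad a -> knot (uncap a) ->
  [/\ a = cap (rad a)^-1 (uncap a), (uncap a).1.1 <= cut, 0 < lam (uncap a) &
      theta (uncap a) = - cos (pi * (rad a)^-1)].
Proof.
move=> r0 kn; set r := rad a in r0 *; set th := - cos (pi / r).
set l := Num.max 0 ((strand 9).1.2 - 8 * a.1.1 / r).
have uE : uncap a = (cut + `|th * l| - l, th * l, (strand 9).2 + 2 * a.2 / r) by [].
have lb : 0 <= l by rewrite le_max lexx.
have pc : (uncap a).1.1 <= cut.
  rewrite uE /=; suff : `|th * l| <= l by lra.
  by rewrite normrM (ger0_norm lb) normrN ler_piMl// ler_norml cos_geN1 cos_le1.
have lE : lam (uncap a) = l by rewrite /lam uE /=; ring.
have l0 := lam_gt0 kn pc; have [b1 b2] := lam_knot_bounds kn pc.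
have lE' : l = (strand 9).1.2 - 8 * a.1.1 / r.
  move: l0; rewrite lE /l; case: (leP ((strand 9).1.2 - 8 * a.1.1 / r) 0) => h //.
  by rewrite ltxx.
have thE : theta (uncap a) = th by rewrite /theta lE uE /= mulfK// gt_eqF// -lE.
have i0 : 0 < r^-1 by rewrite invr_gt0.
have a1 : `|a.1.1| < r.
  move: b1; rewrite lE lE' opprB addrC subrK normrM [`|r^-1|]gtr0_norm// normrM normr_nat.
  by rewrite ltr_pdivrMr//; have := normr_ge0 a.1.1; lra.
have a3 : `|a.2| < r.
  move: b2; rewrite uE /= [_ + _ - _]addrAC subrr add0r normrM [`|r^-1|]gtr0_norm// normrM normr_nat.
  by rewrite ler_pdivrMr//; have := normr_ge0 a.2; lra.
have a2 : r = - a.1.2.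
  apply/eqP; move: a1 a3; rewrite /r /rad /Num.max; case: ifP => [h|_ //].
  by case: ifP => [h2|h2]; rewrite ltxx.
split=> //.
rewrite /cap invrK lE lE' uE /=.
rewrite (_ : _ / (8 * r^-1) = a.1.1); last by field; rewrite gt_eqF.
rewrite (_ : _ / (2 * r^-1) = a.2); last by field; rewrite gt_eqF.
by rewrite a2 opprK; case: (a) => [[? ?] ?].
Qed.

(** Near the tip, the complement of the arc is thus the preimage under [uncap] of the complement of
    the knot, so that [mA] and [mB] can be pulled back. *)
Lemma ghat_iff a : 0 < rad a < 1 -> (exists t, a = ghat t) <-> knot (uncap a).
Proof.
move=> /andP[r0 r1]; split.
  move=> [t aE].
  have [h|h] := leP 0 t.
    move: r0; rewrite aE ghat_line; last by right.
    by rewrite /rad /= normr0 maxxx max_r ?ltxx// oppr_le0.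
  have [h'|h'] := leP t (-1).
    move: r1; rewrite aE ghat_line; last by left.
    rewrite /rad /= normr0 maxxx max_l; lra.
  have [w1 gE] := ghat_cap (ltac:(by apply/andP; split; lra) : -1 <= t < 0).
  have [b1 b2] := strand_knot_bounds (- t^-1); have W1 := unfold_ge1 w1.
  have W0 : 0 < unfold (- t^-1) by lra.
  have [_ _ rE _] := cap_bounds W0 b1 b2.
  rewrite aE gE uncap_cap//; first exact: strand_knot.
    by rewrite lam_strand_gt0// norm_spar_le.
  exact: cos_unfold.
move=> kn; have [aE pc l0 thE] := cap_uncap r0 kn.
have [s s9 sE] := knot_cut kn pc; rewrite sE in thE.
have [w [e1 e2 w1]] := unfold_surj s9 thE.
have {}w1 : 1 < w by apply: w1; rewrite -[ltLHS]invr1 ltf_pV2 ?posrE.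
exists (- w^-1); have i0 : 0 < w^-1 by rewrite invr_gt0; lra.
have [_ gE] := ghat_cap (ltac:(apply/andP; split; [rewrite lerN2 -[leRHS]invr1 lef_pV2 ?posrE; lra|lra]) : -1 <= - w^-1 < 0).
by rewrite gE invrN opprK invrK e1 e2 -sE.
Qed.

Lemma ghat_bounds t :
  [/\ `|(ghat t).1.1| <= `|(ghat t).1.2| / 2, `|(ghat t).2| <= `|(ghat t).1.2| / 2,
      `|(ghat t).1.2| <= 2 * `|t| & -1 < t < 0 -> -1 < (ghat t).1.2 < 0].
Proof.
have n0 := normr_ge0 t.
have [h|h] := leP 0 t.
  rewrite ghat_line; last by right.
  by rewrite /= normr0; split; try lra; rewrite (ltNge t 0) h andbF.
have [h'|h'] := leP t (-1).
  rewrite ghat_line; last by left.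
  by rewrite /= normr0; split; try lra; rewrite (ltNge (-1) t) h'.
have [w1 gE] := ghat_cap (ltac:(by apply/andP; split; lra) : -1 <= t < 0).
have [b1 b2] := strand_knot_bounds (- t^-1); have W1 := unfold_ge1 w1.
have w1' : 1 < - t^-1.
  by rewrite -invrN -[ltLHS]invr1 ltf_pV2 ?posrE; lra.
have W0 : 0 < unfold (- t^-1) by lra.
have [c1 c2 _ c3] := cap_bounds W0 b1 b2; rewrite gE; split=> //.
- by have := normr_ge0 (cap (unfold (- t^-1)) (strand (spar (- t^-1)))).1.2; lra.
- rewrite c3 ltr0_norm//.
  have := unfold_near (- t^-1); rewrite ler_norml => /andP[u1 _].
  (* Either [- t^-1 <= 2] and [1 <= unfold] suffices, or it counts that [unfold] is off by at most
     1. *)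
  have h2 : - t^-1 / 2 <= unfold (- t^-1).
    have [?|?] := leP (- t^-1) 2; lra.
  have -> : 2 * - t = (- t^-1 / 2)^-1 by field; rewrite lt_eqF.
  by rewrite lef_pV2 ?posrE; lra.
move=> _; have W1' := unfold_gt1 w1'.
have : 0 < (unfold (- t^-1))^-1 < 1.
  by rewrite invr_gt0 W0 -[ltRHS]invr1 ltf_pV2 ?posrE.
by move=> /andP[? ?]; rewrite /cap /=; apply/andP; split; lra.
Qed.

Lemma cont_cap w : 0 < unfold w ->
  {for w, continuous (fun w => cap (unfold w) (strand (spar w)))}.
Proof.
move=> W0; have cs : {for w, continuous (fun w => strand (spar w))}.
  by apply: continuous_comp; [exact: continuous_spar|exact: continuous_strand].
have cl : {for w, continuous (fun w => lam (strand (spar w)))}.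
  by apply: (@continuous_comp _ _ _ (fun w => strand (spar w)) lam) => //; exact: continuous_lam.
have cz : {for w, continuous (fun w => (strand (spar w)).2)}.
  by apply: (@continuous_comp _ _ _ (fun w => strand (spar w)) snd) => //; exact: continuous_z.
have cu := @continuous_unfold R w.
have ci (k : R) : k != 0 -> {for w, continuous (fun w => (k * unfold w)^-1)}.
  move=> k0; apply: rcontV; first by apply: rcontM cu; exact: rcontK.
  by rewrite mulf_neq0// gt_eqF.
apply: cont_pair; first apply: cont_pair.
- by apply: rcontM; [apply: rcontB cl; exact: rcontK|apply: ci; rewrite pnatr_eq0].
- by apply: rcontN; apply: rcontV cu _; rewrite gt_eqF.
- by apply: rcontM; [apply: rcontB cz _; exact: rcontK|apply: ci; rewrite pnatr_eq0].
Qed.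

(** For injectivity, the depth gives the shell and hence the page, the other two coordinates give
    [lam] and the height, so the point of the strand is known; [unfold_inj] then recovers the time.
    Continuity at 0 follows from the linear bounds of [ghat_bounds]. *)
Lemma arc_ghat : arc ghat.
Proof.
split=> [t|].
  have [t0|t0|->] := ltgtP t 0; last 1 first.
  - have gE : ghat 0 = (0, 0, 0) by rewrite ghat_line//; right.
    have key (f : R -> R) : (forall s, `|f s| <= 2 * `|s|) -> {for 0, continuous f}.
      move=> hf; apply/cvgrPdist_lt => e e0; have e2 : 0 < e / 2 by lra.
      have f0 : f 0 = 0 by apply/eqP; rewrite -normr_le0; have := hf 0; rewrite normr0; lra.
      have := near_lt (@rcont_abs R _ 0 id (@cvg_id _ _)) (_ : `|0| < e / 2).
      rewrite normr0 => /(_ e2); apply: filterS => s hs.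
      by rewrite f0 sub0r normrN; have := hf s; lra.
    have -> : ghat = (fun s => ((ghat s).1.1, (ghat s).1.2, (ghat s).2)).
      by apply: funext => s; case: (ghat s) => [[]].
    by apply: cont_pair; [apply: cont_pair|]; apply: key => s; have [? ? ? _] := ghat_bounds s;
      have := normr_ge0 (ghat s).1.2; lra.
  - pose w s : R := - (Num.max (-1) s)^-1.
    have m0 : Num.max (-1) t < 0 by rewrite gt_max; apply/andP; split; lra.
    have w1 : 1 <= w t.
      rewrite /w -invrN -[leLHS]invr1 lef_pV2 ?posrE ?ltr01 ?oppr_gt0//.
      by rewrite lerNl le_max lexx.
    have cw : {for t, continuous w}.
      apply: rcontN; apply: rcontV; last by rewrite lt_eqF.
      by apply: rcont_max; [exact: rcontK|exact: cvg_id].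
    have cc : {for t, continuous (fun s => cap (unfold (w s)) (strand (spar (w s))))}.
      apply: (@continuous_comp _ _ _ w (fun w => cap (unfold w) (strand (spar w)))) => //.
      by apply: cont_cap; have := unfold_ge1 w1; lra.
    have c1 : {for t, continuous (fun s => (cap (unfold (w s)) (strand (spar (w s)))).1.1)}.
      exact: (@continuous_comp _ _ _ (fun s => cap (unfold (w s)) (strand (spar (w s)))) (fun p : T3 => p.1.1) t cc (@continuous_x R _)).
    have c2 : {for t, continuous (fun s => (cap (unfold (w s)) (strand (spar (w s)))).1.2)}.
      exact: (@continuous_comp _ _ _ (fun s => cap (unfold (w s)) (strand (spar (w s)))) (fun p : T3 => p.1.2) t cc (@continuous_y R _)).
    have c3 : {for t, continuous (fun s => (cap (unfold (w s)) (strand (spar (w s)))).2)}.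
      exact: (@continuous_comp _ _ _ (fun s => cap (unfold (w s)) (strand (spar (w s)))) (fun p : T3 => p.2) t cc (@continuous_z R _)).
    have c4 : {for t, continuous (fun s : R => Num.min 0 (s + 1))}.
      apply: rcont_min; first exact: rcontK.
      by apply: rcontD; [exact: cvg_id|exact: rcontK].
    apply: (@near_glue _ _ (fun s => ((cap (unfold (w s)) (strand (spar (w s)))).1.1,
        (cap (unfold (w s)) (strand (spar (w s)))).1.2 + Num.min 0 (s + 1),
        (cap (unfold (w s)) (strand (spar (w s)))).2))).
      by apply: filterS (lt_nbhsl t0) => s s0; rewrite /ghat s0.
    by apply: cont_pair c3; apply: cont_pair c1 _; exact: rcontD c2 c4.
  - apply: (@near_glue _ _ (fun s => (0, s, 0))).
      by apply: filterS (lt_nbhsr t0) => s s0; rewrite ghat_line//; right; exact: ltW.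
    by apply: cont_pair; [apply: cont_pair|]; [exact: rcontK|exact: cvg_id|exact: rcontK].
have cls t : (-1 < t < 0) \/ ((t <= -1 \/ 0 <= t) /\ ~ (-1 < (ghat t).1.2 < 0)).
  have [h|h] := leP 0 t; first by right; split; [right|rewrite ghat_line/=; [lra|right]].
  have [h'|h'] := leP t (-1); first by right; split; [left|rewrite ghat_line/=; [lra|left]].
  by left; apply/andP.
move=> t t' e; case: (cls t) => [h|[h n]]; case: (cls t') => [h'|[h' n']].
- have [_ _ _ _] := ghat_bounds t.
  have h1 : -1 <= t < 0 by case/andP: h => ? ?; apply/andP; split; lra.
  have h1' : -1 <= t' < 0 by case/andP: h' => ? ?; apply/andP; split; lra.
  have [w1 gE] := ghat_cap h1; have [w1' gE'] := ghat_cap h1'.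
  have W1 := unfold_ge1 w1; have W1' := unfold_ge1 w1'.
  have W0 : 0 < unfold (- t^-1) by lra.
  have W0' : 0 < unfold (- t'^-1) by lra.
  move: e; rewrite gE gE' => /(cap_inj W0 W0')[eW el ez].
  have l0 := lam_strand_gt0 (norm_spar_le (- t^-1)).
  have : strand (spar (- t^-1)) = strand (spar (- t'^-1)).
    by apply: coords_eq => //; [rewrite gt_eqF|rewrite !cos_unfold eW].
  move=> /strand_inj es; have et : tri (- t^-1) = tri (- t'^-1).
    by move: es; rewrite /spar; lra.
  by have := unfold_inj et eW => /oppr_inj/invr_inj.
- by have [_ _ _ /(_ h)] := ghat_bounds t; rewrite e.
- by have [_ _ _ /(_ h')] := ghat_bounds t'; rewrite -e.
- by move: e; rewrite !ghat_line// => -[].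
Qed.

(** Points of the arc above each other lie on the same shell and come from a crossing of the
    trefoil. The height [1/2] of the crossing is scaled by [1 / (2 W)], and the page of a crossing
    is an inner one. *)
Lemma ghat_chord t t' d : ghat t' = ((ghat t).1, (ghat t).2 + d) -> d != 0 ->
  exists W, [/\ 1 <= W, `|d| = (4 * W)^-1 & 2 * cos (pi * W) ^+ 2 < 1].
Proof.
move=> e d0; have e1 : (ghat t').1 = (ghat t).1 by rewrite e.
have cls s : (-1 < s < 0) \/ (s <= -1 \/ 0 <= s).
  have [h|h] := leP 0 s; first by right; right.
  have [h'|h'] := leP s (-1); first by right; left.
  by left; apply/andP.
have e2 : (ghat t').1.2 = (ghat t).1.2 by rewrite e1.
have lineP s s' : (s <= -1 \/ 0 <= s) -> ghat s' = ((ghat s).1, (ghat s).2 + d) \/ ghat s = ((ghat s').1, (ghat s').2 + d) -> False.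
  move=> hs E; have e3 : (ghat s').1 = (0, s) by case: E => E; have := congr1 fst E; rewrite /= !(ghat_line hs)/=.
  have [b1 b2 b3 b4] := ghat_bounds s'; case: (cls s') => hs'.
    have := b4 hs'; rewrite e3/=; case: hs => ? /andP[]; lra.
  have es : s' = s by move: e3; rewrite ghat_line// => -[].
  by move/eqP: d0; apply; move: E; rewrite es; case=> /(congr1 snd)/=; lra.
case: (cls t) => h; last by exfalso; apply: (lineP t t') => //; left.
case: (cls t') => h'; last by exfalso; apply: (lineP t' t) => //; right.
have h1 : -1 <= t < 0 by case/andP: h => ? ?; apply/andP; split; lra.
have h1' : -1 <= t' < 0 by case/andP: h' => ? ?; apply/andP; split; lra.
have [w1 gE] := ghat_cap h1; have [w1' gE'] := ghat_cap h1'.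
set W := unfold (- t^-1) in gE; set W' := unfold (- t'^-1) in gE'.
set p := strand _ in gE; set p' := strand _ in gE'.
have W1 : 1 <= W := unfold_ge1 w1; have W1' : 1 <= W' := unfold_ge1 w1'.
have eW : W = W'.
  by move: e2; rewrite gE gE' /= => /oppr_inj/invr_inj.
have i8 : (8 * W)^-1 != 0 by rewrite invr_eq0 mulf_neq0 ?pnatr_eq0// gt_eqF//; lra.
have el : lam p = lam p'.
  have := congr1 fst e1; rewrite gE gE' /= -eW => /(mulIf i8); lra.
have l0 : 0 < lam p := lam_strand_gt0 (norm_spar_le (- t^-1)).
have eth : theta p = theta p' by rewrite !cos_unfold -/W -/W' eW.
have y : p.1.2 = p'.1.2.
  rewrite -(divfK (lt0r_neq0 l0) p.1.2) -[_ / _]/(theta p) eth /theta el divfK//.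
  by rewrite -el gt_eqF.
have x : p.1.1 = p'.1.1 by rewrite !coord_lam y el.
have dE : d = (p'.2 - p.2) / (2 * W).
  have := congr1 snd e; rewrite gE gE' /= -eW => h3.
  have -> : d = (p'.2 - (strand 9).2) / (2 * W) - (p.2 - (strand 9).2) / (2 * W) by rewrite h3 addrC addKr.
  rewrite -mulrBl opprB addrA. by rewrite subrK.
have ne : p' <> p by move=> E; move/eqP: d0; apply; rewrite dE E subrr mul0r.
have e11 : p'.1 = p.1.
  by move: x y; case: (p) => [[? ?] ?]; case: (p') => [[? ?] ?] /= -> ->.
have [dz yl] := knot_chord (strand_knot _) (strand_knot _) e11 ne.
exists W; split=> //.
  rewrite dE normrM dz normfV gtr0_norm; last by lra.
  by field; rewrite gt_eqF//; lra.
have := cos_unfold (- t^-1); rewrite -/W -/p => thE.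
have : theta p ^+ 2 = cos (pi * W) ^+ 2 by rewrite thE sqrrN.
move=> <-; rewrite /theta expr_div_n mulrA ltr_pdivrMr ?exprn_gt0// mul1r.
by move: yl; rewrite -y -el.
Qed.

End capsule.

(** * The tip of the arc is knotted *)

Section capsule_germs.
Context {R : realType}.
Local Notation C := (R[i]^o : topologicalType).
Local Notation T3 := (R * R * R)%type.
Local Notation pi := (@pi R).
Implicit Types (p a b : T3) (s t w W x u : R) (j : int).

Lemma rad_cap W p : 0 < W -> `|(strand 9).1.2 - lam p| <= 8 ->
  `|p.2 - (strand 9).2| <= 2 ->
  [/\ rad (cap W p) = W^-1, `|(cap W p).1.1| <= W^-1 & `|(cap W p).2| <= W^-1].
Proof.
move=> W0 h1 h2; have i0 : 0 < W^-1 by rewrite invr_gt0.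
have a1 : `|(cap W p).1.1| <= W^-1.
  rewrite /cap /= invfM mulrA normrM [`|W^-1|]gtr0_norm//.
  by rewrite (ler_piMl (ltW i0))// normrM [`|8^-1|]gtr0_norm; lra.
have a3 : `|(cap W p).2| <= W^-1.
  rewrite /cap /= invfM mulrA normrM [`|W^-1|]gtr0_norm//.
  by rewrite (ler_piMl (ltW i0))// normrM [`|2^-1|]gtr0_norm; lra.
split=> //; rewrite /rad; have -> : - (cap W p).1.2 = W^-1 by rewrite /= opprK.
by rewrite max_l// ge_max a1 a3.
Qed.

Lemma uncap_spec a : 0 < rad a -> 0 < (strand 9).1.2 - 8 * a.1.1 / rad a ->
  [/\ lam (uncap a) = (strand 9).1.2 - 8 * a.1.1 / rad a,
      theta (uncap a) = - cos (pi * (rad a)^-1),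
      (uncap a).2 = (strand 9).2 + 2 * a.2 / rad a &
      rad a = - a.1.2 -> a = cap (rad a)^-1 (uncap a)].
Proof.
move=> r0; set r := rad a in r0 *; set l := _ - _ / r => l0.
have uE : uncap a = (cut + `|- cos (pi / r) * l| - l, - cos (pi / r) * l, (strand 9).2 + 2 * a.2 / r).
  by rewrite /uncap -/r -/l max_r// ltW.
have lE : lam (uncap a) = l by rewrite /lam uE /=; ring.
split=> //; first by rewrite /theta lE uE /= mulfK// gt_eqF.
move=> a2; rewrite /cap invrK lE uE /l /=.
rewrite (_ : _ / (8 * r^-1) = a.1.1); last by field; rewrite gt_eqF.
rewrite (_ : _ / (2 * r^-1) = a.2); last by field; rewrite gt_eqF.
by rewrite a2 opprK; case: (a) => [[? ?] ?].
Qed.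

Lemma continuous_rad a : {for a, continuous rad}.
Proof.
have cx := @rcont_abs R _ a (fun a : T3 => a.1.1) (@continuous_x R a).
have cz := @rcont_abs R _ a (fun a : T3 => a.2) (@continuous_z R a).
apply: rcont_max; first by apply: rcontN; exact: continuous_y.
by apply: rcont_max cx _; exact: cz.
Qed.

Lemma continuous_radV a : 0 < rad a -> {for a, continuous (fun a => (rad a)^-1)}.
Proof. by move=> r0; apply: rcontV; [exact: continuous_rad|rewrite gt_eqF]. Qed.

Lemma cont_height a : 0 < rad a ->
  {for a, continuous (fun a => (strand 9).1.2 - 8 * a.1.1 / rad a)}.
Proof.
move=> r0; apply: rcontB; first exact: rcontK.
apply: rcontM; last exact: continuous_radV.
by apply: rcontM; [exact: rcontK|exact: continuous_x].
Qed.

Lemma cont_level a : 0 < rad a ->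
  {for a, continuous (fun a => (strand 9).2 + 2 * a.2 / rad a)}.
Proof.
move=> r0; apply: rcontD; first exact: rcontK.
apply: rcontM; last exact: continuous_radV.
by apply: rcontM; [exact: rcontK|exact: continuous_z].
Qed.

Lemma continuous_uncap a : 0 < rad a -> {for a, continuous uncap}.
Proof.
move=> r0.
have c1 : {for a, continuous (fun a => - cos (pi / rad a))}.
  apply: rcontN; apply: (@continuous_comp _ _ _ (fun a => (rad a)^-1) (fun x : R => cos (pi * x))).
    exact: continuous_radV.
  exact: continuous_cospi.
have c2 : {for a, continuous (fun a => Num.max 0 ((strand 9).1.2 - 8 * a.1.1 / rad a))}.
  by apply: rcont_max; [exact: rcontK|exact: cont_height].
have c3 := rcontM c1 c2; have c4 := rcont_abs c3.
apply: cont_pair; last exact: cont_level.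
apply: cont_pair c3; apply: rcontB c2; by apply: rcontD c4; exact: rcontK.
Qed.

Lemma ghat_arc_iff t a : -1 < t <= 0 -> 0 < rad a < 1 ->
  (ghat @` `[t - 1, t + 1]) a <-> knot (uncap a).
Proof.
move=> /andP[t1 t0] ra; have /andP[r0 r1] := ra; rewrite -(ghat_iff ra).
split=> [[s _ <-]|[s aE]]; first by exists s.
exists s => //; rewrite /= in_itv/=.
have [h|h] := leP 0 s.
  move: r0; rewrite aE ghat_line; last by right.
  by rewrite /rad /= normr0 maxxx max_r ?ltxx// oppr_le0.
have [h'|h'] := leP s (-1); last by apply/andP; split; lra.
move: r1; rewrite aE ghat_line; last by left.
by rewrite /rad /= normr0 maxxx max_l; lra.
Qed.

Let good p := [/\ 0 < lam p, `|theta p| <= 1, `|(strand 9).1.2 - lam p| <= 8,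
  `|p.2 - (strand 9).2| <= 2 & ~ knot p].

(** By periodicity the page of [p] is shown on the shell [2 m + ang (theta p)] for every integer
    [m]. A large [m] places a continuous copy of the region [good], which contains both test loops,
    in a given neighbourhood of the tip. *)
Lemma small_caps (V : set T3) : open V -> V (0, 0, 0) -> exists c : T3 -> T3,
  forall p, good p -> [/\ V (c p), ~ (ghat @` `[0 - 1, 0 + 1]) (c p), uncap (c p) = p &
    {for p, continuous c}].
Proof.
move=> oV V0; have [e /= e0 he] := (nbhs_ballP _ _).1 (open_nbhs_nbhs (conj oV V0)).
pose m : int := (Num.truncn e^-1).+1%:Z.
have m1 : e^-1 < (m%:~R : R) by exact: truncnS_gt.
have e1 : 0 < e^-1 by rewrite invr_gt0.
pose W p := 2 * m%:~R + ang (theta p).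
exists (fun p => cap (W p) p) => p [l0 th1 b1 b2 nk].
have /andP[g0 g1] := ang_bounds (theta p).
have mm : 1 <= (m%:~R : R) by rewrite -[1]/((1%Z)%:~R) ler_int.
have W0 : 0 < W p by rewrite /W; lra.
have [rE c1 c3] := rad_cap W0 b1 b2.
have We : (W p)^-1 < e by rewrite -[e]invrK ltf_pV2 ?posrE// /W; lra.
have W1 : (W p)^-1 < 1 by rewrite -[ltRHS]invr1 ltf_pV2 ?posrE// /W; lra.
have i0 : 0 < (W p)^-1 by rewrite invr_gt0.
have thE : theta p = - cos (pi * W p).
  by rewrite /W cos_periodic cos_ang ?opprK// -ler_norml.
have uE : uncap (cap (W p) p) = p by exact: uncap_cap.
split=> //.
- apply: he; split; [split|] => /=.
  + by rewrite /ball/= sub0r normrN; apply: le_lt_trans c1 We.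
  + by rewrite /ball/= sub0r !normrN gtr0_norm.
  + by rewrite /ball/= sub0r normrN; apply: le_lt_trans c3 We.
- move=> h; apply: nk; rewrite -uE; apply/(@ghat_arc_iff 0 (cap (W p) p)) => //.
    by apply/andP; split; lra.
  by rewrite rE i0.
- have cl := @continuous_lam R p.
  have cW : {for p, continuous W}.
    apply: rcontD; first exact: rcontK.
    apply: (@continuous_comp _ _ _ theta ang); last exact: continuous_ang.
    by apply: continuous_theta; rewrite gt_eqF.
  have ci (k : R) : k != 0 -> {for p, continuous (fun p => (k * W p)^-1)}.
    move=> k0; apply: rcontV; first by apply: rcontM cW; exact: rcontK.
    by rewrite mulf_neq0// gt_eqF.
  apply: cont_pair; first apply: cont_pair.
  + by apply: rcontM; [apply: rcontB cl; exact: rcontK|apply: ci; rewrite pnatr_eq0].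
  + by apply: rcontN; apply: rcontV cW _; rewrite gt_eqF.
  + by apply: rcontM; [apply: rcontB; [exact: continuous_z|exact: rcontK]|apply: ci; rewrite pnatr_eq0].
Qed.

Lemma complex_neq0 x : 0 < x -> x%:C%C != 0 :> R[i].
Proof. by move=> x0; rewrite -cabs_eq0 cabs_real normr_eq0 gt_eqF. Qed.

Lemma theta_le p : p.1.1 <= cut -> 0 < lam p -> `|theta p| <= 1.
Proof.
move=> pc l0; rewrite /theta normrM normfV (gtr0_norm l0) ler_pdivrMr// mul1r /lam.
by lra.
Qed.

Lemma good_loop_root t : good (loop_root t).
Proof.
have [cA cB] := loop_rootE t; have [c1 c2] := @cut_bounds R.
have k1 := cos_geN1 (2 * pi * t); have k2 := cos_le1 (2 * pi * t).
have k3 := sin_geN1 (2 * pi * t); have k4 := sin_le1 (2 * pi * t).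
have [_ y9 z9] := knot_bounds (@strand_knot R 9).
have y90 := @strand_y9 R.
have lE : lam (loop_root t) = cut + 1 + 9 / 10 * cos (2 * pi * t).
  by rewrite /lam /loop_root /= normr0; ring.
move: y9 z9; rewrite !ler_norml => /andP[_ y9] /andP[z1 z2].
split.
- by rewrite lE; lra.
- by apply: theta_le; rewrite ?lE /loop_root/=; lra.
- by rewrite lE ler_norml; apply/andP; split; lra.
- rewrite -[(loop_root t).2]/(9 / 10 * sin (2 * pi * t)).
  by rewrite ler_norml; apply/andP; split; lra.
- rewrite -knotP cA cB expr0n/= => /esym/eqP; rewrite expf_eq0/= mulf_eq0 (negbTE (cis_neq0 t)) orbF.
  by move=> h; move: (@complex_neq0 (18 / 5)); rewrite h divr_gt0// => /(_ isT).
Qed.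

Lemma good_loop_sqrt t : good (loop_sqrt t).
Proof.
have [cA cB] := loop_sqrtE t; have [c1 c2] := @cut_bounds R.
have k1 := cos_geN1 (2 * pi * t); have k2 := cos_le1 (2 * pi * t).
have k3 : `|sin (2 * pi * t)| <= 1 by rewrite ler_norml sin_geN1 sin_le1.
have [_ y9 z9] := knot_bounds (@strand_knot R 9).
have y90 := @strand_y9 R; have k4 := normr_ge0 (sin (2 * pi * t)).
have lE : lam (loop_sqrt t) = cut - cos (2 * pi * t) + `|sin (2 * pi * t)|.
  by rewrite /lam /loop_sqrt.
move: y9 z9; rewrite !ler_norml => /andP[_ y9] /andP[z1 z2].
split.
- by rewrite lE; lra.
- by apply: theta_le; rewrite ?lE /loop_sqrt/=; lra.
- by rewrite lE ler_norml; apply/andP; split; lra.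
- rewrite -[(loop_sqrt t).2]/(0 : R).
  by rewrite ler_norml; apply/andP; split; lra.
- rewrite -knotP cA cB expr0n/= => /eqP; rewrite expf_eq0/= (negbTE (cis_neq0 t)).
  by [].
Qed.

Lemma cont_cis_lin (k : R) (z : R[i]) t : ccont (fun t => z * cis (k * t)) t.
Proof.
have c : ccont (fun t => cis (k * t)) t.
  apply: (@continuous_comp _ _ C (fun t : R => k * t) (cis : R -> C)).
    by apply: rcontM; [exact: rcontK|exact: cvg_id].
  exact: continuous_cis.
by apply: contM c; exact: contK.
Qed.

Lemma continuous_loop_root t : {for t, continuous loop_root}.
Proof.
have cc : {for t, continuous (fun t : R => cos (2 * pi * t))}.
  apply: (@continuous_comp _ _ _ (fun t : R => 2 * pi * t) cos); last exact: continuous_cos.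
  by apply: rcontM; [exact: rcontK|exact: cvg_id].
have cs : {for t, continuous (fun t : R => sin (2 * pi * t))}.
  apply: (@continuous_comp _ _ _ (fun t : R => 2 * pi * t) sin); last exact: continuous_sin.
  by apply: rcontM; [exact: rcontK|exact: cvg_id].
apply: cont_pair; last by apply: rcontM cs; exact: rcontK.
apply: cont_pair; last exact: rcontK.
apply: rcontN; apply: rcontD; first exact: rcontK.
by apply: rcontM cc; exact: rcontK.
Qed.

Lemma continuous_loop_sqrt t : {for t, continuous loop_sqrt}.
Proof.
apply: cont_pair; last exact: rcontK.
apply: cont_pair.
  apply: (@continuous_comp _ _ _ (fun t : R => 2 * pi * t) cos); last exact: continuous_cos.
  by apply: rcontM; [exact: rcontK|exact: cvg_id].
apply: (@continuous_comp _ _ _ (fun t : R => 2 * pi * t) sin); last exact: continuous_sin.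
by apply: rcontM; [exact: rcontK|exact: cvg_id].
Qed.

Lemma loop_root1 : loop_root 1 = loop_root 0 :> T3.
Proof. by rewrite /loop_root mulr1 mulr0 (mulr_natl pi 2) cos2pi sin2pi cos0 sin0. Qed.

Lemma loop_sqrt1 : loop_sqrt 1 = loop_sqrt 0 :> T3.
Proof. by rewrite /loop_sqrt mulr1 mulr0 (mulr_natl pi 2) cos2pi sin2pi cos0 sin0. Qed.

(** By uniqueness of roots along a path [f 1] is [f 0] times [cis k], so closing up forces
    [cis k = 1]. *)
Lemma no_periodic_root n (k : R) (f : R -> R[i]) (z : R[i]) : z != 0 ->
  (forall t, ccont f t) -> (forall t, f t ^+ n.+1 = z * cis (n.+1%:R * k * t)) ->
  f 1 = f 0 -> exists m : int, k = m%:~R.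
Proof.
move=> z0 cf fE f1.
have f00 : f 0 != 0.
  have := fE 0; rewrite mulr0 cis0 mulr1 => e; apply: contraNneq z0 => e'.
  by rewrite -e e' expr0n.
have h t : f t ^+ n.+1 = (f 0 * cis (k * t)) ^+ n.+1.
  rewrite exprMn !fE mulr0 cis0 mulr1 -cisMn; congr (_ * cis _).
  by rewrite -mulrA mulr_natl.
have e := @root_path_eq R n f (fun t => f 0 * cis (k * t)) cf (@cont_cis_lin k (f 0)) h.
have {e} : f 1 = f 0 * cis (k * 1).
  apply: e => [t|]; first by rewrite mulf_neq0// cis_neq0.
  by rewrite mulr0 cis0 mulr1.
rewrite f1 mulr1 -[X in X = _]mulr1 => /(mulfI f00)/esym; exact: cis_eq1.
Qed.

Lemma wild_ghat0 : wild (@ghat R) 0.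
Proof.
have g0 : ghat 0 = (0, 0, 0) :> T3 by rewrite ghat_line//; right.
rewrite /wild g0.
exists [set a : T3 | [/\ `|a.1.1| < 1, `|a.1.2| < 1 & `|a.2| < 1]].
  split; last by rewrite /= normr0; split.
  rewrite openE => a [h1 h2 h3]; rewrite /interior.
  have n1 := near_lt (@rcont_abs R _ a (fun a : T3 => a.1.1) (@continuous_x R a)) h1.
  have n2 := near_lt (@rcont_abs R _ a (fun a : T3 => a.1.2) (@continuous_y R a)) h2.
  have n3 := near_lt (@rcont_abs R _ a (fun a : T3 => a.2) (@continuous_z R a)) h3.
  by apply: filterS3 n1 n2 n3 => q *; split.
exists (fun a => mA (uncap a)), (fun a => mB (uncap a)); split.
  move=> a [h1 h2 h3] na.
  have r1 : rad a < 1.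
    by rewrite /rad !gt_max h1 h3 !andbT; move: h2; rewrite ltr_norml => /andP[? ?]; lra.
  have r0 : 0 < rad a.
    rewrite ltNge; apply/negP; rewrite /rad !ge_max !normr_le0 => /andP[h4 /andP[/eqP h5 /eqP h6]].
    apply: na; exists a.1.2; first by rewrite /= in_itv/=; move: h2; rewrite ltr_norml => /andP[? ?]; apply/andP; split; lra.
    rewrite ghat_line; last by right; lra.
    by case: a h5 h6 {h1 h2 h3 h4 r1} => [[? ?] ?] /= -> ->.
  have cu := continuous_uncap r0.
  split.
  - exact: (@continuous_comp _ _ C uncap (mA : T3 -> C) a cu (@ccont_mA R _)).
  - exact: (@continuous_comp _ _ C uncap (mB : T3 -> C) a cu (@ccont_mB R _)).
  - apply/eqP => /knotP kn; apply: na; apply/(@ghat_arc_iff 0 a) => //.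
      by apply/andP; split; lra.
    by rewrite r0 r1.
move=> V oV V0 VU; have [c hc] := small_caps oV V0.
split=> -[r hr].
- have hl t := hc _ (good_loop_root t).
  have cl t : ccont (fun t => r (c (loop_root t))) t.
    have [v1 v2 v3 v4] := hl t; have [cr _] := hr _ v1 v2.
    apply: (@continuous_comp _ _ C (fun t => c (loop_root t)) (r : T3 -> C)) => //.
    by apply: continuous_comp v4; exact: continuous_loop_root.
  (* On the copy of the meridian the cubic reads [r ^+ 3 = - (36 / 5) cis t], so a continuous root
     would turn by a third. *)
  have [m] : exists m : int, 3^-1 = m%:~R :> R.
    apply: (@no_periodic_root 2 3^-1 (fun t => r (c (loop_root t))) (- (36 / 5)%:C%C)) => //.
    - by rewrite oppr_eq0; apply: complex_neq0; rewrite divr_gt0.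
    - move=> t; have [v1 v2 v3 v4] := hl t; have [_] := hr _ v1 v2.
      rewrite v3; have [-> ->] := loop_rootE t; rewrite /cubic mulr0 mul0r subr0 => /eqP.
      rewrite addr_eq0 => /eqP ->; rewrite mulNr mulrA mulfV ?mul1r ?pnatr_eq0//; congr (- (_ * _)).
      have -> : (2 : R[i]) = (2 : R)%:C%C by rewrite rmorph_nat.
      by rewrite -rmorphM/=; congr (_%:C%C); field.
    - by rewrite loop_root1.
  move=> h; have : (m * 3)%:~R = 1 :> R by rewrite intrM -h mulVf// pnatr_eq0.
  by rewrite -[1]/((1%Z)%:~R) => /eqP; rewrite eqr_int => /eqP; lia.
- have hl t := hc _ (good_loop_sqrt t).
  have cl t : ccont (fun t => r (c (loop_sqrt t))) t.
    have [v1 v2 v3 v4] := hl t; have [cr _] := hr _ v1 v2.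
    apply: (@continuous_comp _ _ C (fun t => c (loop_sqrt t)) (r : T3 -> C)) => //.
    by apply: continuous_comp v4; exact: continuous_loop_sqrt.
  (* On the copy of the core circle a square root of [3 cis (3 t)] would turn by [3 / 2]. *)
  have [m] : exists m : int, 3 / 2 = m%:~R :> R.
    apply: (@no_periodic_root 1 (3 / 2) (fun t => r (c (loop_sqrt t))) 3) => //.
    - by rewrite pnatr_eq0.
    - move=> t; have [v1 v2 v3 v4] := hl t; have [_ ->] := hr _ v1 v2.
      rewrite v3; have [-> ->] := loop_sqrtE t; rewrite expr0n/= subr0 -cisMn; congr (_ * cis _).
      by rewrite -mulr_natl; field.
    - by rewrite loop_sqrt1.
  move=> h; have : (m * 2)%:~R = 3 :> R by rewrite intrM -h divfK// pnatr_eq0.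
  by rewrite -[3]/((3%Z)%:~R) => /eqP; rewrite eqr_int => /eqP; lia.
Qed.

End capsule_germs.

(** * The other points of the arc *)

Section tame.
Context {R : realType}.
Local Notation C := (R[i]^o : topologicalType).
Local Notation T3 := (R * R * R)%type.
Local Notation pi := (@pi R).
Implicit Types (p a b : T3) (s t w W x u : R) (j : int).

Lemma increasing_inverse (f : R -> R) (a b : R) : a <= b -> continuous f ->
  (forall x y, a <= x -> x < y -> y <= b -> f x < f y) ->
  exists2 g : R -> R, continuous g & (forall x, a <= x <= b -> g (f x) = x) /\
    forall y, f a <= y <= f b -> a <= g y <= b /\ f (g y) = y.
Proof.
move=> ab cf fm; have cf' : {within `[a, b], continuous f} by exact: continuous_subspaceT.
pose g0 y := xget a [set x | a <= x <= b /\ f x = y].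
have fab : f a <= f b by move: ab; rewrite le_eqVlt => /orP[/eqP ->//|h]; exact/ltW/fm.
have g0K x : a <= x <= b -> g0 (f x) = x.
  move=> xab; have [/andP[g1 g2] e] : [set y | a <= y <= b /\ f y = f x] (g0 (f x)).
    by apply: xgetPex; exists x.
  have /andP[x1 x2] := xab.
  have [h|h|//] := ltgtP (g0 (f x)) x.
    by have := fm _ _ g1 h x2; rewrite e ltxx.
  by have := fm _ _ x1 h g2; rewrite e ltxx.
have cg : {within `[f a, f b], continuous g0}.
  by apply: (segment_can_le_continuous ab cf') => x; rewrite in_itv/=; exact: g0K.
exists (fun y => g0 (clamp (f a) (f b) y)); first exact: continuous_clamp.
split=> [x xab|y yab].
  rewrite clamp_id ?g0K//; have /andP[x1 x2] := xab; apply/andP; split.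
    by move: x1; rewrite le_eqVlt => /orP[/eqP ->//|h]; apply: ltW; exact: fm.
  by move: x2; rewrite le_eqVlt => /orP[/eqP ->//|h]; apply: ltW; exact: fm.
rewrite clamp_id//; have [c cab <-] : exists2 c, c \in `[a, b] & f c = y.
  by apply: IVT => //; rewrite min_l// max_r.
by move: cab; rewrite in_itv/= => cab; rewrite g0K.
Qed.

Lemma ghat_line_tame t : t < -1 \/ 0 < t -> ~ wild (@ghat R) t.
Proof.
move=> h; pose f (a : T3) : T3 := (a.1.2, a.1.1, a.2).
have cf : continuous f.
  move=> a; apply: cont_pair; last exact: continuous_z.
  by apply: cont_pair; [exact: continuous_y|exact: continuous_x].
have ff a : f (f a) = a by case: a => [[]].
move=> w; apply: (@line_not_wild R t).
apply: (@wild_map R ghat (fun s => (s, 0, 0)) f f setT setT id id t) => //.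
- exact: arc_ghat.
- exact: arc_line.
- by split=> [|x _|x _]; [by split; exact: openT|split=> //; exact: cf|split=> //; exact: cf].
- by move=> x; exact: cvg_id.
- by move=> x; exact: cvg_id.
case: h => h.
  apply: filterS (lt_nbhsl h) => s s1; rewrite ghat_line//; left; exact: ltW.
by apply: filterS (lt_nbhsr h) => s s1; rewrite ghat_line//; right; exact: ltW.
Qed.

Lemma arc_knotted_uncap t (O : set T3) : -1 < t < 0 -> open O -> O (ghat t) ->
  (forall a, O a -> 0 < rad a < 1) -> wild ghat t ->
  knotted_germ R (fun a => knot (uncap a)) (ghat t).
Proof.
move=> /andP[t1 t0] oO Ot Or; apply: knotted_germ_eq oO Ot _ => a Oa.
by apply: ghat_arc_iff; [apply/andP; split; lra|exact: Or].
Qed.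

Definition rad_chart a : Prop := `|a.1.1| < - a.1.2 /\ `|a.2| < - a.1.2.

Lemma rad_chartE a : rad_chart a -> rad a = - a.1.2 /\ 0 < rad a.
Proof.
move=> [h1 h3]; have rE : rad a = - a.1.2.
  by rewrite /rad max_l// ge_max !ltW.
by split=> //; rewrite rE; apply: le_lt_trans (normr_ge0 _) h1.
Qed.

Lemma near_rad_chart a : rad_chart a -> \forall b \near a, rad_chart b.
Proof.
move=> [h1 h3].
have cy := rcontN (@continuous_y R a).
have c1 := rcontB cy (@rcont_abs R _ a (fun a : T3 => a.1.1) (@continuous_x R a)).
have c3 := rcontB cy (@rcont_abs R _ a (fun a : T3 => a.2) (@continuous_z R a)).
have h1' : 0 < - a.1.2 - `|a.1.1| by lra.
have h3' : 0 < - a.1.2 - `|a.2| by lra.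
by apply: filterS2 (near_gt c1 h1') (near_gt c3 h3') => b ? ?; split; lra.
Qed.

Lemma ghat_chart t : -1 < t < 0 -> let W := unfold (- t^-1) in
  [/\ 1 < W, rad_chart (ghat t), rad (ghat t) = W^-1,
    uncap (ghat t) = strand (spar (- t^-1)) &
    (strand 9).1.2 - 8 * (ghat t).1.1 / rad (ghat t) = lam (strand (spar (- t^-1)))].
Proof.
move=> /andP[t1 t0] W.
have [w1 gE] := ghat_cap (ltac:(by apply/andP; split; lra) : -1 <= t < 0).
have W1 : 1 < W by apply: unfold_gt1; rewrite -invrN -[ltLHS]invr1 ltf_pV2 ?posrE; lra.
have W0 : 0 < W by lra.
have [b1 b2] := strand_knot_bounds (- t^-1).
have [c1 c2 c3 c4] := cap_bounds W0 b1 b2.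
have i0 : 0 < W^-1 by rewrite invr_gt0.
have l0 := lam_strand_gt0 (norm_spar_le (- t^-1)).
rewrite gE -/W; split=> //.
- have e : - (cap W (strand (spar (- t^-1)))).1.2 = W^-1 by rewrite /= opprK.
  by rewrite /rad_chart e; move: c1 c2; rewrite c4; split; lra.
- by apply: uncap_cap => //; exact: cos_unfold.
have e q : (cap W q).1.1 = ((strand 9).1.2 - lam q) / (8 * W) by [].
rewrite c3 invrK e; move: (lam _) => l.
by field; rewrite gt_eqF.
Qed.

Section smooth_point.
Variables (e : R) (J : R).
Hypotheses (e1 : e = 1 \/ e = -1) (J1 : 1 <= 2 * J + e * 0 /\ 1 <= 2 * J + e * 1).
Hypothesis perJ : forall v, cos (pi * (2 * J + v)) = cos (pi * v).

Let O : set T3 := [set a | [/\ rad_chart a, 0 < (strand 9).1.2 - 8 * a.1.1 / rad a &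
  0 < e * ((rad a)^-1 - 2 * J) < 1]].
Let O' : set T3 := [set p | [/\ 0 < lam p, `|theta p| < 1,
  `|(strand 9).1.2 - lam p| < 8 & `|p.2 - (strand 9).2| < 2]].
Let g p : T3 := cap (2 * J + e * ang (theta p)) p.

Let ang_in x : `|x| < 1 -> 0 < ang x < 1.
Proof.
move=> x1; have /andP[a0 a1] := ang_bounds x.
have c := @cos_ang R x (ltac:(by rewrite -ler_norml ltW)).
apply/andP; split; rewrite lt_neqAle ?a0 ?a1 andbT.
  apply: contraTneq x1 => h; move: c; rewrite -h mulr0 cos0 => c.
  by rewrite -normrN -c normr1 ltxx.
apply: contraTneq x1 => h; move: c; rewrite h mulr1 cospi => /oppr_inj <-.
by rewrite normr1 ltxx.
Qed.

Let W0 u : 0 < u < 1 -> 0 < 2 * J + e * u.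
Proof. by move=> /andP[u0 u1]; have [h1 h2] := J1; case: e1 => E; rewrite E in h1 h2 *; lra. Qed.

Let e2 : e * e = 1. Proof. by case: e1 => ->; lra. Qed.

Let cosJ u : cos (pi * (2 * J + e * u)) = cos (pi * u).
Proof. by rewrite perJ; case: e1 => ->; rewrite ?mul1r// mulN1r mulrN cosN. Qed.

Let chart : local_homeo uncap g O O'.
Proof.
have hO a : O a -> [/\ 0 < rad a, rad a = - a.1.2,
    theta (uncap a) = - cos (pi * (e * ((rad a)^-1 - 2 * J))) &
    lam (uncap a) = (strand 9).1.2 - 8 * a.1.1 / rad a].
  move=> [rc l0 u01]; have [rE r0] := rad_chartE rc; have [lE thE _ _] := uncap_spec r0 l0.
  split=> //; rewrite -[X in _ = - X]cosJ thE; congr (- cos (pi * _)).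
  by rewrite mulrA e2; ring.
have hO' p : O' p -> [/\ 0 < ang (theta p) < 1, 0 < 2 * J + e * ang (theta p),
    rad (g p) = (2 * J + e * ang (theta p))^-1 & rad_chart (g p)].
  move=> [l0 th h1 h2]; have a01 := ang_in th; have w0 := W0 a01.
  have [rE _ _] := rad_cap w0 (ltW h1) (ltW h2); split=> //.
  have i0 : 0 < (2 * J + e * ang (theta p))^-1 by rewrite invr_gt0.
  rewrite /rad_chart /g; set W := 2 * J + _ in w0 i0 *.
  have -> : (cap W p).1.1 = ((strand 9).1.2 - lam p) / (8 * W) by [].
  have -> : (cap W p).2 = (p.2 - (strand 9).2) / (2 * W) by [].
  have -> : - (cap W p).1.2 = W^-1 by rewrite /= opprK.
  rewrite !invfM !mulrA !normrM [`|W^-1|]gtr0_norm//.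
  rewrite !gtr_pMl// [`|8^-1|]gtr0_norm ?invr_gt0// [`|2^-1|]gtr0_norm ?invr_gt0//.
  by split; lra.
split.
- split; rewrite openE => a; rewrite /interior.
    move=> Oa; have [r0 _ _ _] := hO _ Oa; case: Oa => rc l0 /andP[u0 u1].
    have cu : {for a, continuous (fun a => e * ((rad a)^-1 - 2 * J))}.
      apply: rcontM; first exact: rcontK.
      by apply: rcontB; [exact: continuous_radV|exact: rcontK].
    have n2 := near_gt (cont_height r0) l0.
    have n3 := near_gt cu u0; have n4 := near_lt cu u1.
    have n5 : \forall b \near a, 0 < e * ((rad b)^-1 - 2 * J) < 1.
      by apply: filterS2 n3 n4 => b -> ->.
    by apply: filterS3 (near_rad_chart rc) n2 n5 => b ? ? ?; split.
  move=> [l0 th h1 h2]; have cl := @continuous_lam R a.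
  have ct : {for a, continuous theta} by apply: continuous_theta; rewrite gt_eqF.
  have cy : {for a, continuous (fun p => (strand 9).1.2 - lam p)}.
    by apply: rcontB cl; exact: rcontK.
  have cz : {for a, continuous (fun p : T3 => p.2 - (strand 9).2)}.
    by apply: rcontB; [exact: continuous_z|exact: rcontK].
  have n1 : \forall b \near a, 0 < lam b /\ `|theta b| < 1.
    by apply: filterS2 (near_gt cl l0) (near_lt (rcont_abs ct) th) => b ? ?; split.
  have n2 := near_lt (rcont_abs cy) h1; have n3 := near_lt (rcont_abs cz) h2.
  by apply: filterS3 n1 n2 n3 => b [? ?] ? ?; split.
- move=> a Oa; have [r0 rE thE lE] := hO _ Oa; have [rc l0 u01] := Oa.
  have [_ _ zE aE] := uncap_spec r0 l0; have [rc1 rc3] := rc; rewrite -rE in rc1 rc3.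
  have i0 : 0 < (rad a)^-1 by rewrite invr_gt0.
  have aK : ang (theta (uncap a)) = e * ((rad a)^-1 - 2 * J).
    by rewrite thE angK//; case/andP: u01 => ? ?; apply/andP; split; lra.
  split; last exact: continuous_uncap.
  + split; first by rewrite lE.
    * rewrite thE normrN; case/andP: u01; set u := e * _ => u0 u1.
      have p0 : 0 < pi * u by rewrite mulr_gt0 ?pi_gt0.
      have p1 : pi * u < pi by rewrite -[ltRHS]mulr1 ltr_pM2l ?pi_gt0.
      have s0 : 0 < sin (pi * u) by apply: sin_gt0_pi; rewrite p0 p1.
      rewrite -(ltr_pXn2r (n := 2)) ?nnegrE// real_normK ?num_real// expr1n.
      have := cos2Dsin2 (pi * u); have : 0 < sin (pi * u) ^+ 2 by rewrite exprn_gt0.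
      lra.
    * rewrite lE opprB addrC subrK normrM [`|_^-1|]gtr0_norm// normrM normr_nat.
      by rewrite ltr_pdivrMr//; lra.
    * rewrite zE [_ + _ - _]addrAC subrr add0r normrM [`|_^-1|]gtr0_norm// normrM normr_nat.
      by rewrite ltr_pdivrMr//; lra.
  + rewrite /g aK mulrA e2 mul1r addrC subrK.
    by rewrite -aE.
- move=> p O'p; have [a01 w0 rE rc] := hO' _ O'p; have [l0 th h1 h2] := O'p.
  have thE : theta p = - cos (pi * (2 * J + e * ang (theta p))).
    by rewrite cosJ cos_ang ?opprK// -ler_norml ltW.
  have lE : (strand 9).1.2 - 8 * (g p).1.1 / rad (g p) = lam p.
    rewrite rE invrK /g; set W := 2 * J + _ in w0 *.
    have -> : (cap W p).1.1 = ((strand 9).1.2 - lam p) / (8 * W) by [].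
    by field; rewrite gt_eqF.
  split.
  + split=> //; first by rewrite lE.
    by rewrite rE invrK addrC addKr mulrA e2 mul1r.
  + by apply: uncap_cap => //; rewrite -/(g p).
  + have cl := @continuous_lam R p.
    have cW : {for p, continuous (fun p => 2 * J + e * ang (theta p))}.
      apply: rcontD; first exact: rcontK; apply: rcontM; first exact: rcontK.
      apply: (@continuous_comp _ _ _ theta ang); last exact: continuous_ang.
      by apply: continuous_theta; rewrite gt_eqF.
    have ci (k : R) : k != 0 -> {for p, continuous (fun p => (k * (2 * J + e * ang (theta p)))^-1)}.
      move=> k0; apply: rcontV; first by apply: rcontM cW; exact: rcontK.
      by rewrite mulf_neq0// gt_eqF.
    apply: cont_pair; first apply: cont_pair.
    * by apply: rcontM; [apply: rcontB cl; exact: rcontK|apply: ci; rewrite pnatr_eq0].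
    * by apply: rcontN; apply: rcontV cW _; rewrite gt_eqF.
    * by apply: rcontM; [apply: rcontB; [exact: continuous_z|exact: rcontK]|apply: ci; rewrite pnatr_eq0].
Qed.

(** Between two integral shells the page number is strictly monotone in the depth, so [uncap] is
    itself a chart: it takes the arc to the knot near a point of the strand, and the knot is nowhere
    knotted. The sign [e] tells a forward sweep from a backward one. *)
Lemma smooth_point_tame t : -1 < t < 0 ->
  0 < e * (unfold (- t^-1) - 2 * J) < 1 -> ~ wild ghat t.
Proof.
move=> tb u01 w; have [W1 rc rE uE lE] := ghat_chart tb.
have [[oO oO'] _ _] := chart.
have Ot : O (ghat t).
  by split=> //; [rewrite lE lam_strand_gt0// norm_spar_le|rewrite rE invrK].
have Or a : O a -> 0 < rad a < 1.
  move=> [rca _ /andP[u0 u1]]; have [_ r0] := rad_chartE rca; rewrite r0/=.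
  suff : 1 < (rad a)^-1 by rewrite -[ltLHS]invr1 ltf_pV2 ?posrE.
  by have [h1 h2] := J1; case: e1 => E; rewrite E in h1 h2 u0 u1; lra.
have kg := arc_knotted_uncap tb oO Ot Or w.
have aa a : O a -> (knot (uncap a) <-> knot (uncap a)) by [].
have := @knotted_germ_local R T3 T3 uncap g O O' _ knot _ chart Ot aa kg.
by rewrite uE; exact: (knot_not_knotted (cabs_su _)).
Qed.

End smooth_point.

Lemma Re_su3 : Re (su 3) = 4 / 5 :> R. Proof. by rewrite Re_su; field. Qed.

Lemma strand3_lt1 : (strand 3).1.1 < 1 :> R.
Proof. by rewrite strand_x Re_su3 /xC; lra. Qed.

Lemma strand_x_le1 s : `|s| <= 3 -> (strand s).1.1 <= 1.
Proof.
move=> s3; rewrite strand_x; have [h|h] := leP (Re (su s)) (3 / 4).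
  by apply: xC_le1; rewrite h andbT; case/andP: (Re_su_bound s).
have [e|ne] := eqVneq (Re (su s)) (4 / 5); first by rewrite e -Re_su3 -strand_x ltW// strand3_lt1.
apply: ltW; apply: lt_trans strand3_lt1; rewrite strand_x; apply: xC_mono; first exact: ltW.
rewrite Re_su3 lt_neqAle ne andTb Re_su ler_pdivrMr ?s21_gt0//.
have : s ^+ 2 <= 9 by rewrite -(real_normK (num_real s)); have := normr_ge0 s; nra.
lra.
Qed.

Lemma strand_y_gt0 s : 3 <= s -> 0 < (strand s).1.2.
Proof.
move=> s3; have := @Re_unit_cube R (su s) (cabs_su s); rewrite ler_norml => /andP[r0 _].
rewrite /strand /knot_pt; set r := 1 + _; have r0' : 0 < r by rewrite /r; lra.
rewrite /su sqrcE realcM /= mulr_gt0//.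
have i0 : 0 < (s ^+ 2 + 1)^-1 by rewrite invr_gt0 s21_gt0.
have h : 0 < s ^+ 2 - 1 by nra.
by rewrite !mulr_gt0//; lra.
Qed.

Lemma norm_y p : 0 < lam p -> `|p.1.2| = `|theta p| * lam p.
Proof.
by move=> l0; rewrite /theta normrM normfV (gtr0_norm l0) divfK// gt_eqF.
Qed.

Section fold_point.
Variables (k sg : R) (Sx : R -> R).
Hypotheses (s1 : sg = 1 \/ sg = -1) (k2 : 2 <= k).
Hypothesis perk : forall u, - cos (pi * (k + u)) = sg * cos (pi * u).
Hypothesis cSx : continuous Sx.
Hypothesis SxK : forall s, 3 <= s <= 9 -> Sx (strand s).1.1 = s.
Hypothesis SxI : forall x, (strand 3).1.1 <= x <= cut ->
  3 <= Sx x <= 9 /\ (strand (Sx x)).1.1 = x.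

(** At an integral shell [k] the sweep turns round, and [uncap] folds two sides onto one. The strand
    is then near an end, where its first coordinate is strictly monotone on [3 <= |s| <= 9]; [Q x]
    is its point with first coordinate [x], at the end selected by [sg]. *)
Let Q x : T3 := strand (sg * Sx x).
Let hl a : R := (strand 9).1.2 - 8 * a.1.1 / rad a.
Let hz a : R := (strand 9).2 + 2 * a.2 / rad a.
Let hu a : R := (rad a)^-1 - k.
(** Up to sign this is [cut - x] at the point [uncap a]; the sign tells the two sides of the fold
    apart. With it as first coordinate, [f] becomes injective across the fold. *)
Let hx a : R := Num.sg (hu a) * (hl a * (1 - cos (pi * hu a))).
Let f a : T3 := (hx a, hl a - lam (Q (cut - `|hx a|)), hz a - (Q (cut - `|hx a|)).2).
Let gl b : R := b.1.2 + lam (Q (cut - `|b.1.1|)).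
Let gz b : R := b.2 + (Q (cut - `|b.1.1|)).2.
(** Recovers the signed distance [hu] from the shell [k] by solving
    [|x| = l (1 - cos (pi * hu))]. *)
Let gu b : R := Num.sg b.1.1 * ang (`|b.1.1| / gl b - 1).
Let g b : T3 :=
  (((strand 9).1.2 - gl b) / (8 * (k + gu b)), - (k + gu b)^-1, (gz b - (strand 9).2) / (2 * (k + gu b))).
(** The last condition means that [uncap a] has first coordinate above 1, which excludes the middle
    part [|s| <= 3] of the strand. *)
Let O : set T3 := [set a | [/\ rad_chart a, 0 < hl a, `|hu a| < 1 / 2 &
  hl a * (1 - cos (pi * hu a)) < cut - 1]].
Let O' : set T3 := [set b | [/\ `|b.1.1| < cut - 1, `|b.1.1| < gl b,
  `|(strand 9).1.2 - gl b| < 8 & `|gz b - (strand 9).2| < 2]].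

Let lamQ s : lam (strand (sg * s)) = lam (strand s).
Proof. by case: s1 => ->; rewrite ?mul1r// mulN1r strandN /lam /= normrN. Qed.

Let thetaQ s : theta (strand (sg * s)) = sg * theta (strand s).
Proof.
by rewrite /theta lamQ; case: s1 => ->; rewrite ?mul1r// !mulN1r strandN /= mulNr.
Qed.

Let cos_pos u : `|u| < 1 / 2 -> 0 < cos (pi * u).
Proof.
rewrite ltr_norml => /andP[u1 u2]; apply: cos_gt0_pihalf; have p0 := pi_gt0 R.
by apply/andP; split; nra.
Qed.

Let cos_norm u : cos (pi * `|u|) = cos (pi * u).
Proof. by have [h|h] := leP 0 u; [rewrite ger0_norm|rewrite ltr0_norm// mulrN cosN]. Qed.

Let cos_lt1 u : `|u| < 1 / 2 -> u != 0 -> cos (pi * u) < 1.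
Proof.
move=> u1 u0; rewrite lt_neqAle cos_le1 andbT; apply: contraNneq u0 => e.
have := @angK R `|u| (ltac:(by rewrite normr_ge0; lra)); rewrite cos_norm e angN1.
by move=> /esym/eqP; rewrite normr_eq0.
Qed.

Let norm_hx a : 0 < hl a -> `|hx a| = hl a * (1 - cos (pi * hu a)).
Proof.
move=> l0; rewrite /hx normrM normr_sg; have [e|ne] := eqVneq (hu a) 0.
  by rewrite e mulr0 cos0 subrr mulr0 normr0 mulr0.
rewrite mul1r ger0_norm//; apply: mulr_ge0; first exact: ltW.
by rewrite subr_ge0 cos_le1.
Qed.

Let on_strand a : O a -> knot (uncap a) <-> axis (f a).
Proof.
move=> [rc l0 u1 x1]; have [rE r0] := rad_chartE rc.
have [lE thE zE _] := uncap_spec r0 l0; have nx := norm_hx l0.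
have {}lE : lam (uncap a) = hl a := lE; have {}zE : (uncap a).2 = hz a := zE.
have thE' : theta (uncap a) = sg * cos (pi * hu a).
  by rewrite thE -perk; congr (- cos (pi * _)); rewrite /hu; ring.
have c0 := cos_pos u1; have c1 := cos_le1 (pi * hu a).
have nth : `|theta (uncap a)| = cos (pi * hu a).
  by rewrite thE' normrM (gtr0_norm c0); case: s1 => ->; rewrite ?normrN normr1 mul1r.
have ny : `|(uncap a).1.2| = cos (pi * hu a) * hl a.
  by rewrite -nth -lE norm_y// lE.
have xE : (uncap a).1.1 = cut - `|hx a| by rewrite coord_lam lE ny nx; rewrite -/(hl a); ring.
have xb : 1 < (uncap a).1.1 <= cut by rewrite xE nx; apply/andP; split; [lra|rewrite -nx; have := normr_ge0 (hx a); lra].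
have /andP[xb1 xb2] := xb; have s31 := strand3_lt1.
split=> [kn|[/eqP e2 /eqP e3]].
  have [s s9 sE] := knot_cut kn xb2.
  have s3 : 3 < `|s|.
    by rewrite ltNge; apply/negP => h; have := strand_x_le1 h; rewrite -sE; lra.
  have sE' : s = sg * `|s|.
    have [h|h] := leP 0 s.
      rewrite ger0_norm//; case: s1 => E; rewrite E ?mul1r//; exfalso.
      have : 0 < theta (uncap a).
        rewrite sE; rewrite ger0_norm// in s3 s9; rewrite /theta divr_gt0 ?strand_y_gt0 ?ltW//.
        by apply: lam_strand_gt0; rewrite ger0_norm// .
      by rewrite thE' E; lra.
    rewrite ltr0_norm//; case: s1 => E; rewrite E ?mulN1r ?opprK//; exfalso.
    have : theta (strand (- s)) > 0.
      rewrite ltr0_norm// in s3 s9; rewrite /theta divr_gt0 ?strand_y_gt0 ?ltW//.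
      by apply: lam_strand_gt0; rewrite normrN ltr0_norm.
    have -> : theta (strand (- s)) = - theta (strand s).
      by rewrite /theta strandN /lam /= normrN mulNr.
    by rewrite -sE thE' E; lra.
  have SE : Sx (cut - `|hx a|) = `|s|.
    have sE2 : uncap a = strand (sg * `|s|) by rewrite sE -sE'.
    rewrite -xE sE2; have -> : (strand (sg * `|s|)).1.1 = (strand `|s|).1.1.
      by case: s1 => ->; rewrite ?mul1r// mulN1r strandN.
    by rewrite SxK// s9 ltW.
  split; first by rewrite -[(f a).1.2]/(hl a - lam (Q (cut - `|hx a|))) /Q SE -sE' -sE lE subrr.
  by rewrite -[(f a).2]/(hz a - (Q (cut - `|hx a|)).2) /Q SE -sE' -sE zE subrr.
have [/andP[S3 S9] SE] := SxI (ltac:(by rewrite -xE; apply/andP; split; lra) :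
  (strand 3).1.1 <= cut - `|hx a| <= cut).
suff -> : uncap a = Q (cut - `|hx a|) by exact: strand_knot.
have lQ : lam (uncap a) = lam (Q (cut - `|hx a|)).
  by rewrite lE; apply/eqP; rewrite -subr_eq0.
apply: coords_eq => //; first by rewrite lE gt_eqF.
  have y0 := strand_y_gt0 S3.
  have ls : lam (strand (Sx (cut - `|hx a|))) = hl a by rewrite -lE lQ /Q lamQ.
  rewrite thE' /Q thetaQ; congr (_ * _); rewrite /theta ls.
  have : `|(strand (Sx (cut - `|hx a|))).1.2| = cos (pi * hu a) * hl a.
    by have := coord_lam (strand (Sx (cut - `|hx a|))); rewrite SE ls nx; lra.
  by rewrite gtr0_norm// => ->; rewrite mulfK// gt_eqF.
by rewrite zE; apply/eqP; rewrite -subr_eq0.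
Qed.

Let continuous_Q x : {for x, continuous Q}.
Proof.
apply: (@continuous_comp _ _ _ (fun x => sg * Sx x) strand); last exact: continuous_strand.
by apply: rcontM; [exact: rcontK|exact: cSx].
Qed.

Let cont_Q (h : T3 -> R) a : {for a, continuous h} ->
  {for a, continuous (fun a => lam (Q (cut - `|h a|)))} /\
  {for a, continuous (fun a => (Q (cut - `|h a|)).2)}.
Proof.
move=> ch; have cQ : {for a, continuous (fun a => Q (cut - `|h a|))}.
  apply: (@continuous_comp _ _ _ (fun a => cut - `|h a|) Q); last exact: continuous_Q.
  by apply: rcontB; [exact: rcontK|exact: rcont_abs].
split.
  by apply: (@continuous_comp _ _ _ (fun a => Q (cut - `|h a|)) lam); [exact: cQ|exact: continuous_lam].
by apply: (@continuous_comp _ _ _ (fun a => Q (cut - `|h a|)) (fun p : T3 => p.2)); [exact: cQ|exact: continuous_z].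
Qed.

Let cont_hu a : 0 < rad a -> {for a, continuous hu}.
Proof. by move=> r0; apply: rcontB; [exact: continuous_radV|exact: rcontK]. Qed.

Let cont_hlc a : 0 < rad a -> {for a, continuous (fun a => hl a * (1 - cos (pi * hu a)))}.
Proof.
move=> r0; apply: rcontM; first exact: cont_height.
apply: rcontB; first exact: rcontK.
apply: (@continuous_comp _ _ _ hu (fun u => cos (pi * u))); first exact: cont_hu.
exact: continuous_cospi.
Qed.

Let cont_f a : 0 < rad a -> {for a, continuous f}.
Proof.
move=> r0; have cx : {for a, continuous hx}.
  apply: cont_sgr; [exact: cont_hu|exact: cont_hlc|].
  by move=> ->; rewrite mulr0 cos0 subrr mulr0.
have [c1 c2] := cont_Q cx.
apply: cont_pair; first apply: cont_pair => //.
  by apply: rcontB c1; exact: cont_height.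
by apply: rcontB c2; exact: cont_level.
Qed.

Let cont_gl b : {for b, continuous gl} /\ {for b, continuous gz}.
Proof.
have [c1 c2] := @cont_Q (fun b => b.1.1) b (@continuous_x R b).
by split; [apply: rcontD c1; exact: continuous_y|apply: rcontD c2; exact: continuous_z].
Qed.

Let gu_spec b : O' b -> [/\ `|gu b| < 1 / 2, cos (pi * gu b) = 1 - `|b.1.1| / gl b &
  Num.sg (gu b) * `|b.1.1| = b.1.1].
Proof.
move=> [x1 xl _ _]; have l0 : 0 < gl b by apply: le_lt_trans xl.
have q01 : 0 <= `|b.1.1| / gl b < 1.
  by rewrite divr_ge0 ?normr_ge0 ?(ltW l0)// ltr_pdivrMr// mul1r.
have /andP[q0 q1] := q01.
have cE := @cos_ang R (`|b.1.1| / gl b - 1) (ltac:(by apply/andP; split; lra)).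
have /andP[a0 a1] := ang_bounds (`|b.1.1| / gl b - 1).
set al := ang _ in cE a0 a1; have guE : gu b = Num.sg b.1.1 * al by [].
have al2 : al < 1 / 2.
  rewrite ltNge; apply/negP => h; have p0 := pi_gt0 R.
  have : 0 <= sin (pi * al - pi / 2) by apply: sin_ge0_pi; apply/andP; split; nra.
  by rewrite sinBpihalf cE; lra.
have [x0|x0] := eqVneq b.1.1 0.
  rewrite guE x0 sgr0 mul0r mulr0 cos0 normr0 mul0r subr0 mulr0; split=> //; lra.
have al0 : 0 < al.
  rewrite lt_neqAle a0 andbT eq_sym; apply: contraNneq x0 => e.
  move: cE; rewrite e mulr0 cos0 => cE; have : `|b.1.1| / gl b = 0 by lra.
  by move/eqP; rewrite mulf_eq0 invr_eq0 (gt_eqF l0) orbF normr_eq0.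
split.
- by rewrite guE normrM normr_sg x0 [true%:R * _]mul1r ger0_norm.
- rewrite -cos_norm guE normrM normr_sg x0 mul1r ger0_norm// cE; ring.
- by rewrite guE sgrM (gtr0_sg al0) mulr1 sgr_id -numEsg.
Qed.

Let g_spec b : O' b -> [/\ rad_chart (g b), rad (g b) = (k + gu b)^-1, hu (g b) = gu b,
  hl (g b) = gl b & hz (g b) = gz b].
Proof.
move=> Ob; have [u1 _ _] := gu_spec Ob; case: Ob => _ _ h1 h2.
have W0 : 0 < k + gu b.
  by have k3 := k2; move: u1; rewrite ltr_norml => /andP[? ?]; lra.
have i0 : 0 < (k + gu b)^-1 by rewrite invr_gt0.
have g1 : (g b).1.1 = ((strand 9).1.2 - gl b) / (8 * (k + gu b)) by [].
have g2 : - (g b).1.2 = (k + gu b)^-1 by rewrite /= opprK.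
have g3 : (g b).2 = (gz b - (strand 9).2) / (2 * (k + gu b)) by [].
have rc : rad_chart (g b).
  rewrite /rad_chart g1 g2 g3 !invfM !mulrA !normrM [`|(k + _)^-1|]gtr0_norm//.
  rewrite !gtr_pMl// [`|8^-1|]gtr0_norm ?invr_gt0// [`|2^-1|]gtr0_norm ?invr_gt0//.
  by split; lra.
have [rE _] := rad_chartE rc; rewrite g2 in rE.
split=> //.
- by rewrite /hu rE invrK addrC addKr.
- by rewrite /hl rE g1; move: (gl b) => l; field; rewrite gt_eqF.
- by rewrite /hz rE g3; move: (gz b) => z; field; rewrite gt_eqF.
Qed.

Let chart : local_homeo f g O O'.
Proof.
split.
- split; rewrite openE => a; rewrite /interior.
    move=> [rc l0 u1 x1]; have [rE r0] := rad_chartE rc.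
    have n2 : \forall b \near a, `|hu b| < 1 / 2 /\ hl b * (1 - cos (pi * hu b)) < cut - 1.
      by apply: filterS2 (near_lt (rcont_abs (cont_hu r0)) u1) (near_lt (cont_hlc r0) x1).
    by apply: filterS3 (near_rad_chart rc) (near_gt (cont_height r0) l0) n2 => b ? ? []; split.
  move=> [h1 h2 h3 h4]; have [cl cz] := cont_gl a.
  have cx := @rcont_abs R _ a (fun a : T3 => a.1.1) (@continuous_x R a).
  have c3 : {for a, continuous (fun b => `|(strand 9).1.2 - gl b|)}.
    by apply: rcont_abs; apply: rcontB cl; exact: rcontK.
  have c4 : {for a, continuous (fun b => `|gz b - (strand 9).2|)}.
    by apply: rcont_abs; apply: rcontB cz _; exact: rcontK.
  have h2' : 0 < gl a - `|a.1.1| by lra.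
  have n1 : \forall b \near a, `|b.1.1| < cut - 1 /\ `|b.1.1| < gl b.
    by apply: filterS2 (near_lt cx h1) (near_gt (rcontB cl cx) h2') => b; split; lra.
  by apply: filterS3 n1 (near_lt c3 h3) (near_lt c4 h4) => b [? ?] ? ?; split.
- move=> a [rc l0 u1 x1]; have [rE r0] := rad_chartE rc; have [rc1 rc3] := rc.
  rewrite -rE in rc1 rc3; have i0 : 0 < (rad a)^-1 by rewrite invr_gt0.
  have nx := norm_hx l0; have c0 := cos_pos u1.
  have glE : gl (f a) = hl a by rewrite /gl /f /= subrK.
  have gzE : gz (f a) = hz a by rewrite /gz /f /= subrK.
  have guE : gu (f a) = hu a.
    rewrite /gu glE -[(f a).1.1]/(hx a) nx [hl a * _]mulrC mulfK ?gt_eqF//.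
    have -> : 1 - cos (pi * hu a) - 1 = - cos (pi * `|hu a|) by rewrite cos_norm; ring.
    rewrite angK; last by rewrite normr_ge0; lra.
    have [e|ne] := eqVneq (hu a) 0; first by rewrite e normr0 mulr0.
    have p0 : 0 < hl a * (1 - cos (pi * hu a)) by rewrite mulr_gt0// subr_gt0 cos_lt1.
    by rewrite /hx sgrM (gtr0_sg p0) mulr1 sgr_id -numEsg.
  split; last exact: cont_f.
  + split; rewrite ?glE ?gzE -?[(f a).1.1]/(hx a) ?nx//.
    * by rewrite gtr_pMr//; lra.
    * rewrite /hl subKr normrM [`|_^-1|]gtr0_norm// normrM normr_nat.
      by rewrite ltr_pdivrMr//; lra.
    * rewrite /hz [_ + _ - _]addrAC subrr add0r normrM [`|_^-1|]gtr0_norm// normrM normr_nat.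
      by rewrite ltr_pdivrMr//; lra.
  + have kE : k + hu a = (rad a)^-1 by rewrite /hu; ring.
    rewrite /g guE glE gzE kE invrK.
    have -> : ((strand 9).1.2 - hl a) / (8 * (rad a)^-1) = a.1.1.
      by rewrite /hl; field; rewrite gt_eqF.
    have -> : (hz a - (strand 9).2) / (2 * (rad a)^-1) = a.2.
      by rewrite /hz; field; rewrite gt_eqF.
    by rewrite rE opprK; case: (a) => [[? ?] ?].
- move=> b Ob; have [u1 cE sx] := gu_spec Ob; have [rc rE uE lE zE] := g_spec Ob.
  have [x1 xl h3 h4] := Ob; have l0 : 0 < gl b by apply: le_lt_trans xl.
  have ex : gl b * (1 - cos (pi * gu b)) = `|b.1.1|.
    by rewrite cE opprB addrC subrK mulrC divfK// gt_eqF.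
  have hxE : hx (g b) = b.1.1 by rewrite /hx uE lE ex.
  split.
  + by split; rewrite ?uE ?lE// ex.
  + rewrite /f hxE lE zE /gl /gz !addrK; by case: (b) => [[? ?] ?].
  have [cl cz] := cont_gl b.
  have cx := @rcont_abs R _ b (fun a : T3 => a.1.1) (@continuous_x R b).
  have cg : {for b, continuous gu}.
    apply: cont_sgr; first exact: continuous_x.
      apply: (@continuous_comp _ _ _ (fun b => `|b.1.1| / gl b - 1) ang); last exact: continuous_ang.
      apply: rcontB; last exact: rcontK.
      by apply: rcontM cx _; apply: rcontV => //; rewrite gt_eqF.
    by move=> ->; rewrite normr0 mul0r sub0r angN1.
  have W0 : 0 < k + gu b.
  by have k3 := k2; move: u1; rewrite ltr_norml => /andP[? ?]; lra.
  have cW : {for b, continuous (fun b => k + gu b)} by apply: rcontD cg; exact: rcontK.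
  have ci (c : R) : c != 0 -> {for b, continuous (fun b => (c * (k + gu b))^-1)}.
    move=> c0; apply: rcontV; first by apply: rcontM cW; exact: rcontK.
    by rewrite mulf_neq0// gt_eqF.
  apply: cont_pair; first apply: cont_pair.
  + by apply: rcontM; [apply: rcontB cl; exact: rcontK|apply: ci; rewrite pnatr_eq0].
  + by apply: rcontN; apply: rcontV cW _; rewrite gt_eqF.
  + by apply: rcontM; [apply: rcontB cz _; exact: rcontK|apply: ci; rewrite pnatr_eq0].
Qed.

Lemma fold_point_tame t : -1 < t < 0 -> unfold (- t^-1) = k -> ~ wild ghat t.
Proof.
move=> tb uk w; have [W1 rc rE uE lE] := ghat_chart tb; rewrite uk in rE.
have [[oO oO'] _ _] := chart; have [c1 c2] := @cut_bounds R.
have u0 : hu (ghat t) = 0 by rewrite /hu rE invrK subrr.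
have Ot : O (ghat t).
  split=> //; first by rewrite /hl lE lam_strand_gt0// norm_spar_le.
    by rewrite u0 normr0; lra.
  by rewrite u0 mulr0 cos0 subrr mulr0; lra.
have Or a : O a -> 0 < rad a < 1.
  move=> [rca _ u1 _]; have [_ r0] := rad_chartE rca; rewrite r0/=.
  suff : 1 < (rad a)^-1 by rewrite -[ltLHS]invr1 ltf_pV2 ?posrE.
  by have k3 := k2; move: u1; rewrite /hu ltr_norml => /andP[? ?]; lra.
have kg := arc_knotted_uncap tb oO Ot Or w.
have := @knotted_germ_local R T3 T3 f g O O' _ axis _ chart Ot on_strand kg.
have : axis (f (ghat t)) by apply/(on_strand Ot); rewrite uE; exact: strand_knot.
case: (f (ghat t)) => [[x y] z] [/= -> ->]; exact: axis_not_knotted.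
Qed.

End fold_point.

Lemma strand_x_inverse : exists2 Sx : R -> R, continuous Sx &
  (forall s, 3 <= s <= 9 -> Sx (strand s).1.1 = s) /\
  forall x, (strand 3).1.1 <= x <= cut -> 3 <= Sx x <= 9 /\ (strand (Sx x)).1.1 = x.
Proof.
rewrite -(@strand_x9 R 9 (normr_nat _ 9)).
apply: (@increasing_inverse (fun s : R => (strand s).1.1) 3 9); first by lra.
  move=> s; apply: (@continuous_comp _ _ _ strand (fun p : T3 => p.1.1)).
    exact: continuous_strand.
  exact: continuous_x.
by move=> x y x3 xy _; exact: strand_x_mono.
Qed.

Lemma ghat_tame t : t <> 0 -> t <> -1 -> ~ wild (@ghat R) t.
Proof.
move=> t0 t1; have [h|h] := leP 0 t.
  by apply: ghat_line_tame; right; rewrite lt_neqAle h andbT eq_sym; apply/eqP.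
have [h'|h'] := leP t (-1).
  by apply: ghat_line_tame; left; rewrite lt_neqAle h' andbT; apply/eqP.
have tb : -1 < t < 0 by rewrite h h'.
have [W1 _ _ _ _] := ghat_chart tb; have [j [v [WE vb]]] := period_dec (unfold (- t^-1)).
have /andP[v1 v2] := vb.
have [v0|v0|v0] := ltgtP v 0; last 1 first.
- have [Sx cSx [SxK SxI]] := strand_x_inverse.
  apply: (@fold_point_tame (2 * j%:~R) (-1) Sx) => //; first by right.
  - rewrite WE v0 addr0 in W1.
    by have := @int_ge1 R j (ltac:(by lra)); lra.
  - by move=> u; rewrite cos_periodic mulN1r.
  - by rewrite WE v0 addr0.
- have [vN|vN] := eqVneq v (-1).
    have [Sx cSx [SxK SxI]] := strand_x_inverse.
    rewrite vN in WE.
    apply: (@fold_point_tame (2 * j%:~R - 1) 1 Sx) => //; first by left.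
    + rewrite WE in W1.
      have j1 := @int_ge1 R j (ltac:(by lra)).
      have ne : (j%:~R : R) != 1 by apply: contraTneq W1 => ->; lra.
      by have := int_ge2 j1 ne; lra.
    + move=> u; rewrite -addrA cos_periodic mulrDr mulrN1 addrC cosB cospi sinpi mulr0 addr0.
      by rewrite mulrN1 opprK mul1r.
  apply: (@smooth_point_tame (-1) (j%:~R)) => //.
  + by right.
  + have j1 := @int_ge1 R j (ltac:(by lra)).
    by split; lra.
  + by move=> u; exact: cos_periodic.
  + have vN' : -1 < v by rewrite lt_neqAle eq_sym vN.
    by rewrite WE addrC addKr mulN1r; apply/andP; split; lra.
- apply: (@smooth_point_tame 1 (j%:~R)) => //.
  + by left.
  + have j1 := @int_ge1 R j (ltac:(by lra)).
    by split; lra.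
  + by move=> u; exact: cos_periodic.
  + by rewrite WE addrC addKr mul1r; apply/andP.
Qed.

End tame.

(** * Arcs with prescribed knotted points *)

Section insertion.
Context {R : realType}.
Local Notation T3 := (R * R * R)%type.
Local Notation pi := (@pi R).
Variables (m f : nat -> R) (act : nat -> Prop).
Hypothesis f0 : forall i, 0 < f i.
Hypothesis sep : forall i j, i <> j -> f i + f j < `|m i - m j|.
Hypothesis f_cvg : forall e, 0 < e -> exists N, forall i, (N <= i)%N -> f i < e.
Implicit Types (t s : R) (i j : nat).

Definition piece i t : T3 :=
  let a := ghat ((t - m i) / f i) in (f i * a.1.1, m i + f i * a.1.2, f i * a.2).

(** The intervals of the copies are disjoint, so at most one index qualifies and the choice is
    immaterial. *)
Definition strung t : T3 :=
  match pselect (exists i, act i /\ m i - f i < t < m i) with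
  | left h => piece (projT1 (cid h)) t
  | right _ => (0, t, 0)
  end.

Lemma same_interval i j t : m i - f i <= t <= m i + f i ->
  m j - f j <= t <= m j + f j -> i = j.
Proof.
move=> /andP[h1 h2] /andP[h3 h4]; apply: contrapT => /sep.
by apply/negP; rewrite -leNgt ler_norml; apply/andP; split; lra.
Qed.

Lemma piece_line i t : t <= m i - f i \/ m i <= t -> piece i t = (0, t, 0).
Proof.
move=> h; have fi := f0 i; rewrite /piece ghat_line.
  by rewrite /= mulr0 [f i * _]mulrC divfK ?gt_eqF// addrC subrK.
case: h => h; first by left; rewrite ler_pdivrMr//; lra.
by right; rewrite ler_pdivlMr//; lra.
Qed.

Lemma strung_in i t : act i -> m i - f i <= t <= m i + f i -> strung t = piece i t.
Proof.
move=> ai /andP[h1 h2]; have fi := f0 i; rewrite /strung; case: pselect => [h|nh].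
  case: (cid h) => j [aj /andP[j1 j2]] /=; congr (piece _ _).
  have fj := f0 j; apply: (@same_interval j i t); apply/andP; split; lra.
rewrite piece_line//; have [h|h] := leP (m i) t; first by right.
left; rewrite leNgt; apply/negP => h3; apply: nh; exists i; split=> //.
by apply/andP.
Qed.

Lemma strung_out t : (forall i, act i -> ~ (m i - f i < t < m i)) -> strung t = (0, t, 0).
Proof. by move=> h; rewrite /strung; case: pselect => // -[i [ai hi]]; case: (h i). Qed.

Lemma strung_cases t : (exists i, [/\ act i, m i - f i < t < m i & strung t = piece i t]) \/
  ((forall i, act i -> ~ (m i - f i < t < m i)) /\ strung t = (0, t, 0)).
Proof.
have [h|nh] := pselect (exists i, act i /\ m i - f i < t < m i).
  case: h => i [ai hi]; left; exists i; split=> //; apply: strung_in => //.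
  by have fi := f0 i; case/andP: hi => ? ?; apply/andP; split; lra.
right; have out i : act i -> ~ (m i - f i < t < m i) by move=> ai hi; apply: nh; exists i.
by split=> //; exact: strung_out.
Qed.

Lemma continuous_piece i t : {for t, continuous (piece i)}.
Proof.
have cg : {for t, continuous (fun t => ghat ((t - m i) / f i))}.
  apply: (@continuous_comp _ _ _ (fun t => (t - m i) / f i) ghat); last exact: arc_ghat.1.
  by apply: rcontM; [apply: rcontB; [exact: cvg_id|exact: rcontK]|exact: rcontK].
have cc (h : T3 -> R) : (forall a, {for a, continuous h}) ->
    {for t, continuous (fun t => f i * h (ghat ((t - m i) / f i)))}.
  move=> ch; apply: rcontM; first exact: rcontK.
  exact: (@continuous_comp _ _ _ (fun t => ghat ((t - m i) / f i)) h t cg (ch _)).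
apply: cont_pair; first apply: cont_pair.
- exact: (cc (fun a => a.1.1) (@continuous_x R)).
- by apply: rcontD; [exact: rcontK|exact: (cc (fun a => a.1.2) (@continuous_y R))].
- exact: (cc snd (@continuous_z R)).
Qed.

Lemma piece_bounds i t : m i - f i < t < m i ->
  [/\ m i - f i < (piece i t).1.2 < m i, `|(piece i t).1.1| <= f i / 2 &
      `|(piece i t).2| <= f i / 2].
Proof.
move=> /andP[h1 h2]; have fi := f0 i; set s := (t - m i) / f i.
have s01 : -1 < s < 0.
  by rewrite /s ltr_pdivlMr// ltr_pdivrMr//; apply/andP; split; lra.
have [b1 b2 b3 /(_ s01)/andP[b4 b5]] := ghat_bounds s.
have y1 : `|(ghat s).1.2| <= 1 by rewrite ler_norml; apply/andP; split; lra.
rewrite /piece -/s /= !normrM (gtr0_norm fi); split; [by apply/andP; split; nra|by nra|by nra].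
Qed.

Lemma piece_near_line i t : [/\ `|(piece i t).1.1| <= 3 * f i,
  `|(piece i t).1.2 - t| <= 3 * f i & `|(piece i t).2| <= 3 * f i].
Proof.
have fi := f0 i; have [h|h] := leP t (m i - f i).
  by rewrite piece_line; [rewrite /= subrr normr0; split; lra|left].
have [h'|h'] := leP (m i) t.
  by rewrite piece_line; [rewrite /= subrr normr0; split; lra|right].
have [/andP[b1 b2] b3 b4] := piece_bounds (ltac:(by rewrite h h') : m i - f i < t < m i).
split; [lra| |lra].
by move: (piece i t).1.2 b1 b2 => y b1 b2; rewrite ler_norml; apply/andP; split; lra.
Qed.

(** At every point at most one term is nonzero, and all but finitely many terms are uniformly small;
    so [F] is a uniform limit of finite sums. *)
Lemma continuous_disjoint_sum (P : nat -> R -> R) (F : R -> R) :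
  (forall i t, {for t, continuous (P i)}) -> (forall i t, `|P i t| <= 3 * f i) ->
  (forall t, (exists i, F t = P i t /\ forall j, j <> i -> P j t = 0) \/
    (F t = 0 /\ forall j, P j t = 0)) -> continuous F.
Proof.
move=> cP bP FP t; apply/cvgrPdist_lt => e e0.
have [N hN] := f_cvg (ltac:(by lra) : 0 < e / 9).
pose SN s : R := \sum_(i < N) P i s.
have cS : {for t, continuous SN}.
  rewrite /SN; elim: N {hN SN} => [|N IH].
    by apply: (@cont_eq _ _ _ (fun=> 0)); [move=> s; rewrite big_ord0|exact: rcontK].
  apply: (@cont_eq _ _ _ (fun s => (\sum_(i < N) P i s) + P N s)).
    by move=> s; rewrite big_ord_recr.
  exact: rcontD IH (cP N t).
have close s : `|F s - SN s| <= e / 3.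
  rewrite /SN; have [[i [-> Pj]]|[-> Pj]] := FP s; last first.
    by rewrite big1 ?subrr ?normr0; [lra|move=> i _; exact: Pj].
  have [iN|Ni] := ltnP i N.
    rewrite (bigD1 (Ordinal iN))//= big1 ?addr0 ?subrr ?normr0; first by lra.
    by move=> j jN; apply: Pj => ji; move/eqP: jN; apply; apply: val_inj.
  rewrite big1 ?subr0; last first.
    by move=> j _; apply: Pj => ji; move: (ltn_ord j); rewrite ji ltnNge Ni.
  by apply: le_trans (bP i s) _; have := hN _ Ni; lra.
have e3 : 0 < e / 3 by lra.
move/cvgrPdist_lt: cS => /(_ _ e3); apply: filterS => s.
have := close t; have := close s; rewrite !ltr_norml !ler_norml.
by move=> /andP[? ?] /andP[? ?] /andP[? ?]; apply/andP; split; lra.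
Qed.

Lemma continuous_strung t : {for t, continuous strung}.
Proof.
have key (c : T3 -> R) (b : R -> R) : (forall i s, {for s, continuous (fun s => c (piece i s) - b s)}) ->
    (forall s, {for s, continuous b}) ->
    (forall s, c (0, s, 0) = b s) -> (forall i s, `|c (piece i s) - b s| <= 3 * f i) ->
    {for t, continuous (fun s => c (strung s))}.
  move=> cP cb c0 bP; pose P i s := if `[< act i >] then c (piece i s) - b s else 0.
  have P0 i s : (act i -> ~ (m i - f i < s < m i)) -> P i s = 0.
    rewrite /P; case: asboolP => // ai /(_ ai) h; rewrite piece_line ?c0 ?subrr//.
    have [h1|h1] := leP s (m i - f i); [by left|right].
    by rewrite leNgt; apply/negP => h2; apply: h; rewrite h1 h2.
  have cF : continuous (fun s => c (strung s) - b s).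
    apply: (@continuous_disjoint_sum P).
    - move=> i s; have [ai|na] := pselect (act i).
        apply: (@cont_eq _ _ _ (fun s => c (piece i s) - b s)); last exact: cP.
        by move=> u; rewrite /P asboolT.
      apply: (@cont_eq _ _ _ (fun=> 0)); last exact: rcontK.
      by move=> u; rewrite /P asboolF.
    - by move=> i s; rewrite /P; case: ifP => _; [exact: bP|rewrite normr0; have := f0 i; lra].
    - move=> s; have [[i [ai hi ->]]|[out ->]] := strung_cases s; last first.
        by right; rewrite c0 subrr; split=> // j; apply: P0; exact: out.
      left; exists i; split; first by rewrite /P asboolT.
      move=> j ji; apply: P0 => _ hj; apply: ji; apply: (@same_interval j i s).
        by have := f0 j; case/andP: hj => ? ? ?; apply/andP; split; lra.
      by have := f0 i; case/andP: hi => ? ? ?; apply/andP; split; lra.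
  apply: (@cont_eq _ _ _ (fun s => (c (strung s) - b s) + b s)).
    by move=> s; rewrite subrK.
  by apply: rcontD; [exact: cF|exact: cb].
have cp i s := @continuous_piece i s.
have -> : strung = (fun s => ((strung s).1.1, (strung s).1.2, (strung s).2)).
  by apply: funext => s; case: (strung s) => [[]].
apply: cont_pair; first apply: cont_pair.
- apply: (key (fun a => a.1.1) (fun=> 0)) => // [i s|s|i s].
  + apply: rcontB; last exact: rcontK.
    exact: (@continuous_comp _ _ _ (piece i) (fun a : T3 => a.1.1) s (cp i s) (@continuous_x R _)).
  + exact: rcontK.
  + by rewrite subr0; have [] := piece_near_line i s.
- apply: (key (fun a => a.1.2) id) => // [i s|s|i s].
  + apply: rcontB; last exact: cvg_id.
    exact: (@continuous_comp _ _ _ (piece i) (fun a : T3 => a.1.2) s (cp i s) (@continuous_y R _)).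
  + exact: cvg_id.
  + by have [] := piece_near_line i s.
- apply: (key snd (fun=> 0)) => // [i s|s|i s].
  + apply: rcontB; last exact: rcontK.
    exact: (@continuous_comp _ _ _ (piece i) (fun a : T3 => a.2) s (cp i s) (@continuous_z R _)).
  + exact: rcontK.
  + by rewrite subr0; have [] := piece_near_line i s.
Qed.

(** A copy keeps the second coordinate within its own interval, so this coordinate tells which copy
    a point belongs to. Injectivity and vertical chords are thereby reduced to a single copy. *)
Lemma strung_y t i : act i -> m i - f i < (strung t).1.2 < m i ->
  m i - f i < t < m i.
Proof.
move=> ai; have [[j [aj hj ->]]|[out ->]] := strung_cases t; last by [].
have [/andP[b1 b2] _ _] := piece_bounds hj => /andP[h1 h2].
suff -> : i = j by [].
by have fi := f0 i; have fj := f0 j; apply: (@same_interval i j (piece j t).1.2); apply/andP; split; lra.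
Qed.

Lemma arc_strung : arc strung.
Proof.
split=> [t|t t' e]; first exact: continuous_strung.
have [[i [ai hi ti]]|[out to]] := strung_cases t.
  have [b1 _ _] := piece_bounds hi.
  have hi' : m i - f i < t' < m i by apply: strung_y => //; rewrite -e ti.
  have fi := f0 i; have ti' : strung t' = piece i t'.
    by apply: strung_in => //; case/andP: hi' => ? ?; apply/andP; split; lra.
  move: e; rewrite ti ti' /piece => -[e1 /addrI e2 e3].
  have fn : f i != 0 by rewrite gt_eqF.
  have : ghat ((t - m i) / f i) = ghat ((t' - m i) / f i).
    move: (mulfI fn e1) (mulfI fn e2) (mulfI fn e3).
    by case: (ghat _) => [[? ?] ?]; case: (ghat _) => [[? ?] ?] /= -> -> ->.
  have fv : (f i)^-1 != 0 by rewrite invr_eq0.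
  by move=> /arc_ghat.2/(mulIf fv)/addIr.
have [[i [ai hi ti]]|[out' to']] := strung_cases t'; last by move: e; rewrite to to' => -[].
have [b1 _ _] := piece_bounds hi.
by exfalso; apply: (out i ai); apply: strung_y => //; rewrite e ti.
Qed.

Lemma strung_chord t t' d : strung t' = ((strung t).1, (strung t).2 + d) -> d != 0 ->
  exists i W, [/\ 1 <= W, `|d| = f i / (4 * W) & 2 * cos (pi * W) ^+ 2 < 1].
Proof.
move=> e d0; have ey : (strung t').1.2 = (strung t).1.2 by rewrite e.
have [[i [ai hi ti]]|[out to]] := strung_cases t; last first.
  exfalso; have [[i [ai hi ti]]|[out' to']] := strung_cases t'.
    have [b1 _ _] := piece_bounds hi.
    by apply: (out i ai); apply: strung_y => //; rewrite -ey ti.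
  move: e; rewrite to to' /= => -[_ d1]; move/eqP: d0; apply.
  by rewrite add0r in d1.
have [b1 _ _] := piece_bounds hi.
have hi' : m i - f i < t' < m i by apply: strung_y => //; rewrite ey ti.
have fi := f0 i; have ti' : strung t' = piece i t'.
  by apply: strung_in => //; case/andP: hi' => ? ?; apply/andP; split; lra.
have fn : f i != 0 by rewrite gt_eqF.
move: e; rewrite ti ti' /piece /= => -[e1 /addrI e2 e3].
have e4 : (ghat ((t' - m i) / f i)).2 = (ghat ((t - m i) / f i)).2 + d / f i.
  by apply: (mulfI fn); rewrite e3 mulrDr [f i * (d / _)]mulrC divfK.
have [] := @ghat_chord R ((t - m i) / f i) ((t' - m i) / f i) (d / f i).
- move: (mulfI fn e1) (mulfI fn e2) e4.
  by case: (ghat _) => [[? ?] ?]; case: (ghat _) => [[? ?] ?] /= -> -> ->.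
- by rewrite mulf_neq0 ?invr_eq0.
move=> W [W1 dW cW]; exists i, W; split=> //.
by rewrite -[f i / _]/(f i * _) -dW normrM normfV (gtr0_norm fi) mulrC divfK.
Qed.

Lemma wild_similar i t : act i -> m i - f i < t < m i + f i ->
  wild strung t <-> wild ghat ((t - m i) / f i).
Proof.
move=> ai /andP[h1 h2]; have fi := f0 i; have fn : f i != 0 by rewrite gt_eqF.
pose h (a : T3) : T3 := (f i * a.1.1, m i + f i * a.1.2, f i * a.2).
pose k (a : T3) : T3 := ((f i)^-1 * a.1.1, (f i)^-1 * (a.1.2 - m i), (f i)^-1 * a.2).
pose th s := m i + f i * s; pose et s := (s - m i) / f i.
have hk : cancel h k.
  by move=> [[x y] z]; rewrite /h /k /= [m i + _]addrC addrK !mulKf.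
have kh : cancel k h.
  by move=> [[x y] z]; rewrite /h /k /= !mulVKf// addrC subrK.
have te : cancel th et by move=> s; rewrite /th /et addrAC subrr add0r mulrC mulKf.
have et' : cancel et th by move=> s; rewrite /th /et mulrC divfK// addrC subrK.
have ch : continuous h.
  move=> a; apply: (@cont_pair _ _ _ _ (fun a : T3 => (f i * a.1.1, m i + f i * a.1.2)) (fun a : T3 => f i * a.2)).
    apply: cont_pair; first by apply: rcontM; [exact: rcontK|exact: continuous_x].
    by apply: rcontD; [exact: rcontK|apply: rcontM; [exact: rcontK|exact: continuous_y]].
  by apply: rcontM; [exact: rcontK|exact: continuous_z].
have ck : continuous k.
  move=> a; apply: (@cont_pair _ _ _ _ (fun a : T3 => ((f i)^-1 * a.1.1, (f i)^-1 * (a.1.2 - m i))) (fun a : T3 => (f i)^-1 * a.2)).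
    apply: cont_pair; first by apply: rcontM; [exact: rcontK|exact: continuous_x].
    by apply: rcontM; [exact: rcontK|apply: rcontB; [exact: continuous_y|exact: rcontK]].
  by apply: rcontM; [exact: rcontK|exact: continuous_z].
have cth : continuous th.
  by move=> s; apply: rcontD; [exact: rcontK|apply: rcontM; [exact: rcontK|exact: cvg_id]].
have cet : continuous et.
  move=> s; apply: (@rcontM R _ s (fun s => s - m i) (fun=> (f i)^-1)); last exact: rcontK.
  by apply: rcontB; [exact: cvg_id|exact: rcontK].
have nr : \forall s \near t, strung s = h (ghat (et s)).
  apply: filterS2 (lt_nbhsr h1) (lt_nbhsl h2) => s s1 s2.
  by apply: strung_in => //; apply/andP; split; lra.
split=> w.
  apply: (@wild_map R strung ghat k h setT setT et th t) => //.
  - exact: arc_strung.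
  - exact: arc_ghat.
  - by split=> [|x _|x _]; [split; exact: openT|split=> //; exact: ck|split=> //; exact: ch].
  - by apply: filterS nr => s ->; rewrite hk.
rewrite -[t]et'; apply: (@wild_map R ghat strung h k setT setT th et (et t)) => //.
- exact: arc_ghat.
- exact: arc_strung.
- by split=> [|x _|x _]; [split; exact: openT|split=> //; exact: ch|split=> //; exact: ck].
- have : \forall s \near et t, strung (th s) = h (ghat (et (th s))).
    have nr' : \forall s \near th (et t), strung s = h (ghat (et s)) by rewrite et'.
    exact: (cth _ _ nr').
  by apply: filterS => s ->; rewrite te.
Qed.

Lemma wild_strung i : act i -> wild strung (m i).
Proof.
move=> ai; have fi := f0 i; apply/(wild_similar ai); first by apply/andP; split; lra.
by rewrite subrr mul0r; exact: wild_ghat0.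
Qed.

Lemma line_near_tame (p : R -> T3) t : arc p -> (\forall s \near t, p s = (0, s, 0)) -> ~ wild p t.
Proof.
move=> ap h w; apply: (@line_not_wild R t).
pose k (a : T3) : T3 := (a.1.2, a.1.1, a.2).
have ck : continuous k.
  move=> a; apply: cont_pair; last exact: continuous_z.
  by apply: cont_pair; [exact: continuous_y|exact: continuous_x].
have kk a : k (k a) = a by case: a => [[]].
apply: (@wild_map R p (fun s => (s, 0, 0)) k k setT setT id id t) => //.
- exact: arc_line.
- by split=> [|x _|x _]; [split; exact: openT|split=> //; exact: ck|split=> //; exact: ck].
- by move=> x; exact: cvg_id.
- by move=> x; exact: cvg_id.
- by apply: filterS h => s ->.
Qed.

(** Near [t] only the copy [i] is left to consider. Outside it the arc is a line; inside, by
    similarity, [ghat_tame] leaves the tip and the undecided end. *)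
Lemma tame_strung t i (e : R) : 0 < e ->
  (forall j s, act j -> j <> i -> `|s - t| < e -> ~ (m j - f j < s < m j)) ->
  wild strung t -> act i /\ (t = m i \/ t = m i - f i).
Proof.
move=> e0 hj w; have fi := f0 i.
have near_line (P : R -> Prop) : (\forall s \near t, P s) ->
    (forall s, P s -> act i -> ~ (m i - f i < s < m i)) -> False.
  move=> nP hP; apply: (line_near_tame arc_strung) w.
  have nb : \forall s \near t, `|s - t| < e.
    by apply/nbhs_ballP; exists e => //= s; rewrite /ball/= distrC.
  apply: filterS2 nP nb => s Ps hs; apply: strung_out => j aj.
  have [ji|ji] := pselect (j = i); last exact: hj.
  by rewrite ji in aj *; exact: hP.
have [ai|na] := pselect (act i); last first.
  exfalso; apply: (near_line (fun _ => True)) => //; exact: filterT.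
split=> //; have [h1|h1|h1] := ltgtP t (m i - f i); last by right.
  exfalso; apply: (near_line (fun s => s < m i - f i)); first exact: lt_nbhsl.
  by move=> s hs _ /andP[]; lra.
have [h2|h2] := leP (m i + f i) t.
  exfalso; apply: (near_line (fun s => m i < s)); first by apply: lt_nbhsr; lra.
  by move=> s hs _ /andP[]; lra.
left; have := (wild_similar ai (ltac:(by rewrite h1 h2) : m i - f i < t < m i + f i)).1 w.
have [->//|ne] := eqVneq t (m i); move=> wg; exfalso; apply: (@ghat_tame R ((t - m i) / f i)) wg.
  by apply/eqP; apply: mulf_neq0; [rewrite subr_eq0|rewrite invr_eq0 gt_eqF].
move/(congr1 (fun x => x * f i)); rewrite divfK ?gt_eqF// => h; lra.
Qed.

End insertion.

(* [i.+1 = 2 ^ n * (4 k + 2 b + 1)] codes the triple [(n, k, b)]. *)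
Definition code_n (i : nat) : nat := logn 2 i.+1.
Definition code_r (i : nat) : nat := (i.+1 %/ 2 ^ code_n i)./2.
Definition code_k (i : nat) : nat := (code_r i)./2.
Definition code_b (i : nat) : bool := odd (code_r i).

Lemma codeE i : i.+1 = (2 ^ code_n i * (4 * code_k i + 2 * code_b i + 1))%N.
Proof.
have d : (2 ^ code_n i %| i.+1)%N by exact: pfactor_dvdnn.
have o : odd (i.+1 %/ 2 ^ code_n i).
  have := @pfactor_coprime 2 i.+1 isT (ltn0Sn i); move=> [q cq e].
  have -> : (i.+1 %/ 2 ^ code_n i)%N = q by rewrite {1}e mulnK// expn_gt0.
  by move: cq; rewrite coprime2n.
rewrite -{1}(divnK d) mulnC; congr (_ * _)%N; rewrite /code_k /code_b -/(code_r i).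
have := odd_double_half (i.+1 %/ 2 ^ code_n i); rewrite o -/(code_r i) => <-.
have := odd_double_half (code_r i); lia.
Qed.

Lemma code_surj n k (b : bool) : exists i, [/\ code_n i = n, code_k i = k & code_b i = b].
Proof.
pose q := (4 * k + 2 * b + 1)%N; have q0 : (0 < 2 ^ n * q)%N by rewrite muln_gt0 expn_gt0/= /q; lia.
have oq : odd q by rewrite /q; lia.
exists (2 ^ n * q).-1.
have nE : code_n (2 ^ n * q).-1 = n.
  rewrite /code_n prednK// lognM ?expn_gt0//; last by rewrite /q; lia.
  by rewrite pfactorK// logn_coprime ?addn0// coprime2n.
have rE : code_r (2 ^ n * q).-1 = (2 * k + b)%N.
  rewrite /code_r nE prednK// mulKn ?expn_gt0//; rewrite /q.
  by case: (b); rewrite ?muln1 ?muln0; lia.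
split=> //; first by rewrite /code_k rE; case: (b); lia.
by rewrite /code_b rE; case: (b); lia.
Qed.

Lemma code_inj i j : code_n i = code_n j -> code_k i = code_k j -> code_b i = code_b j -> i = j.
Proof. by move=> e1 e2 e3; apply: succn_inj; rewrite (codeE i) (codeE j) e1 e2 e3. Qed.

(** * Positions and sizes of the copies *)

Section positions.
Context {R : realType}.
Local Notation T3 := (R * R * R)%type.
Implicit Types (t s : R) (i j n k : nat).

Definition hp (n : nat) : R := 2^-1 ^+ n.
Definition limit_pos n : R := hp (n + 2).
(** For fixed [n] the offsets shrink by 4 with each [k] and never exceed [limit_pos n / 16]. With
    [scale] a quarter of the offset, copies around different limit points, of different rank or on
    different sides are disjoint. *)
Definition offset n k : R := hp (n + 2 * k + 6).
Definition scale i : R := hp (code_n i + 2 * code_k i + 8).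
Definition centre i : R := limit_pos (code_n i) +
  (if code_b i then - offset (code_n i) (code_k i) else offset (code_n i) (code_k i)).

Lemma hp_gt0 n : 0 < hp n.
Proof. by rewrite exprn_gt0// invr_gt0. Qed.

Lemma hpD a b : hp (a + b) = hp a * hp b. Proof. exact: exprD. Qed.

Lemma hp_le a b : (a <= b)%N -> hp b <= hp a.
Proof. by move=> ab; apply: ler_wiXn2l => //; lra. Qed.

Lemma scale_gt0 i : 0 < scale i.
Proof. exact: hp_gt0. Qed.

Lemma limit_pos_gt0 n : 0 < limit_pos n.
Proof. exact: hp_gt0. Qed.

Lemma limit_pos_le n : limit_pos n <= 1 / 4.
Proof. by apply: le_trans (hp_le (leq_addl n 2)) _; rewrite /hp; lra. Qed.

Lemma limit_pos_half a b : (a < b)%N -> limit_pos b <= limit_pos a / 2.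
Proof.
move=> ab; have -> : limit_pos a / 2 = hp (a.+1 + 2) by rewrite /limit_pos addSn /hp exprS mulrC.
by apply: hp_le; lia.
Qed.

Lemma offset_gt0 n k : 0 < offset n k.
Proof. exact: hp_gt0. Qed.

Lemma offset_quarter n a b : (a < b)%N -> offset n b <= offset n a / 4.
Proof.
move=> ab; have -> : offset n a / 4 = hp ((n + 2 * a + 6) + 2) by rewrite hpD /offset; congr (_ * _); rewrite /hp; lra.
by apply: hp_le; lia.
Qed.

Lemma offset_le n k : offset n k <= limit_pos n / 16.
Proof.
have -> : limit_pos n / 16 = hp ((n + 2) + 4) by rewrite hpD /limit_pos; congr (_ * _); rewrite /hp; lra.
by apply: hp_le; lia.
Qed.

Lemma scaleE i : scale i = offset (code_n i) (code_k i) / 4.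
Proof.
have -> : scale i = hp ((code_n i + 2 * code_k i + 6) + 2) by rewrite /scale; congr hp; lia.
by rewrite hpD /offset; congr (_ * _); rewrite /hp; lra.
Qed.

Lemma centre_dist i : `|centre i - limit_pos (code_n i)| = 4 * scale i.
Proof.
rewrite /centre addrAC subrr add0r scaleE; have := offset_gt0 (code_n i) (code_k i).
by case: ifP => _ h; rewrite ?normrN gtr0_norm//; lra.
Qed.

Lemma scale_le i : scale i <= limit_pos (code_n i) / 64.
Proof. by rewrite scaleE; have := offset_le (code_n i) (code_k i); lra. Qed.

Lemma scale_sep i j : i <> j -> scale i + scale j < `|centre i - centre j|.
Proof.
wlog ij : i j / (code_n i <= code_n j)%N => [hw ne|ne].
  have [h|h] := leqP (code_n i) (code_n j); first exact: hw.
  by rewrite addrC distrC; apply: hw (ltnW h) _ => e; apply: ne.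
have di := centre_dist i; have dj := centre_dist j; have si := scale_le i; have sj := scale_le j.
move: ij; rewrite leq_eqVlt => /orP[/eqP en|en]; last first.
  have lh := limit_pos_half en; have l0 := limit_pos_gt0 (code_n i).
  have h := ler_normD (limit_pos (code_n i) - centre i) (centre i - centre j).
  have h2 := ler_normD (limit_pos (code_n i) - centre i + (centre i - centre j)) (centre j - limit_pos (code_n j)).
  have e : limit_pos (code_n i) - centre i + (centre i - centre j) + (centre j - limit_pos (code_n j)) =
    limit_pos (code_n i) - limit_pos (code_n j) by ring.
  rewrite e in h2; have h3 := ler_norm (limit_pos (code_n i) - limit_pos (code_n j)).
  rewrite [`|limit_pos (code_n i) - centre i|]distrC di in h; rewrite dj in h2; lra.
rewrite !scaleE /centre -en; have oi := offset_gt0 (code_n i) (code_k i); have oj := offset_gt0 (code_n i) (code_k j).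
have [kk|kk|kk] := ltngtP (code_k i) (code_k j).
- have := offset_quarter (code_n i) kk; case: (code_b i); case: (code_b j) => q; rewrite ltr_normr; apply/orP; by [left; lra|right; lra].
- have := offset_quarter (code_n i) kk; case: (code_b i); case: (code_b j) => q; rewrite ltr_normr; apply/orP; by [left; lra|right; lra].
rewrite -kk; have [bb|bb] := eqVneq (code_b i) (code_b j); first by case: ne; exact: code_inj.
by move: bb; case: (code_b i); case: (code_b j) => // _; rewrite ltr_normr; apply/orP; [right; lra|left; lra].
Qed.

Lemma nat_le_exp2 n : (n.+1 <= 2 ^ n)%N.
Proof. exact: ltn_expl. Qed.

(** By the coding [i.+1] is at most [2 ^ (n + 2 k + 3)], while [scale i] is the inverse of
    [2 ^ (n + 2 k + 8)]. Hence the scales tend to zero along the enumeration. *)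
Lemma scale_small i : scale i * i.+1%:R < 1.
Proof.
have h : (i.+1 <= 2 ^ (code_n i + 2 * code_k i + 3))%N.
  have -> : (2 ^ (code_n i + 2 * code_k i + 3) = 2 ^ code_n i * 2 ^ (2 * code_k i + 3))%N.
    by rewrite -addnA expnD.
  rewrite {1}codeE leq_mul2l; apply/orP; right.
  apply: (@leq_trans (4 * (code_k i).+1)%N); first by case: (code_b i); lia.
  by rewrite expnD mulnC leq_mul// (leq_trans (nat_le_exp2 _))// leq_exp2l//; lia.
have -> : scale i = hp (code_n i + 2 * code_k i + 3) * hp 5.
  by rewrite -hpD /scale; congr hp; lia.
have h' : (i.+1%:R : R) <= 2 ^+ (code_n i + 2 * code_k i + 3).
  by rewrite -natrX ler_nat.
set N := (code_n i + 2 * code_k i + 3)%N in h' *.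
have p0 := hp_gt0 N; have pE : hp N * 2 ^+ N = 1 by rewrite /hp -exprMn mulVf ?expr1n// pnatr_eq0.
have h2 : hp N * i.+1%:R <= 1 by apply: le_trans (ler_wpM2l (ltW p0) h') _; rewrite pE.
have -> : hp N * hp 5 * i.+1%:R = hp N * i.+1%:R * hp 5 by ring.
have h5 : hp 5 < 1 by rewrite /hp; lra.
by have := hp_gt0 5; nra.
Qed.

Lemma scale_cvg e : 0 < e -> exists N, forall i, (N <= i)%N -> scale i < e.
Proof.
move=> e0; exists (Num.truncn e^-1).+1 => i iN.
have h1 : e^-1 < i.+1%:R.
  by apply: lt_le_trans (truncnS_gt _) _; rewrite ler_nat; apply: leq_trans iN _.
have i0 : 0 < (i.+1%:R : R) by rewrite ltr0n.
have h2 := scale_small i; rewrite -ltr_pdivlMr// div1r in h2.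
by apply: lt_trans h2 _; rewrite -[ltRHS]invrK ltf_pV2// posrE invr_gt0.
Qed.

Lemma limit_pos_cvg e : 0 < e -> exists N, forall n, (N <= n)%N -> limit_pos n < e.
Proof.
move=> e0; exists (Num.truncn e^-1).+1 => n nN.
have h1 : e^-1 < n.+1%:R.
  by apply: lt_le_trans (truncnS_gt _) _; rewrite ler_nat; apply: leq_trans nN _.
have h2 : (n.+1%:R : R) <= 2 ^+ n by rewrite -natrX ler_nat nat_le_exp2.
have pE : hp n * 2 ^+ n = 1 by rewrite /hp -exprMn mulVf ?expr1n// pnatr_eq0.
have p2 : 0 < 2 ^+ n :> R by rewrite exprn_gt0.
have hE : hp n = (2 ^+ n)^-1 by rewrite /hp exprVn.
have : hp n < e by rewrite hE -[ltRHS]invrK ltf_pV2 ?posrE ?invr_gt0//; lra.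
by apply: le_lt_trans; apply: hp_le; lia.
Qed.

Lemma offset_cvg n e : 0 < e -> exists k, offset n k < e.
Proof.
move=> /limit_pos_cvg[N hN]; exists N; apply: le_lt_trans (hN N (leqnn N)).
by apply: hp_le; lia.
Qed.

Lemma centre_bounds i : 0 < centre i - scale i /\ centre i + scale i < 1 / 3.
Proof.
have := centre_dist i; have := scale_le i; have := limit_pos_gt0 (code_n i).
have := limit_pos_le (code_n i); have := scale_gt0 i => s0 l1 l0 s1 /eqP.
by rewrite eqr_norml => /andP[/orP[]/eqP h _]; split; lra.
Qed.

(** Copies of large index are small and close to their limit point, which is itself either near 0 or
    one of finitely many; a point different from all these keeps a distance. *)
Lemma positions_discrete t : t != 0 -> (forall n, t <> limit_pos n) ->
  exists2 e, 0 < e & (forall n, e <= `|t - limit_pos n|) /\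
    exists N, forall i s, (N <= i)%N -> centre i - scale i <= s <= centre i + scale i ->
      e <= `|s - t|.
Proof.
move=> t0 tl.
have far0 : exists2 e, 0 < e & exists n1, forall s n, (n1 <= n)%N ->
    0 <= s <= 2 * limit_pos n -> e <= `|t - s|.
  have nt : 0 < `|t| by rewrite normr_gt0.
  exists (`|t| / 2); first by lra.
  have [N hN] := limit_pos_cvg (ltac:(lra) : 0 < `|t| / 4).
  exists N => s n nN /andP[s0 s1]; have h := hN _ nN.
  have := ler_normD (t - s) s; rewrite subrK (ger0_norm s0); lra.
have [e1 e10 [n1 hn1]] := far0.
have [e2 e20 he2] : exists2 e2, 0 < e2 & forall n, (n < n1)%N -> e2 <= `|t - limit_pos n|.
  elim: n1 {hn1} => [|n [e e0 he]]; first by exists 1.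
  exists (Num.min e `|t - limit_pos n|).
    by rewrite lt_min e0 normr_gt0 subr_eq0; apply/eqP; exact: tl.
  move=> k; rewrite ltnS leq_eqVlt => /orP[/eqP ->|/he h]; first by rewrite ge_min lexx orbT.
  by rewrite ge_min h.
pose e := Num.min e1 (e2 / 2).
have e0 : 0 < e by rewrite lt_min e10 divr_gt0.
have ee1 : e <= e1 by rewrite ge_min lexx.
have ee2 : e <= e2 / 2 by rewrite ge_min lexx orbT.
exists e => //; split=> [n|].
  have [h|h] := leqP n1 n.
    have l0 := limit_pos_gt0 n.
    by have := hn1 (limit_pos n) n h (ltac:(apply/andP; split; lra)); lra.
  by have := he2 n h; lra.
have [N hN] := scale_cvg (ltac:(lra) : 0 < e2 / 10).
exists N => i s iN /andP[s1 s2]; have si := hN _ iN; have di := centre_dist i.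
have sl := scale_le i; have l0 := limit_pos_gt0 (code_n i); have si0 := scale_gt0 i.
have [c0 _] := centre_bounds i.
have ds : `|s - limit_pos (code_n i)| <= 5 * scale i.
  have := ler_normD (s - centre i) (centre i - limit_pos (code_n i)).
  rewrite addrA subrK di; have : `|s - centre i| <= scale i by rewrite ler_norml; apply/andP; split; lra.
  lra.
have [h|h] := leqP n1 (code_n i).
  rewrite distrC; apply: le_trans ee1 _; apply: hn1 h _.
  by move: ds; rewrite ler_norml => /andP[? ?]; apply/andP; split; lra.
have := he2 _ h; have := ler_normD (t - s) (s - limit_pos (code_n i)).
rewrite addrA subrK [`|t - s|]distrC; lra.
Qed.

Lemma finite_discrete (a : nat -> R) N t : exists2 e, 0 < e & forall i, (i < N)%N ->
  `|a i - t| < e -> a i = t.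
Proof.
elim: N => [|N [e e0 he]]; first by exists 1.
have [h|h] := eqVneq (a N) t.
  exists e => // i; rewrite ltnS leq_eqVlt => /orP[/eqP ->//|]; exact: he.
exists (Num.min e `|a N - t|); first by rewrite lt_min e0 normr_gt0 subr_eq0.
move=> i; rewrite ltnS leq_eqVlt => /orP[/eqP ->|iN]; rewrite lt_min => /andP[h1 h2].
  by rewrite ltxx in h2.
exact: he.
Qed.

(** The closed intervals are disjoint, so at most one contains [t]; that one is [i], with 0 as an
    arbitrary value if there is none. *)
Lemma finite_closed N t : exists2 e, 0 < e & exists i, forall j s, (j < N)%N -> j <> i ->
  `|s - t| < e -> ~ (centre j - scale j < s < centre j).
Proof.
have [e e0 he] : exists2 e, 0 < e & forall j s, (j < N)%N ->
    ~ (centre j - scale j <= t <= centre j + scale j) ->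
    `|s - t| < e -> ~ (centre j - scale j < s < centre j).
  elim: N => [|N [e e0 he]]; first by exists 1.
  have sN := scale_gt0 N.
  have [e' e'0 he'] : exists2 e', 0 < e' & forall s, 
      ~ (centre N - scale N <= t <= centre N + scale N) -> `|s - t| < e' -> ~ (centre N - scale N < s < centre N).
    have [h1|h1] := ltP t (centre N - scale N).
      exists (centre N - scale N - t); first by lra.
      by move=> s _; rewrite ltr_norml => /andP[? ?] /andP[? ?]; lra.
    have [h2|h2] := ltP (centre N + scale N) t.
      exists (t - (centre N + scale N)); first by lra.
      by move=> s _; rewrite ltr_norml => /andP[? ?] /andP[? ?]; lra.
    by exists 1 => // s []; rewrite h1 h2.
  exists (Num.min e e'); first by rewrite lt_min e0 e'0.
  move=> j s; rewrite ltnS leq_eqVlt => /orP[/eqP ->|jN] nt; rewrite lt_min => /andP[h1 h2].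
    exact: he'.
  exact: he.
exists e => //; have [[i hi]|no] := pselect (exists i, centre i - scale i <= t <= centre i + scale i).
  exists i => j s jN ji st; apply: he => // hj; apply: ji.
  exact: (same_interval scale_sep hj hi).
by exists 0%N => j s jN _; apply: he => // hj; apply: no; exists j.
Qed.

Definition active (S : nat -> bool) i : Prop := code_b i -> S (code_n i).

Definition string S : R -> T3 := strung centre scale (active S).

Lemma arc_string S : arc (string S).
Proof. by apply: arc_strung; [exact: scale_gt0|exact: scale_sep|exact: scale_cvg]. Qed.

Lemma wild_string_right S n k : wild (string S) (limit_pos n + offset n k).
Proof.
have [i [e1 e2 e3]] := code_surj n k false.
have -> : limit_pos n + offset n k = centre i by rewrite /centre e3 e1 e2.
apply: wild_strung; [exact: scale_gt0|exact: scale_sep|exact: scale_cvg|].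
by rewrite /active e3.
Qed.

Lemma wild_string_left (S : nat -> bool) n k : S n -> wild (string S) (limit_pos n - offset n k).
Proof.
move=> Sn; have [i [e1 e2 e3]] := code_surj n k true.
have -> : limit_pos n - offset n k = centre i by rewrite /centre e3 e1 e2.
apply: wild_strung; [exact: scale_gt0|exact: scale_sep|exact: scale_cvg|].
by rewrite /active e1.
Qed.

Lemma wild_string S t : wild (string S) t -> [\/ t = 0, exists n, t = limit_pos n |
  exists2 i, active S i & t = centre i \/ t = centre i - scale i].
Proof.
move=> w; have [->|t0] := eqVneq t 0; first by constructor 1.
have [[n e]|nl] := pselect (exists n, t = limit_pos n); first by constructor 2; exists n.
have tl n : t <> limit_pos n by move=> e; apply: nl; exists n.
have [e e0 [_ [N hN]]] := positions_discrete t0 tl.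
have [e' e'0 [i hi]] := finite_closed N t.
have [||ai ti] := @tame_strung R centre scale (active S) scale_gt0 scale_sep scale_cvg t i (Num.min e e') _ _ w.
- by rewrite lt_min e0.
- move=> j s aj ji; rewrite lt_min => /andP[h1 h2].
  have [jN|Nj] := ltnP j N; first exact: hi.
  move=> /andP[h3 h4]; have sj := scale_gt0 j.
  have := hN j s Nj (ltac:(by apply/andP; split; lra)); lra.
by constructor 3; exists i.
Qed.

End positions.

(** * Translates of the arc and their return *)

Section closed_strand.
Context {R : realType}.
Local Notation T3 := (R * R * R)%type.
Local Notation pi := (@pi R).
Implicit Types (t s W d : R) (i j n k : nat).

Lemma double_cos W : 2 * cos (pi * W) ^+ 2 = 1 + Re (cis W).
Proof.
have -> : Re (cis W) = cos (pi * W + pi * W) by rewrite /cis /=; congr cos; ring.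
rewrite cosD; have := cos2Dsin2 (pi * W); rewrite !expr2.
move: (cos _ * cos _) (sin _ * sin _) => a b; lra.
Qed.

(* No two points of a string differ by the vertical vector [(0, 0, d)]. *)
Definition no_chord d : Prop := forall i W, 1 <= W ->
  `|d| = scale i / (4 * W) -> 1 <= 2 * cos (pi * W) ^+ 2.

Lemma no_chordN d : no_chord d -> no_chord (- d).
Proof. by move=> h i W; rewrite normrN; exact: h. Qed.

(** A chord in the copy [i] has [(4 |d|)^-1 = 2 ^+ e * W], where [2 ^+ e] is the inverse of
    [scale i]. If this is close to [2 ^+ k], then either [e > k], against [1 <= W], or [W] is within
    [1/8] of an integer, where the square of the cosine is at least [1/2]. *)
Lemma no_chord_power d k : `|(4 * `|d|)^-1 - 2 ^+ k| <= 1 / 8 -> no_chord d.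
Proof.
move=> hd i W W1 dE; set e := (code_n i + 2 * code_k i + 8)%N.
have M0 : 0 < (2 : R) ^+ e by rewrite exprn_gt0.
have sE : @scale R i = (2 ^+ e)^-1 by rewrite /scale /hp exprVn.
have hW : (4 * `|d|)^-1 = 2 ^+ e * W.
  by rewrite dE sE; field; rewrite !gt_eqF//; lra.
rewrite hW in hd; have [ek|ke] := leqP e k; last first.
  exfalso; have : 2 * (2 : R) ^+ k <= 2 ^+ e by rewrite -exprS ler_weXn2l//; lra.
  have : 1 <= (2 : R) ^+ k by apply: exprn_ege1; lra.
  move: hd; rewrite ler_norml => /andP[_]; move: ((2 : R) ^+ e) ((2 : R) ^+ k) M0 => a b; nra.
have kE : (2 : R) ^+ k = 2 ^+ e * (2 ^ (k - e))%:R by rewrite natrX -exprD subnKC.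
set J := (2 ^ (k - e))%N in kE.
have u8 : `|W - J%:R| <= 1 / 8.
  have M1 : 1 <= (2 : R) ^+ e by apply: exprn_ege1; lra.
  move: hd; rewrite kE -mulrBr normrM (gtr0_norm M0); have := normr_ge0 (W - J%:R).
  move: `|W - J%:R| => a; nra.
have -> : 2 * cos (pi * W) ^+ 2 = 1 + Re (cis (W - J%:R)).
  by rewrite double_cos cisB cis_nat divr1.
suff : 0 <= Re (cis (W - J%:R)) by lra.
apply: ltW; apply: cos_gt0_pihalf; have p0 := pi_gt0 R.
by move: u8; rewrite ler_norml => /andP[u1 u2]; apply/andP; split; nra.
Qed.

Variable S : nat -> bool.

Lemma string_line t : t <= 0 \/ 1 / 3 <= t -> string S t = (0, t, 0).
Proof.
move=> h; apply: strung_out => i _ /andP[h1 h2]; have [c1 c2] := @centre_bounds R i.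
by have s0 := @scale_gt0 R i; case: h => h; lra.
Qed.

Lemma string_chord t t' d : no_chord d -> string S t' = ((string S t).1, (string S t).2 + d) -> d = 0.
Proof.
move=> nc e; apply/eqP; apply/negP => /negP d0.
have [i [W [W1 dW cW]]] := strung_chord scale_gt0 scale_sep e d0.
by have := nc i W W1 dW; lra.
Qed.

(** On the way back [ramp1] rises during the second quarter and [ramp2] during the third. While
    [ramp1 < 1] the third coordinate still tells [q]; afterwards the first and third together tell
    [q']. Sliding sideways by [q'] thus lets the strands pass from the order of [q] to that of [q']
    without meeting. *)
Definition ramp1 t : R := clamp 0 1 (4 * (2 * t - 1) - 1).
Definition ramp2 t : R := clamp 0 1 (4 * (2 * t - 1) - 2).

(* For [t <= 1/2] a copy of the string at height [q]; for [t >= 1/2] the way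
   back, from height [q] to height [q'], along which the second coordinate
   decreases. *)
Definition path t q q' : T3 :=
  ((string S t).1.1 + Num.max 0 (8 * Num.min (t - 1 / 2) (1 - t)) + (ramp1 t - ramp2 t) * q',
   (string S t).1.2 - Num.max 0 (2 * t - 1),
   (string S t).2 + (1 - ramp1 t) * q + ramp2 t * q').

Lemma ramp_bounds t : [/\ 0 <= ramp1 t <= 1, 0 <= ramp2 t <= 1, ramp2 t <= ramp1 t &
  ramp1 t < 1 -> ramp2 t = 0].
Proof.
have h1 := @clamp_in R 0 1 (4 * (2 * t - 1) - 1) ler01.
have h2 := @clamp_in R 0 1 (4 * (2 * t - 1) - 2) ler01.
split=> //; rewrite /ramp1 /ramp2 /clamp /Num.max /Num.min; do ! case: ifP; lra.
Qed.

Lemma ramp_half t : t <= 1 / 2 -> ramp1 t = 0 /\ ramp2 t = 0.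
Proof.
by move=> h; rewrite /ramp1 /ramp2 /clamp !min_r ?max_l//; lra.
Qed.

Lemma ramp_end t : 7 / 8 <= t -> ramp1 t = 1 /\ ramp2 t = 1.
Proof.
by move=> h; rewrite /ramp1 /ramp2 /clamp !min_l ?max_r//; lra.
Qed.

Lemma path_half t q q' : t <= 1 / 2 ->
  path t q q' = ((string S t).1, (string S t).2 + q).
Proof.
move=> h; have [r1 r2] := ramp_half h; have m1 : Num.max 0 (2 * t - 1) = 0 by rewrite max_l//; lra.
have m2 : Num.max 0 (8 * Num.min (t - 1 / 2) (1 - t)) = 0 by rewrite max_l// min_l; lra.
rewrite /path r1 r2 m1 m2 subrr !mul0r !subr0 mul1r !addr0.
by case: (string S t) => [[]].
Qed.

Lemma path_back t q q' : 1 / 2 <= t <= 1 -> path t q q' =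
  (8 * Num.min (t - 1 / 2) (1 - t) + (ramp1 t - ramp2 t) * q', 1 - t,
   (1 - ramp1 t) * q + ramp2 t * q').
Proof.
move=> /andP[h1 h2]; rewrite /path string_line; last by right; lra.
have -> : Num.max 0 (2 * t - 1) = 2 * t - 1 by rewrite max_r//; lra.
have m0 : 0 <= 8 * Num.min (t - 1 / 2) (1 - t) by rewrite mulr_ge0// le_min; apply/andP; split; lra.
rewrite (max_r m0).
by rewrite /= !add0r; congr (_, _, _); lra.
Qed.

Lemma path_end t q q' : 7 / 8 <= t <= 1 -> path t q q' = (8 * (1 - t), 1 - t, q').
Proof.
move=> /andP[h1 h2]; have [r1 r2] := ramp_end h1.
rewrite path_back; last by apply/andP; split; lra.
have -> : Num.min (t - 1 / 2) (1 - t) = 1 - t by rewrite min_r//; lra.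
by rewrite r1 r2 !subrr !mul0r mul1r addr0 add0r.
Qed.

(** A copy that reaches second coordinate [v] has width at most half its scale, tiny against [v]; so
    the way back, which bulges sideways with slope 8, passes beside the string. *)
Lemma string_vs_back t v : string S t = ((string S t).1.1, v, (string S t).2) -> 0 < v < 1 / 2 ->
  `|(string S t).1.1| < 8 * Num.min (1 / 2 - v) v.
Proof.
move=> e /andP[v0 v1]; have yE : (string S t).1.2 = v by rewrite e.
have m0 : 0 < Num.min (1 / 2 - v) v by rewrite lt_min; apply/andP; split; lra.
have [[i [ai hi ti]]|[out to]] := strung_cases (active S) scale_gt0 scale_sep t; last first.
  by rewrite [string S t]to /= normr0; lra.
have [/andP[b1 b2] b3 _] := piece_bounds scale_gt0 hi.
move: yE; rewrite [string S t]ti => yE; rewrite yE in b1 b2.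
have ci := @centre_dist R i; have si := @scale_le R i; have li := @limit_pos_le R (code_n i).
have l0 := @limit_pos_gt0 R (code_n i); have s0 := @scale_gt0 R i.
have h2 : `|centre i - limit_pos (code_n i)| <= limit_pos (code_n i) / 16 :> R by rewrite ci; lra.
move: h2; rewrite ler_norml => /andP[h2 h3].
apply: le_lt_trans b3 _; rewrite /Num.min; case: ifP => _; lra.
Qed.

(** Only one of the two heights is recovered at a given time. This is enough, since each belongs to
    a point of the fibre on the same flow line. *)
Lemma path_inj t t' q q' r r' : 0 <= t < 1 -> 0 <= t' < 1 -> 0 <= q' -> 0 <= r' ->
  no_chord (q - r) -> path t q q' = path t' r r' -> t = t' /\ (q = r \/ q' = r').
Proof.
wlog tt : t t' q q' r r' / t <= t' => [hw h1 h2 q0 r0 nc e|].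
  have [h|h] := leP t t'; first exact: hw e.
  have nc' : no_chord (r - q) by rewrite -opprB; exact: no_chordN.
  have [-> [->|->]] := hw t' t r r' q q' (ltW h) h2 h1 r0 q0 nc' (esym e).
    by split=> //; left.
  by split=> //; right.
move=> /andP[t0 t1] /andP[t0' t1'] q0 r0 nc.
have [h'|h'] := leP t' (1 / 2).
  have h : t <= 1 / 2 by lra.
  rewrite !path_half// => e.
  have d0 : q - r = 0.
    apply: (string_chord nc (t := t) (t' := t')).
    case: e => e1 e2; rewrite [LHS]surjective_pairing -e1; congr (_, _); lra.
  have qr : q = r by lra.
  split; last by left.
  apply: (arc_string S).2; case: e => e1 e2.
  by rewrite [LHS]surjective_pairing e1 [RHS]surjective_pairing; congr (_, _); lra.
have [h|h] := leP t (1 / 2).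
  rewrite path_half// path_back; last by apply/andP; split; lra.
  case: (string S t) (@string_vs_back t (1 - t')) => [[x y] z] /= hb [e1 e2 e3].
  have [/andP[_ _] _ rr _] := ramp_bounds t'.
  have : x < 8 * Num.min (1 / 2 - (1 - t')) (1 - t').
    apply: le_lt_trans (ler_norm _) _; apply: hb; first by rewrite e2.
    by apply/andP; split; lra.
  rewrite e1; have -> : 1 / 2 - (1 - t') = t' - 1 / 2 by lra.
  have : 0 <= (ramp1 t' - ramp2 t') * r' by rewrite mulr_ge0// subr_ge0.
  lra.
have hb : 1 / 2 <= t <= 1 by apply/andP; split; lra.
have hb' : 1 / 2 <= t' <= 1 by apply/andP; split; lra.
rewrite !path_back//; move=> [e1 e2 e3]; have te : t = t' by lra.
split=> //; rewrite -te in e1 e3.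
have [/andP[a0 a1] _ _ rz] := ramp_bounds t.
have [r1|r1] := ltP (ramp1 t) 1.
  left; move: e3; rewrite rz// !mul0r !addr0 => /mulfI; apply.
  by rewrite gt_eqF//; lra.
right; have {}r1 : ramp1 t = 1 by lra.
rewrite r1 subrr !mul0r !add0r in e3; rewrite r1 in e1; lra.
Qed.

Lemma cont_path (T : topologicalType) (a q q' : T -> R) x :
  {for x, continuous a} -> {for x, continuous q} -> {for x, continuous q'} ->
  {for x, continuous (fun y => path (a y) (q y) (q' y))}.
Proof.
move=> ca cq cq'.
have cs (c : T3 -> R) : continuous c -> {for x, continuous (fun y => c (string S (a y)))}.
  move=> cc; have c1 : {for x, continuous (fun y => string S (a y))}.
    by apply: (@continuous_comp _ _ _ a (string S)) => //; exact: (arc_string S).1.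
  exact: (@continuous_comp _ _ _ (fun y => string S (a y)) c x c1 (cc _)).
have cl (k : R) : {for x, continuous (fun y => 2 * a y - k)}.
  by apply: rcontB; [apply: rcontM ca; exact: rcontK|exact: rcontK].
have cc (k : R) : {for x, continuous (fun y => clamp 0 1 (4 * (2 * a y - 1) - k))}.
  apply: rcont_max; first exact: rcontK; apply: rcont_min; first exact: rcontK.
  by apply: rcontB; [apply: rcontM; [exact: rcontK|exact: cl]|exact: rcontK].
have c1 : {for x, continuous (fun y => ramp1 (a y))} := cc 1.
have c2 : {for x, continuous (fun y => ramp2 (a y))} := cc 2.
have cm : {for x, continuous (fun y => Num.max 0 (8 * Num.min (a y - 1 / 2) (1 - a y)))}.
  apply: rcont_max; first exact: rcontK; apply: rcontM; first exact: rcontK.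
  by apply: rcont_min; apply: rcontB => //; exact: rcontK.
apply: cont_pair; first apply: cont_pair.
- apply: rcontD; first by apply: rcontD cm; exact: (cs (fun a => a.1.1) (@continuous_x R)).
  by apply: rcontM cq'; exact: rcontB c1 c2.
- apply: rcontB; first exact: (cs (fun a => a.1.2) (@continuous_y R)).
  by apply: rcont_max; [exact: rcontK|exact: cl].
- apply: rcontD; last exact: rcontM c2 cq'.
  apply: rcontD; first exact: (cs snd (@continuous_z R)).
  by apply: rcontM cq; apply: rcontB c1; exact: rcontK.
Qed.

Lemma path_close t q q' r r' : let a := path t q q' in let b := path t r r' in
  [/\ `|a.1.1 - b.1.1| <= `|q' - r'|, a.1.2 = b.1.2 & `|a.2 - b.2| <= `|q - r| + `|q' - r'|].
Proof.
rewrite /path /=; have [/andP[a0 a1] /andP[b0 b1] rr _] := ramp_bounds t; split=> //.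
  have -> : forall c : R, c + (ramp1 t - ramp2 t) * q' - (c + (ramp1 t - ramp2 t) * r') =
    (ramp1 t - ramp2 t) * (q' - r') by move=> c; ring.
  by rewrite normrM ler_piMl// ler_norml; apply/andP; split; lra.
have -> : forall c : R, c + (1 - ramp1 t) * q + ramp2 t * q' - (c + (1 - ramp1 t) * r + ramp2 t * r') =
    (1 - ramp1 t) * (q - r) + ramp2 t * (q' - r') by move=> c; ring.
apply: le_trans (ler_normD _ _) _; rewrite !normrM; apply: lerD; rewrite ler_piMl// ler_norml; apply/andP; split; lra.
Qed.

End closed_strand.

(** * The solenoid and its flow *)

Section subsets_products.

Lemma cont_set_type (T X : topologicalType) (A : set X) (f : T -> set_type A) (x : T) :
  {for x, continuous (fun t => set_val (f t))} -> {for x, continuous f}.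
Proof.
move=> cf U [/= V [[W oW <-]]] /= Wfx /filterS; apply.
by apply: cf; exact: open_nbhs_nbhs.
Qed.

Lemma cont_prod_topology (T : topologicalType) (I : Type) (K : I -> topologicalType)
    (f : T -> prod_topology K) (x : T) :
  (forall i, {for x, continuous (fun t => f t i)}) -> {for x, continuous f}.
Proof.
move=> cf; apply/cvg_sup => i U [/= V [[W oW <-]]] /= Wfx /filterS; apply.
by apply: (cf i); exact: open_nbhs_nbhs.
Qed.

Lemma compact_set_type (X : topologicalType) (A : set X) :
  compact A -> compact [set: set_type A].
Proof.
move=> cA G PG _.
have [|p [Ap clp]] := cA (fmap set_val G).
  rewrite /fmap /=; apply: filterS filterT => -[x xA] _ /=; exact: set_mem xA.
exists (exist _ p (mem_set Ap)); split=> // B N GB [/= V [[W oW <-]] /= Wp VN].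
have [|_ [[b Bb <-] Wb]] := clp (set_val @` B) W _ (open_nbhs_nbhs (conj oW Wp)).
  by rewrite /fmap /=; apply: filterS GB => b Bb; exists b.
by exists b; split=> //; exact: VN.
Qed.

Lemma set_type_inj (X : Type) (A : set X) (x y : set_type A) : set_val x = set_val y -> x = y.
Proof. exact: val_inj. Qed.

Lemma compact_embedding (X Y : topologicalType) (e : X -> Y) : compact [set: X] ->
  hausdorff_space Y -> continuous e -> injective e -> embedding e.
Proof.
move=> cX hY ce ie.
pose f x : set_type (range e) := exist _ (e x) (mem_set (imageT e x)).
have ex (y : set_type (range e)) : exists x, e x = set_val y.
  by case: y => y yP; have [x _ xE] := set_mem yP; exists x.
pose g y := projT1 (cid (ex y)).
have gE y : e (g y) = set_val y by rewrite /g; case: cid.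
exists f => //; exists g; split.
- by move=> x; apply: ie; rewrite gE.
- by move=> y; apply: set_type_inj; exact: gE.
- by move=> x; apply: cont_set_type; exact: ce.
apply/continuous_closedP => D cD.
have -> : g @^-1` D = set_val @^-1` (e @` D).
  apply/seteqP; split=> y /=; first by move=> Dy; exists (g y).
  by move=> [x Dx]; rewrite -gE => /ie <-.
apply: preimage_closed; first by move=> y _; exact: initial_continuous.
apply: compact_closed => //; apply: continuous_compact; first exact: continuous_subspaceT.
by apply: (subclosed_compact cD cX).
Qed.

End subsets_products.

Section solenoid_topology.
Context {R : realType}.
Local Notation C := (R[i]^o : topologicalType).
Variable n : nat -> nat.
Local Notation S1 := (set_type (@circle R)).
Local Notation L := (set_type (@power_limit R n)).

Definition coord i (x : L) : R[i] := set_val ((set_val x : nat -> S1) i).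

Lemma coordX i x : coord i x = coord i.+1 x ^+ n i.
Proof. by case: x => z zP; exact: (set_mem zP i). Qed.

Lemma cabs_coord i x : cabs (coord i x) = 1.
Proof.
rewrite /coord; case: (set_val x i) => z zP; have h : (@circle R) z := set_mem zP.
have : (cabs z)%:C%C = 1 by rewrite -cabsE.
by case.
Qed.

Lemma coord_neq0 i x : coord i x != 0.
Proof. by rewrite -cabs_eq0 cabs_coord oner_eq0. Qed.

Lemma coord_ext x y : (forall i, coord i x = coord i y) -> x = y.
Proof.
move=> h; apply: set_type_inj; apply: functional_extensionality_dep => i.
by apply: set_type_inj; exact: h.
Qed.

Lemma circle_cabs (z : R[i]) : cabs z = 1 -> (@circle R) z.
Proof. by move=> h; rewrite /circle /= cabsE h. Qed.

Lemma coord_exists (z : nat -> R[i]) : (forall i, cabs (z i) = 1) ->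
  (forall i, z i = z i.+1 ^+ n i) -> exists x : L, forall i, coord i x = z i.
Proof.
move=> z1 zX.
pose w i : S1 := exist _ (z i) (mem_set (circle_cabs (z1 i))).
have wP : (@power_limit R n) (w : prod_topology _) by move=> i /=; exact: zX.
by exists (exist (fun y => y \in @power_limit R n) (w : prod_topology (fun _ => S1)) (mem_set wP)).
Qed.

Lemma continuous_coord i x : ccont (coord i) x.
Proof.
apply: (@continuous_comp _ _ C (fun x : L => (set_val x : prod_topology (fun _ : nat => S1)) i) set_val).
  apply: (@continuous_comp _ _ _ (fun x : L => set_val x) (fun z : prod_topology (fun _ : nat => S1) => z i)).
    exact: initial_continuous.
  exact: proj_continuous.
exact: initial_continuous.
Qed.

Lemma cont_coord (T : topologicalType) (f : T -> L) (t : T) :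
  (forall i, ccont (fun s => coord i (f s)) t) -> {for t, continuous f}.
Proof.
move=> cf; apply: cont_set_type; apply: cont_prod_topology => i.
by apply: cont_set_type; exact: cf.
Qed.

Lemma compact_solenoid : compact [set: L].
Proof.
apply: compact_set_type.
have cS1 : compact [set: S1].
  pose f (t : R) : S1 := exist _ (cis t) (mem_set (circle_cabs (cabs_cis t))).
  have -> : [set: S1] = f @` `[0, 1].
    apply/seteqP; split=> // -[z zP] _; have [t zt] : exists t, z = cis t.
      by apply: cis_surj; have : (cabs z)%:C%C = 1; [rewrite -cabsE; exact: (set_mem zP)|case].
    have /andP[f1 f2] := floor_itv t; rewrite intrD in f2; exists (t - (Num.floor t)%:~R).
      by rewrite /= in_itv/=; apply/andP; split; lra.
    have e : cis (t - (Num.floor t)%:~R) = z by rewrite zt cisB cis_int divr1.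
    by apply: set_type_inj; exact: e.
  apply: continuous_compact; last exact: segment_compact.
  by apply: continuous_subspaceT => t; apply: cont_set_type; exact: continuous_cis.
have cP : compact [set f : prod_topology (fun _ : nat => S1) | forall i, [set: S1] (f i)].
  exact: (@tychonoff nat (fun _ => S1) (fun _ => setT) (fun _ => cS1)).
apply: (subclosed_compact _ cP); last by move=> z _ i.
have -> : @power_limit R n = \bigcap_i [set z | set_val (z i) - (set_val (z i.+1) : R[i]) ^+ n i = 0].
  apply/seteqP; split=> z /= h i; first by move=> _; rewrite /= (h i) subrr.
  by have /= := h i I => /eqP; rewrite subr_eq0 => /eqP.
apply: closed_bigI => i _.
have cp j (z : prod_topology (fun _ : nat => S1)) : ccont (fun z : prod_topology (fun _ : nat => S1) => set_val (z j)) z.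
  apply: (@continuous_comp _ _ C (fun z : prod_topology (fun _ : nat => S1) => z j) set_val).
    exact: proj_continuous.
  exact: initial_continuous.
have cd z : ccont (fun z : prod_topology (fun _ : nat => S1) => set_val (z i) - (set_val (z i.+1) : R[i]) ^+ n i) z.
  exact: (contB (cp i z) (contX (cp i.+1 z))).
have c0 : closed [set (0 : C)] by apply: accessible_closed_set1; exact: hausdorff_accessible hausdorff_complex.
exact: (@preimage_closed _ C _ _ (fun z _ => cd z) c0).
Qed.

End solenoid_topology.

(** * The flow, its fibre and the heights *)

Section flow.
Context {R : realType}.
Local Notation C := (R[i]^o : topologicalType).
Variable n : nat -> nat.
Hypothesis n2 : forall i, (2 <= n i)%N.
Local Notation L := (set_type (@power_limit R n)).
Implicit Types (x y c : L) (s t : R) (i j : nat).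

(** The period of the coordinate [i] along a flow line: it turns [1 / winding i] times per unit of
    time. *)
Definition winding i : nat := \prod_(j < i) n j.

Lemma winding0 : winding 0 = 1%N.
Proof. by rewrite /winding big_ord0. Qed.

Lemma windingS i : winding i.+1 = (winding i * n i)%N.
Proof. by rewrite /winding big_ord_recr. Qed.

Lemma winding_gt i : (i < winding i)%N.
Proof.
elim: i => [|i IH]; first by rewrite winding0.
by rewrite windingS; have := n2 i; nia.
Qed.

Lemma winding_neq0 i : (winding i)%:R != 0 :> R.
Proof. by rewrite pnatr_eq0 -lt0n; apply: leq_ltn_trans (winding_gt i). Qed.

Lemma flow_exists x t : exists y : L, forall i, coord i y = coord i x * cis (t / (winding i)%:R).
Proof.
apply: coord_exists => [i|i]; first by rewrite cabsM cabs_coord cabs_cis mulr1.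
rewrite exprMn -coordX -cisMn; congr (_ * cis _).
rewrite windingS natrM -mulr_natl.
have n0 : (n i)%:R != 0 :> R by rewrite pnatr_eq0; have := n2 i; lia.
by field; rewrite n0 winding_neq0.
Qed.

Definition flow x t : L := projT1 (cid (flow_exists x t)).

Lemma coord_flow i x t : coord i (flow x t) = coord i x * cis (t / (winding i)%:R).
Proof. by rewrite /flow; case: cid. Qed.

Lemma coord0_flow x t : coord 0 (flow x t) = coord 0 x * cis t.
Proof. by rewrite coord_flow winding0 divr1. Qed.

Lemma flow0 x : flow x 0 = x.
Proof. by apply: coord_ext => i; rewrite coord_flow mul0r cis0 mulr1. Qed.

Lemma flowD x s t : flow (flow x s) t = flow x (s + t).
Proof. by apply: coord_ext => i; rewrite !coord_flow mulrDl cisD mulrA. Qed.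

(** A period would be a multiple of every [winding i], and these are unbounded since all [n i] are
    at least 2. *)
Lemma flow_free x s t : flow x s = flow x t -> s = t.
Proof.
move=> e; apply/eqP; rewrite -subr_eq0; apply/negP => /negP st.
have h i : exists m : int, (s - t) / (winding i)%:R = m%:~R.
  have := congr1 (coord i) e; rewrite !coord_flow => /(mulfI (coord_neq0 i x)) ei.
  by apply: cis_eq1; rewrite mulrBl cisB ei divff// cis_neq0.
pose i := (Num.truncn `|s - t|).+1; have [m hm] := h i.
have m0 : m != 0.
  by apply: contraNneq st => e0; move/eqP: hm; rewrite e0 mulf_eq0 invr_eq0 (negbTE (winding_neq0 i)) orbF.
have : `|s - t| = `|m|%:~R * (winding i)%:R.
  by rewrite -(divfK (winding_neq0 i) (s - t)) hm normrM normr_nat intr_norm.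
have : 1 <= (`|m|%:~R : R) by rewrite -[1]/((1%Z)%:~R) ler_int; lia.
have := truncnS_gt `|s - t|; have : (i%:R : R) <= (winding i)%:R by rewrite ler_nat ltnW// winding_gt.
rewrite -/i; have : 0 <= (i%:R : R) by []. 
move: (`|m|%:~R : R) => M; nra.
Qed.

Lemma cont_flow (T : topologicalType) (f : T -> L) (a : T -> R) (u : T) :
  {for u, continuous f} -> {for u, continuous a} ->
  {for u, continuous (fun v => flow (f v) (a v))}.
Proof.
move=> cf ca; apply: cont_coord => i.
have c1 : ccont (fun v => coord i (f v)) u.
  exact: (@continuous_comp _ _ C f (coord i) u cf (@continuous_coord _ _ i _)).
have c2 : ccont (fun v => cis (a v / (winding i)%:R)) u.
  apply: (@continuous_comp _ _ C (fun v => a v / (winding i)%:R) (cis : R -> C)); last exact: continuous_cis.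
  by apply: rcontM ca _; exact: rcontK.
apply: (@cont_eq _ _ C (fun v => coord i (f v) * cis (a v / (winding i)%:R))).
  by move=> v; rewrite coord_flow.
exact: (contM c1 c2).
Qed.

Definition fibre x : Prop := coord 0 x = 1.

Lemma fibre_flow x t : fibre x -> cis t = 1 -> fibre (flow x t).
Proof. by move=> Fx t1; rewrite /fibre coord0_flow Fx t1 mulr1. Qed.

Lemma fibre_root i x : fibre x -> coord i x ^+ winding i = 1.
Proof.
move=> Fx; elim: i => [|i IH]; first by rewrite winding0 expr1.
by rewrite windingS mulnC exprM -coordX.
Qed.

Lemma fibre_cis i x : fibre x -> exists l : nat, coord i x = cis (l%:R / (winding i)%:R).
Proof.
move=> Fx; have [s sE] := cis_surj (cabs_coord i x).
have := fibre_root i Fx; rewrite sE -cisMn => /cis_eq1[m mE].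
have w0 : (winding i : int) != 0.
  by rewrite -lt0n; apply: leq_ltn_trans (winding_gt i).
exists `|(m %% winding i)%Z|%N.
have me := divz_eq m (winding i).
have l0 : (`|(m %% winding i)%Z|%N : int) = (m %% winding i)%Z by rewrite gez0_abs// modz_ge0.
have sE' : s = (m %/ winding i)%Z%:~R + (`|(m %% winding i)%Z|%N)%:R / (winding i)%:R.
  have -> : ((`|(m %% winding i)%Z|%N)%:R : R) = ((m %% winding i)%Z)%:~R by rewrite -l0.
  have : s * (winding i)%:R = m%:~R by rewrite mulr_natr.
  rewrite {1}me intrD intrM => h.
  apply: (mulIf (winding_neq0 i)); rewrite h mulrDl divfK ?winding_neq0//.
by rewrite sE' cisD cis_int mul1r.
Qed.

(* [weight m.+1 = 64 * weight m ^+ 2]: two heights that first differ at the bit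
   [m] are at distance close to [1 / (4 * weight m)], which [no_chord] allows. *)
Fixpoint digit_exp m : nat := if m is m'.+1 then (6 + 2 * digit_exp m')%N else 6.

Definition weight m : R := 2 ^+ digit_exp m.

Lemma weight_ge64 m : 64 <= weight m.
Proof.
have -> : 64 = 2 ^+ 6 :> R by rewrite -natrX.
by apply: ler_weXn2l; [lra|case: m => //= m; lia].
Qed.

Lemma weightS m : weight m.+1 = 64 * weight m ^+ 2.
Proof.
have -> : 64 = 2 ^+ 6 :> R by rewrite -natrX.
by rewrite /weight /= exprD mulnC exprM.
Qed.

Lemma weight_ge m : m%:R <= weight m.
Proof.
have h k : (k <= digit_exp k)%N by elim: k => //= k IH; lia.
rewrite /weight -natrX ler_nat; apply: leq_trans (ltnW (ltn_expl m _)) _; first exact: (ltnSn 1).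
by rewrite leq_exp2l.
Qed.

(* On a fibre the [i]-th coordinate is a root of unity of order [winding i], so
   the bits determine the point. *)
Definition bit m x : R :=
  if unpickle m is Some (i, l) then
    (`[< coord i x = cis ((l : nat)%:R / (winding i)%:R) >])%:R
  else 0.

Definition partial_height x M : R := \sum_(m < M) bit m x / (4 * weight m).

(** The sum of the series of weighted bits, taken as a supremum because its terms are
    nonnegative. *)
Definition height x : R := sup (range (partial_height x)).

Lemma bit01 m x : bit m x = 0 \/ bit m x = 1.
Proof. by rewrite /bit; case: unpickle => [[i l]|]; [case: asboolP; [right|left]|left]. Qed.

Lemma partial_heightS x M : partial_height x M.+1 = partial_height x M + bit M x / (4 * weight M).
Proof. by rewrite /partial_height big_ord_recr. Qed.

Lemma weight_step M : (4 * weight M)^-1 + 2 / (4 * weight M.+1) <= 2 / (4 * weight M).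
Proof.
rewrite weightS; have := weight_ge64 M; move: (weight M) => w w64.
have w0 : 0 < w by lra.
have -> : (4 * w)^-1 + 2 / (4 * (64 * w ^+ 2)) = (4 * w)^-1 * (1 + (32 * w)^-1).
  by field; rewrite gt_eqF.
rewrite [2 / _]mulrC ler_pM2l ?invr_gt0 ?mulr_gt0//.
have : (32 * w)^-1 <= 1 by rewrite invf_le1 ?mulr_gt0//; lra.
lra.
Qed.

Lemma partial_height_mono x M k : partial_height x M <= partial_height x (M + k) <=
  partial_height x M + 2 / (4 * weight M) - 2 / (4 * weight (M + k)).
Proof.
elim: k => [|k /andP[h1 h2]]; first by rewrite addn0 addrK !lexx.
rewrite addnS partial_heightS; have := weight_step (M + k).
have := weight_ge64 (M + k); move: (weight (M + k)) h2 => w h2 w64.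
have i0 : 0 < (4 * w)^-1 by rewrite invr_gt0 mulr_gt0//; lra.
by case: (bit01 (M + k) x) => ->; rewrite ?mul0r ?div1r => h3; apply/andP; split; lra.
Qed.

Lemma height_bounds x M :
  partial_height x M <= height x <= partial_height x M + 2 / (4 * weight M).
Proof.
have w0 k : 0 < 2 / (4 * weight k).
  by rewrite divr_gt0// mulr_gt0//; have := weight_ge64 k; lra.
have ub N : ubound (range (partial_height x)) (partial_height x N + 2 / (4 * weight N)).
  move=> _ [k _ <-]; have [h|h] := leqP N k.
    have := partial_height_mono x N (k - N); rewrite subnKC// => /andP[_].
    by have := w0 k; lra.
  have := partial_height_mono x k (N - k); rewrite subnKC ?(ltnW h)// => /andP[h1 _].
  by have := w0 N; lra.
apply/andP; split.
  apply: ub_le_sup; last by exists M.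
  by exists (partial_height x 0 + 2 / (4 * weight 0)); exact: ub.
by apply: ge_sup (ub M); exists (partial_height x 0); exists 0%N.
Qed.

Lemma height_ge0 x : 0 <= height x.
Proof. by have /andP[h _] := height_bounds x 0; move: h; rewrite /partial_height big_ord0. Qed.

Lemma height_close x y M : (forall m, (m < M)%N -> bit m x = bit m y) ->
  `|height x - height y| <= 2 / (4 * weight M).
Proof.
move=> h; have e : partial_height x M = partial_height y M.
  by apply: eq_bigr => m _; rewrite h.
have := height_bounds x M; have := height_bounds y M; rewrite e.
by move=> /andP[? ?] /andP[? ?]; rewrite ler_norml; apply/andP; split; lra.
Qed.

(** Let [w] be the weight of the first bit that differs. The later bits move [4 |d|] away from
    [w^-1] by at most [w^-1 * w^-1 / 32], so [(4 |d|)^-1] is within [1/8] of [w], a power of two.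
    This absolute rather than relative precision is why the weights are squared at each step. *)
Lemma height_separated x y : fibre x -> fibre y -> x <> y ->
  height x <> height y /\ no_chord (height x - height y).
Proof.
move=> Fx Fy ne.
have [m0 hm0] : exists m, bit m x != bit m y.
  apply: contrapT => no; apply: ne; apply: coord_ext => i.
  have [l lE] := fibre_cis i Fx.
  have : bit (pickle (i, l)) x == bit (pickle (i, l)) y.
    by apply/negPn/negP => h; apply: no; exists (pickle (i, l)).
  rewrite /bit pickleK asboolT// => /eqP; case: asboolP => [-> //|_] /eqP.
  by rewrite oner_eq0.
have [M hM minM] := ex_minnP (ex_intro (fun m => bit m x != bit m y) m0 hm0).
have eM : partial_height x M = partial_height y M.
  apply: eq_bigr => m _; have [->//|h] := eqVneq (bit m x) (bit m y).
  by have := minM _ h; rewrite leqNgt ltn_ord.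
have hx := height_bounds x M.+1; have hy := height_bounds y M.+1.
rewrite !partial_heightS eM in hx hy; move: hx hy.
rewrite weightS; have wE : weight M = 2 ^+ digit_exp M by [].
have := weight_ge64 M; set w := weight M in wE *; move=> w64.
have w0 : 0 < w by lra.
have i0 : 0 < w^-1 by rewrite invr_gt0.
have iw : w^-1 * w = 1 by rewrite mulVf// gt_eqF.
have -> : 2 / (4 * (64 * w ^+ 2)) = w^-1 * w^-1 / 128 by field; rewrite gt_eqF.
have -> : (4 * w)^-1 = w^-1 / 4 by field; rewrite gt_eqF.
have i64 : w^-1 <= 64^-1 by rewrite lef_pV2 ?posrE.
move=> /andP[x1 x2] /andP[y1 y2].
have d4 : `|4 * `|height x - height y| - w^-1| <= w^-1 * w^-1 / 32.
  have ii : w^-1 * w^-1 <= w^-1 * 64^-1 by rewrite ler_pM2l.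
  move: hM x1 x2 y1 y2; case: (bit01 M x) => ->; case: (bit01 M y) => ->; rewrite ?eqxx// => _ x1 x2 y1 y2.
    rewrite [`|height x - height y|]ltr0_norm; last by lra.
    by rewrite ler_norml; apply/andP; split; lra.
  rewrite [`|height x - height y|]gtr0_norm; last by lra.
  by rewrite ler_norml; apply/andP; split; lra.
move: d4; set X := 4 * `|_| => d4.
have X0 : w^-1 / 2 <= X.
  have ii : w^-1 * w^-1 <= w^-1 * 64^-1 by rewrite ler_pM2l.
  by move: d4; rewrite ler_norml => /andP[? _]; lra.
split.
  by move=> e; move: X0; rewrite /X e subrr normr0 mulr0; lra.
apply: (@no_chord_power R _ (digit_exp M)); rewrite -wE -/X.
have Xp : 0 < X by lra.
have -> : X^-1 - w = (w^-1 - X) * w * X^-1 by field; rewrite !gt_eqF.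
rewrite 2!normrM (gtr0_norm w0) distrC [`|X^-1|]gtr0_norm ?invr_gt0// ler_pdivrMr//.
have h1 : `|X - w^-1| * w <= w^-1 / 32.
  apply: le_trans (ler_wpM2r (ltW w0) d4) _.
  by have -> : w^-1 * w^-1 / 32 * w = w^-1 / 32 by field; rewrite gt_eqF.
lra.
Qed.

(** On the fibre the coordinate is a root of unity of order dividing [winding i]. It takes finitely
    many values, so it is locally constant where it is continuous. *)
Lemma near_fibre (T : topologicalType) (c : T -> L) (u : T) i :
  (\forall v \near u, fibre (c v)) -> ccont (fun v => coord i (c v)) u ->
  \forall v \near u, coord i (c v) = coord i (c u).
Proof.
move=> Fc cc; have Fu := nbhs_singleton Fc.
have wi : (0 < winding i)%N by apply: leq_ltn_trans (winding_gt i).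
pose z := coord i (c u); pose N := (winding i).-1.
pose h v := \sum_(k < N.+1) coord i (c v) ^+ (N - k) * z ^+ k.
have ch : ccont h u.
  by apply: (@cont_sum _ _ _ (fun k v => coord i (c v) ^+ (N - k) * z ^+ k)) => k; exact: (contM (contX cc) (@contK _ _ _ _)).
have z0 : z != 0 by exact: coord_neq0.
have h0 : h u != 0.
  rewrite /h (eq_bigr (fun=> z ^+ N)); last by move=> k _; rewrite -exprD subnK// -ltnS.
  by rewrite sumr_const card_ord mulrn_eq0/= expf_neq0.
apply: filterS2 Fc (near_neq ch h0) => v Fv hv; apply/eqP; rewrite -subr_eq0 -/z.
have : (coord i (c v) - z) * h v = 0.
  by rewrite -subrXX prednK// !fibre_root// subrr.
by move/eqP; rewrite mulf_eq0 (negbTE hv) orbF.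
Qed.

Lemma cont_fibre_height (T : topologicalType) (c : T -> L) (u : T) :
  (\forall v \near u, fibre (c v)) -> {for u, continuous c} ->
  {for u, continuous (fun v => height (c v))}.
Proof.
move=> Fc cc; apply/cvgrPdist_lt => e e0.
pose M := (Num.truncn e^-1).+1.
have nb : \forall v \near u, forall m, (m < M)%N -> bit m (c v) = bit m (c u).
  elim: M => [|M IH]; first exact: nearW.
  have nM : \forall v \near u, bit M (c v) = bit M (c u).
    rewrite /bit; case: (unpickle M) => [[i l]|]; last exact: nearW.
    have ci : ccont (fun v => coord i (c v)) u.
      exact: (@continuous_comp _ _ C c (coord i) u cc (@continuous_coord _ _ i _)).
    by apply: filterS (near_fibre Fc ci) => v ->.
  by apply: filterS2 IH nM => v h1 h2 m; rewrite ltnS leq_eqVlt => /orP[/eqP ->|/h1].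
apply: filterS nb => v hv; rewrite distrC; apply: le_lt_trans (height_close hv) _.
have wM := weight_ge M; have M1 : e^-1 < M%:R by exact: truncnS_gt.
have ei : 0 < e^-1 by rewrite invr_gt0.
rewrite -[e]invrK ltr_pdivrMr; last by lra.
by rewrite mulrC ltr_pdivlMr//; lra.
Qed.

End flow.

(** * The embeddings *)

Section solenoid_embedding.
Context {R : realType}.
Local Notation C := (R[i]^o : topologicalType).
Local Notation T3 := (R * R * R)%type.
Variable n : nat -> nat.
Hypothesis n2 : forall i, (2 <= n i)%N.
Variable S : nat -> bool.
Local Notation L := (set_type (@power_limit R n)).
Local Notation flow := (flow n2).
Implicit Types (x y c : L) (s t : R) (i j : nat).

Definition phase x : R := xget 0 [set t | 0 <= t < 1 /\ cis t = coord 0 x].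

Lemma frac_exists t : exists2 m : int, 0 <= t - m%:~R < 1 & True.
Proof.
have /andP[f1 f2] := floor_itv t; rewrite intrD in f2; exists (Num.floor t) => //.
by apply/andP; split; lra.
Qed.

Lemma phaseP x : 0 <= phase x < 1 /\ cis (phase x) = coord 0 x.
Proof.
rewrite /phase; apply: (@xgetPex R 0 [set t | 0 <= t < 1 /\ cis t = coord 0 x]).
have [t tE] := cis_surj (cabs_coord 0 x); have [m mb _] := frac_exists t.
by exists (t - m%:~R); split=> //; rewrite cisB cis_int divr1.
Qed.

Lemma cis_unit_inj s t : 0 <= s < 1 -> 0 <= t < 1 -> cis s = cis t -> s = t.
Proof.
move=> /andP[s0 s1] /andP[t0 t1] /cis_eq[m mE].
have h1 : (m%:~R : R) < 1 by lra.
have h2 : -1 < (m%:~R : R) by lra.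
have : m = 0 by move: h1 h2; rewrite -[1]/((1%Z)%:~R) -mulrN1z ltr_int ltr_int; lia.
by move=> m0; rewrite mE m0 addr0.
Qed.

Lemma phase_unique x t : 0 <= t < 1 -> cis t = coord 0 x -> phase x = t.
Proof. by move=> tb tE; have [pb pE] := phaseP x; apply: cis_unit_inj => //; rewrite pE. Qed.

(** The heights are those of the two points, at phases 0 and 1, between which the flow line through
    [x] leaves the fibre and returns to it. *)
Definition emb x : T3 :=
  path S (phase x) (height (flow x (- phase x))) (height (flow x (1 - phase x))).

Lemma fibre_phase x : fibre (flow x (- phase x)).
Proof. by rewrite /fibre coord0_flow cisN -(phaseP x).2 mulfV// cis_neq0. Qed.

Lemma emb_flow c t : fibre c -> 0 <= t <= 1 ->
  emb (flow c t) = path S t (height c) (height (flow c 1)).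
Proof.
move=> Fc /andP[t0]; rewrite le_eqVlt => /orP[/eqP ->|t1].
  have F1 : fibre (flow c 1) by apply: fibre_flow => //; exact: cis1.
  have p0 : phase (flow c 1) = 0.
    by apply: phase_unique; [rewrite lexx ltr01|rewrite cis0 F1].
  rewrite /emb p0 oppr0 flow0 path_half ?path_end; first last.
  - lra.
  - by apply/andP; split; lra.
  rewrite string_line; last by left.
  by rewrite /= add0r; congr (_, _, _); lra.
have pE : phase (flow c t) = t.
  by apply: phase_unique; [rewrite t0 t1|rewrite coord0_flow Fc mul1r].
by rewrite /emb pE !flowD subrr flow0 addrC subrK.
Qed.

Lemma emb_inj : injective emb.
Proof.
move=> x y e; have [/andP[p0 p1] pE] := phaseP x; have [/andP[p0' p1'] pE'] := phaseP y.
have Fx := fibre_phase x; have Fy := fibre_phase y.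
have Fx1 : fibre (flow x (1 - phase x)).
  by rewrite addrC -flowD; apply: fibre_flow => //; exact: cis1.
have Fy1 : fibre (flow y (1 - phase y)).
  by rewrite addrC -flowD; apply: fibre_flow => //; exact: cis1.
have nc : no_chord (height (flow x (- phase x)) - height (flow y (- phase y))).
  have [->|ne] := pselect (flow x (- phase x) = flow y (- phase y)).
    by rewrite subrr => i W W1; rewrite normr0 => h; have := @scale_gt0 R i;
      have : 0 < scale i / (4 * W) :> R by [rewrite divr_gt0 ?scale_gt0// mulr_gt0//; lra]; rewrite -h ltxx.
  by have [] := height_separated n2 Fx Fy ne.
have xE : x = flow (flow x (- phase x)) (phase x) by rewrite flowD addNr flow0.
have yE : y = flow (flow y (- phase y)) (phase y) by rewrite flowD addNr flow0.
have pb : 0 <= phase x < 1 by rewrite p0 p1.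
have pb' : 0 <= phase y < 1 by rewrite p0' p1'.
have [pp [h|h]] := path_inj pb pb' (height_ge0 _) (height_ge0 _) nc e.
  have fE : flow x (- phase x) = flow y (- phase y).
    apply: contrapT => ne.
    by have [] := height_separated n2 Fx Fy ne.
  by rewrite xE yE fE pp.
have fE : flow x (1 - phase x) = flow y (1 - phase y).
  apply: contrapT => ne.
  by have [] := height_separated n2 Fx1 Fy1 ne.
have x1 : x = flow (flow x (1 - phase x)) (phase x - 1) by rewrite flowD -[1 - _]opprB addNr flow0.
have y1 : y = flow (flow y (1 - phase y)) (phase y - 1) by rewrite flowD -[1 - _]opprB addNr flow0.
by rewrite x1 y1 fE pp.
Qed.

(** [phase] jumps where the coordinate 0 equals 1; the branch found here is continuous at [x] and
    agrees with it nearby up to integers. *)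
Lemma local_phase x : exists a : L -> R, [/\ a x = phase x, {for x, continuous a} &
  \forall y \near x, cis (a y) = coord 0 y].
Proof.
have x0 := coord_neq0 0 x; have [_ pE] := phaseP x.
exists (fun y => phase x + arg0 (coord 0 y / coord 0 x)).
have cq : ccont (fun y => coord 0 y / coord 0 x) x.
  by apply: contM; [exact: continuous_coord|exact: contK].
have r0 : 0 < Re (coord 0 x / coord 0 x) by rewrite divff//= ltr01.
have q1 y : cabs (coord 0 y / coord 0 x) = 1 by rewrite cabsM cabsV !cabs_coord invr1 mulr1.
split.
- rewrite divff//; have a1 : arg0 (1 : R[i]) = 0.
    have pi0 := pi_gt0 R; have := @sinK R 0; rewrite sin0 /arg0 /= => ->; first by rewrite mul0r.
    by rewrite in_itv/=; apply/andP; split; lra.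
  by rewrite a1 addr0.
- apply: rcontD; first exact: rcontK.
  apply: (@continuous_comp _ _ _ (fun y => coord 0 y / coord 0 x : C) (arg0 : C -> R)); first exact: cq.
  by apply: continuous_arg0.
- apply: filterS (near_gt (contRe cq) r0) => y ry.
  by rewrite cisD pE arg0K ?ltW// mulrC divfK.
Qed.

Lemma continuous_emb : continuous emb.
Proof.
move=> x; have [a [ax ca na]] := local_phase x.
have ci : {for x, continuous (fun y : L => y)} by exact: cvg_id.
have cna : {for x, continuous (fun y => - a y)} by exact: rcontN ca.
have cc : {for x, continuous (fun y => flow y (- a y))} by exact: cont_flow.
have cc1 : {for x, continuous (fun y => flow y (1 - a y))}.
  by apply: cont_flow => //; apply: rcontB => //; exact: rcontK.
have Fc : \forall y \near x, fibre (flow y (- a y)).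
  by apply: filterS na => y e; rewrite /fibre coord0_flow -e cisN mulfV// cis_neq0.
have Fc1 : \forall y \near x, fibre (flow y (1 - a y)).
  by apply: filterS na => y e; rewrite /fibre coord0_flow -e cisB cis1 mulrC divfK// cis_neq0.
have ch := cont_fibre_height n2 Fc cc; have ch1 := cont_fibre_height n2 Fc1 cc1.
have [/andP[p0 p1] pE] := phaseP x.
move: p0; rewrite le_eqVlt => /orP[/eqP p0|p0]; last first.
  apply: (@near_glue _ _ (fun y => path S (a y) (height (flow y (- a y))) (height (flow y (1 - a y))))); last exact: cont_path.
  have n0 : \forall y \near x, 0 < a y by apply: near_gt => //; rewrite ax.
  have n1 : \forall y \near x, a y < 1 by apply: near_lt => //; rewrite ax.
  apply: filterS3 na n0 n1 => y e a0 a1; rewrite /emb.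
  by rewrite (phase_unique _ e)// ltW.
rewrite -p0 in ax.
(* At the jump of the phase the end of one path continues as the beginning of the next, and [G] is
   one formula for both sides. For [a y < 0] the string is straight, and the maxima adjust it to the
   values [8 (1 - t)] and [1 - t] of the path end at [t = 1 + a y]. *)
pose G y : T3 := ((string S (a y)).1.1 + Num.max 0 (- (8 * a y)),
  (string S (a y)).1.2 + Num.max 0 (- (2 * a y)), (string S (a y)).2 + height (flow y (- a y))).
have cs (h : T3 -> R) : continuous h -> {for x, continuous (fun y => h (string S (a y)))}.
  move=> chh; have c1 : {for x, continuous (fun y => string S (a y))}.
    by apply: (@continuous_comp _ _ _ a (string S)) => //; exact: (arc_string S).1.
  exact: (@continuous_comp _ _ _ (fun y => string S (a y)) h x c1 (chh _)).
have cm (k : R) : {for x, continuous (fun y => Num.max 0 (- (k * a y)))}.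
  by apply: rcont_max; [exact: rcontK|apply: rcontN; apply: rcontM ca; exact: rcontK].
have cG : {for x, continuous G}.
  apply: (@cont_pair _ _ _ _ (fun y => ((string S (a y)).1.1 + Num.max 0 (- (8 * a y)),
    (string S (a y)).1.2 + Num.max 0 (- (2 * a y)))) (fun y => (string S (a y)).2 + height (flow y (- a y)))).
    apply: cont_pair.
      exact: (rcontD (cs (fun a => a.1.1) (@continuous_x R)) (cm 8)).
    exact: (rcontD (cs (fun a => a.1.2) (@continuous_y R)) (cm 2)).
  by apply: rcontD ch; exact: (cs snd (@continuous_z R)).
apply: (near_glue _ cG).
have n0 : \forall y \near x, - (1 / 8) < a y by apply: near_gt => //; rewrite ax; lra.
have n1 : \forall y \near x, a y < 1 / 2 by apply: near_lt => //; rewrite ax; lra.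
apply: filterS3 na n0 n1 => y e a0 a1; rewrite /G /emb.
have [h|h] := leP 0 (a y).
  rewrite (phase_unique _ e); last by apply/andP; split; lra.
  rewrite path_half; last by lra.
  have m1 : Num.max 0 (- (8 * a y)) = 0 by rewrite max_l//; lra.
  have m2 : Num.max 0 (- (2 * a y)) = 0 by rewrite max_l//; lra.
  by rewrite m1 m2 !addr0; case: (string S (a y)) => [[]].
have pE' : phase y = 1 + a y.
  by apply: phase_unique; [apply/andP; split; lra|rewrite cisD cis1 mul1r].
rewrite pE' path_end; last by apply/andP; split; lra.
rewrite string_line; last by left; exact: ltW.
have m1 : Num.max 0 (- (8 * a y)) = - (8 * a y) by rewrite max_r//; lra.
have m2 : Num.max 0 (- (2 * a y)) = - (2 * a y) by rewrite max_r//; lra.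
have -> : 1 - (1 + a y) = - a y by ring.
by rewrite m1 m2 /= !add0r; congr (_, _, _); ring.
Qed.

Lemma embedding_emb : embedding emb.
Proof.
apply: compact_embedding; [exact: compact_solenoid|exact: norm_hausdorff|exact: continuous_emb|exact: emb_inj].
Qed.

Lemma emb_close e : 0 < e -> exists j, forall x y, coord j x = coord j y ->
  [/\ `|(emb x).1.1 - (emb y).1.1| < e, `|(emb x).1.2 - (emb y).1.2| < e &
      `|(emb x).2 - (emb y).2| < e].
Proof.
move=> e0; pose M := (Num.truncn e^-1).+1.
have wM : 2 * (2 / (4 * weight M)) < e :> R.
  have h1 := @weight_ge R M; have h2 : e^-1 < M%:R by exact: truncnS_gt.
  have ei : 0 < e^-1 by rewrite invr_gt0.
  have w0 : 0 < weight M :> R by lra.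
  have -> : 2 * (2 / (4 * weight M)) = (weight M)^-1 :> R by field; rewrite gt_eqF.
  by rewrite -[ltRHS]invrK ltf_pV2 ?posrE//; lra.
(* The sum bounds each of the coordinate indices occurring in the first [M] bits, so that the
   coordinate [j] decides all these bits. *)
pose j := (\sum_(m < M) (odflt (0%N, 0%N) (unpickle m : option (nat * nat))).1)%N.
have downX i k x y : coord (i + k) x = coord (i + k) y -> coord i x = coord i y.
  elim: k => [|k IH]; first by rewrite addn0.
  by rewrite addnS => h; apply: IH; rewrite (coordX (i + k) x) h -coordX.
have down i x y : (i <= j)%N -> coord j x = coord j y -> coord i x = coord i y.
  by move=> ij h; apply: (downX i (j - i)%N); rewrite subnKC.
have bits x y : coord j x = coord j y -> forall m, (m < M)%N -> bit m x = bit m y.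
  move=> h m mM; rewrite /bit; case E : (unpickle m) => [[i l]|//].
  rewrite (down i x y)//; rewrite /j (bigD1 (Ordinal mM))//= E /=; exact: leq_addr.
exists j => x y h.
have pp : phase x = phase y.
  by rewrite /phase (down 0 x y).
have hf t : coord j (flow x t) = coord j (flow y t) by rewrite !coord_flow h.
rewrite /emb -pp.
have h1 := height_close (bits _ _ (hf (- phase x))); have h2 := height_close (bits _ _ (hf (1 - phase x))).
have [c1 c2 c3] := path_close S (phase x) (height (flow x (- phase x))) (height (flow x (1 - phase x)))
  (height (flow y (- phase x))) (height (flow y (1 - phase x))).
have p2 : 0 <= 2 / (4 * weight M) :> R by rewrite divr_ge0// mulr_ge0//; have := @weight_ge64 R M; lra.
by rewrite c2 subrr normr0; split=> //; lra.
Qed.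

End solenoid_embedding.

(** * Rigidity *)

Section lifts.
Context {R : realType}.
Local Notation C := (R[i]^o : topologicalType).

Lemma lift_cis (V : normedModType R) (D : set V) (x0 : V) (p : V -> R[i]) :
  open D -> D x0 -> (forall x, D x -> forall t : R, 0 <= t <= 1 -> D (x0 + t *: (x - x0))) ->
  (forall v, D v -> ccont p v) -> (forall v, D v -> cabs (p v) = 1) ->
  exists th : V -> R, forall v, D v -> {for v, continuous th} /\ cis (th v) = p v.
Proof.
move=> oD D0 st cp p1; have [t0 t0E] := cis_surj (p1 _ D0).
have UN := @lift_cis_unique R V p D; have LS := lift_cis_local oD cp p1.
have [th _ hth] := @star_lifting R V R (fun v => [set t : R | cis t = p v]) D x0
  (@norm_hausdorff _ R) D0 st UN LS t0 (esym t0E).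
by exists th => v Dv; have [h1 h2] := hth v Dv.
Qed.

Lemma lift_cis_line (p : R -> R[i]) : (forall t, ccont p t) -> (forall t, cabs (p t) = 1) ->
  exists2 th : R -> R, continuous th & forall t, cis (th t) = p t.
Proof.
move=> cp p1; have [th hth] := @lift_cis R^o setT 0 p openT I (fun _ _ _ _ => I) (fun v _ => cp v) (fun v _ => p1 v).
by exists th => t; have [] := hth t I.
Qed.

Variable n : nat -> nat.
Hypothesis n2 : forall i, (2 <= n i)%N.
Local Notation L := (set_type (@power_limit R n)).
Local Notation flow := (flow n2).
Implicit Types (x y c : L) (s t : R) (i j : nat).

(** A path in the solenoid stays on one flow line: the coordinate 0 is lifted to a time, and the
    coordinate [i], a root of it of order [winding i], is determined along the path by its initial
    value. *)
Lemma path_lifting (g : R -> L) : continuous g ->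
  exists2 th : R -> R, continuous th & forall t, g t = flow (g 0) (th t).
Proof.
move=> cg.
have cr i t : ccont (fun t => coord i (g t) / coord i (g 0)) t.
  apply: contM; last exact: contK.
  exact: (@continuous_comp _ _ C g (coord i) t (cg t) (@continuous_coord _ _ i _)).
have r1 i t : cabs (coord i (g t) / coord i (g 0)) = 1.
  by rewrite cabsM cabsV !cabs_coord invr1 mulr1.
have [th0 cth0 th0E] := lift_cis_line (cr 0%N) (r1 0%N).
have [m mE] : exists m : int, th0 0 = m%:~R.
  by apply: cis_eq1; rewrite th0E divff// coord_neq0.
pose th t := th0 t - m%:~R; have cth : continuous th.
  by move=> t; apply: (@rcontB R _ t th0 (fun=> m%:~R)); [exact: cth0|exact: rcontK].
have thE t : cis (th t) = coord 0 (g t) / coord 0 (g 0) by rewrite cisB cis_int divr1 th0E.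
have th00 : th 0 = 0 by rewrite /th mE subrr.
exists th => // t; apply: coord_ext => i; rewrite coord_flow.
have pw i' x : coord i' x ^+ winding n i' = coord 0 x.
  elim: i' => [|j IH]; first by rewrite winding0 expr1.
  by rewrite windingS mulnC exprM -coordX.
have [k kE] : exists k, winding n i = k.+1.
  by exists (winding n i).-1; rewrite prednK//; apply: leq_ltn_trans (winding_gt n2 i).
have w0 := @winding_neq0 R n n2 i.
have e : coord i (g t) / coord i (g 0) = cis (th t / (winding n i)%:R).
  have := @root_path_eq R k (fun s => coord i (g (t * s)) / coord i (g 0))
    (fun s => cis (th (t * s) / (winding n i)%:R)).
  rewrite mulr1 mulr0 th00 mul0r cis0 divff ?coord_neq0//; apply=> // [s|s|s|s].
  - apply: (@continuous_comp _ _ C (fun s : R => t * s) (fun u => coord i (g u) / coord i (g 0))); last exact: cr.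
    by apply: rcontM; [exact: rcontK|exact: cvg_id].
  - apply: (@continuous_comp _ _ C (fun s : R => th (t * s) / (winding n i)%:R) (cis : R -> C)); last exact: continuous_cis.
    apply: rcontM; last exact: rcontK.
    apply: (@continuous_comp _ _ _ (fun s : R => t * s) th); last exact: cth.
    by apply: rcontM; [exact: rcontK|exact: cvg_id].
  - rewrite -kE exprMn exprVn !pw -cisMn -thE; congr cis.
    by rewrite -[RHS]mulr_natr divfK.
  - exact: cis_neq0.
by rewrite -e mulrC divfK// coord_neq0.
Qed.

Lemma flow_line_continuous x : continuous (fun t => flow x t).
Proof. by move=> t; apply: cont_flow; [exact: cvg_cst|exact: cvg_id]. Qed.

Lemma homeo_flow (u v : L -> L) x : continuous u -> continuous v -> cancel u v -> cancel v u ->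
  exists th et : R -> R, [/\ continuous th, continuous et, cancel th et, cancel et th &
    forall t, u (flow x t) = flow (u x) (th t)].
Proof.
move=> cu cv uv vu.
have [th cth thE] := @path_lifting (fun t => u (flow x t)) (fun t => 
  @continuous_comp _ _ _ (fun t => flow x t) u t (@flow_line_continuous x t) (cu _)).
have [et cet etE] := @path_lifting (fun t => v (flow (u x) t)) (fun t => 
  @continuous_comp _ _ _ (fun t => flow (u x) t) v t (@flow_line_continuous (u x) t) (cv _)).
rewrite flow0 in thE; rewrite flow0 uv in etE.
exists th, et; split=> // t.
  by apply: (@flow_free R n n2 x); rewrite -etE -thE uv.
by apply: (@flow_free R n n2 (u x)); rewrite -thE -etE vu.
Qed.

Variable S : nat -> bool.

Definition line x t := emb n2 S (flow x t).

Lemma arc_line_emb x : arc (line x).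
Proof.
split=> [t|s t /emb_inj/flow_free//].
by apply: (@continuous_comp _ _ _ (fun t => flow x t)); [exact: flow_line_continuous|exact: continuous_emb].
Qed.

End lifts.

Lemma wild_homeo (R : realType) (p p' : R -> R * R * R) (f g : R * R * R -> R * R * R)
    (th et : R -> R) t : arc p -> arc p' -> cancel f g -> cancel g f ->
  continuous f -> continuous g -> cancel th et -> cancel et th ->
  continuous th -> continuous et ->
  (\forall s \near t, f (p s) = p' (th s)) -> wild p t -> wild p' (th t).
Proof.
move=> ap ap' fg gf cf cg te et' cth cet nr w.
have lh : local_homeo f g setT setT.
  split=> [|a _|a _]; first by split; exact: openT.
    by split; [|exact: fg|exact: cf].
  by split; [|exact: gf|exact: cg].
exact: (wild_map ap ap' lh I te et' cth cet nr w).
Qed.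

(** * Knotted times along a flow line *)

Section wild_times.
Context {R : realType}.
Local Notation T3 := (R * R * R)%type.
Variable n : nat -> nat.
Hypothesis n2 : forall i, (2 <= n i)%N.
Variable S : nat -> bool.
Local Notation L := (set_type (@power_limit R n)).
Local Notation flow := (flow n2).
Local Notation line := (line n2 S).
Implicit Types (x y c : L) (s t r : R) (i j : nat) (k : int).

Lemma line_on_piece x k r : fibre x -> 0 <= r <= 1 -> line x (k%:~R + r) =
  path S r (height (flow x k%:~R)) (height (flow x (k%:~R + 1))).
Proof.
move=> Fx rb; rewrite /line -flowD emb_flow//; last by apply: fibre_flow => //; exact: cis_int.
by rewrite flowD.
Qed.

Lemma wild_line_string x k r : fibre x -> 0 < r < 1 / 2 ->
  wild (line x) (k%:~R + r) <-> wild (string S) r.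
Proof.
move=> Fx /andP[r0 r1]; set q := height (flow x k%:~R).
pose f (a : T3) : T3 := (a.1, a.2 + q); pose g (a : T3) : T3 := (a.1, a.2 - q).
have fg : cancel f g by move=> [a b]; rewrite /f /g /= addrK.
have gf : cancel g f by move=> [a b]; rewrite /f /g /= subrK.
have cf : continuous f.
  move=> a; apply: (@cont_pair _ _ _ _ (fun a : T3 => a.1) (fun a : T3 => a.2 + q)); first exact: cvg_fst.
  by apply: rcontD; [exact: continuous_z|exact: rcontK].
have cg : continuous g.
  move=> a; apply: (@cont_pair _ _ _ _ (fun a : T3 => a.1) (fun a : T3 => a.2 - q)); first exact: cvg_fst.
  by apply: rcontB; [exact: continuous_z|exact: rcontK].
pose th s : R := k%:~R + s; pose et s : R := s - k%:~R.
have te : cancel th et by move=> s; rewrite /th /et addrC addKr.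
have et' : cancel et th by move=> s; rewrite /th /et addrC subrK.
have cth : continuous th.
  by move=> s; apply: (@rcontD R _ s (fun=> k%:~R) id); [exact: rcontK|exact: cvg_id].
have cet : continuous et.
  by move=> s; apply: (@rcontB R _ s id (fun=> k%:~R)); [exact: cvg_id|exact: rcontK].
have nr : \forall s \near r, line x (th s) = f (string S s).
  apply: filterS2 (lt_nbhsr r0) (lt_nbhsl r1) => s s0 s1.
  rewrite /th line_on_piece//; last by apply/andP; split; lra.
  by rewrite path_half//; exact: ltW.
have ar := arc_string (R := R) S; have al := arc_line_emb n2 S x.
split=> w.
  have nr' : \forall s \near et (th r), line x (th s) = f (string S s) by rewrite te.
  have nr2 : \forall s \near th r, line x (th (et s)) = f (string S (et s)) := cet _ _ nr'.
  have nr3 : \forall s \near th r, g (line x s) = string S (et s).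
    by apply: filterS nr2 => s; rewrite et' => ->; exact: fg.
  by have := wild_homeo al ar gf fg cg cf et' te cet cth nr3 w; rewrite te.
have nr3 : \forall s \near r, f (string S s) = line x (th s) by apply: filterS nr => s ->.
exact: (wild_homeo ar al fg gf cf cg te et' cth cet nr3 w).
Qed.

(** On the way back the second coordinate is [1 - r], so the curve is a graph over it and a shear of
    space straightens it. *)
Lemma line_back_tame x k r : fibre x -> 1 / 2 < r < 1 -> ~ wild (line x) (k%:~R + r).
Proof.
move=> Fx /andP[r0 r1] w; set q := height (flow x k%:~R); set q' := height (flow x (k%:~R + 1)).
pose h1 v : R := 8 * Num.min (1 - v - 1 / 2) v + (ramp1 (1 - v) - ramp2 (1 - v)) * q'.
pose h3 v : R := (1 - ramp1 (1 - v)) * q + ramp2 (1 - v) * q'.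
have cv (T : topologicalType) (v : T -> R) (a : T) (l : R) : {for a, continuous v} ->
    {for a, continuous (fun b => clamp 0 1 (4 * (2 * (1 - v b) - 1) - l))}.
  move=> cva; apply: rcont_max; first exact: rcontK; apply: rcont_min; first exact: rcontK.
  apply: rcontB; last exact: rcontK; apply: rcontM; first exact: rcontK.
  apply: rcontB; last exact: rcontK; apply: rcontM; first exact: rcontK.
  by apply: rcontB cva; exact: rcontK.
have ch1 v : {for v, continuous h1}.
  have c1 := cv R id v 1 (@cvg_id _ _); have c2 := cv R id v 2 (@cvg_id _ _).
  apply: rcontD.
    apply: rcontM; first exact: rcontK; apply: rcont_min; last exact: cvg_id.
    by apply: rcontB; [apply: rcontB; [exact: rcontK|exact: cvg_id]|exact: rcontK].
  by apply: rcontM; [exact: rcontB c1 c2|exact: rcontK].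
have ch3 v : {for v, continuous h3}.
  have c1 := cv R id v 1 (@cvg_id _ _); have c2 := cv R id v 2 (@cvg_id _ _).
  apply: rcontD; apply: rcontM; [apply: rcontB c1; exact: rcontK|exact: rcontK|exact: c2|exact: rcontK].
pose f (a : T3) : T3 := (a.1.2, a.1.1 - h1 a.1.2, a.2 - h3 a.1.2).
pose g (a : T3) : T3 := (a.1.2 + h1 a.1.1, a.1.1, a.2 + h3 a.1.1).
have fg : cancel f g by move=> [[a b] c]; rewrite /f /g /= !subrK.
have gf : cancel g f by move=> [[a b] c]; rewrite /f /g /= !addrK.
have cf : continuous f.
  move=> a.
  have c1 : {for a, continuous (fun a : T3 => h1 a.1.2)}.
    by apply: (@continuous_comp _ _ _ (fun a : T3 => a.1.2) h1); [exact: continuous_y|exact: ch1].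
  have c3 : {for a, continuous (fun a : T3 => h3 a.1.2)}.
    by apply: (@continuous_comp _ _ _ (fun a : T3 => a.1.2) h3); [exact: continuous_y|exact: ch3].
  apply: (@cont_pair _ _ _ _ (fun a : T3 => (a.1.2, a.1.1 - h1 a.1.2)) (fun a : T3 => a.2 - h3 a.1.2)).
    apply: cont_pair; first exact: continuous_y.
    by apply: rcontB c1; exact: continuous_x.
  by apply: rcontB c3; exact: continuous_z.
have cg : continuous g.
  move=> a.
  have c1 : {for a, continuous (fun a : T3 => h1 a.1.1)}.
    by apply: (@continuous_comp _ _ _ (fun a : T3 => a.1.1) h1); [exact: continuous_x|exact: ch1].
  have c3 : {for a, continuous (fun a : T3 => h3 a.1.1)}.
    by apply: (@continuous_comp _ _ _ (fun a : T3 => a.1.1) h3); [exact: continuous_x|exact: ch3].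
  apply: (@cont_pair _ _ _ _ (fun a : T3 => (a.1.2 + h1 a.1.1, a.1.1)) (fun a : T3 => a.2 + h3 a.1.1)).
    apply: cont_pair; last exact: continuous_x.
    by apply: rcontD c1; exact: continuous_y.
  by apply: rcontD c3; exact: continuous_z.
pose th s : R := 1 - (s - k%:~R); pose et s : R := k%:~R + (1 - s).
have te : cancel th et by move=> s; rewrite /th /et; ring.
have et' : cancel et th by move=> s; rewrite /th /et; ring.
have cth : continuous th.
  move=> s; apply: (@rcontB R _ s (fun=> 1) (fun s => s - k%:~R)); first exact: rcontK.
  by apply: rcontB; [exact: cvg_id|exact: rcontK].
have cet : continuous et.
  move=> s; apply: (@rcontD R _ s (fun=> k%:~R) (fun s => 1 - s)); first exact: rcontK.
  by apply: rcontB; [exact: rcontK|exact: cvg_id].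
apply: (@line_not_wild R (th (k%:~R + r))).
have al := arc_line_emb n2 S x; have ar := @arc_line R.
suff nr : \forall s \near k%:~R + r, f (line x s) = (th s, 0, 0).
  exact: (wild_homeo al ar fg gf cf cg te et' cth cet nr w).
have k0 : k%:~R + 1 / 2 < k%:~R + r by lra.
have k1 : k%:~R + r < k%:~R + 1 by lra.
apply: filterS2 (lt_nbhsr k0) (lt_nbhsl k1) => s s0 s1.
have -> : s = k%:~R + (s - k%:~R) by ring.
rewrite line_on_piece//; last by apply/andP; split; lra.
rewrite path_back; last by apply/andP; split; lra.
have e : k%:~R + (s - k%:~R) = s by ring.
rewrite /f /th e /h1 /h3 /=; have -> : 1 - (1 - (s - k%:~R)) = s - k%:~R by ring.
by rewrite !subrr.
Qed.

Lemma wild_line x t : fibre x -> wild (line x) t -> exists k r, [/\ t = k%:~R + r,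
  0 <= r < 1 & [\/ r = 0, r = 1 / 2 | 0 < r < 1 / 2 /\ wild (string S) r]].
Proof.
move=> Fx w; have [k rb _] := frac_exists t; set r := t - _ in rb.
have tE : t = k%:~R + r by rewrite /r addrC subrK.
exists k, r; split=> //; rewrite tE in w; have /andP[r0 r1] := rb.
have [h|h|h] := ltgtP r (1 / 2); last by constructor 2.
  move: r0; rewrite le_eqVlt => /orP[/eqP <-|r0]; first by constructor 1.
  constructor 3; split; first by apply/andP; split.
  by apply/(@wild_line_string x k r Fx) => //; rewrite r0 h.
by exfalso; apply: (@line_back_tame x k r Fx) w; rewrite h.
Qed.

(** Points other than [t] itself are required, so isolated knotted times do not count; the undecided
    ends and the times at phase [1/2] thus become harmless. *)
Definition clusters (A : set R) t := forall e, 0 < e -> exists2 s, A s & 0 < `|s - t| < e.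
Definition clusters_left (A : set R) t := forall e, 0 < e -> exists2 s, A s & t - e < s < t.

Lemma limit_pos_isolated r : 0 < r -> exists2 e, 0 < e & forall j, limit_pos j != r :> R ->
  e <= `|limit_pos j - r|.
Proof.
move=> r0; have [[j ->]|nl] := pselect (exists j, r = limit_pos j).
  have l0 := @limit_pos_gt0 R j; exists (limit_pos j / 2); first by lra.
  move=> i; have [h|h|->] := ltngtP i j; last by rewrite eqxx.
    have := @limit_pos_half R _ _ h => h1 _.
    by rewrite gtr0_norm; lra.
  have := @limit_pos_half R _ _ h => h1 _.
  by rewrite ltr0_norm; lra.
have tl j : r <> limit_pos j by move=> e; apply: nl; exists j.
have r0' : r != 0 by rewrite gt_eqF.
have [e e0 [he _]] := positions_discrete r0' tl.
by exists e => // j _; rewrite distrC.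
Qed.

Lemma int_close k k' (d : R) : `|d| < 1 -> k%:~R = k'%:~R + d :> R -> k = k'.
Proof.
move=> d1 e; have h : d = (k - k')%:~R by rewrite intrB e; ring.
move: d1; rewrite h -intr_norm -[1]/((1%Z)%:~R) ltr_int => h1.
by apply/eqP; rewrite -subr_eq0 -normr_eq0; lia.
Qed.

(** The tips to the right of each limit point are knotted whatever [S] is, and the limit points
    accumulate at the integers. Elsewhere the copies do not accumulate. The set of clusters is
    therefore the same for all [S]. *)
Lemma clusters_wild x t : fibre x -> clusters (wild (line x)) t <->
  exists k, t = k%:~R \/ exists j, t = k%:~R + limit_pos j.
Proof.
move=> Fx; split; last first.
  have right k j l : wild (line x) (k%:~R + (limit_pos j + offset j l)).
    apply/(@wild_line_string x k _ Fx); last exact: wild_string_right.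
    have := @limit_pos_gt0 R j; have := @offset_gt0 R j l; have := @limit_pos_le R j; have := @offset_le R j l.
    by move=> *; apply/andP; split; lra.
  move=> [k [->|[j ->]]] e e0.
    have [N hN] := limit_pos_cvg (ltac:(by lra) : 0 < e / 2).
    exists (k%:~R + (limit_pos N + offset N 0)); first exact: right.
    have := hN N (leqnn N); have := @limit_pos_gt0 R N; have := @offset_gt0 R N 0; have := @offset_le R N 0.
    by move=> h1 h2 h3 h4; rewrite addrC addKr gtr0_norm; [apply/andP; split; lra|lra].
  have [l hl] := offset_cvg j e0; exists (k%:~R + (limit_pos j + offset j l)); first exact: right.
  have -> : k%:~R + (limit_pos j + offset j l) - (k%:~R + limit_pos j) = offset j l :> R by ring.
  by have o0 := @offset_gt0 R j l; rewrite gtr0_norm// o0.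
move=> acc; have [k rb _] := frac_exists t; set r := t - _ in rb.
have tE : t = k%:~R + r by rewrite /r addrC subrK.
exists k; have /andP[r0 r1] := rb.
move: r0; rewrite le_eqVlt => /orP[/eqP r0|r0]; first by left; rewrite tE -r0 addr0.
have [[j rj]|nl] := pselect (exists j, r = limit_pos j).
  by right; exists j; rewrite tE rj.
exfalso; have tl j : r <> limit_pos j by move=> e; apply: nl; exists j.
have [e1 e10 [he1 [N hN]]] := positions_discrete (lt0r_neq0 r0) tl.
have [e2 e20 he2] := @finite_discrete R centre N r.
have [e3 e30 he3] := @finite_discrete R (fun i => centre i - scale i) N r.
have [e4 e40 he4] : exists2 e4, 0 < e4 & r != 1 / 2 -> e4 <= `|1 / 2 - r|.
  have [e|e] := eqVneq r (1 / 2); first by exists 1.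
  by exists `|1 / 2 - r| => //; rewrite normr_gt0 subr_eq0 eq_sym.
pose e := Num.min (Num.min (Num.min e1 e2) (Num.min e3 e4)) (Num.min r (1 - r)).
have [|s ws /andP[s0 se]] := acc e.
  by rewrite !lt_min e10 e20 e30 e40 r0 subr_gt0 r1.
move: se; rewrite !lt_min -!andbA => /and5P[se1 se2 se3 se4 /andP[se5 se6]].
have [k' [r' [sE /andP[r'0 r'1] cs]]] := wild_line Fx ws.
have kk : k = k'.
  have hs : 0 < s - k%:~R < 1.
    move: se5 se6; rewrite tE; have -> : s - (k%:~R + r) = (s - k%:~R) - r by ring.
    by rewrite !ltr_norml => /andP[? ?] /andP[? ?]; apply/andP; split; lra.
  apply/esym; apply: (@int_close _ _ ((s - k%:~R) - r')); last by rewrite sE; ring.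
  by case/andP: hs => ? ?; rewrite ltr_norml; apply/andP; split; lra.
have sr : s - t = r' - r by rewrite sE tE kk; ring.
rewrite sr in s0 se1 se2 se3 se4 se5 se6.
have ner : r' <> r by move=> e'; move: s0; rewrite e' subrr normr0 ltxx.
case: cs => [r'E|r'E|[r'b w]].
- by move: se5; rewrite r'E sub0r normrN gtr0_norm// ltxx.
- have := he4; have -> : r != 1 / 2 by apply/eqP => e'; apply: ner; rewrite r'E e'.
  by move=> /(_ isT); rewrite -r'E leNgt se4.
case: (wild_string w) => [r'E|[j r'E]|[i ai ci]].
- by move: r'b; rewrite r'E ltxx.
- by have := he1 j; rewrite -r'E distrC leNgt se1.
have [iN|Ni] := ltnP i N.
  apply: ner; case: ci => ci.
    by rewrite ci; apply: he2 => //; rewrite -ci.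
  by rewrite ci; apply: (he3 i) => //; rewrite -ci.
have i0 := @scale_gt0 R i.
have rc : centre i - scale i <= r' <= centre i + scale i.
  by case: ci => ->; apply/andP; split; lra.
by have := hN i r' Ni rc; rewrite leNgt se1.
Qed.

Lemma clusters_left_wild x k j : fibre x ->
  clusters_left (wild (line x)) (k%:~R + limit_pos j) <-> S j.
Proof.
move=> Fx; have l0 := @limit_pos_gt0 R j; have l4 := @limit_pos_le R j; split=> [acc|Sj e e0]; last first.
  have [l hl] := offset_cvg j e0; exists (k%:~R + (limit_pos j - offset j l)).
    apply/(@wild_line_string x k _ Fx); last exact: wild_string_left.
    have := @offset_gt0 R j l; have := @offset_le R j l.
    by move=> *; apply/andP; split; lra.
  by have := @offset_gt0 R j l => ?; apply/andP; split; lra.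
apply: contrapT => /negP nS; have [|s ws /andP[s1 s2]] := acc (limit_pos j / 8); first by lra.
have [k' [r' [sE /andP[r'0 r'1] cs]]] := wild_line Fx ws.
have kk : k = k'.
  apply/esym; apply: (@int_close _ _ ((s - k%:~R) - r')); last by rewrite sE; ring.
  by rewrite ltr_norml; apply/andP; split; lra.
rewrite sE kk in s1 s2.
(* A knotted time in a copy lies within five times its scale, hence within [5/64] of the size of its
   limit point. These ranges are disjoint, so [s] belongs to a copy around [limit_pos j], and this
   copy is on the right. *)
have key i : limit_pos i * (1 - 5 / 64) <= r' <= limit_pos i * (1 + 5 / 64) -> i = j.
  move=> /andP[h1 h2]; have li0 := @limit_pos_gt0 R i.
  by have [h|h|//] := ltngtP i j; exfalso; have := @limit_pos_half R _ _ h; lra.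
case: cs => [r'E|r'E|[r'b w]]; [lra|lra|].
case: (wild_string w) => [r'E|[i r'E]|[i ai ci]]; first by lra.
  have li0 := @limit_pos_gt0 R i.
  have ij := key i (ltac:(by rewrite r'E; apply/andP; split; lra)).
  by rewrite r'E ij in s2; lra.
have di := @centre_dist R i; have si := @scale_le R i; have si0 := @scale_gt0 R i; have li0 := @limit_pos_gt0 R (code_n i).
have db : `|centre i - limit_pos (code_n i)| <= 4 * scale i :> R by rewrite di.
move: db; rewrite ler_norml => /andP[d1 d2].
have ij := key (code_n i) (ltac:(by case: ci => ->; apply/andP; split; lra)).
have nb : code_b i = false.
  by apply/negP => b; have := ai b; rewrite ij (negbTE nS).
have cE : centre i = limit_pos j + 4 * scale i :> R.
  by rewrite /centre nb ij scaleE ij; lra.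
by case: ci => ci; rewrite ci cE in s2; lra.
Qed.

End wild_times.

(** * From the cluster points back to the set of left-hand copies *)

Section rigidity.
Context {R : realType}.
Implicit Types (s t r : R) (i j : nat) (k : int) (th et : R -> R).

Lemma monotone_bijection th : continuous th -> injective th ->
  (forall s t, s < t -> th s < th t) \/ (forall s t, s < t -> th t < th s).
Proof.
move=> cth ith.
have cw : {within [set` `]-oo, +oo[%R], continuous th} by exact: continuous_subspaceT.
have [h|h] := itv_continuous_inj_mono cw (fun s t _ _ e => ith s t e); [left|right] => s t st.
  by apply: h => //; rewrite in_itv.
by apply: h => //; rewrite in_itv.
Qed.

Lemma clusters_map (A B : set R) th t : continuous th -> injective th ->
  (forall s, A s -> B (th s)) -> clusters A t -> clusters B (th t).
Proof.
move=> cth ith AB acc e e0; have /cvgrPdist_lt/(_ _ e0) nb := cth t.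
have [d /= d0 hd] := (nbhs_ballP _ _).1 nb.
have [s As /andP[s0 sd]] := acc d d0; exists (th s); first exact: AB.
rewrite distrC hd /ball/= ?[`|t - s|]distrC// andbT normr_gt0 subr_eq0.
by apply: contraTneq s0 => /ith ->; rewrite subrr normr0 ltxx.
Qed.

Lemma clusters_left_map (A B : set R) th t : continuous th ->
  (forall s t, s < t -> th s < th t) ->
  (forall s, A s -> B (th s)) -> clusters_left A t -> clusters_left B (th t).
Proof.
move=> cth mth AB acc e e0; have /cvgrPdist_lt/(_ _ e0) nb := cth t.
have [d /= d0 hd] := (nbhs_ballP _ _).1 nb.
have [s As /andP[s0 sd]] := acc d d0; exists (th s); first exact: AB.
rewrite mth// andbT; have : `|th t - th s| < e.
  by apply: hd; rewrite /ball/= ltr_norml; apply/andP; split; lra.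
by rewrite ltr_norml => /andP[? ?]; lra.
Qed.

(** The cluster points of the knotted times; the integers are in turn the cluster points of
    these. *)
Definition marks t : Prop := exists k, t = k%:~R \/ exists j, t = k%:~R + limit_pos j.
Definition integers t : Prop := exists k, t = k%:~R.

Lemma marks_right (e : R) : 0 < e -> exists j, 0 < (limit_pos j : R) < e /\ marks (limit_pos j : R).
Proof.
move=> e0; have [N hN] := limit_pos_cvg e0; exists N.
rewrite limit_pos_gt0 hN//; split=> //; exists 0; right; exists N.
by rewrite add0r.
Qed.

Lemma marks_left k t : k%:~R - 1 / 2 < t < k%:~R -> ~ marks t.
Proof.
move=> /andP[t1 t2] [k' [tE|[j tE]]].
  have e : k' = k by apply: (@int_close R _ _ (t - k%:~R)); [rewrite ltr_norml; apply/andP; split; lra|rewrite -tE; ring].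
  by rewrite tE e ltxx in t2.
have l0 := @limit_pos_gt0 R j; have l4 := @limit_pos_le R j.
have e : k' = k.
  apply: (@int_close R _ _ (t - k%:~R - limit_pos j)); last by rewrite tE; ring.
  by rewrite ltr_norml; apply/andP; split; lra.
rewrite e in tE; lra.
Qed.

Lemma clusters_marks t : clusters marks t <-> integers t.
Proof.
split=> [acc|[k ->] e e0]; last first.
  have [j [/andP[l0 le] _]] := marks_right e0; exists (k%:~R + limit_pos j).
    by exists k; right; exists j.
  by rewrite addrC addKr gtr0_norm// l0.
have [k rb _] := frac_exists t; set r := t - _ in rb.
have tE : t = k%:~R + r by rewrite /r addrC subrK.
exists k; have /andP[r0 r1] := rb; move: r0; rewrite le_eqVlt => /orP[/eqP r0|r0].
  by rewrite tE -r0 addr0.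
exfalso; have [e e0 he] := limit_pos_isolated r0.
have [|s [k' sE] /andP[s0 se]] := acc (Num.min e (Num.min r (1 - r))).
  by rewrite !lt_min e0 r0 subr_gt0 r1.
move: se; rewrite !lt_min => /and3P[se s1 s2].
have hs : 0 < s - k%:~R < 1.
  move: s1 s2; have -> : s - t = (s - k%:~R) - r by rewrite tE; ring.
  by rewrite !ltr_norml => /andP[? ?] /andP[? ?]; apply/andP; split; lra.
have /andP[hs0 hs1] := hs; case: sE => [sE|[j sE]].
  have kk : k' = k.
    by apply: (@int_close R _ _ (s - k%:~R)); [rewrite gtr0_norm|rewrite -sE; ring].
  by rewrite sE kk subrr ltxx in hs0.
have l0 := @limit_pos_gt0 R j; have l4 := @limit_pos_le R j.
have kk : k' = k.
  apply: (@int_close R _ _ (s - k%:~R - limit_pos j)); last by rewrite sE; ring.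
  by rewrite ltr_norml; apply/andP; split; lra.
have sr : s - t = limit_pos j - r by rewrite sE tE kk; ring.
rewrite sr in s0 se.
have ne : limit_pos j != r by rewrite -subr_eq0 -normr_gt0.
by have := he j ne; rewrite leNgt se.
Qed.

Lemma limit_pos_inj i j : limit_pos i = limit_pos j :> R -> i = j.
Proof.
move=> e; have l0 := @limit_pos_gt0 R j; have l0' := @limit_pos_gt0 R i.
by have [h|h|//] := ltngtP i j; exfalso; have := @limit_pos_half R _ _ h; lra.
Qed.

Lemma limit_pos_mono i j : (i < j)%N = (limit_pos j < limit_pos i :> R).
Proof.
have l0 := @limit_pos_gt0 R j; have l0' := @limit_pos_gt0 R i.
have [h|h|->] := ltngtP i j; last by rewrite ltxx.
  by have := @limit_pos_half R _ _ h => h2; apply/esym; lra.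
by have := @limit_pos_half R _ _ h => h2; apply/esym/negbTE; rewrite -leNgt; lra.
Qed.

Lemma increasing_surjection (f : nat -> nat) : (forall i j, (i < j)%N -> (f i < f j)%N) ->
  (forall j, exists i, f i = j) -> forall i, f i = i.
Proof.
move=> mf sf; have ge i : (i <= f i)%N.
  by elim: i => // i IH; apply: leq_ltn_trans IH (mf _ _ (ltnSn i)).
elim/ltn_ind => i IH; have [j fj] := sf i.
have [h|h|ji] := ltngtP j i; last by rewrite -{1}ji.
  by move: (IH j h); rewrite fj => e; move: h; rewrite -e ltnn.
by have := mf _ _ h; rewrite fj ltnNge ge.
Qed.

Lemma integers0 : integers 0.
Proof. by exists 0; rewrite mulr0z. Qed.

Section homeo.
Variables (th et : R -> R).
Hypotheses (cth : continuous th) (cet : continuous et) (te : cancel th et) (et' : cancel et th).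
Hypothesis hM : forall t, marks t <-> marks (th t).

Let hZ t : integers t <-> integers (th t).
Proof.
rewrite -!clusters_marks; split.
  by apply: clusters_map => //; [exact: can_inj te|move=> s /hM].
move=> h; rewrite -[t]te; apply: (@clusters_map marks marks) => //.
  exact: can_inj et'.
by move=> s ms; apply/hM; rewrite et'.
Qed.

(** Marks accumulate at an integer from the right only, so a homeomorphism of the line that
    preserves them cannot reverse the order. *)
Lemma marks_increasing s t : s < t -> th s < th t.
Proof.
have [h|h] := monotone_bijection cth (can_inj te); first exact: h.
exfalso; have [k kE] := (hZ 0).1 integers0.
have /cvgrPdist_lt/(_ (1 / 2)) := @cth 0; rewrite divr_gt0// => /(_ isT) nb.
have [d /= d0 hd] := (nbhs_ballP _ _).1 nb.
have [j [/andP[l0 ld] ml]] := marks_right d0.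
apply: (@marks_left k (th (limit_pos j))); last exact: (hM _).1 ml.
rewrite -kE h// andbT; have : `|th 0 - th (limit_pos j)| < 1 / 2.
  by apply: hd; rewrite /ball/= sub0r normrN gtr0_norm.
by rewrite ltr_norml => /andP[? ?]; lra.
Qed.

(** An increasing bijection of the integers is a translation. *)
Lemma marks_shift : exists a : int, forall k, th k%:~R = (a + k)%:~R.
Proof.
have [a aE] := (hZ 0).1 integers0.
have step k b : th k%:~R = b%:~R -> th (k + 1)%:~R = (b + 1)%:~R.
  move=> kb; have [b' bE] : integers (th (k + 1)%:~R) by apply: (hZ _).1; exists (k + 1).
  have lt : (b < b')%R.
    by rewrite -(ltr_int R) -bE -kb; apply: marks_increasing; rewrite ltr_int; lia.
  rewrite bE; congr (_%:~R); apply/eqP; rewrite eq_le; apply/andP; split; last by lia.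
  rewrite leNgt; apply/negP => lt'.
  have [c cE] : integers (et (b + 1)%:~R) by apply: (hZ _).2; rewrite et'; exists (b + 1).
  have cE' : th c%:~R = (b + 1)%:~R by rewrite -cE et'.
  have inc x y : th x < th y -> x < y.
    move=> h; rewrite ltNge; apply/negP; rewrite le_eqVlt => /orP[/eqP e|/marks_increasing h'].
      by rewrite e ltxx in h.
    by have := lt_trans h h'; rewrite ltxx.
  have h1 : (k%:~R : R) < c%:~R by apply: inc; rewrite kb cE' ltr_int; lia.
  have h2 : (c%:~R : R) < (k + 1)%:~R by apply: inc; rewrite bE cE' ltr_int.
  by move: h1 h2; rewrite !ltr_int; lia.
exists a => k; pose P (j : int) := th j%:~R = (a + j)%:~R.
have pos (m : nat) : P m%:Z.
  elim: m => [|m IH]; first by rewrite /P addr0.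
  by have := step _ _ IH; rewrite /P -addrA intS [1 + _]addrC.
have neg (m : nat) : P (- m%:Z).
  elim: m => [|m IH]; first by rewrite /P oppr0 addr0.
  have [b bE] : integers (th (- m.+1%:Z)%:~R) by apply: (hZ _).1; exists (- m.+1%:Z).
  have := step _ _ bE; have -> : (- m.+1%:Z + 1)%R = - m%:Z by lia.
  by rewrite IH /P bE => /eqP; rewrite eqr_int => /eqP e; congr (_%:~R); lia.
by case: (intP k) => [|m|m]; [exact: (pos 0%N)|exact: pos|exact: neg].
Qed.

(** Between consecutive integers the marks form a decreasing sequence. Up to translation [th]
    permutes it and preserves the order, and the only increasing bijection of the natural numbers is
    the identity. *)
Lemma marks_limit_pos (a : int) : (forall k, th k%:~R = (a + k)%:~R) ->
  forall j, th (limit_pos j) = a%:~R + limit_pos j.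
Proof.
move=> aE; have a0 : th 0 = a%:~R by have := aE 0; rewrite addr0.
have a1 : th 1 = a%:~R + 1 by have := aE 1; rewrite intrD.
have img (h : R -> R) (b c : int) : (forall s t, s < t -> h s < h t) ->
    (forall t, marks t -> marks (h t)) -> h b%:~R = c%:~R -> h (b%:~R + 1) = c%:~R + 1 ->
    forall j, exists i, h (b%:~R + limit_pos j) = c%:~R + limit_pos i.
  move=> mh hm hb hb1 j; have l0 := @limit_pos_gt0 R j; have l4 := @limit_pos_le R j.
  have h1 : c%:~R < h (b%:~R + limit_pos j) by rewrite -hb; apply: mh; lra.
  have h2 : h (b%:~R + limit_pos j) < c%:~R + 1 by rewrite -hb1; apply: mh; lra.
  have [k [kE|[i kE]]] : marks (h (b%:~R + limit_pos j)).
      by apply: hm; exists b; right; exists j.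
    have kc : k = c.
      apply: (@int_close R _ _ (h (b%:~R + limit_pos j) - c%:~R)); last by rewrite kE; ring.
      by rewrite ltr_norml; apply/andP; split; lra.
    by rewrite kE kc ltxx in h1.
  exists i; have li0 := @limit_pos_gt0 R i; have li4 := @limit_pos_le R i.
  rewrite kE; congr (_%:~R + _); apply: (@int_close R _ _ (h (b%:~R + limit_pos j) - c%:~R - limit_pos i)).
    by rewrite ltr_norml; apply/andP; split; lra.
  by rewrite kE; ring.
have mth := marks_increasing.
have met s t : s < t -> et s < et t.
  move=> st; rewrite ltNge; apply/negP; rewrite le_eqVlt => /orP[/eqP/(can_inj et') e|/mth].
    by rewrite e ltxx in st.
  by rewrite !et' => /(lt_trans st); rewrite ltxx.
have r1 : th (0%:~R + 1) = a%:~R + 1 by rewrite add0r.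
have /choice[sg sgE] := img th 0 a mth (fun t => (hM t).1) a0 r1.
have q0 : et a%:~R = 0%:~R by rewrite -a0 te.
have q1 : et (a%:~R + 1) = 0%:~R + 1 by rewrite -a1 te add0r.
have hM' t : marks t -> marks (et t) by move=> mt; apply/hM; rewrite et'.
have hsg i : sg i = i.
  apply: increasing_surjection => [i' j ij|j].
    rewrite limit_pos_mono; have := mth (0%:~R + limit_pos j) (0%:~R + limit_pos i').
    by rewrite !sgE => h; have := h (ltac:(by rewrite ltrD2l -limit_pos_mono)); rewrite ltrD2l.
  have [l lE] := img et a 0 met hM' q0 q1 j; exists l; apply: limit_pos_inj.
  by have := sgE l; rewrite -lE et' => /addrI.
by move=> j; have := sgE j; rewrite hsg add0r.
Qed.

End homeo.

Variables (n : nat -> nat) (n2 : forall i, (2 <= n i)%N).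
Local Notation L := (set_type (@power_limit R n)).

Lemma wild_times_rigid (S S' : nat -> bool) (x x' : L) th et : fibre x -> fibre x' ->
  continuous th -> continuous et -> cancel th et -> cancel et th ->
  (forall t, wild (line n2 S x) t <-> wild (line n2 S' x') (th t)) ->
  S =1 S' /\ exists C, forall t, `|th t - t| <= C.
Proof.
move=> Fx Fx' cth cet te et' hw.
have hM t : marks t <-> marks (th t).
  have h1 := clusters_wild n2 S t Fx; have h2 := clusters_wild n2 S' (th t) Fx'.
  split=> [/h1 acc|/h2 acc].
    apply/h2; apply: (clusters_map cth (can_inj te)) acc => s; exact: (hw s).1.
  apply/h1; rewrite -[t]te; apply: (clusters_map cet (can_inj et')) acc => s ws.
  by apply/hw; rewrite et'.
have mth := marks_increasing cth cet te et' hM.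
have [a aE] := marks_shift cth cet te et' hM.
have lE := marks_limit_pos cth cet te et' hM aE.
have met s t : s < t -> et s < et t.
  move=> st; rewrite ltNge; apply/negP; rewrite le_eqVlt => /orP[/eqP/(can_inj et') e|/mth].
    by rewrite e ltxx in st.
  by rewrite !et' => /(lt_trans st); rewrite ltxx.
split.
  move=> j; have h1 := clusters_left_wild n2 S 0 j Fx; have h2 := clusters_left_wild n2 S' a j Fx'.
  rewrite add0r in h1; rewrite -lE in h2.
  apply/idP/idP => [/h1 acc|/h2 acc].
    apply/h2; apply: (clusters_left_map cth mth) acc => s; exact: (hw s).1.
  apply/h1; rewrite -[limit_pos j]te; apply: (clusters_left_map cet met) acc => s ws.
  by apply/hw; rewrite et'.
(* For [t] between [k] and [k + 1] the value [th t] is squeezed between [a + k] and [a + k + 1]. *)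
exists (`|a%:~R| + 1) => t; have [k /andP[k0 k1] _] := frac_exists t.
have h1 : (a + k)%:~R <= th t.
  rewrite -aE; have : k%:~R <= t by lra.
  by rewrite le_eqVlt => /orP[/eqP ->//|/mth/ltW].
have h2 : th t <= (a + (k + 1))%:~R by rewrite -aE; apply/ltW/mth; rewrite intrD; lra.
rewrite intrD in h1; rewrite !intrD in h2.
have a1 := ler_norm (a%:~R : R); have a2 := ler_norm (- (a%:~R : R)); rewrite normrN in a2.
by rewrite ler_norml; apply/andP; split; lra.
Qed.

Lemma continuous_into_embedding (X Y Z : topologicalType) (e : Y -> Z) (k : X -> Y) :
  embedding e -> continuous (e \o k) -> continuous k.
Proof.
move=> [f [g [fg gf cf cg]] fE] cek.
have cfk : continuous (f \o k).
  move=> x; apply: cont_set_type; rewrite (_ : (fun t : X => set_val ((f \o k) t)) = e \o k); first exact: cek.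
  by apply: funext => t /=; rewrite fE.
have -> : k = g \o (f \o k) by apply: funext => t /=; rewrite fg.
by move=> x; apply: continuous_comp; [exact: cfk|exact: cg].
Qed.

Lemma homeo_of_embeddings (S S' : nat -> bool) (h g : R * R * R -> R * R * R) :
  cancel h g -> continuous h -> h @` range (emb n2 S) `<=` range (emb n2 S') ->
  exists2 u : L -> L, continuous u & forall z, emb n2 S' (u z) = h (emb n2 S z).
Proof.
move=> hg ch sub.
have ex z : exists w, emb n2 S' w = h (emb n2 S z).
  by have [|w _ wE] := sub (h (emb n2 S z)); [exists (emb n2 S z) => //; exists z|exists w].
have /choice[u uE] := ex; exists u => //.
apply: (continuous_into_embedding (embedding_emb n2 S')).
have -> : emb n2 S' \o u = h \o emb n2 S by apply: funext => z /=.
by move=> z; apply: continuous_comp; [exact: continuous_emb|exact: ch].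
Qed.

Lemma solenoid_inhabited : exists x : L, fibre x.
Proof.
have [x xE] := @coord_exists R n (fun=> 1) (fun=> @cabs1 R) (fun i => esym (expr1n _ _)).
by exists x; exact: xE.
Qed.

Lemma emb_rigid (S S' : nat -> bool) (h g : R * R * R -> R * R * R) :
  cancel h g -> cancel g h -> continuous h -> continuous g ->
  h @` range (emb n2 S) = range (emb n2 S') ->
  S =1 S' /\ exists (x y : L) (th : R -> R) (C : R), [/\ continuous th,
    forall t, h (line n2 S x t) = line n2 S' y (th t) & forall t, `|th t - t| <= C].
Proof.
move=> hg gh ch cg hK.
have [u cu uE] := homeo_of_embeddings hg ch (ltac:(by rewrite hK) : h @` range (emb n2 S) `<=` range (emb n2 S')).
have gK : g @` range (emb n2 S') `<=` range (emb n2 S).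
  by rewrite -hK => _ [_ [_ [z _ <-] <-] <-]; rewrite hg; exists z.
have [v cv vE] := homeo_of_embeddings gh cg gK.
have uv : cancel u v by move=> z; apply: (@emb_inj R n n2 S); rewrite vE uE hg.
have vu : cancel v u by move=> z; apply: (@emb_inj R n n2 S'); rewrite uE vE gh.
have [x Fx] := solenoid_inhabited.
have [th [et [cth cet te et' thE]]] := homeo_flow n2 x cu cv uv vu.
(* The point [u x] need not lie in the fibre; the origin of time on its line is moved back by its
   phase. *)
set y := u x in thE; pose y1 := flow n2 y (- phase y).
have Fy : fibre y1 by exact: fibre_phase.
pose th1 t := th t + phase y; pose et1 t := et (t - phase y).
have te1 : cancel th1 et1 by move=> t; rewrite /th1 /et1 addrK te.
have et1' : cancel et1 th1 by move=> t; rewrite /th1 /et1 et' subrK.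
have cth1 : continuous th1.
  by move=> t; apply: (@rcontD R _ t th (fun=> phase y)); [exact: cth|exact: rcontK].
have cet1 : continuous et1.
  move=> t; apply: (@continuous_comp _ _ _ (fun t => t - phase y) et); last exact: cet.
  by apply: (@rcontB R _ t id (fun=> phase y)); [exact: cvg_id|exact: rcontK].
have hl t : h (line n2 S x t) = line n2 S' y1 (th1 t).
  by rewrite /line -uE thE /y1 flowD /th1 addrC addrK.
have al := arc_line_emb n2 S x; have al' := arc_line_emb n2 S' y1.
have hw t : wild (line n2 S x) t <-> wild (line n2 S' y1) (th1 t).
  split=> w.
    have nr : \forall s \near t, h (line n2 S x s) = line n2 S' y1 (th1 s).
      by apply: filterS (filterT (F := nbhs t)) => s _; exact: hl.
    exact: (wild_homeo al al' hg gh ch cg te1 et1' cth1 cet1 nr w).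
  have nr : \forall s \near th1 t, g (line n2 S' y1 s) = line n2 S x (et1 s).
    by apply: filterS (filterT (F := nbhs (th1 t))) => s _; rewrite -{1}[s]et1' -hl hg.
  by have := wild_homeo al' al gh hg cg ch et1' te1 cet1 cth1 nr w; rewrite te1.
have [SS [C hC]] := wild_times_rigid Fx Fy cth1 cet1 te1 et1' hw.
by split=> //; exists x, y1, th1, C.
Qed.

End rigidity.

(** * The embedded solenoids are not attractors *)

Section boxes.
Context {R : realType}.
Local Notation C := (R[i]^o : topologicalType).
Local Notation T3 := (R * R * R)%type.
Implicit Types (a b c z : T3) (s t e : R).

Definition box e a : set T3 :=
  [set b | [/\ `|b.1.1 - a.1.1| < e, `|b.1.2 - a.1.2| < e & `|b.2 - a.2| < e]].

Lemma open_box e a : open (box e a).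
Proof.
rewrite openE => b [h1 h2 h3]; rewrite /interior.
have c1 : {for b, continuous (fun b : T3 => `|b.1.1 - a.1.1|)}.
  by apply: (@rcont_abs R _ b (fun b : T3 => b.1.1 - a.1.1)); apply: rcontB; [exact: continuous_x|exact: rcontK].
have c2 : {for b, continuous (fun b : T3 => `|b.1.2 - a.1.2|)}.
  by apply: (@rcont_abs R _ b (fun b : T3 => b.1.2 - a.1.2)); apply: rcontB; [exact: continuous_y|exact: rcontK].
have c3 : {for b, continuous (fun b : T3 => `|b.2 - a.2|)}.
  by apply: (@rcont_abs R _ b (fun b : T3 => b.2 - a.2)); apply: rcontB; [exact: continuous_z|exact: rcontK].
by apply: filterS3 (near_lt c1 h1) (near_lt c2 h2) (near_lt c3 h3) => z ? ? ?; split.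
Qed.

Lemma box_nbhs (U : set T3) a : nbhs a U -> exists2 e, 0 < e & box e a `<=` U.
Proof.
move=> /nbhs_ballP[e /= e0 he]; exists e => // b [h1 h2 h3]; apply: he.
by split; [split|]; rewrite /ball/= distrC.
Qed.

(** A Lebesgue number for the cover of [K] by boxes contained in [U]. *)
Lemma compact_boxes (K U : set T3) : compact K -> (forall a, K a -> nbhs a U) ->
  exists2 e, 0 < e & forall a, K a -> box e a `<=` U.
Proof.
move=> /compact_near_coveringP cK KU.
have [|e /= e0 he] := (nbhs_ballP _ _).1 (@cK R (nbhs (0 : R)) (fun e a => box e a `<=` U) _ _).
  move=> a Ka; have [r r0 hr] := box_nbhs (KU a Ka).
  have r2 : 0 < r / 2 by lra.
  have nb : nbhs a (box (r / 2) a).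
    apply: open_nbhs_nbhs; split; first exact: open_box.
    by rewrite /box /= !subrr normr0.
  have n0 : nbhs (0 : R) (ball (0 : R) (r / 2)) by exact: nbhsx_ballx.
  exists (box (r / 2) a, ball (0 : R) (r / 2)); first by split.
  move=> [b e] [/= [b1 b2 b3] eb] c [c1 c2 c3].
  have e2 : e < r / 2.
    by move: eb; rewrite /ball/= sub0r normrN; apply: le_lt_trans; exact: ler_norm.
  apply: hr; split.
  - have := ler_normD (c.1.1 - b.1.1) (b.1.1 - a.1.1); rewrite addrA subrK; lra.
  - have := ler_normD (c.1.2 - b.1.2) (b.1.2 - a.1.2); rewrite addrA subrK; lra.
  - have := ler_normD (c.2 - b.2) (b.2 - a.2); rewrite addrA subrK; lra.
exists (e / 2); first by lra.
by apply: he; rewrite /ball/= sub0r normrN gtr0_norm; lra.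
Qed.

Lemma compact_thickening (K : set T3) e : compact K ->
  compact [set b : T3 | exists2 a, K a & [/\ `|b.1.1 - a.1.1| <= e, `|b.1.2 - a.1.2| <= e & `|b.2 - a.2| <= e]].
Proof.
move=> cK; pose I : set R := `[- e, e]%classic.
have cI : compact I by exact: segment_compact.
have cB : compact (I `*` I `*` I) by apply: compact_setX => //; exact: compact_setX.
pose f (p : T3 * T3) : T3 := (p.1.1.1 + p.2.1.1, p.1.1.2 + p.2.1.2, p.1.2 + p.2.2).
have -> : [set b : T3 | exists2 a, K a & [/\ `|b.1.1 - a.1.1| <= e, `|b.1.2 - a.1.2| <= e & `|b.2 - a.2| <= e]]
    = f @` (K `*` (I `*` I `*` I)).
  apply/seteqP; split=> b.
    move=> [a Ka [h1 h2 h3]]; exists (a, (b.1.1 - a.1.1, b.1.2 - a.1.2, b.2 - a.2)).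
      by split=> //=; rewrite /I; split; [split|]; rewrite /= in_itv/= -ler_norml.
    by rewrite /f /= ![_ + (_ - _)]addrC !subrK; case: b {h1 h2 h3} => [[]].
  move=> [[a d] [/= Ka [[d1 d2] d3]] <-]; exists a => //.
  move: d1 d2 d3; rewrite /I /= !in_itv/= -!ler_norml => d1 d2 d3.
  by rewrite /f /= ![a.1.1 + _]addrC ![a.1.2 + _]addrC ![a.2 + _]addrC !addrK.
apply: continuous_compact; last by apply: compact_setX.
apply: continuous_subspaceT => p.
have c1 (h : T3 -> R) : continuous h -> {for p, continuous (fun p : T3 * T3 => h p.1)}.
  by move=> ch; apply: (@continuous_comp _ _ _ fst h); [exact: cvg_fst|exact: ch].
have c2 (h : T3 -> R) : continuous h -> {for p, continuous (fun p : T3 * T3 => h p.2)}.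
  by move=> ch; apply: (@continuous_comp _ _ _ snd h); [exact: cvg_snd|exact: ch].
apply: (@cont_pair _ _ _ _ (fun p : T3 * T3 => (p.1.1.1 + p.2.1.1, p.1.1.2 + p.2.1.2))
  (fun p : T3 * T3 => p.1.2 + p.2.2)); first apply: cont_pair.
- exact: (rcontD (c1 (fun a => a.1.1) (@continuous_x R)) (c2 (fun a => a.1.1) (@continuous_x R))).
- exact: (rcontD (c1 (fun a => a.1.2) (@continuous_y R)) (c2 (fun a => a.1.2) (@continuous_y R))).
- exact: (rcontD (c1 snd (@continuous_z R)) (c2 snd (@continuous_z R))).
Qed.

Definition seg a b s : T3 :=
  let u := clamp 0 1 s in
  (a.1.1 + u * (b.1.1 - a.1.1), a.1.2 + u * (b.1.2 - a.1.2), a.2 + u * (b.2 - a.2)).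

Lemma seg0 a b : seg a b 0 = a.
Proof.
rewrite /seg /= clamp_id; last by rewrite lexx ler01.
by rewrite !mul0r !addr0; case: a => [[]].
Qed.

Lemma seg1 a b : seg a b 1 = b.
Proof.
rewrite /seg /= clamp_id; last by rewrite lexx ler01.
by rewrite !mul1r ![_ + (_ - _)]addrC !subrK; case: b => [[]].
Qed.

Lemma cont_seg (T : topologicalType) (a b : T -> T3) (s : T -> R) (x : T) :
  {for x, continuous a} -> {for x, continuous b} -> {for x, continuous s} ->
  {for x, continuous (fun y => seg (a y) (b y) (s y))}.
Proof.
move=> ca cb cs.
have cu : {for x, continuous (fun y => clamp 0 1 (s y))}.
  by apply: rcont_max; [exact: rcontK|apply: rcont_min => //; exact: rcontK].
have ch (h : T3 -> R) : continuous h -> {for x, continuous (fun y => h (a y) + clamp 0 1 (s y) * (h (b y) - h (a y)))}.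
  move=> chh.
  have c1 : {for x, continuous (fun y => h (a y))} by exact: (@continuous_comp _ _ _ a h x ca (chh _)).
  have c2 : {for x, continuous (fun y => h (b y))} by exact: (@continuous_comp _ _ _ b h x cb (chh _)).
  exact: (rcontD c1 (rcontM cu (rcontB c2 c1))).
apply: cont_pair; first apply: cont_pair.
- exact: (ch (fun a => a.1.1) (@continuous_x R)).
- exact: (ch (fun a => a.1.2) (@continuous_y R)).
- exact: (ch snd (@continuous_z R)).
Qed.

Lemma seg_coord_bound (u v w e s : R) : `|u - w| < e -> `|v - w| < e ->
  `|u + clamp 0 1 s * (v - u) - w| < e.
Proof.
have /andP[c0 c1] := @clamp_in R 0 1 s ler01; move: (clamp 0 1 s) c0 c1 => c c0 c1.
rewrite !ltr_norml => /andP[h1 h2] /andP[h3 h4].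
by have [h|h] := leP u v; apply/andP; split; nra.
Qed.

Lemma seg_box a b c e s : box e c a -> box e c b -> box e c (seg a b s).
Proof. by move=> [? ? ?] [? ? ?]; split; exact: seg_coord_bound. Qed.

(** Two lifts differ by an integer that is constant along the line. *)
Lemma lift_diff (f g : R -> R) (p : R -> R[i]) : continuous f -> continuous g ->
  (forall s, cis (f s) = p s) -> (forall s, cis (g s) = p s) ->
  forall s t, f s - f t = g s - g t.
Proof.
move=> cf cg fp gp s t.
have UN := @lift_cis_unique R R^o p setT.
have [m mE] : exists m : int, f t = g t + m%:~R by apply: cis_eq; rewrite fp gp.
have h1 : selection_on (fun v : R^o => [set t : R | cis t = p v]) setT f.
  by move=> v _; split; [exact: fp|exact: cf].
have h2 : selection_on (fun v : R^o => [set t : R | cis t = p v]) setT (fun v => g v + m%:~R).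
  move=> v _; split; first by rewrite /= cisD cis_int mulr1 gp.
  by apply: (@rcontD R _ v g (fun=> m%:~R)); [exact: cg|exact: rcontK].
have e := @selection_eq_segment R R^o R (fun v => [set t : R | cis t = p v]) setT
  (@norm_hausdorff _ R) UN setT f (fun v => g v + m%:~R) t s (fun _ _ => I) openT h1 h2 (fun _ _ => I) mE.
by rewrite e mE; ring.
Qed.

End boxes.

(** * Winding of an extended coordinate *)

Section attractor.
Context {R : realType}.
Local Notation C := (R[i]^o : topologicalType).
Local Notation T3 := (R * R * R)%type.
Variable n : nat -> nat.
Hypothesis n2 : forall i, (2 <= n i)%N.
Variable S : nat -> bool.
Local Notation L := (set_type (@power_limit R n)).
Local Notation flow := (@flow R n n2).
Local Notation line := (@line R n n2 S).
Local Notation emb := (@emb R n n2 S).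
Local Notation K := (range emb).

Lemma compact_emb : compact K.
Proof.
by apply: continuous_compact; [apply: continuous_subspaceT; exact: continuous_emb|exact: compact_solenoid].
Qed.

(** Tietze extension from the compact, hence closed, image; real functions suffice because the parts
    of a complex coordinate are extended separately. *)
Lemma real_extension (h : L -> R) : continuous h -> (forall x, `|h x| <= 1) ->
  exists2 g : T3 -> R, continuous g & forall x, g (emb x) = h x.
Proof.
move=> ch h1; have [x0 _] := @solenoid_inhabited R n.
pose inv z := xget x0 [set x | emb x = z].
have invK x : inv (emb x) = x.
  apply: (@emb_inj R n n2 S); have : [set y | emb y = emb x] (inv (emb x)); last by [].
  by apply: xgetPex; exists x.
have clK : closed K by apply: compact_closed; [exact: norm_hausdorff|exact: compact_emb].
have [F [G [FG GF cF cG]] FE] := @embedding_emb R n n2 S.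
have cw : {within K, continuous (h \o inv)}.
  apply/subspace_sigL_continuousP.
  have -> : sigL K (h \o inv) = h \o G.
    by apply: funext => y; rewrite /sigL /=; congr h; rewrite -{1}[y]GF FE invK.
  by move=> y; apply: continuous_comp; [exact: cG|exact: ch].
have [g [gE cg _]] := @continuous_bounded_extension T3 R pseudometric_normal K clK (h \o inv) 1
  ltr01 cw (fun z _ => h1 (inv z)).
exists g; first exact: cg.
by move=> x; rewrite -gE ?inE /= ?invK//; exists x.
Qed.

Lemma coord_extension i : exists2 Psi : T3 -> R[i], (forall z, ccont Psi z) &
  forall x, Psi (emb x) = coord i x.
Proof.
have [|x|g1 cg1 g1E] := @real_extension (fun x => Re (coord i x)).
- by move=> x; exact: contRe (@continuous_coord R n i x).
- by apply: le_trans (ge_Re_cabs _) _; rewrite cabs_coord.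
have [|x|g2' cg2 g2E] := @real_extension (fun x => Im (coord i x)).
- by move=> x; exact: contIm (@continuous_coord R n i x).
- by apply: le_trans (ge_Im_cabs _) _; rewrite cabs_coord.
exists (fun z => (g1 z +i* g2' z)%C); first by move=> z; apply: cont_complex; [exact: cg1|exact: cg2].
by move=> x; rewrite g1E g2E; case: (coord i x).
Qed.

Lemma iter_cancel (f g : T3 -> T3) m : cancel f g -> cancel (iter m f) (iter m g).
Proof. by move=> fg; elim: m => // m IH z; rewrite iterSr iterS fg IH. Qed.

Lemma iter_continuous (f : T3 -> T3) m : continuous f -> continuous (iter m f).
Proof.
move=> cf; elim: m => [|m IH] z; first exact: cvg_id.
by apply: (@continuous_comp _ _ _ (iter m f) f); [exact: IH|exact: cf].
Qed.

(* [Psi] extends the coordinate [j.+1], and nearby points of the line are those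
   with the same coordinate [j].  The change of argument of [Psi \o f] along
   the segment from [p t] to [p (t + N)], [N = winding j], is
   [(th (t + N) - th t) / winding j.+1 + c] with an integer [c]; adding these up
   one stays in a box around [p 0], where the argument is bounded. *)
Lemma no_return (f : T3 -> T3) (Psi : T3 -> R[i]) (x y : L) (th : R -> R) (B e : R) j :
  continuous f -> (forall z, ccont Psi z) -> (forall x, Psi (emb x) = coord j.+1 x) ->
  continuous th -> (forall t, f (line x t) = line y (th t)) ->
  (forall t, `|th t - t| <= B) -> 0 < e ->
  (forall x y, coord j x = coord j y -> box (e / 2) (emb y) (emb x)) ->
  (forall x z, box e (emb x) z -> Psi (f z) != 0) -> False.
Proof.
move=> cf cPsi PsiE cth fE thB e0 near_j nz.
set N : R := (winding n j)%:R; set N' : R := (winding n j.+1)%:R.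
have N0 : 0 < N by rewrite ltr0n; apply: leq_ltn_trans (winding_gt n2 j).
have N'0 : 0 < N' by rewrite ltr0n; apply: leq_ltn_trans (winding_gt n2 j.+1).
pose p := line x; have cp : continuous p := (arc_line_emb n2 S x).1.
have nearp (k l : nat) (t : R) : box (e / 2) (p (t + k%:R * N)) (p (t + l%:R * N)).
  by apply: near_j; rewrite !coord_flow !mulrDl !cisD !mulfK ?gt_eqF// !cis_nat.
have box2 a : box (e / 2) a `<=` box e a.
  by move=> b [h1 h2 h3]; split; lra.
pose Phi z : R[i] := (cabs (Psi (f z)))^-1%:C%C * Psi (f z).
have cPf z : ccont (fun z => Psi (f z)) z.
  exact: (@continuous_comp _ _ C f (Psi : T3 -> C) z (cf z) (cPsi _)).
have cPhi z : Psi (f z) != 0 -> ccont Phi z.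
  move=> h; apply: (contM _ (cPf z)); apply: ccont_real; apply: rcontV; first exact: cont_cabs (cPf z).
  by rewrite cabs_eq0.
have Phi1 z : Psi (f z) != 0 -> cabs (Phi z) = 1.
  move=> h; rewrite /Phi cabsM cabs_real ger0_norm ?invr_ge0 ?cabs_ge0//.
  by rewrite mulVf// cabs_eq0.
have Phi_line t : Phi (p t) = coord j.+1 y * cis (th t / N').
  rewrite /Phi /p fE PsiE cabs_coord invr1 mul1r coord_flow; by [].
(* The segments from [p t] to [p (t + N)] for all [t]. The domain is a plane, so the argument along
   them can be lifted for all [t] at once. *)
pose H (v : R^o * R^o) : T3 := seg (p v.1) (p (v.1 + N)) v.2.
have Hb v : box e (p v.1) (H v).
  apply: seg_box; first by rewrite /box /= !subrr normr0.
  by apply: box2; have := nearp 0%N 1%N v.1; rewrite mul0r addr0 mul1r.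
have Hnz v : Psi (f (H v)) != 0 by apply: nz (Hb v).
have cpN : continuous (fun t => p (t + N)).
  move=> t; apply: (@continuous_comp _ _ _ (fun t : R => t + N) p); last exact: cp.
  by apply: rcontD; [exact: cvg_id|exact: rcontK].
have cH v : {for v, continuous H}.
  apply: cont_seg.
  - by apply: (@continuous_comp _ _ _ (fun v : R^o * R^o => v.1 : R) p); [exact: cvg_fst|exact: cp].
  - by apply: (@continuous_comp _ _ _ (fun v : R^o * R^o => v.1 : R) (fun t => p (t + N))); [exact: cvg_fst|exact: cpN].
  - exact: cvg_snd.
have HE v : H v = seg (p v.1) (p (v.1 + N)) v.2 by [].
have H0 t : H (t, 0) = p t by exact: seg0.
have H1 t : H (t, 1) = p (t + N) by exact: seg1.
have nzp t z : box e (p t) z -> Psi (f z) != 0 by exact: nz.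
have NE : N = (winding n j)%:R by [].
have NE' : N' = (winding n j.+1)%:R by [].
clearbody H Phi p N N'.
have [la hla] := @lift_cis R (R^o * R^o)%type setT 0 (fun v => Phi (H v)) openT I (fun _ _ _ _ => I)
  (fun v _ => @continuous_comp _ _ C H (Phi : T3 -> C) v (cH v) (cPhi _ (Hnz v)))
  (fun v _ => Phi1 _ (Hnz v)).
have laE v : cis (la v) = Phi (H v) := (hla v I).2.
have cla v : {for v, continuous la} := (hla v I).1.
pose a t := la (t, 1) - la (t, 0).
pose d t := (th (t + N) - th t) / N'.
have ca : continuous a.
  move=> t; apply: rcontB; apply: (@continuous_comp _ _ _ _ la); try exact: cla.
    by apply: cont_pair; [exact: cvg_id|exact: rcontK].
  by apply: cont_pair; [exact: cvg_id|exact: rcontK].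
have cd : continuous d.
  move=> t; have c1 : {for t, continuous (fun t : R => t + N)}.
    by apply: rcontD; [exact: cvg_id|exact: rcontK].
  have c2 : {for t, continuous (fun t => th (t + N))}.
    by apply: (@continuous_comp _ _ _ (fun t : R => t + N) th); [exact: c1|exact: cth].
  apply: (@rcontM R _ t (fun t => th (t + N) - th t) (fun=> N'^-1)); [exact: (rcontB c2 (@cth t))|exact: rcontK].
have aE t : cis (a t) = cis (d t).
  rewrite cisB !laE H0 H1 !Phi_line /d mulrBl cisB.
  by field; rewrite !cis_neq0 coord_neq0.
have [c cE] : exists c : int, a 0 = d 0 + c%:~R by exact: cis_eq.
(* Both sides lift the same function, so the integer [c] does not depend on [t]. *)
have adc t : a t = d t + c%:~R.
  have := @lift_diff R a d (fun t => cis (d t)) ca cd aE (fun _ => erefl) t 0.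
  by rewrite cE; lra.
(* A single-valued argument on the box around [p 0], to which all points at times [k N] belong. *)
have [mu hmu] := @lift_cis R T3 (box e (p 0)) (p 0) Phi (@open_box _ e (p 0))
  (ltac:(by rewrite /box /= !subrr normr0) : box e (p 0) (p 0))
  (ltac:(by move=> z bz t t01; have := @seg_box R (p 0) z (p 0) e t
     (ltac:(by rewrite /box /= !subrr normr0)) bz; rewrite /seg clamp_id))
  (fun z bz => cPhi z (nzp 0 z bz)) (fun z bz => Phi1 z (nzp 0 z bz)).
have pk (k : nat) : box (e / 2) (p 0) (p (k%:R * N)).
  by have := nearp 0%N k 0; rewrite mul0r !add0r.
have step (k : nat) : mu (p (k.+1%:R * N)) - mu (p (k%:R * N)) = a (k%:R * N).
  have kN : k%:R * N + N = k.+1%:R * N by rewrite -[k.+1]addn1 natrD mulrDl mul1r.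
  pose z s := H (k%:R * N, s).
  have bz s : box e (p 0) (z s).
    by rewrite /z HE; apply: seg_box; apply: box2; rewrite /= ?kN; exact: pk.
  have cz : continuous z.
    move=> s; apply: (@continuous_comp _ _ _ (fun s : R => (k%:R * N, s) : R^o * R^o) H); last exact: cH.
    by apply: cont_pair; [exact: rcontK|exact: cvg_id].
  have cm : continuous (fun s => mu (z s)).
    by move=> s; apply: (@continuous_comp _ _ _ z mu); [exact: cz|exact: (hmu _ (bz s)).1].
  have cl : continuous (fun s : R => la (k%:R * N, s)).
    move=> s; apply: (@continuous_comp _ _ _ (fun s : R => (k%:R * N, s) : R^o * R^o) la); last exact: cla.
    by apply: cont_pair; [exact: rcontK|exact: cvg_id].
  have := lift_diff cm cl (fun s => (hmu _ (bz s)).2) (fun s => laE (k%:R * N, s)) 1 0.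
  by rewrite /z H0 H1 kN.
have total (M : nat) : mu (p (M%:R * N)) - mu (p 0) = (th (M%:R * N) - th 0) / N' + M%:R * c%:~R.
  elim: M => [|M IH]; first by rewrite !mul0r !subrr mul0r addr0.
  have := step M; rewrite adc /d.
  have -> : M%:R * N + N = M.+1%:R * N by rewrite -[M.+1]addn1 natrD mulrDl mul1r.
  have -> : M.+1%:R = M%:R + 1 :> R by rewrite -[M.+1]addn1 natrD.
  move=> h.
  have tele (u v w : R) : u - w = (u - v) + (v - w) by ring.
  rewrite (tele _ (mu (p (M%:R * N)))) h IH.
  by ring.
have [B' hB'] : exists B', forall z, box (e / 2) (p 0) z -> `|mu z| <= B'.
  pose D := [set b : T3 | exists2 a, [set p 0] a &
    [/\ `|b.1.1 - a.1.1| <= e / 2, `|b.1.2 - a.1.2| <= e / 2 & `|b.2 - a.2| <= e / 2]].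
  have cD : compact D by apply: compact_thickening; exact: compact_set1.
  have : compact (mu @` D).
    apply: continuous_compact cD; apply/subspace_continuousP => z Dz.
    have bz : box e (p 0) z by case: Dz => _ -> [h1 h2 h3]; split; lra.
    by have := (hmu z bz).1; apply: cvg_trans; apply: cvg_app; exact: cvg_within.
  move/compact_bounded => [M [_ hM]]; exists (`|M| + 1) => z [h1 h2 h3].
  have M1 : M < `|M| + 1 by have := ler_norm M; lra.
  apply: (hM _ M1); exists z => //; exists (p 0) => //; split; exact: ltW.
have bounded (M : nat) : `|M%:R * (N / N' + c%:~R)| <= 2 * B' + 2 * B / N'.
  have b1 := hB' _ (pk M); have b2 := hB' (p 0) (ltac:(by rewrite /box /= !subrr normr0 divr_gt0)).
  have t1 := thB (M%:R * N); have t2 := thB 0; rewrite subr0 in t2.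
  have arith (u v w w' : R) : u - v = (w - w') / N' + M%:R * c%:~R -> `|u| <= B' -> `|v| <= B' ->
      `|w - M%:R * N| <= B -> `|w'| <= B -> `|M%:R * (N / N' + c%:~R)| <= 2 * B' + 2 * B / N'.
    move=> h u1 v1 w1 w2.
    have -> : M%:R * (N / N' + c%:~R) = (u - v) - ((w - M%:R * N) - w') / N'.
      by rewrite h; field; rewrite gt_eqF.
    apply: le_trans (ler_normB _ _) _; apply: lerD.
      by apply: le_trans (ler_normB _ _) _; lra.
    rewrite normrM normfV (gtr0_norm N'0) ler_pM2r ?invr_gt0//.
    by apply: le_trans (ler_normB _ _) _; lra.
  exact: (arith _ _ _ _ (total M) b1 b2 t1 t2).
(* All natural multiples of this number obey one bound, so it vanishes. Then [winding j] is an
   integral multiple of [winding j.+1], which is at least twice as large. *)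
have w0 : N / N' + c%:~R = 0.
  apply/eqP; apply: contrapT => /negP; rewrite -normr_gt0 => w0.
  set w := `|_| in w0; set B2 := 2 * B' + 2 * B / N' in bounded.
  have B20 : 0 <= B2 by have := bounded 0%N; rewrite mul0r normr0.
  have := bounded (Num.truncn (B2 / w)).+1; rewrite normrM normr_nat -/w => h.
  have := truncnS_gt (B2 / w); rewrite ltr_pdivrMr// => h'.
  by have := lt_le_trans h' h; rewrite ltxx.
have Nc : (winding n j : int) = - c * (winding n j.+1 : int).
  apply/eqP; rewrite -(eqr_int R) intrM intrN; apply/eqP.
  have h : N / N' = - c%:~R by lra.
  have : (winding n j)%:R = - c%:~R * (winding n j.+1)%:R :> R by rewrite -NE -NE' -h divfK// gt_eqF.
  exact.
move: Nc; rewrite windingS; have := winding_gt n2 j; have := n2 j.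
move: (winding n j) (n j) => w m m2 w1; rewrite PoszM => h.
have : (w : int) * (1 + c * m) = 0 by move: h; lia.
move/eqP; rewrite mulf_eq0 => /orP[/eqP|/eqP]; first by lia.
have m2' : (2 <= m :> int) by lia.
have [c0|c0] : (0 <= c) \/ (c <= -1) by lia.
  by nia.
by nia.
Qed.

Lemma emb_not_attractor (f : T3 -> T3) : homeomorphism f -> ~ attractor f K.
Proof.
move=> [g [fg gf cf cg]] [cK fK [U KU att]].
have [e e0 he] := compact_boxes cK KU.
have e2 : 0 < e / 2 by lra.
pose P := [set b : T3 | exists2 a, K a &
    [/\ `|b.1.1 - a.1.1| <= e / 2, `|b.1.2 - a.1.2| <= e / 2 & `|b.2 - a.2| <= e / 2]].
have cP : compact P by exact: compact_thickening.
have PU : P `<=` U by move=> b [a Ka [h1 h2 h3]]; apply: (he a Ka); split; lra.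
(* [no_return] is applied with the radius [e / 2] of the thickening and asks for half of it. *)
have [j hj] := emb_close n2 S (ltac:(by lra) : 0 < e / 2 / 2).
have [Psi cPsi PsiE] := coord_extension j.+1.
pose V := [set z : T3 | Psi z != 0].
have KV : set_nbhs K V.
  move=> _ [x _ <-]; apply: (@near_neq R T3 Psi (emb x) 0 (cPsi _)).
  by rewrite PsiE coord_neq0.
have [m hm] := att P cP PU V KV.
(* The iterate is again a homeomorphism of space preserving [K], so rigidity applies to it. *)
have fmK : iter m f @` K = K.
  elim: m {hm} => [|m IH]; first by rewrite image_id.
  rewrite -[RHS]fK -{2}IH; apply/seteqP; split=> z.
    by move=> [w Kw <-]; exists (iter m f w) => //; exists w.
  by move=> [_ [w Kw <-] <-]; exists w.
have cfm := @iter_continuous f m cf.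
have [_ [x [y [th [B [cth fE thB]]]]]] := emb_rigid (iter_cancel m fg) (iter_cancel m gf) cfm (@iter_continuous g m cg) fmK.
apply: (@no_return (iter m f) Psi x y th B (e / 2) j) => //.
move=> x' z [h1 h2 h3].
apply: (hm m (leqnn m)); exists z => //; exists (emb x') => //.
by split; exact: ltW.
Qed.

End attractor.

(** * Transport to row vectors *)

Section transport.
Context {T U : topologicalType}.
Variables (p : T -> U) (q : U -> T).
Hypotheses (pq : cancel p q) (qp : cancel q p) (cp : continuous p) (cq : continuous q).

Lemma homeomorphism_conj (f : U -> U) : homeomorphism f -> homeomorphism (q \o f \o p).
Proof.
move=> [g [fg gf cf cg]]; exists (q \o g \o p); split.
- by move=> x /=; rewrite qp fg pq.
- by move=> x /=; rewrite qp gf pq.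
- move=> x; apply: (@continuous_comp _ _ _ (f \o p) q); last exact: cq.
  by apply: continuous_comp; [exact: cp|exact: cf].
- move=> x; apply: (@continuous_comp _ _ _ (g \o p) q); last exact: cq.
  by apply: continuous_comp; [exact: cp|exact: cg].
Qed.

Lemma attractor_conj (f : U -> U) (K : set T) :
  attractor f (p @` K) -> attractor (q \o f \o p) K.
Proof.
have qpK (P : set T) : q @` (p @` P) = P.
  by rewrite image_comp (_ : q \o p = id) ?image_id//; apply: funext.
have iterE m x : iter m (q \o f \o p) x = q (iter m f (p x)).
  by elim: m => [|m IH] /=; rewrite ?pq// IH qp.
move=> [cK fK [V KV att]]; split.
- by rewrite -(qpK K); apply: continuous_compact cK; exact: continuous_subspaceT.
- by transitivity (q @` (f @` (p @` K))); [rewrite !image_comp|rewrite fK qpK].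
exists (p @^-1` V); first by move=> x Kx; apply: cp; apply: KV; exists x.
move=> P cP PV W KW.
have cpP : compact (p @` P) by apply: continuous_compact cP; exact: continuous_subspaceT.
have [||m hm] := att _ cpP _ (q @^-1` W) _.
- by move=> _ [x Px <-]; exact: PV.
- by move=> _ [x Kx <-]; apply: cq; rewrite pq; exact: KW.
exists m => k mk _ [x Px <-]; rewrite iterE; apply: (hm k mk).
by exists (p x) => //; exists x.
Qed.

End transport.

Section coordinates.
Context {R : realType}.
Local Notation T3 := (R * R * R)%type.

Definition to_rV (a : T3) : 'rV[R]_3 := \row_(j < 3) [:: a.1.1; a.1.2; a.2]`_j.

Definition of_rV (v : 'rV[R]_3) : T3 :=
  (v 0 (@Ordinal 3 0 isT), v 0 (@Ordinal 3 1 isT), v 0 (@Ordinal 3 2 isT)).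

Lemma to_rVK : cancel to_rV of_rV.
Proof. by move=> [[x y] z]; rewrite /of_rV /to_rV !mxE. Qed.

Lemma of_rVK : cancel of_rV to_rV.
Proof.
move=> v; apply/rowP => j; rewrite mxE.
by case: j => [[|[|[|]]]] //= h; congr (v _ _); exact: val_inj.
Qed.

Lemma continuous_to_rV : continuous to_rV.
Proof.
move=> a; apply/cvg_ballP => e e0.
have nb : nbhs a (box e a).
  by apply: open_nbhs_nbhs; split; [exact: open_box|rewrite /box /= !subrr normr0].
apply: filterS nb => b [h1 h2 h3]; split=> // i j; rewrite !mxE /ball /= distrC.
by case: j => [[|[|[|]]]].
Qed.

Lemma continuous_of_rV : continuous of_rV.
Proof. by move=> v; apply: cont_pair; [apply: cont_pair|]; exact: coord_continuous. Qed.

End coordinates.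

(** The diagonal argument along an injection into the natural numbers: [D] holds at the code of [S]
    exactly when [S] fails there. *)
Lemma uncountable_binary : ~ countable [set: nat -> bool].
Proof.
move=> /countable_injP[f finj].
pose D k := `[< exists2 S : nat -> bool, f S = k & ~~ S k >].
have DN : ~~ D (f D).
  by apply/negP => DT; move: (DT) => /asboolP[S /finj ->]; rewrite ?inE// DT.
by move: (DN) => /negP; apply; apply/asboolP; exists D.
Qed.

Theorem corollary26 (R : realType) (Sigma : topologicalType)
    (hSigma : solenoid R Sigma) :
  exists (A : Type) (e : A -> Sigma -> 'rV[R]_3),
    [/\ ~ countable [set: A],
        forall a, embedding (e a),
        forall a b, a <> b -> ~ equivalent_embeddings (e a) (e b) &
        forall a (f : 'rV[R]_3 -> 'rV[R]_3),
          homeomorphism f -> ~ attractor f (range (e a))].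
Proof.
case: hSigma => n n2 [phi [psi [pK qK cphi cpsi]]].
pose e (S : nat -> bool) (x : Sigma) := to_rV (emb n2 S (phi x)).
have range_e S : range (e S) = to_rV @` range (emb n2 S).
  apply/seteqP; split=> [_ [x _ <-]|_ [_ [y _ <-] <-]].
    by exists (emb n2 S (phi x)) => //; exists (phi x).
  by exists (psi y) => //; rewrite /e qK.
exists (nat -> bool), e; split.
- exact: uncountable_binary.
- move=> S; apply: compact_embedding.
  + have -> : [set: Sigma] = psi @` [set: set_type (@power_limit R n)].
      by apply/seteqP; split=> // x _; exists (phi x).
    by apply: continuous_compact; [exact: continuous_subspaceT|exact: compact_solenoid].
  + exact: norm_hausdorff.
  + move=> x; apply: (@continuous_comp _ _ _ (fun x => emb n2 S (phi x)) to_rV); last exact: continuous_to_rV.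
    by apply: (@continuous_comp _ _ _ phi (emb n2 S)); [exact: cphi|exact: continuous_emb].
  + by move=> x y /(can_inj to_rVK)/emb_inj/(can_inj pK).
- move=> S S' ne [h hh hE]; apply: ne; apply: funext.
  have [g [hg gh ch cg]] := homeomorphism_conj to_rVK of_rVK continuous_to_rV continuous_of_rV hh.
  have [] // := emb_rigid (n2 := n2) (S := S) (S' := S') hg gh ch cg _.
  have qp T (A : set T) (F : T -> R * R * R) : of_rV @` (to_rV @` (F @` A)) = F @` A.
    by rewrite !image_comp; apply: eq_imagel => x _ /=; rewrite to_rVK.
  by rewrite -[in RHS]qp -range_e -hE range_e !image_comp.
- move=> S f hf; rewrite range_e => /(attractor_conj to_rVK of_rVK continuous_to_rV continuous_of_rV).
  apply: emb_not_attractor.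
  exact: (homeomorphism_conj to_rVK of_rVK continuous_to_rV continuous_of_rV hf).
Qed.
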